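(* There exist sequences $\epsilon_k\to0$ and $\gamma_k\to 1$ such that the following holds. Let $(I,\sigma)$ be a uniform instance–solution pair where either (a) $I$ is a graph on $n$ vertices with $dn/2$ edges, $(1+\epsilon_k)k\ln k\le d\le(2-\epsilon_k)k\ln k$, and $\sigma$ is a $k$-coloring of $I$; or (b) $I$ is a $k$-CNF formula on $n$ variables with $rn$ clauses, $(1+\epsilon_k)\frac{2^k}{k}\ln k\le r\le(1-\epsilon_k)2^k\ln 2$, and $\sigma$ is a satisfying assignment of $I$; or (c) $I$ is a $k$-uniform hypergraph on $n$ vertices with $rn$ edges, $(1+\epsilon_k)\frac{2^{k-1}}{k}\ln k\le r\le(1-\epsilon_k)2^{k-1}\ln 2$, and $\sigma$ is a 2-coloring of $I$. Then there is a constant $c>0$ such that w.h.p. at least $\gamma_k n$ variables of $(I,\sigma)$ are $cn$-rigid.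
   Context: Instances: (a) graphs on vertex set $\{1,\dots,n\}$ with $m$ edges, solutions are proper $k$-colorings in $\{1,\dots,k\}^n$; (b) sets of $m$ distinct $k$-clauses over $x_1,\dots,x_n$ (clauses on $k$ distinct variables), solutions are satisfying assignments in $\{0,1\}^n$; (c) sets of $m$ distinct $k$-subsets of $\{1,\dots,n\}$, solutions are 2-colorings in $\{1,2\}^n$ with no monochromatic edge. $\mathcal{S}(I)$ is the set of solutions of $I$. A uniform instance–solution pair is generated by choosing $I$ uniformly among all instances with the given number $m$ of constraints and then, if $\mathcal{S}(I)\neq\emptyset$, choosing $\sigma\in\mathcal{S}(I)$ uniformly at random. Given $(I,\sigma)$ with $\sigma\in\mathcal{S}(I)$, a variable $v$ is $f(n)$-rigid if every $\tau\in\mathcal{S}(I)$ with $\tau(v)\neq\sigma(v)$ satisfies $\mathrm{dist}(\sigma,\tau)\ge f(n)$, where dist is Hamming distance. W.h.p. means with probability tending to 1 as $n\to\infty$. *)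

(* Defs.v *)
From HB Require Import structures.
From mathcomp Require Import all_boot all_order all_algebra.
From mathcomp Require Import all_classical all_reals all_analysis.

Set Implicit Arguments.
Unset Strict Implicit.
Unset Printing Implicit Defensive.

Import Order.TTheory GRing.Theory Num.Theory.
Import numFieldNormedType.Exports.

Local Open Scope ring_scope.
Local Open Scope classical_set_scope.

Definition uniform_hypergraphs (k n m : nat) : {set {set {set 'I_n}}} :=
  [set H : {set {set 'I_n}} | (#|H| == m) && [forall e in H, #|e| == k]]%SET.

Definition graphs (n m : nat) : {set {set {set 'I_n}}} :=
  uniform_hypergraphs 2 n m.

Definition proper_colorings (k n : nat) (G : {set {set 'I_n}}) :
    {set {ffun 'I_n -> 'I_k}} :=
  [set s : {ffun 'I_n -> 'I_k} |
    [forall u, forall v,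
       ((u != v) && ([set u; v]%SET \in G)) ==> (s u != s v)]]%SET.

Definition monochromatic (n : nat) (s : {ffun 'I_n -> 'I_2})
    (e : {set 'I_n}) : bool :=
  [forall u in e, forall v in e, s u == s v].

Definition hypergraph_2colorings (n : nat) (H : {set {set 'I_n}}) :
    {set {ffun 'I_n -> 'I_2}} :=
  [set s : {ffun 'I_n -> 'I_2} | [forall e in H, ~~ monochromatic s e]]%SET.

(* The literal (v, true) is x_v and (v, false) is its negation; a clause is
   the set of its literals. *)
Definition is_kclause (k n : nat) (C : {set 'I_n * bool}) : bool :=
  (#|C| == k) && [forall l in C, forall l' in C, (l.1 == l'.1) ==> (l == l')].

Definition cnf_formulas (k n m : nat) : {set {set {set 'I_n * bool}}} :=
  [set F : {set {set 'I_n * bool}} |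
    (#|F| == m) && [forall C in F, is_kclause k C]]%SET.

Definition sat_assignments (n : nat) (F : {set {set 'I_n * bool}}) :
    {set {ffun 'I_n -> bool}} :=
  [set s : {ffun 'I_n -> bool} |
    [forall C in F, exists l in C, s l.1 == l.2]]%SET.

Definition hamming (n : nat) (Q : finType) (s t : {ffun 'I_n -> Q}) : nat :=
  #|[set v | s v != t v]%SET|.

Definition rigid (R : realType) (n : nat) (Q : finType)
    (S : {set {ffun 'I_n -> Q}}) (s : {ffun 'I_n -> Q}) (f : R) (v : 'I_n) :
    bool :=
  [forall t in S, (t v != s v) ==> (f <= (hamming s t)%:R)].

(* Probability of E when J is uniform in inst and then s is uniform in sol J.
   An instance with sol J empty yields no pair and contributes 0 / 0 = 0, that
   is, E fails on it. *)
Definition pair_prob (R : realType) (I S : finType) (inst : {set I})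
    (sol : I -> {set S}) (E : I -> S -> bool) : R :=
  (\sum_(J in inst) #|[set s in sol J | E J s]%SET|%:R / #|sol J|%:R)
    / #|inst|%:R.

Definition whp_rigid (R : realType) (Q : finType) (I : nat -> finType)
    (inst : forall n : nat, nat -> {set I n})
    (sol : forall n : nat, I n -> {set {ffun 'I_n -> Q}})
    (m : nat -> nat) (c g : R) : Prop :=
  (fun n : nat =>
     pair_prob R (inst n (m n)) (sol n)
       (fun J s =>
          g * n%:R <= #|[set v | rigid (sol n J) s (c * n%:R) v]%SET|%:R))
    @ \oo --> (1 : R).

(* Main.v *)
Require Import Defs.
From HB Require Import structures.
From mathcomp Require Import all_boot all_order all_algebra.
From mathcomp Require Import all_classical all_reals all_analysis.
From mathcomp Require Import fintype finset bigop ring lra zify.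

Set Implicit Arguments.
Unset Strict Implicit.
Unset Printing Implicit Defensive.

Import Order.TTheory GRing.Theory Num.Theory.
Import numFieldNormedType.Exports.

Local Open Scope ring_scope.
Local Open Scope classical_set_scope.

(* Fix a small [eps]; for large [k] each part is shown with [eps_k = eps] and
   [gam_k = 1 - eps], and the sequences are obtained by a diagonal choice.
   For one [eps] two estimates are combined.

   Lower bound.  With high probability the number of solutions is at least
   [exp (- zeta n)] times its expectation, for any fixed [zeta > 0].  Revealing the
   constraints one at a time turns (solutions / expectation) into a nonnegative
   martingale [mass]; while two random solutions have typical overlap, each step
   has small conditional variance and rarely halves the mass, so [ln mass] cannot
   fall linearly.  For SAT the solutions are reweighted so that the linear
   Fourier coefficients of a clause vanish, for 2-colourings only balanced ones are
   kept, and for k-colourings the vertices of a binomial random graph are revealed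
   in turn.

   Planted first moment.  If many variables of [sigma] are not rigid, the flips of
   nearby solutions cover a set [A] of about [n / k] variables such that no
   constraint is critical for one variable of [A] and touches [A] nowhere else.  Above
   the threshold a random constraint is critical with probability large enough to
   beat the number of sets [A], so the expected number of such pairs is smaller
   by [exp (- 2 zeta n)] than the expected number of solutions.  For k-colourings [A]
   must carry the new colours as well; it is explored as a forest, whose edges pay
   for the choice of the colours. *)

(** A plain second moment gives many solutions only with some positive probability, whereas the
    comparison with planted pairs needs probability tending to 1. Following the logarithm of the
    normalised count yields this directly: the inverse of the mass has only a small drift as long as
    no step halves the mass. The obstacle is the sudden drop. The quadratic part of a step has mean
    square of order 1/n up to small factors, which is not summable over linearly many steps, so
    quadratic terms must never suffice for halving. For clauses and hyperedges they are
    deterministically small; cubic terms have mean square about n^(-3/2) and are summable. For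
    colourings an edge has only quadratic terms and may kill, so a whole vertex is exposed: its
    colour is uniform given the past, hence one edge has no average effect, one pair of edges a
    bounded one, and two bad pairs at once are rare. Sets of distinct constraints are dominated by
    lists of independent tuples up to a constant factor, harmless because the lower bound fails with
    probability o(1) and the first moment wins by an exponential factor. *)

Lemma eq_ler (R : realType) (x y : R) : x = y -> x <= y.
Proof. by move=> ->. Qed.

Lemma cauchy_schwarz (R : realType) (I : finType) (a b : I -> R) :
  (\sum_i a i * b i) ^+ 2 <= (\sum_i a i ^+ 2) * (\sum_i b i ^+ 2).
Proof.
rewrite -subr_ge0 -(pmulr_rge0 (x := 2)) //.
have -> : 2 * ((\sum_i a i ^+ 2) * (\sum_i b i ^+ 2) - (\sum_i a i * b i) ^+ 2) =
  \sum_i \sum_j (a i * b j - a j * b i) ^+ 2.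
  rewrite [RHS](eq_bigr (fun i => a i ^+ 2 * (\sum_j b j ^+ 2) + b i ^+ 2 * (\sum_j a j ^+ 2)
    - 2 * (a i * b i) * \sum_j a j * b j)); last first.
    move=> i _; rewrite !mulr_sumr -big_split /= -sumrB.
    by apply: eq_bigr => j _; ring.
  rewrite sumrB big_split /= -!mulr_suml -mulr_sumr; ring.
by apply: sumr_ge0 => i _; apply: sumr_ge0 => j _; exact: sqr_ge0.
Qed.

(** * Expectation over lists of independent draws *)

Section Expectation.
Variables (R : realType) (X : finType) (P : nat -> X -> R).
Hypothesis P0 : forall t x, 0 <= P t x.
Hypothesis P1 : forall t, \sum_x P t x = 1.

(** The newest draw is the head of the list, so the length of the tail is the index of the step, and
    unfolding once is conditioning on the past. *)
Fixpoint Ex (t : nat) (F : seq X -> R) : R :=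
  if t is s.+1 then Ex s (fun xs => \sum_x P s x * F (x :: xs)) else F [::].

Lemma Ex_le t F G :
  (forall xs, size xs = t -> F xs <= G xs) -> Ex t F <= Ex t G.
Proof.
elim: t F G => [|t IH] F G FG /=; first exact: FG.
apply: IH => xs sx; apply: ler_sum => x _; apply: ler_wpM2l => //.
by apply: FG; rewrite /= sx.
Qed.

Lemma eq_Ex t F G :
  (forall xs, size xs = t -> F xs = G xs) -> Ex t F = Ex t G.
Proof.
by move=> FG; apply/eqP; rewrite eq_le; apply/andP; split; apply: Ex_le => xs /FG ->.
Qed.

Lemma ExD t F G : Ex t (fun xs => F xs + G xs) = Ex t F + Ex t G.
Proof.
elim: t F G => [//|t IH] F G /=; rewrite -IH; apply: eq_Ex => xs _.
by rewrite -big_split; apply: eq_bigr => x _; rewrite mulrDr.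
Qed.

Lemma ExZ t a F : Ex t (fun xs => a * F xs) = a * Ex t F.
Proof.
elim: t F => [//|t IH] F /=; rewrite -IH; apply: eq_Ex => xs _.
by rewrite mulr_sumr; apply: eq_bigr => x _; rewrite mulrCA.
Qed.

Lemma Ex_cst t a : Ex t (fun=> a) = a.
Proof.
elim: t a => [//|t IH] a /=; rewrite -[RHS]IH; apply: eq_Ex => xs _.
by rewrite -mulr_suml P1 mul1r.
Qed.

Lemma Ex_ge0 t F : (forall xs, size xs = t -> 0 <= F xs) -> 0 <= Ex t F.
Proof. by move=> F0; rewrite -(Ex_cst t 0); apply: Ex_le. Qed.

Lemma Ex_sum t (I : Type) (r : seq I) (Q : pred I) (F : I -> seq X -> R) :
  Ex t (fun xs => \sum_(i <- r | Q i) F i xs) = \sum_(i <- r | Q i) Ex t (F i).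
Proof.
elim: r => [|i r IH].
  by rewrite big_nil -[RHS](Ex_cst t); apply: eq_Ex => xs _; rewrite big_nil.
rewrite big_cons; case: ifP => Qi.
  by rewrite -IH -ExD; apply: eq_Ex => xs _; rewrite big_cons Qi.
by rewrite -IH; apply: eq_Ex => xs _; rewrite big_cons Qi.
Qed.

Lemma Ex_markov t (F : seq X -> R) (a : R) : 0 < a -> (forall xs, size xs = t -> 0 <= F xs) ->
  Ex t (fun xs => (a < F xs)%R%:R) <= Ex t F / a.
Proof.
move=> a0 F0; rewrite mulrC -ExZ; apply: Ex_le => xs sx.
rewrite ler_pdivlMl //; case: ltP => [/ltW|_]; rewrite ?mulr1 ?mulr0 //.
exact: F0.
Qed.

Lemma Ex_prod t (h : X -> R) q : (forall s, \sum_x P s x * h x = q) ->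
  Ex t (fun xs => \prod_(x <- xs) h x) = q ^+ t.
Proof.
move=> hq; elim: t => [|t IH] /=; first by rewrite big_nil.
rewrite exprS -IH -ExZ; apply: eq_Ex => xs _.
rewrite -(hq t) mulr_suml; apply: eq_bigr => x _.
by rewrite big_cons mulrA.
Qed.

End Expectation.

(** * A likelihood-ratio process stays away from zero *)

Section Process.
Variables (R : realType) (X : finType) (P : nat -> X -> R).
Hypothesis P0 : forall t x, 0 <= P t x.
Hypothesis P1 : forall t, \sum_x P t x = 1.
Variables (Om : finType) (mu : Om -> R) (l : nat -> X -> Om -> R).
Hypothesis mu0 : forall s, 0 <= mu s.
Hypothesis mu1 : \sum_s mu s = 1.
Hypothesis l0 : forall t x s, 0 <= l t x s.
Hypothesis l1 : forall t s, \sum_x P t x * l t x s = 1.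
Local Notation Ex := (Ex P).

(** [mu] is a prior on solutions and [l t x s] a likelihood ratio of mean 1 under [P t]. Thus [mass]
    is a normalised count, a nonnegative martingale of mean 1, and [weight xs] divided by it is the
    posterior law of a planted solution. *)
Fixpoint weight (xs : seq X) (s : Om) : R :=
  if xs is x :: ys then l (size ys) x s * weight ys s else mu s.

Definition mass xs : R := \sum_s weight xs s.
Definition Kt t (s s' : Om) : R := \sum_x P t x * (l t x s * l t x s').

Lemma wt_ge0 xs s : 0 <= weight xs s.
Proof. by elim: xs => [|x xs IH] //=; rewrite mulr_ge0. Qed.

Lemma Wt_ge0 xs : 0 <= mass xs.
Proof. by apply: sumr_ge0 => s _; exact: wt_ge0. Qed.

Lemma Ex_wt t s : Ex t (fun xs => weight xs s) = mu s.
Proof.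
elim: t => [//|t IH] /=; rewrite -IH; apply: eq_Ex => // xs sx.
under eq_bigr do rewrite mulrA.
by rewrite -mulr_suml sx l1 mul1r.
Qed.

Lemma Ex_wt2 t s s' :
  Ex t (fun xs => weight xs s * weight xs s') = mu s * mu s' * \prod_(i < t) Kt i s s'.
Proof.
elim: t => [|t IH] /=; first by rewrite big_ord0 mulr1.
rewrite big_ord_recr /= mulrA -IH mulrC -ExZ //; apply: eq_Ex => // xs sx.
rewrite /Kt mulr_suml; apply: eq_bigr => x _; rewrite sx; ring.
Qed.

Lemma Wt_mean xs : \sum_x P (size xs) x * mass (x :: xs) = mass xs.
Proof.
rewrite /mass; under eq_bigr do rewrite mulr_sumr.
rewrite exchange_big /=; apply: eq_bigr => s _.
under eq_bigr do rewrite mulrA.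
by rewrite -mulr_suml l1 mul1r.
Qed.

Lemma Wt_sq xs : \sum_x P (size xs) x * mass (x :: xs) ^+ 2 =
  \sum_s \sum_s' weight xs s * weight xs s' * Kt (size xs) s s'.
Proof.
rewrite /mass; under eq_bigr do rewrite expr2 mulr_suml mulr_sumr.
rewrite exchange_big /=; apply: eq_bigr => s _.
under eq_bigr do rewrite mulr_sumr mulr_sumr.
rewrite exchange_big /=; apply: eq_bigr => s' _.
by rewrite /Kt mulr_sumr; apply: eq_bigr => x _; ring.
Qed.

Variables (T : nat) (G : seq X -> bool) (lam v eta gamma : nat -> R).
Hypothesis lam0 : 0 <= lam 0.
Hypothesis step_var : forall xs, (size xs < T)%N -> G xs ->
  expR (- lam (size xs)) <= mass xs ->
  \sum_x P (size xs) x * (mass (x :: xs) / mass xs) ^+ 2 <= 1 + v (size xs).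
Hypothesis step_kill : forall xs, (size xs < T)%N -> G xs ->
  expR (- lam (size xs)) <= mass xs ->
  \sum_x P (size xs) x * (mass (x :: xs) < mass xs / 2)%R%:R <= eta (size xs).
Hypothesis eta0 : forall t, 0 <= eta t.
Hypothesis G_prob : forall t, (t < T)%N -> Ex t (fun xs => (~~ G xs)%:R) <= gamma t.

(** Death has three causes, charged separately in [Ex_dead]: the side condition [G] fails, one step
    more than halves the mass, or the mass falls through the barrier [exp (- lam t)]. *)
Fixpoint alive (xs : seq X) : bool :=
  if xs is x :: ys then
    [&& alive ys, G ys, mass ys / 2 <= mass xs & expR (- lam (size xs)) <= mass xs]
  else true.

Lemma alive_Wt xs : alive xs -> expR (- lam (size xs)) <= mass xs.
Proof.
case: xs => [_|x xs /= /and4P[_ _ _ //]] /=.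
by rewrite /mass /= mu1 -expR0 ler_expR oppr_le0.
Qed.

(** Liveness before the last test of the barrier: the event on which Markov's inequality is applied
    to the inverse mass. *)
Definition pre_alive xs : bool :=
  if xs is x :: ys then [&& alive ys, G ys & mass ys / 2 <= mass xs] else true.

(** The linear term averages to zero along a martingale, so the inverse mass gains only a multiple
    of the conditional variance. A bound of this kind fails for small [f], which is why halving
    steps are excluded. *)
Lemma inv_le_quadratic (f : R) : 1 / 2 <= f -> f^-1 <= 1 - (f - 1) + 2 * (f - 1) ^+ 2.
Proof.
move=> f2; have f0 : 0 < f by lra.
rewrite -[leLHS]mul1r ler_pdivrMr //.
have -> : (1 - (f - 1) + 2 * (f - 1) ^+ 2) * f = 1 + (f - 1) ^+ 2 * (2 * f - 1) by ring.
rewrite lerDl mulr_ge0 ?sqr_ge0 //; lra.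
Qed.

Lemma pre_alive_step xs : (size xs < T)%N ->
  \sum_x P (size xs) x * ((pre_alive (x :: xs))%:R / mass (x :: xs)) <=
  expR (2 * v (size xs)) * ((alive xs)%:R / mass xs).
Proof.
move=> sT; have W0 := Wt_ge0 xs.
have [/= |nal] := boolP (alive xs && G xs); last first.
  rewrite big1 => [|x _].
    by apply: mulr_ge0; rewrite ?expR_ge0 // divr_ge0.
  by move: nal => /=; case: (alive xs) => //=; case: (G xs) => //=; rewrite !(mul0r, mulr0).
move=> /andP[al g]; have Wp : 0 < mass xs.
  by apply: lt_le_trans (alive_Wt al); exact: expR_gt0.
have st := step_var sT g (alive_Wt al).
apply: (@le_trans _ _ ((1 + 2 * v (size xs)) * (1 / mass xs))); last first.
  rewrite al; apply: ler_wpM2r; first by rewrite divr_ge0.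
  exact: expR_ge1Dx.
apply: (@le_trans _ _ (\sum_x P (size xs) x * ((1 - (mass (x :: xs) / mass xs - 1) +
     2 * (mass (x :: xs) / mass xs - 1) ^+ 2) * (1 / mass xs)))).
  apply: ler_sum => x _; apply: ler_wpM2l => //; rewrite /= al g /=.
  set W' := mass (x :: xs); have W'0 : 0 <= W' := Wt_ge0 _.
  (* At a halving step the left side is zero, while the quadratic bound on the right remains
     nonnegative. *)
  case: (leP (mass xs / 2) W') => h; last first.
    have q0 : 0 <= W' / mass xs by rewrite divr_ge0.
    have q1 : W' / mass xs <= 1 / 2 by rewrite ler_pdivrMr //; lra.
    rewrite mul0r; apply: mulr_ge0; last by rewrite divr_ge0.
    by move: (W' / mass xs) q0 q1 => q q0 q1; have := sqr_ge0 (q - 1); lra.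
  have W'p : 0 < W' by lra.
  have -> : 1%:R / W' = (W' / mass xs)^-1 * (1 / mass xs).
    by rewrite invf_div !mul1r mulrAC divff ?mul1r ?lt0r_neq0.
  apply: ler_wpM2r; first by rewrite divr_ge0.
  apply: inv_le_quadratic; rewrite ler_pdivlMr //; lra.
under eq_bigr do rewrite mulrA.
rewrite -mulr_suml; apply: ler_wpM2r; first by rewrite divr_ge0.
have -> : \sum_x P (size xs) x * (1 - (mass (x :: xs) / mass xs - 1) +
     2 * (mass (x :: xs) / mass xs - 1) ^+ 2) =
   4 * \sum_x P (size xs) x - 5 * \sum_x P (size xs) x * (mass (x :: xs) / mass xs) +
   2 * \sum_x P (size xs) x * (mass (x :: xs) / mass xs) ^+ 2.
  by rewrite !mulr_sumr -sumrB -big_split; apply: eq_bigr => x _ /=; ring.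
have -> : \sum_x P (size xs) x * (mass (x :: xs) / mass xs) = 1.
  under eq_bigr do rewrite mulrA.
  by rewrite -mulr_suml Wt_mean divff ?lt0r_neq0.
rewrite P1; lra.
Qed.

Lemma Ex_pre_alive t : (t < T)%N ->
  Ex t.+1 (fun xs => (pre_alive xs)%:R / mass xs) <=
  expR (2 * v t) * Ex t (fun xs => (alive xs)%:R / mass xs).
Proof.
move=> tT; rewrite -ExZ // /=; apply: Ex_le => // xs sx.
by rewrite -sx; apply: pre_alive_step; rewrite sx.
Qed.

Lemma alive_pre xs : alive xs -> pre_alive xs.
Proof. by case: xs => //= x xs /and4P[-> -> ->]. Qed.

Lemma Ex_alive t : (t <= T)%N ->
  Ex t (fun xs => (alive xs)%:R / mass xs) <= expR (\sum_(s < t) 2 * v s).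
Proof.
elim: t => [_|t IH tT] /=.
  by rewrite big_ord0 expR0 /mass /= mu1 divr1.
rewrite big_ord_recr /= expRD mulrC.
apply: (@le_trans _ _ (expR (2 * v t) * Ex t (fun xs => (alive xs)%:R / mass xs))).
  apply: le_trans (Ex_pre_alive tT).
  apply: (@Ex_le _ _ _ P0 t.+1 (fun xs => (alive xs)%:R / mass xs)) => xs _.
  apply: ler_wpM2r; first by rewrite invr_ge0 Wt_ge0.
  by rewrite ler_nat; case: (boolP (alive xs)) => // /alive_pre ->.
by apply: ler_wpM2l; rewrite ?expR_ge0 // IH // ltnW.
Qed.

(** One more step costs [gamma] for the side condition, [eta] for halving, and for the barrier at
    most its height times the mean inverse mass, which [Ex_alive] bounds by the accumulated
    variance. *)
Lemma Ex_dead t : (t <= T)%N ->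
  Ex t (fun xs => (~~ alive xs)%:R) <=
  \sum_(s < t) (gamma s + eta s + expR (\sum_(r < s.+1) 2 * v r - lam s.+1)).
Proof.
elim: t => [_|t IH tT] /=; first by rewrite big_ord0.
rewrite big_ord_recr /=; set S := \sum_(s < t) _ in IH *.
pose K xs : R := \sum_x P (size xs) x * (mass (x :: xs) < mass xs / 2)%R%:R.
apply: (@le_trans _ _ (Ex t (fun xs => (~~ alive xs)%:R + ((~~ G xs)%:R +
   ((alive xs && G xs)%:R * K xs +
    expR (- lam t.+1) * \sum_x P t x * ((pre_alive (x :: xs))%:R / mass (x :: xs))))))).
  apply: Ex_le => // xs sx.
  have -> : (~~ alive xs)%:R + ((~~ G xs)%:R + ((alive xs && G xs)%:R * K xs +
    expR (- lam t.+1) * \sum_x P t x * ((pre_alive (x :: xs))%:R / mass (x :: xs)))) =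
    \sum_x P t x * ((~~ alive xs)%:R + (~~ G xs)%:R +
      (alive xs && G xs)%:R * (mass (x :: xs) < mass xs / 2)%R%:R +
      expR (- lam t.+1) * ((pre_alive (x :: xs))%:R / mass (x :: xs))).
    rewrite [RHS](eq_bigr (fun x => P t x * (~~ alive xs)%:R + (P t x * (~~ G xs)%:R +
      ((alive xs && G xs)%:R * (P t x * (mass (x :: xs) < mass xs / 2)%R%:R) +
      expR (- lam t.+1) * (P t x * ((pre_alive (x :: xs))%:R / mass (x :: xs))))))).
      by rewrite !big_split /= -!mulr_suml P1 !mul1r -!mulr_sumr /K sx.
    by move=> x _; rewrite !mulrDr !(mulrCA (P t x)) !addrA.
  apply: ler_sum => x _; apply: ler_wpM2l => //=; rewrite sx.
  have W'0 := Wt_ge0 (x :: xs).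
  have e0 : 0 <= expR (- lam t.+1) := expR_ge0 _.
  case al: (alive xs); case g: (G xs) => /=; rewrite ?mul0r ?mulr0 ?addr0 ?add0r //; last by lra.
  have Wp : 0 < mass xs by apply: lt_le_trans (alive_Wt al); exact: expR_gt0.
  rewrite mul1r; case: (ltP _ (mass xs / 2)) => h /=; first by lra.
  rewrite add0r mul1r; case: (leP (expR _) (mass (x :: xs))) => h2 /=; first by rewrite mulr_ge0 // invr_ge0.
  by rewrite ler_pdivlMr ?mul1r ?ltW //; lra.
rewrite !ExD // ExZ //.
have e1 : Ex t (fun xs => (alive xs && G xs)%:R * K xs) <= eta t.
  rewrite -[leRHS](Ex_cst P0 P1 t); apply: Ex_le => // xs sx.
  have [/andP[al g]|] := boolP (alive xs && G xs); last first.
    by move=> _; rewrite mul0r.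
  rewrite mul1r -sx; apply: step_kill => //; rewrite ?sx //.
  by rewrite -sx; apply: alive_Wt.
have e2 : expR (- lam t.+1) * Ex t (fun xs => \sum_x P t x * ((pre_alive (x :: xs))%:R / mass (x :: xs))) <= expR (\sum_(r < t.+1) 2 * v r - lam t.+1).
  rewrite [leRHS]expRD mulrC; apply: ler_wpM2r; first exact: expR_ge0.
  apply: le_trans (Ex_pre_alive tT) _.
  rewrite big_ord_recr /= expRD mulrC; apply: ler_wpM2r; first exact: expR_ge0.
  by apply: Ex_alive; exact: ltnW.
have := IH (ltnW tT); have := G_prob tT; lra.
Qed.

Lemma process_lower_bound :
  Ex T (fun xs => (mass xs < expR (- lam T))%R%:R) <=
  \sum_(s < T) (gamma s + eta s + expR (\sum_(r < s.+1) 2 * v r - lam s.+1)).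
Proof.
apply: le_trans (Ex_dead (leqnn T)); apply: Ex_le => // xs sx.
rewrite ler_nat; case: ltP => // h; have [al|//] := boolP (alive xs).
by move: (alive_Wt al); rewrite sx leNgt h.
Qed.

End Process.

(** * Uniform subsets and independent sequences *)

Section Subsets.
Variables (R : realType) (U : finType) (C : {set U}).

Definition subs m : {set {set U}} :=
  [set J : {set U} | (J \subset C) && (#|J| == m)]%SET.

Lemma card_subs m : #|subs m| = 'C(#|C|, m).
Proof. exact: cards_draws. Qed.

(** Pairs of a set with [m.+1] elements and one of its elements are counted in two ways. *)
Lemma sum_subsS m (g : {set U} -> R) :
  (\sum_(J in subs m.+1) g J) *+ m.+1 =
  \sum_(J in subs m) \sum_(e in C :\: J) g (e |: J)%SET.
Proof.
transitivity (\sum_(J in subs m.+1) \sum_(e in J) g J).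
  rewrite -sumrMnl; apply: eq_bigr => J; rewrite inE => /andP[_ /eqP cJ].
  by rewrite sumr_const cJ.
rewrite (exchange_big_dep (mem C)) /=; last first.
  by move=> J e; rewrite inE => /andP[/fintype.subsetP JC _]; exact: JC.
rewrite [RHS](exchange_big_dep (mem C)) /=; last first.
  by move=> J e _; rewrite inE => /andP[].
apply: eq_bigr => e eC.
rewrite (reindex_onto (fun J => e |: J)%SET (fun J => J :\ e)%SET) /=; last first.
  by move=> J /andP[_ eJ]; rewrite setD1K.
apply: eq_bigl => J; rewrite !inE eqxx /= andbT eC andbT subUset sub1set eC.
have [eJ|eJ] := boolP (e \in J); rewrite ?andbF /=.
  apply/andP => -[_ /eqP eJJ]; move: eJ; rewrite -eJJ.
  by rewrite !inE eqxx.
by rewrite setU1K // eqxx andbT cardsU1 eJ eqSS andbT.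
Qed.

Lemma subs_avgS m (g : {set U} -> R) : (m < #|C|)%N ->
  (\sum_(J in subs m.+1) g J) / #|subs m.+1|%:R =
  (\sum_(J in subs m) (\sum_(e in C :\: J) g (e |: J)%SET) / (#|C|%:R - m%:R)) /
    #|subs m|%:R.
Proof.
move=> mC.
have cS : #|subs m.+1|%:R * m.+1%:R = #|subs m|%:R * (#|C|%:R - m%:R) :> R.
  rewrite !card_subs -natrB ?(ltnW mC) // -!natrM; congr _%:R.
  by rewrite [LHS]mulnC mul_bin_left mulnC.
rewrite -mulr_suml -sum_subsS -mulrA -invfM (mulrC (_ - _)) -cS.
by rewrite -[_ *+ m.+1]mulr_natr invfM mulrACA divff ?mulr1 // pnatr_eq0.
Qed.

Variables (X : finType) (e : X -> U) (M : nat).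
Hypothesis M0 : (0 < M)%N.
Hypothesis fibre : forall u, u \in C -> (M <= #|[set x | e x == u]%SET|)%N.
Hypothesis C0 : (0 < #|C|)%N.

Definition setof (xs : seq X) : {set U} := [set u in map e xs]%SET.
(** The same law at every step, in the shape that [Ex] expects. *)
Definition unif (t : nat) (x : X) : R := #|X|%:R^-1.

Lemma unif0 t x : 0 <= unif t x. Proof. by rewrite invr_ge0. Qed.

Lemma unif1 t : (0 < #|X|)%N -> \sum_x unif t x = 1.
Proof. by move=> X0; rewrite sumr_const -[LHS]mulr_natl divff // pnatr_eq0 -lt0n. Qed.

Lemma sum_fibre (h : U -> R) : (forall u, 0 <= h u) ->
  M%:R * \sum_(u in C) h u <= \sum_(x | e x \in C) h (e x).
Proof.
move=> h0; rewrite mulr_sumr (partition_big e (mem C)) //=.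
apply: ler_sum => u uC.
rewrite (eq_bigr (fun=> h u)); last by move=> x /andP[_ /eqP ->].
rewrite sumr_const -[leRHS]mulr_natl; apply: ler_wpM2r => //; rewrite ler_nat.
apply: leq_trans (fibre uC) _; apply/eq_leq/eq_card => x.
by rewrite !inE unfold_in; case: (e x =P u) => [->|]; rewrite ?andbF ?andbT.
Qed.

(** Induction on [m]: the last element is uniform on [C :\: J], a law at most [#|C| / (#|C| - m)]
    times the uniform law on [C], which in turn is at most [#|X| / (M * #|C|)] times the law of
    [e x]. As [g] is nonnegative, repeated elements may be added back. *)
Lemma subset_le_list m (g : {set U} -> R) : (forall J, 0 <= g J) -> (m <= #|C|)%N ->
  (\sum_(J in subs m) g J) / #|subs m|%:R <=
  (#|X|%:R / (M%:R * #|C|%:R)) ^+ m * \prod_(i < m) (#|C|%:R / (#|C|%:R - i%:R)) *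
  Ex unif m (fun xs => (all (fun x => e x \in C) xs)%:R * g (setof xs)).
Proof.
have X0 : (0 < #|X|)%N.
  have /card_gt0P[u uC] := C0; have := leq_trans M0 (fibre uC).
  by move=> /card_gt0P[x _]; apply/card_gt0P; exists x.
elim: m g => [|m IH] g g0 mC.
  rewrite big_ord0 expr0 !mul1r /= card_subs bin0 divr1.
  rewrite (big_pred1 set0) => [|J]; last first.
    by rewrite !inE cards_eq0; case: eqP => [->|]; rewrite ?sub0set ?andbF.
  by rewrite mul1r (_ : setof [::] = set0) //; apply/setP => u; rewrite !inE.
pose g' J := (\sum_(u in C) g (u |: J)%SET) / (#|C|%:R - m%:R).
have Cm : 0 < #|C|%:R - m%:R :> R by rewrite subr_gt0 ltr_nat.
have g'0 J : 0 <= g' J by rewrite divr_ge0 ?(ltW Cm) // sumr_ge0.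
apply: (@le_trans _ _ ((\sum_(J in subs m) g' J) / #|subs m|%:R)).
  rewrite subs_avgS //; apply: ler_wpM2r; first by rewrite invr_ge0.
  apply: ler_sum => J _; apply: ler_wpM2r; first by rewrite invr_ge0 ltW.
  rewrite [leRHS](big_setID J) /=; apply: ler_wpDl => //.
  by apply: sumr_ge0.
apply: le_trans (IH g' g'0 (ltnW mC)) _.
rewrite exprSr big_ord_recr /=.
have ME : 0 < M%:R :> R by rewrite ltr0n.
have CE : 0 < #|C|%:R :> R by rewrite ltr0n.
have XE : 0 < #|X|%:R :> R by rewrite ltr0n.
set a := _ ^+ m; set b := \prod_(i < m) _; set c := _ / (_ * _); set d := _ / (_ - _).
have -> : a * c * (b * d) = (a * b) * (c * d) by ring.
rewrite -[leRHS]mulrA; apply: ler_wpM2l.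
  apply: mulr_ge0; first by rewrite exprn_ge0 // divr_ge0 // mulr_ge0.
  apply: prodr_ge0 => i _; apply: divr_ge0 => //.
  by rewrite subr_ge0 ler_nat; apply: leq_trans (ltnW (ltn_ord i)) (ltnW mC).
rewrite -ExZ; last exact: unif0.
apply: Ex_le => [|xs sx]; first exact: unif0.
rewrite [leRHS]mulr_sumr /=.
case al: (all _ xs); last first.
  by rewrite mul0r; apply: sumr_ge0 => x _; rewrite andbF mul0r !mulr0.
rewrite mul1r /g' ler_pdivrMr // mulr_suml.
rewrite -(ler_pM2l ME); apply: le_trans (sum_fibre _) _ => //.
rewrite big_mkcond mulr_sumr; apply: ler_sum => x _ /=.
rewrite andbT /unif /c /d; case: ifP => ex /=; last by rewrite !(mul0r, mulr0).
rewrite (_ : setof (x :: xs) = e x |: setof xs)%SET; last first.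
  by apply/setP => u; rewrite !inE.
rewrite mul1r le_eqVlt; apply/orP; left; apply/eqP.
by field; rewrite !lt0r_neq0.
Qed.

(** A uniform set of size [m.+1] is a uniform set of size [m] with a uniform further element. *)
Lemma subs_avg_mono m (g : {set U} -> R) :
  (forall (J : {set U}) u, J \subset C -> u \in C -> g J <= g (u |: J)%SET) -> (m < #|C|)%N ->
  (\sum_(J in subs m) g J) / #|subs m|%:R <=
  (\sum_(J in subs m.+1) g J) / #|subs m.+1|%:R.
Proof.
move=> gm mC.
have Cm : 0 < #|C|%:R - m%:R :> R by rewrite subr_gt0 ltr_nat.
rewrite subs_avgS //; apply: ler_wpM2r; first by rewrite invr_ge0.
apply: ler_sum => J; rewrite inE => /andP[JC /eqP cJ]; rewrite ler_pdivlMr //.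
apply: (@le_trans _ _ (\sum_(u in C :\: J) g J)).
  rewrite sumr_const -[leRHS]mulr_natr; apply: eq_ler; congr (_ * _).
  by rewrite cardsDS // cJ natrB // ltnW.
by apply: ler_sum => u; rewrite inE => /andP[_ uC]; exact: gm.
Qed.

End Subsets.

(** * From the uniform pair to a planted first moment *)

Section Transfer.
Variable R : realType.

(** Instances with fewer than [L] solutions are given up. On the others the proportion of bad
    solutions is at most their number over [L], so a bound on the mean number of bad solutions is
    enough. *)
Lemma pair_prob_ge (I S : finType) (inst : {set I}) (sol : I -> {set S})
    (E : I -> S -> bool) (L : R) : 0 < L -> (0 < #|inst|)%N ->
  1 - (\sum_(J in inst) (#|sol J|%:R < L)%R%:R) / #|inst|%:R
    - (\sum_(J in inst) #|[set s in sol J | ~~ E J s]%SET|%:R) / #|inst|%:R / L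
  <= pair_prob R inst sol E.
Proof.
move=> L0 i0; have ip : 0 < #|inst|%:R :> R by rewrite ltr0n.
rewrite /pair_prob ler_pdivlMr // !mulrBl mul1r.
rewrite divfK ?lt0r_neq0 // mulrAC divfK ?lt0r_neq0 //.
rewrite -sumr_const mulr_suml -!sumrB; apply: ler_sum => J _.
set a := #|[set s in sol J | E J s]%SET|; set b := #|[set s in sol J | ~~ E J s]%SET|.
have ab : (a + b)%N = #|sol J|.
  rewrite /a /b -(cardsID [set s | E J s]%SET (sol J)).
  by congr (_ + _)%N; apply: eq_card => s; rewrite !inE // andbC.
case: ltP => h.
  apply: (@le_trans _ _ 0); last by rewrite divr_ge0.
  by rewrite subrr sub0r oppr_le0 divr_ge0 // ltW.
have s0 : 0 < #|sol J|%:R :> R by apply: lt_le_trans h.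
rewrite subr0 ler_pdivlMr // mulrBl mul1r lerBlDr -ab natrD lerD2l.
rewrite mulrAC ler_pdivlMr //; rewrite -ab natrD in h.
by rewrite ler_wpM2l.
Qed.

Lemma pair_prob_le1 (I S : finType) (inst : {set I}) (sol : I -> {set S})
    (E : I -> S -> bool) : pair_prob R inst sol E <= 1.
Proof.
rewrite /pair_prob; have [->|i0] := posnP #|inst|; first by rewrite invr0 mulr0.
rewrite ler_pdivrMr ?ltr0n // mul1r -sumr_const; apply: ler_sum => J _.
have [->|s0] := posnP #|sol J|; first by rewrite invr0 mulr0.
rewrite ler_pdivrMr ?ltr0n // mul1r ler_nat; apply: subset_leq_card.
by apply/fintype.subsetP => s; rewrite inE => /andP[].
Qed.

Lemma prod_falling_le (N m : nat) : (2 * m <= N)%N -> (0 < N)%N ->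
  \prod_(i < m) (N%:R / (N%:R - i%:R)) <= expR (2 * m%:R ^+ 2 / N%:R) :> R.
Proof.
move=> mN N0; have Np : 0 < N%:R :> R by rewrite ltr0n.
apply: (@le_trans _ _ (\prod_(i < m) expR (2 * m%:R / N%:R))); last first.
  rewrite prodr_const card_ord -expRM_natl ler_expR.
  by apply: eq_ler; ring.
apply: ler_prod => i _; have im : i%:R <= m%:R :> R by rewrite ler_nat ltnW.
have mN' : 2 * m%:R <= N%:R :> R by rewrite -natrM ler_nat.
have i0 : 0 <= i%:R :> R by [].
rewrite divr_ge0 //=; last by lra.
apply: le_trans (expR_ge1Dx _).
rewrite ler_pdivrMr; last by lra.
have -> : (1 + 2 * m%:R / N%:R) * (N%:R - i%:R) =
   N%:R - i%:R + 2 * m%:R * (1 - i%:R / N%:R) :> R by field; rewrite lt0r_neq0.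
have : 2^-1 <= 1 - i%:R / N%:R :> R.
  have : i%:R / N%:R <= 2^-1 :> R by rewrite ler_pdivrMr //; lra.
  lra.
move: (1 - _) => q q2; have : m%:R <= 2 * m%:R * q :> R; last by lra.
have m0 : 0 <= m%:R :> R by [].
nra.
Qed.

End Transfer.

Lemma sum_indic (R : realType) (T : finType) (B : {set T}) :
  \sum_x (x \in B)%:R = #|B|%:R :> R.
Proof. by rewrite -sumr_const [RHS]big_mkcond; apply: eq_bigr => x _; case: ifP. Qed.

Section AverageTuples.
Variables (R : realType) (k : nat) (Lam : finType).
Local Notation X := {ffun 'I_k -> Lam}.

Lemma avg_prod (h : 'I_k -> Lam -> R) t :
  \sum_x unif R (X := X) t x * \prod_i h i (x i) =
  \prod_i ((\sum_l h i l) / #|Lam|%:R).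
Proof.
rewrite -mulr_sumr -bigA_distr_bigA big_split /= mulrC; congr (_ * _).
by rewrite prodr_const card_ord /unif card_ffun card_ord natrX exprVn.
Qed.
End AverageTuples.

(** Every assignment is [s] with the bits of a unique set flipped, and its distance is the size of
    that set. *)
Lemma sum_hamming (R : realType) n (s : {ffun 'I_n -> bool}) (h : nat -> R) :
  \sum_s' h (hamming s s') = \sum_(j < n.+1) 'C(n, j)%:R * h j.
Proof.
pose D (s' : {ffun 'I_n -> bool}) := [set v | s v != s' v]%SET.
pose D' (A : {set 'I_n}) : {ffun 'I_n -> bool} := [ffun v => s v (+) (v \in A)].
have DK : cancel D D'.
  by move=> s'; apply/ffunP => v; rewrite ffunE inE; case: (s v); case: (s' v).
have D'K : cancel D' D.
  by move=> A; apply/setP => v; rewrite inE ffunE; case: (s v); case: (v \in A).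
rewrite (reindex D') /=; last by exists D => x _; [exact: D'K|exact: DK].
rewrite (partition_big (fun A : {set 'I_n} => inord #|A| : 'I_n.+1) xpredT) //=.
apply: eq_bigr => j _.
have cA (A : {set 'I_n}) : (#|A| < n.+1)%N by rewrite ltnS -[n in (_ <= n)%N]card_ord max_card.
rewrite (eq_bigr (fun=> h j)) => [|A /eqP <-]; last first.
  by rewrite /hamming -/(D (D' A)) D'K inordK.
rewrite sumr_const -[LHS]mulr_natl; congr (_%:R * _).
have := card_draws 'I_n j; rewrite card_ord => <-.
by apply: eq_card => A; rewrite [RHS]inE -[LHS]/(inord #|A| == j) -val_eqE /= inordK.
Qed.

(** * Lower bound for weighted solution counts of spin systems *)

Section Spin.
Variables (R : realType) (n k : nat) (Lam : finType).
Variables (Om0 : {set {ffun 'I_n -> bool}}) (sp : {ffun 'I_n -> bool} -> Lam -> R).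
Variables (g : nat -> R) (A : R).
Local Notation Om := {ffun 'I_n -> bool}.
Local Notation X := {ffun 'I_k -> Lam}.
Hypothesis n0 : (0 < n)%N.
Hypothesis Lam0 : (0 < #|Lam|)%N.
Definition ov (s s' : Om) : R := 1 - 2 * (hamming s s')%:R / n%:R.
Hypothesis sp1 : forall s l, `|sp s l| <= 1.
Hypothesis sp_mean : forall s, s \in Om0 -> \sum_l sp s l = 0.
Hypothesis sp_ov : forall s s', \sum_l sp s l * sp s' l = #|Lam|%:R * ov s s'.
Hypothesis Om0_card : 2 ^+ n <= (n.+1)%:R * #|Om0|%:R :> R.
Hypothesis g1 : g 1 = 0.
Hypothesis g2 : forall j, `|g j| <= 2.
Hypothesis A0 : 0 <= A.
Hypothesis Ag0 : A * g 0 <= 1 / 4.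
Hypothesis Ak : 2 * A * k%:R ^+ 2 <= 1 / 8.

Definition chr (s : Om) (S : {set 'I_k}) (x : X) : R := \prod_(i in S) sp s (x i).
(** A symmetric function of the [k] spins, given by one Fourier coefficient for each size of set.
    [Fs] subtracts its multiple by [A] from 1 and normalises to mean 1; in both applications [A] is
    chosen so that [Fs] vanishes on violated constraints. *)
Definition Gs (s : Om) (x : X) : R := \sum_(S : {set 'I_k}) g #|S| * chr s S x.
Definition Fs (s : Om) (x : X) : R := (1 - A * Gs s x) / (1 - A * g 0).
Hypothesis Fs0 : forall s x, s \in Om0 -> 0 <= Fs s x.
Local Notation P := (unif R (X := X)).

Lemma X_gt0 : (0 < #|X|)%N.
Proof. by rewrite card_ffun expn_gt0 Lam0. Qed.

Lemma P_sum1 t : \sum_x P t x = 1. Proof. exact: unif1 X_gt0. Qed.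
Lemma P_ge0 t x : 0 <= P t x. Proof. exact: unif0. Qed.

Lemma LamN0 : #|Lam|%:R != 0 :> R. Proof. by rewrite pnatr_eq0 -lt0n. Qed.

Lemma chrE s (S : {set 'I_k}) x : chr s S x = \prod_i (if i \in S then sp s (x i) else 1).
Proof. exact: big_mkcond. Qed.

Lemma avg_chr2 t s s' S :
  \sum_x P t x * (chr s S x * chr s' S x) = ov s s' ^+ #|S|.
Proof.
under eq_bigr do rewrite !chrE -big_split /=.
rewrite (avg_prod (fun i l => (if i \in S then sp s l else 1) * (if i \in S then sp s' l else 1))).
rewrite -prodr_const [RHS]big_mkcond /=; apply: eq_bigr => i _.
case: ifP => iS; first by rewrite sp_ov mulrC mulKf ?LamN0.
by rewrite mulr1 sumr_const -[X in X / _]mulr_natl mulr1 divff ?LamN0.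
Qed.

Lemma avg_chrD t s s' S S' : s \in Om0 -> s' \in Om0 -> S != S' ->
  \sum_x P t x * (chr s S x * chr s' S' x) = 0.
Proof.
move=> sO sO' SS'.
under eq_bigr do rewrite !chrE -big_split /=.
rewrite (avg_prod (fun i l => (if i \in S then sp s l else 1) * (if i \in S' then sp s' l else 1))).
have [i iSS] : exists i, (i \in S) != (i \in S').
  apply/existsP; apply: contraNT SS' => /existsPn h; apply/eqP/setP => i.
  by apply/eqP; have := h i; rewrite negbK.
rewrite (bigD1 i) //=; move: iSS; case: (i \in S); case: (i \in S') => //= _.
  by (under eq_bigr do rewrite mulr1); rewrite sp_mean // !mul0r.
by (under eq_bigr do rewrite mul1r); rewrite sp_mean // !mul0r.
Qed.

Lemma avg_chr t s S : s \in Om0 -> \sum_x P t x * chr s S x = (S == set0)%:R.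
Proof.
move=> sO; have c0 s' x : chr s' set0 x = 1 by rewrite /chr big_set0.
case: eqP => [->|/eqP S0].
  by (under eq_bigr do rewrite c0 mulr1); rewrite P_sum1.
rewrite -[RHS](avg_chrD t sO sO S0); apply: eq_bigr => x _.
by rewrite c0 mulr1.
Qed.

Definition mu (s : Om) : R := (s \in Om0)%:R / #|Om0|%:R.
(** [Fs] is nonnegative with mean 1 only for [s] in [Om0]. Elsewhere the prior is zero, and the
    value 1 makes [lk] a likelihood ratio for all [s]. *)
Definition lk (t : nat) (x : X) (s : Om) : R := if s \in Om0 then Fs s x else 1.

Lemma Om0_gt0 : 0 < #|Om0|%:R :> R.
Proof.
rewrite lt0r ler0n andbT; apply/eqP => o0; have := Om0_card.
by rewrite o0 mulr0 leNgt exprn_gt0.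
Qed.

Lemma mu_ge0 s : 0 <= mu s. Proof. by rewrite divr_ge0. Qed.

Lemma mu_sum1 : \sum_s mu s = 1.
Proof.
by rewrite -mulr_suml sum_indic divff // lt0r_neq0 // Om0_gt0.
Qed.

Lemma Ag_gt0 : 0 < 1 - A * g 0. Proof. by rewrite subr_gt0; apply: le_lt_trans Ag0 _; lra. Qed.

Lemma lk_ge0 t x s : 0 <= lk t x s.
Proof. by rewrite /lk; case: ifP => // /Fs0. Qed.

Lemma avg_Gs t s : s \in Om0 -> \sum_x P t x * Gs s x = g 0.
Proof.
move=> sO; under eq_bigr do rewrite mulr_sumr; rewrite exchange_big /=.
rewrite (bigD1 set0) //= [X in _ + X]big1 => [|S S0].
  under eq_bigr do rewrite mulrCA; rewrite -mulr_sumr avg_chr // eqxx cards0 mulr1 addr0 //.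
under eq_bigr do rewrite mulrCA; rewrite -mulr_sumr avg_chr // (negbTE S0) mulr0 //.
Qed.

Lemma avg_lk t s : \sum_x P t x * lk t x s = 1.
Proof.
rewrite /lk; case sO: (s \in Om0); last by (under eq_bigr do rewrite mulr1); rewrite P_sum1.
under eq_bigr do rewrite /Fs mulrA.
rewrite -mulr_suml.
under eq_bigr do rewrite mulrBr mulr1 mulrCA.
by rewrite sumrB P_sum1 -mulr_sumr avg_Gs // divff // lt0r_neq0 // Ag_gt0.
Qed.

Definition A' := A / (1 - A * g 0).
Definition Hs (r : R) : R := \sum_(S : {set 'I_k} | S != set0) g #|S| ^+ 2 * r ^+ #|S|.

(** The characters are orthogonal, so two solutions interact only through their overlap. *)
Lemma Kt_lk t s s' : s \in Om0 -> s' \in Om0 ->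
  Kt P lk t s s' = 1 + A' ^+ 2 * Hs (ov s s').
Proof.
move=> sO sO'; rewrite /Kt /lk sO sO'.
have -> : \sum_x P t x * (Fs s x * Fs s' x) =
  (\sum_x P t x - A * (\sum_x P t x * Gs s x) - A * (\sum_x P t x * Gs s' x) +
   A ^+ 2 * \sum_x P t x * (Gs s x * Gs s' x)) / (1 - A * g 0) ^+ 2.
  rewrite !mulr_sumr -!sumrB -big_split mulr_suml; apply: eq_bigr => x _ /=.
  by rewrite /Fs; field; rewrite lt0r_neq0 ?Ag_gt0.
rewrite P_sum1 !avg_Gs //.
have -> : \sum_x P t x * (Gs s x * Gs s' x) = g 0 ^+ 2 + Hs (ov s s').
  transitivity (\sum_(S : {set 'I_k}) g #|S| ^+ 2 * ov s s' ^+ #|S|); last first.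
    by rewrite (bigD1 set0) //= cards0 mulr1.
  under eq_bigr do rewrite mulr_suml mulr_sumr; rewrite exchange_big /=.
  apply: eq_bigr => S _; under eq_bigr do rewrite mulr_sumr mulr_sumr.
  rewrite exchange_big /= (bigD1 S) //= [X in _ + X]big1 => [|S' S'S].
    rewrite addr0 -(avg_chr2 t) mulr_sumr; apply: eq_bigr => x _; ring.
  transitivity (g #|S| * g #|S'| * \sum_x P t x * (chr s S x * chr s' S' x)).
    by rewrite mulr_sumr; apply: eq_bigr => x _; ring.
  by rewrite avg_chrD ?mulr0 // eq_sym.
by rewrite /A'; field; rewrite lt0r_neq0 ?Ag_gt0.
Qed.

Local Notation wt := (weight mu lk).
Local Notation Wt := (mass mu lk).

Lemma wt_out xs s : s \notin Om0 -> wt xs s = 0.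
Proof.
by move=> sO; elim: xs => [|x xs IH] /=; rewrite ?IH ?mulr0 // /mu (negbTE sO) mul0r.
Qed.

Lemma wt_nonneg xs s : 0 <= wt xs s.
Proof. by apply: wt_ge0; [exact: mu_ge0|exact: lk_ge0]. Qed.

Lemma expR_mass xs L : expR (- L) <= Wt xs -> 1 <= expR (2 * L) * Wt xs ^+ 2.
Proof.
move=> WL; apply: (@le_trans _ _ (expR (2 * L) * expR (- L) ^+ 2)).
  by rewrite -expRM_natl -expRD (_ : _ + _ = 0) ?expR0 //; ring.
apply: ler_wpM2l; first exact: expR_ge0.
by rewrite !expr2; apply: ler_pM; rewrite ?expR_ge0.
Qed.

Lemma ov_le1 s s' : `|ov s s'| <= 1.
Proof.
have h : (hamming s s' <= n)%N by rewrite -[n in (_ <= n)%N]card_ord max_card.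
have np : 0 < n%:R :> R by rewrite ltr0n.
have : (hamming s s')%:R / n%:R <= 1 :> R by rewrite ler_pdivrMr // mul1r ler_nat.
have : 0 <= (hamming s s')%:R / n%:R :> R by rewrite divr_ge0.
rewrite /ov -mulrA ler_norml; lra.
Qed.

Lemma Hs_norm (r : R) : Hs r <= Hs `|r|.
Proof.
apply: ler_sum => S _; apply: ler_wpM2l; rewrite ?sqr_ge0 //.
by apply: le_trans (ler_norm _) _; rewrite normrX.
Qed.

Lemma Hs_ge0 (r : R) : 0 <= Hs `|r|.
Proof. by apply: sumr_ge0 => S _; rewrite mulr_ge0 ?sqr_ge0 ?exprn_ge0. Qed.

(** As [g 1 = 0], every contributing set has at least two elements. A linear term would beat the
    Gaussian decay of the number of pairs near overlap 0, and [pair_bound] would fail. *)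
Lemma Hs_quad (r : R) : `|r| <= 1 -> Hs `|r| <= 4 * 2 ^+ k * r ^+ 2.
Proof.
move=> r1; apply: (@le_trans _ _ (\sum_(S : {set 'I_k}) 4 * r ^+ 2)); last first.
  rewrite sumr_const -cardsT (_ : [set: _] = powerset [set: 'I_k])%SET; last first.
    by apply/setP => S; rewrite !inE subsetT.
  rewrite card_powerset cardsT card_ord -[leLHS]mulr_natl natrX; lra.
rewrite /Hs big_mkcond; apply: ler_sum => S _; case: ifP => S0; last first.
  by rewrite mulr_ge0 // sqr_ge0.
have [->|S1] := eqVneq #|S| 1%N; first by rewrite g1 expr0n mul0r mulr_ge0 ?sqr_ge0.
have : (1 < #|S|)%N by move: S0 S1; rewrite -cards_eq0; case: #|S| => [|[]].
case: #|S| => [|[|j]] // _; rewrite -(add2n j) exprD real_normK ?num_real //.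
have : g (2 + j) ^+ 2 <= 4.
  by rewrite -(real_normK (num_real (g _))); have := g2 (2 + j); have := normr_ge0 (g (2 + j)); nra.
have : `|r| ^+ j <= 1 by rewrite exprn_ile1.
have : 0 <= `|r| ^+ j by rewrite exprn_ge0.
have := sqr_ge0 (g (2 + j)); have := sqr_ge0 r.
move: (g _ ^+ 2) (`|r| ^+ j) (r ^+ 2) => a b c c0 a0 b0 b1 a4.
apply: ler_pM => //; first by rewrite mulr_ge0.
by rewrite ler_piMr.
Qed.

Variables (m : nat) (kap : R).
Hypothesis kap0 : 0 < kap.
Hypothesis pair_bound : forall j, (j <= n)%N ->
  'C(n, j)%:R / 2 ^+ n * expR (m%:R * A' ^+ 2 * Hs `|1 - 2 * j%:R / n%:R|) <=
  expR (- (kap * (n%:R * (1 - 2 * j%:R / n%:R) ^+ 2))) :> R.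

Definition bigpairs (y : R) xs : R :=
  \sum_s \sum_s' (y <= n%:R * ov s s' ^+ 2)%R%:R * (wt xs s * wt xs s').

Lemma prod_Kt_le t s s' : (t <= m)%N -> s \in Om0 -> s' \in Om0 ->
  \prod_(i < t) Kt P lk i s s' <= expR (m%:R * A' ^+ 2 * Hs `|ov s s'|).
Proof.
move=> tm sO sO'; have H0 := Hs_ge0 (ov s s'); have A'2 := sqr_ge0 A'.
apply: (@le_trans _ _ (\prod_(i < t) expR (A' ^+ 2 * Hs `|ov s s'|))).
  apply: ler_prod => i _; apply/andP; split.
    by apply: sumr_ge0 => x _; rewrite mulr_ge0 ?P_ge0 // mulr_ge0 ?lk_ge0.
  rewrite Kt_lk //; apply: le_trans (expR_ge1Dx _); rewrite lerD2l.
  by rewrite ler_wpM2l // Hs_norm.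
rewrite prodr_const card_ord -expRM_natl ler_expR -mulrA.
apply: ler_wpM2r; first exact: mulr_ge0.
by rewrite ler_nat.
Qed.

(** Summing over [s'] by distance reduces this to [pair_bound]. One factor [n.+1] is the number of
    distances, the other comes from [Om0_card]. *)
Lemma Ex_bigpairs t y : (t <= m)%N ->
  Ex P t (bigpairs y) <= n.+1%:R ^+ 2 * expR (- (kap * y)).
Proof.
move=> tm; rewrite Ex_sum; [|exact: P_ge0|exact: P_sum1].
apply: (@le_trans _ _ (\sum_s mu s * (n.+1%:R ^+ 2 * expR (- (kap * y))))); last first.
  by rewrite -mulr_suml mu_sum1 mul1r.
have ge0 s s' : 0 <= (n.+1%:R / 2 ^+ n) *
    ((y <= n%:R * (1 - 2 * (hamming s s')%:R / n%:R) ^+ 2)%R%:R *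
      expR (m%:R * A' ^+ 2 * Hs `|1 - 2 * (hamming s s')%:R / n%:R|)) :> R.
  by rewrite mulr_ge0 ?divr_ge0 ?exprn_ge0 // mulr_ge0 ?expR_ge0.
apply: ler_sum => s _; rewrite Ex_sum; [|exact: P_ge0|exact: P_sum1].
case sO: (s \in Om0); last first.
  rewrite /mu sO !mul0r big1 // => s' _.
  rewrite -[RHS](Ex_cst P_ge0 P_sum1 t); apply: eq_Ex => [|xs _]; first exact: P_ge0.
  by rewrite (wt_out xs (s := s)) ?sO // mul0r mulr0.
apply: (@le_trans _ _ (\sum_s' mu s * ((n.+1%:R / 2 ^+ n) *
    ((y <= n%:R * (1 - 2 * (hamming s s')%:R / n%:R) ^+ 2)%R%:R *
      expR (m%:R * A' ^+ 2 * Hs `|1 - 2 * (hamming s s')%:R / n%:R|))))).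
  apply: ler_sum => s' _; rewrite ExZ; last exact: P_ge0.
  rewrite (Ex_wt2 P_ge0); set pr := \prod_(i < t) _.
  have -> (u : R) : u * (mu s * mu s' * pr) = mu s * (mu s' * (u * pr)) by ring.
  apply: ler_wpM2l; first exact: mu_ge0.
  rewrite /mu; case sO': (s' \in Om0); last by rewrite !mul0r; exact: ge0.
  rewrite mul1r; apply: ler_pM; rewrite ?invr_ge0 //.
  - by rewrite mulr_ge0 // prodr_ge0 // => i _; apply: sumr_ge0 => x _;
      rewrite mulr_ge0 ?P_ge0 // mulr_ge0 ?lk_ge0.
  - rewrite ler_pdivlMr ?exprn_gt0 // mulrC ler_pdivrMr ?Om0_gt0 //.
  by apply: ler_wpM2l => //; exact: prod_Kt_le.
rewrite -mulr_sumr; apply: ler_wpM2l; first exact: mu_ge0.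
rewrite -mulr_sumr (sum_hamming s (fun j => (y <= n%:R * (1 - 2 * j%:R / n%:R) ^+ 2)%R%:R *
      expR (m%:R * A' ^+ 2 * Hs `|1 - 2 * j%:R / n%:R|))).
rewrite [in leRHS]expr2 -[leRHS]mulrA -[leLHS]mulrA; apply: ler_wpM2l => //.
rewrite mulr_sumr; apply: (@le_trans _ _ (\sum_(j < n.+1) expR (- (kap * y)))); last first.
  by rewrite sumr_const card_ord -[leLHS]mulr_natl.
apply: ler_sum => j _; case: (leP y) => h; last by rewrite !(mul0r, mulr0) expR_ge0.
rewrite mul1r mulrA (mulrC _^-1); apply: le_trans (pair_bound _) _.
  by rewrite -ltnS.
by rewrite ler_expR lerN2 ler_pM2l.
Qed.

(** The slack [n ^ 2] over the mean makes this fail with probability at most [n ^- 2] by Markov's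
    inequality, which is summable over linearly many steps. *)
Definition goodpairs (y : R) xs : bool :=
  bigpairs y xs <= n%:R ^+ 2 * (n.+1%:R ^+ 2 * expR (- (kap * y))).

Lemma bigpairs_ge0 y xs : 0 <= bigpairs y xs.
Proof.
apply: sumr_ge0 => s _; apply: sumr_ge0 => s' _.
by rewrite mulr_ge0 // mulr_ge0 ?wt_nonneg.
Qed.

Lemma Ex_goodpairs t y : (t <= m)%N ->
  Ex P t (fun xs => (~~ goodpairs y xs)%:R) <= n%:R ^- 2.
Proof.
move=> tm; have np : 0 < n%:R ^+ 2 :> R by rewrite exprn_gt0 // ltr0n.
have ep : 0 < n.+1%:R ^+ 2 * expR (- (kap * y)) :> R.
  by rewrite mulr_gt0 ?expR_gt0 ?exprn_gt0 // ltr0n.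
apply: (@le_trans _ _ (Ex P t (fun xs => (n%:R ^+ 2 * (n.+1%:R ^+ 2 * expR (- (kap * y))) < bigpairs y xs)%R%:R))).
  by apply: Ex_le => [|xs _]; [exact: P_ge0|rewrite /goodpairs -ltNge].
apply: le_trans (Ex_markov P_ge0 _ _) _.
- by rewrite mulr_gt0.
- by move=> xs _; exact: bigpairs_ge0.
rewrite ler_pdivrMr ?(mulr_gt0 np ep) // [leRHS]mulrA mulVf ?lt0r_neq0 // mul1r.
exact: Ex_bigpairs.
Qed.

Lemma bigpairs_mass xs y L : goodpairs y xs -> expR (- L) <= Wt xs ->
  bigpairs y xs <= n%:R ^+ 2 * n.+1%:R ^+ 2 * expR (2 * L - kap * y) * Wt xs ^+ 2.
Proof.
move=> gp WL; apply: le_trans gp _; rewrite [leLHS]mulrA -[leRHS]mulrA.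
apply: ler_wpM2l; first by rewrite mulr_ge0 ?exprn_ge0.
rewrite expRD mulrAC -[leLHS]mul1r; apply: ler_wpM2r; first exact: expR_ge0.
exact: expR_mass.
Qed.

Lemma pair_average xs (h : R -> R) (y c b : R) : 0 < Wt xs -> 0 <= c ->
  (forall s s', n%:R * ov s s' ^+ 2 < y -> h (ov s s') <= b) -> 0 <= b ->
  (forall s s', h (ov s s') <= c) ->
  \sum_s \sum_s' wt xs s * wt xs s' * h (ov s s') <=
   b * Wt xs ^+ 2 + c * bigpairs y xs.
Proof.
move=> Wp c0 hb b0 hc; have w0 s := wt_ge0 mu_ge0 lk_ge0 xs s.
have -> : b * Wt xs ^+ 2 + c * bigpairs y xs = \sum_s \sum_s'
   (wt xs s * wt xs s') * (b + c * (y <= n%:R * ov s s' ^+ 2)%R%:R).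
  rewrite /mass expr2 mulr_suml !mulr_sumr -big_split; apply: eq_bigr => s _ /=.
  rewrite !mulr_sumr -big_split; apply: eq_bigr => s' _ /=; ring.
apply: ler_sum => s _; apply: ler_sum => s' _; apply: ler_wpM2l; first exact: mulr_ge0.
case: (leP y) => hy; first by have := hc s s'; rewrite mulr1; lra.
by rewrite mulr0 addr0 hb.
Qed.

Lemma step_variance xs y L : goodpairs y xs -> expR (- L) <= Wt xs -> 0 <= y ->
  \sum_x P (size xs) x * (Wt (x :: xs) / Wt xs) ^+ 2 <=
  1 + A' ^+ 2 * (4 * 2 ^+ k) * (y / n%:R +
     n%:R ^+ 2 * n.+1%:R ^+ 2 * expR (2 * L - kap * y)).
Proof.
move=> gp WL y0; have Wp : 0 < Wt xs by apply: lt_le_trans WL; exact: expR_gt0.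
have W2p : 0 < Wt xs ^+ 2 by rewrite exprn_gt0.
have np : 0 < n%:R :> R by rewrite ltr0n.
under eq_bigr do rewrite expr_div_n mulrA.
rewrite -mulr_suml Wt_sq ler_pdivrMr //.
set c := A' ^+ 2 * (4 * 2 ^+ k).
have c0 : 0 <= c by rewrite mulr_ge0 ?sqr_ge0 ?mulr_ge0 ?exprn_ge0.
apply: (@le_trans _ _ (\sum_s \sum_s' wt xs s * wt xs s' * (1 + c * ov s s' ^+ 2))).
  apply: ler_sum => s _; apply: ler_sum => s' _.
  case sO: (s \in Om0); last by rewrite (wt_out xs (s := s)) ?sO // !mul0r.
  case sO': (s' \in Om0); last by rewrite (wt_out xs (s := s')) ?sO' // mulr0 !mul0r.
  apply: ler_wpM2l; first by rewrite mulr_ge0 ?wt_nonneg.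
  rewrite Kt_lk // lerD2l /c -mulrA; apply: ler_wpM2l; first exact: sqr_ge0.
  by apply: le_trans (Hs_norm _) _; apply: Hs_quad; exact: ov_le1.
have -> : \sum_s \sum_s' wt xs s * wt xs s' * (1 + c * ov s s' ^+ 2) =
   Wt xs ^+ 2 + \sum_s \sum_s' wt xs s * wt xs s' * (c * ov s s' ^+ 2).
  rewrite /mass expr2 mulr_suml -big_split; apply: eq_bigr => s _ /=.
  by rewrite mulr_sumr -big_split; apply: eq_bigr => s' _ /=; ring.
rewrite [leRHS]mulrDl mul1r lerD2l.
apply: le_trans (pair_average (y := y) (c := c) (b := c * (y / n%:R)) (h := fun r => c * r ^+ 2) Wp _ _ _ _) _ => //.
- by move=> s s' h; apply: ler_wpM2l => //; rewrite ler_pdivlMr // mulrC ltW.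
- by rewrite mulr_ge0 // divr_ge0.
- move=> s s'; rewrite ler_piMr // -(real_normK (num_real (ov s s'))).
  by rewrite exprn_ile1 // ov_le1.
by rewrite mulrDr mulrDl lerD2l -[leRHS]mulrA; apply: ler_wpM2l => //; exact: bigpairs_mass.
Qed.

(** Posterior mean of a character. Its mean square over the next draw is the posterior average of
    [ov s s' ^ #|S|] over pairs; this is how overlaps control a single step. *)
Definition avgc xs S x : R := (\sum_s wt xs s * chr s S x) / Wt xs.

Lemma chr_le1 s S x : `|chr s S x| <= 1.
Proof.
by rewrite /chr normr_prod; apply: prodr_ile1 => i _; rewrite normr_ge0 sp1.
Qed.

Lemma avgc_le1 xs S x : 0 < Wt xs -> `|avgc xs S x| <= 1.
Proof.
move=> Wp; rewrite /avgc normrM normfV (gtr0_norm Wp) ler_pdivrMr // mul1r.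
apply: le_trans (ler_norm_sum _ _ _) _; apply: ler_sum => s _.
by rewrite normrM ger0_norm ?ler_piMr ?chr_le1 ?wt_nonneg.
Qed.

Lemma Wt_cons xs x : 0 < Wt xs ->
  Wt (x :: xs) / Wt xs = (1 - A * \sum_(S : {set 'I_k}) g #|S| * avgc xs S x) / (1 - A * g 0).
Proof.
move=> Wp; rewrite {1}/mass.
rewrite (eq_bigr (fun s => (wt xs s - A * (wt xs s * Gs s x)) / (1 - A * g 0))); last first.
  move=> s _ /=; rewrite /lk; case: ifP => sO; last by rewrite wt_out ?sO // !(mul0r, mulr0, subr0, mulr1) .
  by rewrite /Fs; field; rewrite lt0r_neq0 ?Ag_gt0.
rewrite -mulr_suml sumrB -mulr_sumr mulrAC; congr (_ / _).
rewrite mulrBl divff ?lt0r_neq0 //; congr (_ - _); rewrite -mulrA; congr (_ * _).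
rewrite mulr_suml /Gs /avgc; under eq_bigr do rewrite mulr_sumr mulr_suml.
rewrite exchange_big /=; apply: eq_bigr => S _.
by rewrite mulrA mulr_sumr mulr_suml; apply: eq_bigr => s _; ring.
Qed.

Definition Ts xs x : R := \sum_(S : {set 'I_k} | (2 < #|S|)%N) g #|S| * avgc xs S x.

(** Degree 0 contributes [A * g 0], degree 1 nothing, and degree 2 at most [2 * A * k ^ 2], small by
    [Ak]. Only characters of degree at least 3 can halve the mass, and their mean squares are of the
    order of the cubed overlap. *)
Lemma kill_Ts xs x : 0 < Wt xs -> Wt (x :: xs) < Wt xs / 2 -> 1 / 8 < A * `|Ts xs x|.
Proof.
move=> Wp; rewrite ltNge => h; rewrite ltNge; apply: contra h => h.
have Agp := Ag_gt0; have a4 := Ag0.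
suff : 1 / 2 <= Wt (x :: xs) / Wt xs by rewrite ler_pdivlMr //; lra.
rewrite Wt_cons // ler_pdivlMr // (bigID (fun S : {set 'I_k} => (2 < #|S|)%N)) /= -/(Ts xs x).
set T2 := \sum_(S | _) _.
have : T2 <= g 0 + 2 * k%:R ^+ 2.
  rewrite /T2 (bigD1 set0) ?cards0 //=.
  have -> : avgc xs set0 x = 1.
    rewrite /avgc; under eq_bigr do rewrite /chr big_set0 mulr1.
    by rewrite divff // lt0r_neq0.
  rewrite mulr1 lerD2l.
  apply: (@le_trans _ _ (\sum_(S : {set 'I_k} | #|S| == 2%N) 2)).
    rewrite [leRHS]big_mkcond [leLHS]big_mkcond; apply: ler_sum => S _.
    case: ifP => [|_]; last by case: ifP.
    rewrite -leqNgt -cards_eq0; case E: #|S| => [|[|[|]]] //= _.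
      by rewrite g1 mul0r.
    apply: le_trans (ler_norm _) _; rewrite normrM -[leRHS]mulr1.
    by apply: ler_pM; rewrite ?g2 ?avgc_le1.
  rewrite sumr_const -[leLHS]mulr_natr ler_pM2l // -natrX ler_nat.
  have := card_draws 'I_k 2; rewrite card_ord => c2.
  apply: (@leq_trans 'C(k, 2)); first by rewrite -c2; apply/eq_leq/eq_card => S; rewrite inE.
  by rewrite bin2 leq_half_double; lia.
have : Ts xs x <= `|Ts xs x| by exact: ler_norm.
move: (Ts xs x) (`|_|) T2 h => a b c h ab cg.
have : A * a <= 1 / 8 by apply: le_trans h; exact: ler_wpM2l.
have : A * c <= A * (g 0 + 2 * k%:R ^+ 2) by exact: ler_wpM2l.
have := Ak; rewrite !mulrDr; move: (A * a) (A * c) => u v.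
have -> : A * (2 * k%:R ^+ 2) = 2 * A * k%:R ^+ 2 by ring.
by move: (A * g 0) (2 * A * k%:R ^+ 2) Agp a4 => p q; lra.
Qed.

Lemma Ex_Ts2 xs (rho : R) L : goodpairs (n%:R * rho ^+ 2) xs -> expR (- L) <= Wt xs -> 0 <= rho ->
  \sum_x P (size xs) x * Ts xs x ^+ 2 <= 4 * 4 ^+ k *
   (rho ^+ 3 + n%:R ^+ 2 * n.+1%:R ^+ 2 * expR (2 * L - kap * (n%:R * rho ^+ 2))).
Proof.
move=> gp WL r0; have Wp : 0 < Wt xs by apply: lt_le_trans WL; exact: expR_gt0.
have W2p : 0 < Wt xs ^+ 2 by rewrite exprn_gt0.
have np : 0 < n%:R :> R by rewrite ltr0n.
set B := rho ^+ 3 + _.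
have cardS : #|{: {set 'I_k}}|%:R = 2 ^+ k :> R.
  rewrite -cardsT (_ : [set: _] = powerset [set: 'I_k])%SET; last first.
    by apply/setP => S; rewrite !inE subsetT.
  by rewrite card_powerset cardsT card_ord natrX.
have avgB (S : {set 'I_k}) : (2 < #|S|)%N -> \sum_x P (size xs) x * avgc xs S x ^+ 2 <= B.
  move=> S2; rewrite /avgc; under eq_bigr do rewrite expr_div_n mulrA.
  rewrite -mulr_suml ler_pdivrMr //.
  have -> : \sum_x P (size xs) x * (\sum_s wt xs s * chr s S x) ^+ 2 =
     \sum_s \sum_s' wt xs s * wt xs s' * ov s s' ^+ #|S|.
    under eq_bigr do rewrite expr2 mulr_suml mulr_sumr.
    rewrite exchange_big /=; apply: eq_bigr => s _.
    under eq_bigr do rewrite mulr_sumr mulr_sumr.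
    rewrite exchange_big /=; apply: eq_bigr => s' _.
    by rewrite -(avg_chr2 (size xs)) mulr_sumr; apply: eq_bigr => x _; ring.
  have o1 s s' : ov s s' ^+ #|S| <= `|ov s s'| ^+ 3.
    apply: le_trans (ler_norm _) _; rewrite normrX.
    by apply: ler_wiXn2l => //; exact: ov_le1.
  apply: le_trans (pair_average (y := n%:R * rho ^+ 2) (c := 1) (b := rho ^+ 3) (h := fun r => r ^+ #|S|) Wp _ _ _ _) _ => //.
  - move=> s s' h; apply: le_trans (o1 s s') _; apply: lerXn2r => //.
    move: h; rewrite ltr_pM2l // -(real_normK (num_real (ov s s'))) => h.
    by rewrite leNgt; apply/negP => h2; move: h; rewrite ltNge lerXn2r // ?nnegrE ?ltW.
  - by rewrite exprn_ge0.
  - by move=> s s'; apply: le_trans (o1 s s') _; rewrite exprn_ile1 // ov_le1.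
  by rewrite mul1r /B mulrDl lerD2l; exact: bigpairs_mass.
have B0 : 0 <= B by rewrite addr_ge0 ?exprn_ge0 // !mulr_ge0 ?exprn_ge0 ?expR_ge0.
apply: (@le_trans _ _ (\sum_x P (size xs) x * (2 ^+ k * \sum_(S : {set 'I_k} | (2 < #|S|)%N) 4 * avgc xs S x ^+ 2))).
  apply: ler_sum => x _; apply: ler_wpM2l; first exact: P_ge0.
  rewrite /Ts big_mkcond /=.
  rewrite (eq_bigr (fun S : {set 'I_k} => 1 * (if (2 < #|S|)%N then g #|S| * avgc xs S x else 0))); last by move=> S _; rewrite mul1r.
  apply: le_trans (cauchy_schwarz _ _) _.
  rewrite (eq_bigr (fun=> 1)) => [|S _]; last by rewrite expr1n.
  rewrite sumr_const cardS; apply: ler_wpM2l; first by rewrite exprn_ge0.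
  rewrite [leRHS]big_mkcond; apply: ler_sum => S _; case: ifP => S2; last by rewrite expr0n.
  rewrite exprMn; apply: ler_wpM2r; first exact: sqr_ge0.
  by rewrite -(real_normK (num_real (g _))); have := g2 #|S|; have := normr_ge0 (g #|S|); nra.
under eq_bigr do rewrite mulrCA.
rewrite -mulr_sumr; under eq_bigr do rewrite mulr_sumr.
rewrite exchange_big /= -[4 ^+ k](_ : 2 ^+ k * 2 ^+ k = _); last by rewrite -exprMn; congr (_ ^+ _); ring.
have -> : 4 * (2 ^+ k * 2 ^+ k) * B = 2 ^+ k * (2 ^+ k * (4 * B)) by ring.
apply: ler_wpM2l; first by rewrite exprn_ge0.
rewrite -cardS mulr_natl -sumr_const big_mkcond; apply: ler_sum => S _.
case: ifP => S2; last by rewrite mulr_ge0.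
by under eq_bigr do rewrite mulrCA; rewrite -mulr_sumr ler_pM2l // avgB.
Qed.

Lemma step_killing xs (rho : R) L : goodpairs (n%:R * rho ^+ 2) xs -> expR (- L) <= Wt xs -> 0 <= rho ->
  \sum_x P (size xs) x * (Wt (x :: xs) < Wt xs / 2)%R%:R <= 64 * A ^+ 2 * (4 * 4 ^+ k *
   (rho ^+ 3 + n%:R ^+ 2 * n.+1%:R ^+ 2 * expR (2 * L - kap * (n%:R * rho ^+ 2)))).
Proof.
move=> gp WL r0; have Wp : 0 < Wt xs by apply: lt_le_trans WL; exact: expR_gt0.
apply: (@le_trans _ _ (64 * A ^+ 2 * \sum_x P (size xs) x * Ts xs x ^+ 2)).
  rewrite mulr_sumr; apply: ler_sum => x _; rewrite mulrCA; apply: ler_wpM2l; first exact: P_ge0.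
  case: (ltP (Wt (x :: xs)) (Wt xs / 2)) => [/(kill_Ts Wp)|_]; last by apply: mulr_ge0; rewrite ?sqr_ge0 // mulr_ge0 ?sqr_ge0.
  move=> h; rewrite -(real_normK (num_real (Ts xs x))) -mulrA -exprMn.
  by move: (A * _) h => q; rewrite /=; nra.
apply: ler_wpM2l; first by rewrite mulr_ge0 ?sqr_ge0.
exact: Ex_Ts2.
Qed.

Variable y : R.
Let C1 := A' ^+ 2 * (4 * 2 ^+ k).
Let c := 4 * (3 * C1 / kap + 1).
Hypothesis y1 : 1 <= y.
Hypothesis y8 : y ^+ 8 = n%:R.
Hypothesis y_large : C1 * (n%:R ^+ 2 * n.+1%:R ^+ 2 * expR (- y)) <= y / n%:R.

(** When [m] is linear in [n = y ^ 8] this is a constant multiple of [y], so the mass keeps at least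
    [exp] of minus order n^(1/8). *)
Definition spin_loss := y * expR (c * m%:R / n%:R).
Definition spin_failure := m%:R * (2 * n%:R ^- 2 + 64 * A ^+ 2 * (4 * 4 ^+ k *
   (y ^- 9 + n%:R ^+ 2 * n.+1%:R ^+ 2 * expR (2 * spin_loss - kap * y ^+ 2))) + expR (- (y / 2))).

Lemma spin_lower_bound :
  Ex P m (fun xs => (Wt xs < expR (- spin_loss))%R%:R) <= spin_failure.
Proof.
have np : 0 < n%:R :> R by rewrite ltr0n.
have yp : 0 < y by apply: lt_le_trans y1.
have C10 : 0 <= C1 by rewrite mulr_ge0 ?sqr_ge0 // mulr_ge0 ?exprn_ge0.
have c0 : 0 <= c by rewrite mulr_ge0 // addr_ge0 // divr_ge0 ?(ltW kap0) // mulr_ge0.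
(* The variance of a step is proportional to [lam t / n]. With this ratio the sum of [2 * v]
   telescopes to [(lam t - y) / 2], so [lam] grows twice as fast as the drift. *)
pose q : R := 1 + c / n%:R.
have q1 : 1 <= q by rewrite lerDl divr_ge0 ?(ltW np).
pose lam t := y * q ^+ t.
have lam_y t : y <= lam t by rewrite ler_peMr ?exprn_ege1 // ltW.
have lam_up t : (t <= m)%N -> lam t <= spin_loss.
  move=> tm; apply: ler_wpM2l; first exact: ltW.
  apply: (@le_trans _ _ (expR (c / n%:R) ^+ t)).
    by apply: lerXn2r; rewrite ?nnegrE ?expR_ge0 ?expR_ge1Dx // (le_trans _ q1).
  rewrite -expRM_natl ler_expR mulrCA -[leRHS]mulrA; apply: ler_wpM2l => //.
  by apply: ler_wpM2r; rewrite ?invr_ge0 ?(ltW np) // ler_nat.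
(* Overlap cut-off for halving. [n * rho ^ 2 = y ^ 2] beats the barrier, whose exponent is of order
   [y], and [rho ^ 3 = y ^- 9] is [1 / (n * y)], small after summation over the steps. *)
pose rho := y ^- 3.
have rho0 : 0 <= rho by rewrite invr_ge0 exprn_ge0 // ltW.
have nrho : n%:R * rho ^+ 2 = y ^+ 2.
  by rewrite -y8 /rho; field; rewrite lt0r_neq0.
have rho3 : rho ^+ 3 = y ^- 9 by rewrite /rho; field; rewrite lt0r_neq0.
(* Dividing by the squared mass costs [exp (2 * lam t)]; the factor 3 leaves [exp (- lam t)]. *)
pose x t := 3 * lam t / kap.
pose v t := (3 * C1 / kap + 1) * lam t / n%:R.
pose eta := 64 * A ^+ 2 * (4 * 4 ^+ k *
   (y ^- 9 + n%:R ^+ 2 * n.+1%:R ^+ 2 * expR (2 * spin_loss - kap * y ^+ 2))).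
have eta0 : 0 <= eta.
  apply: mulr_ge0; first by rewrite mulr_ge0 ?sqr_ge0.
  apply: mulr_ge0; first by rewrite mulr_ge0 ?exprn_ge0.
  apply: addr_ge0; first by rewrite invr_ge0 exprn_ge0 // ltW.
  by apply: mulr_ge0; rewrite ?expR_ge0 // mulr_ge0 ?exprn_ge0.
pose G xs := goodpairs (x (size xs)) xs && goodpairs (n%:R * rho ^+ 2) xs.
have sum_lam t : \sum_(r < t) 2 * v r = (lam t - y) / 2.
  elim: t => [|t IH]; first by rewrite big_ord0 /lam expr0 mulr1 subrr mul0r.
  rewrite big_ord_recr /= IH /v /lam exprS /q /c.
  by field; rewrite lt0r_neq0 // lt0r_neq0.
apply: (@le_trans _ _ (Ex P m (fun xs => (Wt xs < expR (- lam m))%R%:R))).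
  apply: Ex_le => [|xs _]; first exact: P_ge0.
  rewrite ler_nat; case: ltP => // h; case: ltP => // h2.
  have := le_lt_trans h2 h; rewrite ltr_expR ltrN2.
  by move=> h3; have := lt_le_trans h3 (lam_up m (leqnn m)); rewrite ltxx.
apply: le_trans (process_lower_bound (G := G) (v := v) (eta := fun=> eta)
  (gamma := fun=> 2 * n%:R ^- 2) P_ge0 P_sum1 mu_ge0 mu_sum1 lk_ge0 avg_lk _ _ _ _ _) _.
- by rewrite (le_trans _ (lam_y 0%N)) // ltW.
- move=> xs sm /andP[g1' g2'] WL.
  apply: le_trans (step_variance g1' WL _) _.
    by rewrite divr_ge0 ?(ltW kap0) // mulr_ge0 // (le_trans _ (lam_y _)) // ltW.
  rewrite lerD2l -/C1 mulrDr /v.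
  have -> : (3 * C1 / kap + 1) * lam (size xs) / n%:R =
     C1 * (x (size xs) / n%:R) + lam (size xs) / n%:R.
    by rewrite /x; field; rewrite !lt0r_neq0.
  rewrite lerD2l; apply: (@le_trans _ _ (y / n%:R)); last first.
    by apply: ler_wpM2r; rewrite ?invr_ge0 ?(ltW np).
  apply: le_trans y_large; apply: ler_wpM2l => //; apply: ler_wpM2l.
    by rewrite mulr_ge0 ?exprn_ge0.
  rewrite ler_expR /x; have -> : kap * (3 * lam (size xs) / kap) = 3 * lam (size xs).
    by field; rewrite lt0r_neq0.
  by have := lam_y (size xs); lra.
- move=> xs sm /andP[g1' g2'] WL.
  apply: le_trans (step_killing g2' WL rho0) _.
  apply: ler_wpM2l; first by rewrite mulr_ge0 ?sqr_ge0.
  apply: ler_wpM2l; first by rewrite mulr_ge0 ?exprn_ge0.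
  rewrite rho3 lerD2l; apply: ler_wpM2l; first by rewrite mulr_ge0 ?exprn_ge0.
  by rewrite ler_expR nrho; have := lam_up _ (ltnW sm); lra.
- by [].
- move=> t tm; apply: (@le_trans _ _ (Ex P t (fun xs => (~~ goodpairs (x t) xs)%:R + (~~ goodpairs (n%:R * rho ^+ 2) xs)%:R))).
    apply: Ex_le => [|xs sx]; first exact: P_ge0.
    rewrite /G sx; case: (goodpairs _ xs); case: (goodpairs _ xs) => //=;
      rewrite ?addr0 ?add0r //; lra.
  rewrite ExD; last exact: P_ge0.
  have := Ex_goodpairs (x t) (ltnW tm); have := Ex_goodpairs (n%:R * rho ^+ 2) (ltnW tm); lra.
apply: (@le_trans _ _ (\sum_(s < m) (2 * n%:R ^- 2 + eta + expR (- (y / 2))))); last first.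
  by rewrite sumr_const card_ord -[leLHS]mulr_natl.
apply: ler_sum => s _; rewrite lerD2l ler_expR sum_lam.
by have := lam_y s.+1; lra.
Qed.
End Spin.

(** * Binomial estimates and the bound on pairs of given overlap *)

Section Analysis.
Variable R : realType.
Implicit Types (x y z r e : R).

Lemma bin_le_z n i z : 0 <= z -> 'C(n, i)%:R * z ^+ i <= expR (n%:R * z).
Proof.
move=> z0; apply: (@le_trans _ _ ((1 + z) ^+ n)); last first.
  rewrite expRM_natl; apply: lerXn2r; rewrite ?nnegrE ?expR_ge0 ?addr_ge0 //.
  exact: expR_ge1Dx.
have [ni|ni] := ltnP n i; first by rewrite bin_small // mul0r exprn_ge0 // addr_ge0.
rewrite exprDn (bigD1 (inord i)) //= inordK ?ltnS // expr1n mul1r.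
rewrite mulr_natl lerDl.
by apply: sumr_ge0 => j _; rewrite mulrn_wge0 // mulr_ge0 ?exprn_ge0.
Qed.

Lemma expR_le_half x : `|x| <= 1 / 2 -> expR x <= 1 + x + 2 * x ^+ 2.
Proof.
rewrite ler_norml => /andP[x1 x2].
have e0 := expR_gt0 x; have : 1 - x <= expR (- x) by have := expR_ge1Dx (- x); lra.
rewrite expRN -[leRHS]mul1r ler_pdivlMr // => h.
have xx : 0 <= (1 - 2 * x) * x ^+ 2 by rewrite mulr_ge0 ?sqr_ge0 //; lra.
have : expR x * (1 - x) <= (1 + x + 2 * x ^+ 2) * (1 - x).
  rewrite mulrC; apply: le_trans h _.
  have -> : (1 + x + 2 * x ^+ 2) * (1 - x) = 1 + (1 - 2 * x) * x ^+ 2 by ring.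
  by rewrite lerDl.
by rewrite ler_pM2r //; lra.
Qed.

(** Exponential moment with tilt [r / 4]. The constant 1/8 instead of the optimal 1/2 reflects the
    crude bound [expR_le_half]. *)
Lemma bin_hoeffding n j r : (0 < n)%N -> (j <= n)%N -> r = 1 - 2 * j%:R / n%:R ->
  'C(n, j)%:R / 2 ^+ n <= expR (- (n%:R * r ^+ 2 / 8)) :> R.
Proof.
move=> n0 jn rE; have np : 0 < n%:R :> R by rewrite ltr0n.
have nr : n%:R * r = n%:R - 2 * j%:R by rewrite rE; field; rewrite lt0r_neq0.
have jn' : j%:R <= n%:R :> R by rewrite ler_nat.
have j0 : 0 <= j%:R :> R by [].
have r1 : `|r| <= 1.
  rewrite ler_norml -(ler_pM2l np) -(ler_pM2l np r) nr; lra.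
pose s := r / 4.
have s2 : `|s| <= 1 / 2 by rewrite /s normrM (ger0_norm (x := 4^-1)) ?invr_ge0 //; lra.
rewrite ler_pdivrMr ?exprn_gt0 //.
have h1 : 'C(n, j)%:R * expR (s * (n%:R - 2 * j%:R)) <= (expR s + expR (- s)) ^+ n.
  rewrite exprDn (bigD1 (inord j)) //= inordK ?ltnS // -!expRM_natl -expRD.
  have -> : (n - j)%:R * s + j%:R * - s = s * (n%:R - 2 * j%:R) :> R.
    by rewrite natrB //; ring.
  rewrite mulr_natl lerDl; apply: sumr_ge0 => i _.
  by rewrite mulrn_wge0 // mulr_ge0 ?exprn_ge0 ?expR_ge0.
have h2 : (expR s + expR (- s)) ^+ n <= 2 ^+ n * expR (n%:R * (2 * s ^+ 2)).
  rewrite expRM_natl -exprMn; apply: lerXn2r; rewrite ?nnegrE ?mulr_ge0 ?addr_ge0 ?expR_ge0 //.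
  have := expR_le_half s2; have := @expR_le_half (- s); rewrite normrN sqrrN => /(_ s2).
  have := expR_ge1Dx (2 * s ^+ 2); lra.
have := le_trans h1 h2; rewrite -nr -ler_pdivlMr ?expR_gt0 // => h3.
apply: le_trans h3 _; rewrite -[leLHS]mulrA [leLHS]mulrC; apply: ler_wpM2r; first by rewrite exprn_ge0.
rewrite -expRN -expRD ler_expR le_eqVlt; apply/orP; left; apply/eqP; rewrite /s; lra.
Qed.

(* [K0 = 5] separates overlaps with [1 - |r| >= 10 / k], where the Gaussian bound wins,
   from those near [1], where the binomial coefficient itself is small. *)
Lemma pair_exponent (n j k m : nat) (h B e Hr : R) : (0 < n)%N -> (j <= n)%N -> (0 < k)%N ->
  let r := 1 - 2 * j%:R / n%:R in
  0 < e -> e <= 1 -> 1 <= h -> 0 <= B ->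
  Hr <= h * (1 + `|r|) ^+ k ->
  (`|r| <= 1 / 2 -> Hr <= 16 * r ^+ 2 * (3 / 2) ^+ k) ->
  m%:R * B * h * 2 ^+ k <= (1 - e) * ln 2 * n%:R ->
  16 * (3 / 4) ^+ k <= 1 / 16 :> R ->
  5 * ln (8 / e) <= e / 8 * k%:R ->
  'C(n, j)%:R / 2 ^+ n * expR (m%:R * B * Hr) <= expR (- (e / 16 * (n%:R * r ^+ 2))).
Proof.
move=> n0 jn k0 r e0 e1 h1 B0 H1 H2 Hm Hk1 Hk2.
have np : 0 < n%:R :> R by rewrite ltr0n.
have kp : 0 < k%:R :> R by rewrite ltr0n.
have nr : n%:R * r = n%:R - 2 * j%:R by rewrite /r; field; rewrite lt0r_neq0.
have jn' : j%:R <= n%:R :> R by rewrite ler_nat.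
have j0 : 0 <= j%:R :> R by [].
have r1 : `|r| <= 1 by rewrite ler_norml -(ler_pM2l np) -(ler_pM2l np r) nr; lra.
have r2 : r ^+ 2 <= 1 by rewrite -(real_normK (num_real r)) exprn_ile1.
have r20 := sqr_ge0 r.
have ln2 : 1 / 2 <= ln 2 :> R.
  have : 1 / 2 <= 1 - (2 : R)^-1 by lra.
  move=> hh; apply: le_trans hh _.
  have := @le_ln1Dx R (- 2^-1); rewrite (_ : 1 - 2^-1 = 2^-1 :> R); last by lra.
  by rewrite lnV ?posrE //; lra.
have ln2' : ln 2 <= 1 :> R by have := @le_ln1Dx R 1; rewrite (_ : 1 + 1 = 2 :> R); lra.
have mB0 : 0 <= m%:R * B by rewrite mulr_ge0.
have Hoe := @bin_hoeffding n j r n0 jn erefl.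
have nr2 : 0 <= n%:R * r ^+ 2 by rewrite mulr_ge0.
have er2 : e / 16 * (n%:R * r ^+ 2) <= n%:R * r ^+ 2 / 16 by nra.
(* For small overlap [Hr] is quadratic, and after the density is inserted its coefficient carries
   (3/4)^k; half of the Gaussian exponent absorbs it. *)
have [rs|rl] := leP `|r| (1 / 2).
  have E : m%:R * B * Hr <= n%:R * r ^+ 2 / 16.
    apply: (@le_trans _ _ (m%:R * B * (16 * r ^+ 2 * (3 / 2) ^+ k))).
      by apply: ler_wpM2l => //; exact: H2.
    have E2 : m%:R * B * 2 ^+ k <= n%:R.
      apply: (@le_trans _ _ (m%:R * B * h * 2 ^+ k)).
        by apply: ler_wpM2r; rewrite ?exprn_ge0 // ler_peMr.
      apply: le_trans Hm _; rewrite ler_piMl ?(ltW np) //; nra.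
    have -> : m%:R * B * (16 * r ^+ 2 * (3 / 2) ^+ k) =
       (m%:R * B * 2 ^+ k) * (16 * (3 / 4) ^+ k) * r ^+ 2.
      have -> : (3 / 2) ^+ k = 2 ^+ k * (3 / 4) ^+ k :> R by rewrite -exprMn; congr (_ ^+ _); lra.
      ring.
    rewrite [leRHS]mulrAC; apply: ler_wpM2r => //; rewrite [leRHS](_ : _ = n%:R * (1 / 16)); last by ring.
    by apply: ler_pM => //; rewrite ?mulr_ge0 ?exprn_ge0 ?divr_ge0.
  apply: (@le_trans _ _ (expR (- (n%:R * r ^+ 2 / 8)) * expR (n%:R * r ^+ 2 / 16))).
    by apply: ler_pM; rewrite ?expR_ge0 ?divr_ge0 ?exprn_ge0 // ler_expR.
  by rewrite -expRD ler_expR; lra.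
pose u := (1 - `|r|) / 2.
have u0 : 0 <= u by rewrite /u; lra.
have Eu : m%:R * B * Hr <= (1 - e) * ln 2 * n%:R * (1 - u) ^+ k.
  apply: (@le_trans _ _ (m%:R * B * (h * (1 + `|r|) ^+ k))); first exact: ler_wpM2l.
  have -> : (1 + `|r|) ^+ k = 2 ^+ k * (1 - u) ^+ k.
    by rewrite -exprMn; congr (_ ^+ _); rewrite /u; field.
  rewrite !mulrA; apply: ler_wpM2r => //.
  by rewrite exprn_ge0 // /u; have := normr_ge0 r; lra.
have rsq : 1 / 4 <= r ^+ 2 by rewrite -(real_normK (num_real r)); nra.
(* In the first case (1 - u)^k is at most exp(-5), below 1/64, while the Gaussian exponent is at
   least [n / 32] because [r ^ 2] is at least 1/4. *)
have [uk|uk] := leP 5 (u * k%:R).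
  have E : m%:R * B * Hr <= n%:R / 64.
    apply: le_trans Eu _.
    have e5 : (1 - u) ^+ k <= 1 / 64.
      apply: (@le_trans _ _ (expR (- u) ^+ k)).
        apply: lerXn2r; rewrite ?nnegrE ?expR_ge0 // ?expR_ge1Dx //.
        by rewrite /u; have := normr_ge0 r; lra.
      rewrite -expRM_natl; apply: (@le_trans _ _ (expR (- 5))); first by rewrite ler_expR; lra.
      rewrite expRN mul1r lef_pV2 ?posrE ?expR_gt0 //.
      rewrite (_ : 5 = 20%:R * (1 / 4)) ?expRM_natl; last by lra.
      apply: (@le_trans _ _ ((1 + 1 / 4) ^+ 20)).
        by rewrite (exprM _ 4 5); have : 12 / 5 <= (1 + 1 / 4) ^+ 4 :> R by [lra];
           move: (_ ^+ 4) => w w5; apply: (@le_trans _ _ ((12 / 5) ^+ 5)); [lra|rewrite lerXn2r ?nnegrE; lra].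
      by apply: lerXn2r; rewrite ?nnegrE ?expR_ge0 ?expR_ge1Dx //; lra.
    have -> : n%:R / 64 = n%:R * (1 / 64) :> R by ring.
    apply: ler_pM; rewrite ?mulr_ge0 //; try lra.
    - by rewrite exprn_ge0 // /u; have := normr_ge0 r; lra.
    - by rewrite ler_piMl ?(ltW np) //; nra.
  apply: (@le_trans _ _ (expR (- (n%:R * r ^+ 2 / 8)) * expR (n%:R / 64))).
    by apply: ler_pM; rewrite ?expR_ge0 ?divr_ge0 ?exprn_ge0 // ler_expR.
  rewrite -expRD ler_expR.
  have : n%:R * (1 / 4) <= n%:R * r ^+ 2 by rewrite ler_pM2l.
  lra.
(* [bin_le_z] with this [z] gives [z + u * ln (1 / z)] per variable. As [u < 5 / k] this is at most
   [e / 4], less than the gap [e * ln 2] to the satisfiability bound. *)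
pose z := e / 8.
have zp : 0 < z by rewrite divr_gt0.
(* [i] counts disagreements or agreements, whichever are fewer, so overlaps near -1 are treated like
   those near 1. *)
have [i [ijn iu]] : exists i, 'C(n, i) = 'C(n, j) /\ i%:R = u * n%:R.
  have [rp|rn] := leP 0 r.
    by exists j; split=> //; rewrite /u ger0_norm // /r; field; rewrite lt0r_neq0.
  exists (n - j)%N; rewrite bin_sub //; split=> //.
  by rewrite natrB // /u ltr0_norm // /r; field; rewrite lt0r_neq0.
have Cb : 'C(n, j)%:R <= expR (n%:R * (z + u * ln (z^-1))) :> R.
  rewrite -ijn mulrDr expRD.
  have -> : n%:R * (u * ln z^-1) = i%:R * ln z^-1 by rewrite iu; ring.
  rewrite (expRM_natl i) lnK ?posrE ?invr_gt0 // exprVn ler_pdivlMr ?exprn_gt0 //.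
  by apply: bin_le_z; exact: ltW.
have E : m%:R * B * Hr <= (1 - e) * ln 2 * n%:R.
  apply: le_trans Eu _; rewrite ler_piMr // ?exprn_ile1 //.
  - by rewrite mulr_ge0 // mulr_ge0 //; lra.
  - by rewrite /u; have := normr_ge0 r; lra.
  - by rewrite /u; have := normr_ge0 r; lra.
have two : 2 ^- n = expR (- (n%:R * ln 2)) :> R.
  by rewrite expRN expRM_natl lnK ?posrE.
rewrite two; apply: (@le_trans _ _ (expR (n%:R * (z + u * ln z^-1)) * expR (- (n%:R * ln 2)) * expR ((1 - e) * ln 2 * n%:R))).
  apply: ler_pM; rewrite ?mulr_ge0 ?expR_ge0 //; last by rewrite ler_expR.
  by rewrite ler_wpM2r ?expR_ge0.
rewrite -!expRD ler_expR.
have lnz : 0 <= ln z^-1 by rewrite ln_ge0 // -[leLHS]invr1 lef_pV2 ?posrE // /z; lra.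
have uz : u * ln z^-1 <= e / 8.
  rewrite -(ler_pM2r kp) mulrAC; apply: le_trans Hk2.
  rewrite /z invf_div; apply: ler_wpM2r; last exact: ltW.
  by move: lnz; rewrite /z invf_div.
have -> : n%:R * (z + u * ln z^-1) - n%:R * ln 2 + (1 - e) * ln 2 * n%:R =
  n%:R * (z + u * ln z^-1 - e * ln 2) by ring.
have : n%:R * (z + u * ln z^-1 - e * ln 2) <= n%:R * (- (e / 4)).
  by rewrite ler_pM2l // /z; nra.
have : n%:R * (e / 4 * r ^+ 2) <= n%:R * (e / 4) by rewrite ler_pM2l // ler_piMr //; lra.
nra.
Qed.

Lemma pow_le_expR N y : 0 <= y -> (0 < N)%N -> y ^+ N <= (2 * N%:R) ^+ N * expR (y / 2).
Proof.
move=> y0 N0; have Np : 0 < N%:R :> R by rewrite ltr0n.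
have -> : expR (y / 2) = expR (y / (2 * N%:R)) ^+ N.
  by rewrite -expRM_natl; congr expR; field; rewrite lt0r_neq0.
rewrite -exprMn; apply: lerXn2r; rewrite ?nnegrE ?mulr_ge0 ?expR_ge0 //.
rewrite mulrC -ler_pdivrMr ?mulr_gt0 //.
by apply: le_trans (expR_ge1Dx _); rewrite lerDr.
Qed.

(* With [n = y ^ 8] every error term of the spin process is at most a constant over [y]. *)
Lemma spin_asymptotics (k : nat) (g : nat -> R) (A kap r d : R) : 0 < kap -> 0 <= r -> 0 < d ->
  exists Y0, forall y n m, Y0 <= y -> y ^+ 8 = n%:R -> m%:R <= r * n%:R ->
  [/\ 1 <= y,
      A' g A ^+ 2 * (4 * 2 ^+ k) * (n%:R ^+ 2 * n.+1%:R ^+ 2 * expR (- y)) <= y / n%:R,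
      spin_failure n k g A m kap y <= d & spin_loss n k g A m kap y <= d * n%:R].
Proof.
move=> kap0 r0 d0; set C1 := A' g A ^+ 2 * (4 * 2 ^+ k).
have C10 : 0 <= C1 by rewrite mulr_ge0 ?sqr_ge0 // mulr_ge0 ?exprn_ge0.
pose c := 4 * (3 * C1 / kap + 1).
have c0 : 0 <= c by rewrite mulr_ge0 // addr_ge0 // divr_ge0 ?(ltW kap0) // mulr_ge0.
pose D := expR (c * r); have D1 : 1 <= D by rewrite -expR0 ler_expR mulr_ge0.
(* 40 = 32 + 8: the polynomial [n ^ 2 * n.+1 ^ 2] is of order [y ^ 32], and one further factor
   [n = y ^ 8] has to be beaten. *)
have [B B0 HB] : exists2 B : R, 0 <= B & forall y, 0 < y -> y ^+ 40 * expR (- (y / 2)) <= B / y.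
  exists ((2 * 41%:R) ^+ 41) => [|y y0]; first by rewrite exprn_ge0 // mulr_ge0.
  rewrite ler_pdivlMr // mulrAC -exprSr expRN ler_pdivrMr ?expR_gt0 //.
  by apply: pow_le_expR; rewrite ?(ltW y0).
pose Q := 64 * A ^+ 2 * (4 * 4 ^+ k).
have Q0 : 0 <= Q by rewrite mulr_ge0 // mulr_ge0 ?sqr_ge0 // exprn_ge0.
pose E := r * (2 + Q * (1 + 4 * B) + B).
have E0 : 0 <= E by rewrite mulr_ge0 // addr_ge0 // addr_ge0 // mulr_ge0 // addr_ge0 // mulr_ge0.
exists (1 + 4 * C1 * B + (2 * D + 1) / kap + E / d + D / d) => y n m yY y8 mr.
have t1 : 0 <= 4 * C1 * B by rewrite mulr_ge0 // mulr_ge0.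
have t2 : 0 <= (2 * D + 1) / kap by rewrite divr_ge0 ?(ltW kap0) //; lra.
have t3 : 0 <= E / d by rewrite divr_ge0 ?(ltW d0).
have t4 : 0 <= D / d by rewrite divr_ge0 ?(ltW d0) //; lra.
have y1 : 1 <= y by lra.
have yp : 0 < y by lra.
have np : 0 < n%:R :> R by rewrite -y8 exprn_gt0.
have n1 : 1 <= n%:R :> R by rewrite -y8 exprn_ege1.
have nS : n.+1%:R <= 2 * n%:R :> R by rewrite -natr1; lra.
have nn : n%:R ^+ 2 * n.+1%:R ^+ 2 <= 4 * y ^+ 32 :> R.
  have -> : 4 * y ^+ 32 = n%:R ^+ 2 * (2 * n%:R) ^+ 2 by rewrite -y8; ring.
  by apply: ler_wpM2l; rewrite ?exprn_ge0 // lerXn2r ?nnegrE // mulr_ge0.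
have ey : expR (- y) <= expR (- (y / 2)) by rewrite ler_expR; lra.
have e0 := expR_ge0 (- y).
have yle j : (j <= 40)%N -> y ^+ j * expR (- (y / 2)) <= B / y.
  move=> j40; apply: le_trans (HB y yp); apply: ler_wpM2r; first exact: expR_ge0.
  exact: ler_weXn2l.
have Dy : D <= d * y by rewrite mulrC -ler_pdivrMr //; lra.
have loss : spin_loss n k g A m kap y <= D * y.
  rewrite /spin_loss mulrC; apply: ler_wpM2r; first exact: ltW.
  rewrite ler_expR -mulrA; apply: ler_wpM2l => //.
  by rewrite ler_pdivrMr.
split=> //.
- rewrite ler_pdivlMr // -[leLHS]mulrA.
  apply: (@le_trans _ _ (C1 * (4 * (B / y)))); last first.
    rewrite !mulrA ler_pdivrMr //.
    have -> : C1 * 4 * B = 4 * C1 * B by ring.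
    nra.
  apply: ler_wpM2l => //; apply: (@le_trans _ _ (4 * y ^+ 32 * expR (- (y / 2)) * n%:R)).
    apply: ler_wpM2r; first exact: ltW.
    by apply: ler_pM => //; rewrite mulr_ge0 ?exprn_ge0.
  have -> : 4 * y ^+ 32 * expR (- (y / 2)) * n%:R = 4 * (y ^+ 40 * expR (- (y / 2))).
    by rewrite -y8; ring.
  by rewrite ler_pM2l //; exact: yle.
- rewrite /spin_failure; apply: (@le_trans _ _ (E / y)); last first.
    by rewrite ler_pdivrMr // mulrC -ler_pdivrMr //; lra.
  have kyy : expR (2 * spin_loss n k g A m kap y - kap * y ^+ 2) <= expR (- (y / 2)).
    rewrite ler_expR.
    have ky : (2 * D + 1) <= kap * y by rewrite [leRHS]mulrC -ler_pdivrMr //; lra.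
    have : (2 * D + 1) * y <= kap * y * y by apply: ler_wpM2r => //; exact: ltW.
    by move: loss yp; clear; lra.
  set X := 2 * n%:R ^- 2 + _ + _.
  have Xle : X <= (2 + Q * (1 + 4 * B) + B) / (y * n%:R).
    have -> : (2 + Q * (1 + 4 * B) + B) / (y * n%:R) = 2 / (y * n%:R) +
      64 * A ^+ 2 * (4 * 4 ^+ k * (1 / (y * n%:R) + 4 * (B / (y * n%:R)))) + B / (y * n%:R).
      by rewrite /Q; field; rewrite !lt0r_neq0.
    have yn : y <= n%:R by rewrite -y8 -[leLHS]expr1 ler_weXn2l.
    have yB : expR (- (y / 2)) <= B / (y * n%:R).
      rewrite invfM mulrA ler_pdivlMr // mulrC -y8; exact: yle.
    rewrite /X lerD // lerD //.
      by rewrite ler_pM2l // lef_pV2 ?posrE ?exprn_gt0 ?mulr_gt0 // expr2 ler_pM2r.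
    apply: ler_wpM2l; first by rewrite mulr_ge0 ?sqr_ge0.
    apply: ler_wpM2l; first by rewrite mulr_ge0 ?exprn_ge0.
    rewrite lerD //.
      by rewrite mul1r lef_pV2 ?posrE ?exprn_gt0 ?mulr_gt0 // -y8 -exprS.
    apply: (@le_trans _ _ (4 * y ^+ 32 * expR (- (y / 2)))).
      by apply: ler_pM; rewrite ?expR_ge0 // mulr_ge0 ?exprn_ge0.
    rewrite -mulrA ler_pM2l // invfM mulrA ler_pdivlMr // mulrAC -y8 -exprD.
    exact: yle.
  have X0 : 0 <= X.
    apply: addr_ge0; last exact: expR_ge0.
    apply: addr_ge0; first by apply: mulr_ge0; rewrite // invr_ge0 exprn_ge0.
    apply: mulr_ge0; first by rewrite mulr_ge0 ?sqr_ge0.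
    apply: mulr_ge0; first by rewrite mulr_ge0 ?exprn_ge0.
    apply: addr_ge0; first by rewrite invr_ge0 exprn_ge0 // ltW.
    by apply: mulr_ge0; rewrite ?expR_ge0 // mulr_ge0 ?exprn_ge0.
  apply: (@le_trans _ _ ((r * n%:R) * ((2 + Q * (1 + 4 * B) + B) / (y * n%:R)))).
    by apply: ler_pM.
  by rewrite /E le_eqVlt; apply/orP; left; apply/eqP; field; rewrite !lt0r_neq0.
- apply: le_trans loss _; apply: (@le_trans _ _ (d * y * y)).
    by apply: ler_wpM2r; rewrite ?(ltW yp).
  rewrite -mulrA ler_pM2l // -y8 -expr2; exact: ler_weXn2l.
Qed.

End Analysis.

(** * Non-rigid variables and their windows *)

(** Members are discarded as long as the union of the rest keeps [u1] points. When the next removal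
    would go below, the union exceeds [u1] by at most one member, and each of its points still has a
    member inside the union. *)
Lemma union_window n (fl : pred {set 'I_n}) (q u1 : nat) :
  (forall T, fl T -> (#|T| <= q)%N) ->
  (u1 <= #|[set w | [exists T : {set 'I_n}, fl T && (w \in T)]]%SET|)%N ->
  exists X : {set 'I_n}, [/\ (u1 <= #|X|)%N, (#|X| <= u1 + q)%N &
    forall w, w \in X -> exists T, [/\ fl T, w \in T & T \subset X]].
Proof.
move=> flq hu.
have [X0 hX hu'] : exists2 l : seq {set 'I_n}, all fl l &
    (u1 <= #|\bigcup_(T <- l) T|)%N.
  exists [seq T <- enum {: {set 'I_n}} | fl T]; first exact: filter_all.
  apply: leq_trans hu _; apply: subset_leq_card; apply/fintype.subsetP => w.
  rewrite inE => /existsP[T /andP[fT wT]]; rewrite big_filter big_enum_cond.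
  by apply/bigcupP; exists T.
elim: X0 hX hu' => [|T l IH] /=.
  rewrite big_nil cards0 leqn0 => _ /eqP ->; exists set0; split; rewrite ?cards0 //.
  by move=> w; rewrite inE.
move=> /andP[fT al]; rewrite big_cons => h.
have [h2|h2] := leqP u1 #|\bigcup_(T <- l) T|; first exact: IH.
exists (T :|: \bigcup_(T <- l) T); split => //.
  by apply: leq_trans (leq_card_setU _ _) _; rewrite addnC leq_add ?flq // ltnW.
move=> w; rewrite inE => /orP[wT|].
  by exists T; split=> //; exact: subsetUl.
rewrite bigcup_seq => /bigcupP[T' T'l wT']; exists T'; split=> //.
  exact: (allP al).
by apply: subset_trans (subsetUr _ _); exact: (bigcup_sup T').
Qed.

(** A non-rigid variable lies in the flip set of a solution closer than [c * n]. A union of such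
    flip sets has size controlled from both sides, and each of its variables can be flipped with all
    other changes inside it; these are the sets over which the first moment runs. *)
Lemma nonrigid_window (R : realType) n (Q : finType) (S : {set {ffun 'I_n -> Q}})
    (s : {ffun 'I_n -> Q}) (c g : R) (u1 : nat) :
  0 <= c -> ~~ (g * n%:R <= #|[set v | rigid S s (c * n%:R) v]%SET|%:R) ->
  u1%:R <= (1 - g) * n%:R ->
  exists X : {set 'I_n}, [/\ (u1 <= #|X|)%N, #|X|%:R <= u1%:R + c * n%:R :> R &
    forall w, w \in X -> exists t, [/\ t \in S, t w != s w &
       forall v, t v != s v -> v \in X]].
Proof.
move=> c0; rewrite -ltNge => hr hu.
pose fl (T : {set 'I_n}) := [exists t in S, (T == [set v | s v != t v]%SET) &&
   ((hamming s t)%:R < c * n%:R)%R].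
have cn0 : 0 <= c * n%:R by rewrite mulr_ge0.
have flP T : fl T -> (#|T| <= Num.truncn (c * n%:R))%N.
  move=> /existsP[t /andP[_ /andP[/eqP -> h]]].
  by rewrite truncn_ge_nat // ltW.
have [|X [X1 X2 X3]] := @union_window n fl _ u1 flP.
  rewrite -(ler_nat R); apply: le_trans hu _.
  rewrite mulrBl mul1r lerBlDr; apply: (@le_trans _ _
    (#|[set v | rigid S s (c * n%:R) v]%SET|%:R + #|~: [set v | rigid S s (c * n%:R) v]%SET|%:R)).
    by rewrite -natrD cardsC card_ord.
  rewrite addrC lerD ?(ltW hr) //; rewrite ler_nat; apply: subset_leq_card.
  apply/fintype.subsetP => v; rewrite !inE => /forallPn[t].
  rewrite negb_imply => /andP[tS]; rewrite negb_imply -ltNge => /andP[tv h].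
  apply/existsP; exists [set v | s v != t v]%SET; rewrite inE eq_sym tv andbT.
  by apply/existsP; exists t; rewrite tS eqxx.
exists X; split=> //.
  apply: (@le_trans _ _ (u1 + Num.truncn (c * n%:R))%:R); first by rewrite ler_nat.
  by rewrite natrD lerD2l truncn_le.
move=> w /X3[T [/existsP[t /andP[tS /andP[/eqP TE _]]] wT TX]].
exists t; split=> //; first by move: wT; rewrite TE inE eq_sym.
by move=> v tv; apply: (fintype.subsetP TX); rewrite TE inE eq_sym.
Qed.

(** * Random tuples of literals on distinct variables *)

Section Tuples.
Variables (R : realType) (n k f : nat) (Lam : finType) (var : Lam -> 'I_n).
Hypothesis n0 : (0 < n)%N.
Hypothesis f0 : (0 < f)%N.
Hypothesis var_card : forall v, #|[set l | var l == v]%SET| = f.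
Local Notation X := {ffun 'I_k -> Lam}.

Lemma Lam_card : #|Lam| = (f * n)%N.
Proof.
rewrite -sum1_card (partition_big var xpredT) //=.
rewrite (eq_bigr (fun=> f)) => [|v _]; last first.
  by rewrite sum1dep_card -(var_card v); apply: eq_card => l; rewrite !inE.
by rewrite sum_nat_const card_ord mulnC.
Qed.

Lemma avg_collision t (i j : 'I_k) : i != j ->
  \sum_x unif R (X := X) t x * (var (x i) == var (x j))%:R = n%:R^-1.
Proof.
move=> ij; have np : 0 < n%:R :> R by rewrite ltr0n.
have fp : 0 < f%:R :> R by rewrite ltr0n.
have L0 : #|Lam|%:R != 0 :> R by rewrite Lam_card natrM mulf_neq0 ?lt0r_neq0.
rewrite (eq_bigr (fun x : X => \sum_v unif R t x * \prod_(a : 'I_k)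
   (if (a == i) || (a == j) then (var (x a) == v)%:R else 1))); last first.
  move=> x _; rewrite -mulr_sumr; congr (_ * _).
  rewrite (bigD1 (var (x i))) //= [X in _ + X]big1 ?addr0 => [|v vx].
    rewrite (bigD1 i) //= !eqxx /= mul1r (bigD1 j) 1?eq_sym //= eqxx orbT big1 => [|a /andP[ai aj]].
      by rewrite mulr1 eq_sym.
    by rewrite (negbTE ai) (negbTE aj).
  by rewrite (bigD1 i) //= eqxx /= eq_sym (negbTE vx) mul0r.
rewrite exchange_big /= (eq_bigr (fun=> n%:R ^- 2)) => [|v _]; last first.
  rewrite (avg_prod (fun a l => if (a == i) || (a == j) then (var l == v)%:R else 1)).
  have S1 : (\sum_l (var l == v)%:R) / #|Lam|%:R = n%:R^-1 :> R.
    rewrite (eq_bigr (fun l => (l \in [set l | var l == v]%SET)%:R)) => [|l _]; last by rewrite inE.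
    by rewrite sum_indic var_card Lam_card natrM; field; rewrite !lt0r_neq0.
  rewrite (bigD1 i) //= eqxx /= S1 (bigD1 j) 1?eq_sym //= eqxx orbT S1 big1 => [|a /andP[ai aj]].
    by rewrite mulr1 expr2 invfM.
  by rewrite (negbTE ai) (negbTE aj) /= sumr_const -[X in X / _]mulr_natl mulr1 divff.
rewrite sumr_const card_ord -[LHS]mulr_natl expr2 invfM mulrA divff ?mul1r // lt0r_neq0 //.
Qed.

Definition distinct_vars (x : X) : bool := injectiveb (fun i => var (x i)).

Lemma avg_distinct t :
  1 - k%:R ^+ 2 / n%:R <= \sum_x unif R (X := X) t x * (distinct_vars x)%:R.
Proof.
have X0 : (0 < #|X|)%N by rewrite card_ffun expn_gt0 Lam_card muln_gt0 f0 n0.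
apply: (@le_trans _ _ (\sum_x unif R (X := X) t x * (1 - \sum_(p : 'I_k * 'I_k | p.1 != p.2)
   (var (x p.1) == var (x p.2))%:R))).
  under eq_bigr do rewrite mulrBr mulr1 mulr_sumr.
  rewrite sumrB unif1 // lerD2l lerN2 exchange_big /=.
  rewrite (eq_bigr (fun=> n%:R^-1)) => [|p pp]; last exact: avg_collision.
  rewrite sumr_const -[leLHS]mulr_natl; apply: ler_wpM2r; first by rewrite invr_ge0.
  rewrite -natrX ler_nat; apply: leq_trans (max_card _) _.
  by rewrite card_prod card_ord mulnn.
apply: ler_sum => x _; apply: ler_wpM2l; first exact: unif0.
have [|/injectivePn[i [j ij vij]]] := boolP (distinct_vars x).
  by move=> _; rewrite gerBl sumr_ge0.
rewrite (bigD1 (i, j)) //= vij eqxx subr_le0 lerDl sumr_ge0 //.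
Qed.
End Tuples.

(** * From the uniform instance to sequences of independent constraints *)

(** Each constraint is encoded by [M] tuples, and at most a fraction [kappa / n] of the tuples
    encodes none. So there are at least of order [n ^ 2] constraints, many more than the linearly
    many that are drawn. *)
Lemma constraint_count (R : realType) (U X : finType) (C : {set U}) (e : X -> U)
    (M n m : nat) (kappa r : R) :
  (0 < M)%N -> (0 < n)%N -> 0 <= r ->
  (forall u, u \in C -> #|[set x | e x == u]%SET| = M) ->
  (n ^ 2 <= #|X|)%N ->
  1 - kappa / n%:R <= (\sum_x unif R 0 x * (e x \in C)%:R) ->
  0 <= kappa -> 2 * kappa <= n%:R ->
  m%:R <= r * n%:R -> 4 * r * M%:R <= n%:R ->
  [/\ 0 < #|C|%:R :> R, (1 - kappa / n%:R) * #|X|%:R <= M%:R * #|C|%:R,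
      n%:R ^+ 2 <= 2 * (M%:R * #|C|%:R) :> R & (2 * m <= #|C|)%N].
Proof.
move=> M0 n0 r0 fib nX hC k0 kn mr rM.
have np : 0 < n%:R :> R by rewrite ltr0n.
have Mp : 0 < M%:R :> R by rewrite ltr0n.
have Xp : 0 < #|X|%:R :> R by rewrite ltr0n; apply: leq_trans nX; rewrite expn_gt0 n0.
have knu : kappa / n%:R <= 1 / 2 by rewrite ler_pdivrMr //; lra.
have MC : (1 - kappa / n%:R) * #|X|%:R <= M%:R * #|C|%:R.
  rewrite -ler_pdivlMr //; apply: le_trans hC _.
  rewrite -mulr_sumr /unif mulrC; apply: ler_wpM2r; first by rewrite invr_ge0 ltW.
  rewrite (eq_bigr (fun x => (x \in [set x | e x \in C]%SET)%:R)); last by move=> x _; rewrite inE.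
  rewrite sum_indic -natrM ler_nat -sum1_card (partition_big e (mem C)) /=; last by move=> x; rewrite inE.
  rewrite (eq_bigr (fun=> M)) => [|u uC]; first by rewrite sum_nat_const mulnC.
  rewrite sum1dep_card -(fib u uC); apply: eq_card => x; rewrite !inE.
  by case: eqP => [->|]; rewrite ?andbT ?andbF.
have XC : #|X|%:R <= 2 * (M%:R * #|C|%:R) :> R.
  have : 1 / 2 * #|X|%:R <= (1 - kappa / n%:R) * #|X|%:R by apply: ler_wpM2r; [exact: ltW|lra].
  by move: MC; clear; lra.
have Cp : 0 < #|C|%:R :> R.
  by rewrite -(pmulr_rgt0 _ Mp); apply: lt_le_trans MC; apply: mulr_gt0 => //; lra.
have n2 : n%:R ^+ 2 <= 2 * (M%:R * #|C|%:R) :> R.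
  by apply: le_trans XC; rewrite -natrX ler_nat.
have mC : 2 * m%:R <= #|C|%:R :> R.
  rewrite -(ler_pM2l (x := 2 * M%:R)) ?mulr_gt0 //.
  have e1 : M%:R * m%:R <= M%:R * (r * n%:R) by rewrite ler_pM2l.
  have : 4 * r * M%:R * n%:R <= n%:R * n%:R by rewrite ler_pM2r.
  by move: n2 e1; clear; lra.
by split=> //; rewrite -(ler_nat R) natrM.
Qed.

(** Degenerate tuples and repeated constraints each cost a factor [1 + O(1 / n)] per draw. With at
    most [r * n] draws the product is bounded independently of [n]. *)
Lemma subset_le_list_const (R : realType) (U X : finType) (C : {set U}) (e : X -> U)
    (M n m : nat) (kappa r : R) (g : {set U} -> R) :
  (0 < M)%N -> (0 < n)%N -> 0 <= r ->
  (forall u, u \in C -> #|[set x | e x == u]%SET| = M) ->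
  (n ^ 2 <= #|X|)%N ->
  1 - kappa / n%:R <= (\sum_x unif R 0 x * (e x \in C)%:R) ->
  0 <= kappa -> 2 * kappa <= n%:R ->
  m%:R <= r * n%:R -> 4 * r * M%:R <= n%:R ->
  (forall J, 0 <= g J) ->
  (\sum_(J in subs C m) g J) / #|subs C m|%:R <=
  expR (2 * kappa * r + 4 * r ^+ 2 * M%:R) *
  Ex (unif R (X := X)) m (fun xs => (all (fun x => e x \in C) xs)%:R * g (setof e xs)).
Proof.
move=> M0 n0 r0 fib nX hC k0 kn mr rM g0.
have [Cp MC n2 mC'] := constraint_count M0 n0 r0 fib nX hC k0 kn mr rM.
have np : 0 < n%:R :> R by rewrite ltr0n.
have Mp : 0 < M%:R :> R by rewrite ltr0n.
have Xp : 0 < #|X|%:R :> R by rewrite ltr0n; apply: leq_trans nX; rewrite expn_gt0 n0.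
have knu : kappa / n%:R <= 1 / 2 by rewrite ler_pdivrMr //; lra.
apply: le_trans (subset_le_list (e := e) M0 _ _ g0 _) _.
- by move=> u uC; rewrite fib.
- by move: Cp; rewrite ltr0n.
- by apply: leq_trans mC'; exact: leq_pmull.
apply: ler_wpM2r.
  apply: Ex_ge0 => [||xs _]; [exact: unif0| |by rewrite mulr_ge0].
  by move=> t; apply: unif1; move: Xp; rewrite ltr0n.
rewrite expRD; apply: ler_pM.
- by rewrite exprn_ge0 // divr_ge0 // mulr_ge0.
- apply: prodr_ge0 => i _; rewrite divr_ge0 // subr_ge0 ler_nat.
  by apply: leq_trans (ltnW (ltn_ord i)) _; apply: leq_trans mC'; exact: leq_pmull.
- apply: (@le_trans _ _ (expR (2 * kappa / n%:R) ^+ m)).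
    apply: lerXn2r; rewrite ?nnegrE ?expR_ge0 ?divr_ge0 ?mulr_ge0 //.
    apply: (@le_trans _ _ ((1 - kappa / n%:R)^-1)).
      rewrite ler_pdivrMr ?mulr_gt0 // mulrC ler_pdivlMr //; last by lra.
      by rewrite mulrC.
    apply: le_trans (expR_ge1Dx _).
    rewrite -[leLHS]mul1r ler_pdivrMr; last by lra.
    have kn0 : 0 <= kappa / n%:R by rewrite divr_ge0.
    have -> : 2 * kappa / n%:R = 2 * (kappa / n%:R) by ring.
    have -> : (1 + 2 * (kappa / n%:R)) * (1 - kappa / n%:R) =
       1 + kappa / n%:R * (1 - 2 * (kappa / n%:R)) by ring.
    by rewrite lerDl; apply: mulr_ge0 => //; move: knu; clear; lra.
  rewrite -expRM_natl ler_expR mulrA ler_pdivrMr // mulrC -!mulrA ler_pM2l //.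
  by rewrite ler_wpM2l.
- apply: le_trans (prod_falling_le R mC' _) _; first by move: Cp; rewrite ltr0n.
  rewrite ler_expR ler_pdivrMr //.
  have : m%:R ^+ 2 <= (r * n%:R) ^+ 2 by rewrite lerXn2r // ?nnegrE // mulr_ge0 // ltW.
  rewrite exprMn.
  have : r ^+ 2 * n%:R ^+ 2 <= r ^+ 2 * (2 * (M%:R * #|C|%:R)) by apply: ler_wpM2l; rewrite ?sqr_ge0.
  by clear; lra.
Qed.

(** * Sums over large sets *)

Section CountingSets.
Variable R : realType.

Lemma sum_set_pow n (z : R) : \sum_(A : {set 'I_n}) z ^+ #|A| = (1 + z) ^+ n.
Proof.
rewrite exprDn (partition_big (fun A : {set 'I_n} => inord #|A| : 'I_n.+1) xpredT) //=.
apply: eq_bigr => j _.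
have cA (A : {set 'I_n}) : (#|A| < n.+1)%N by rewrite ltnS -[n in (_ <= n)%N]card_ord max_card.
rewrite (eq_bigr (fun=> z ^+ j)) => [|A /eqP <-]; last by rewrite inordK.
rewrite sumr_const expr1n mul1r; congr (_ *+ _).
have := card_draws 'I_n j; rewrite card_ord => <-.
by apply: eq_card => A; rewrite [RHS]inE -[LHS]/(inord #|A| == j) -val_eqE /= inordK.
Qed.

(** The tilt [s] rewards size, after which the restriction on size is dropped and the sum is a
    binomial expansion. The term [n * exp (s - nu)] is at most [n / k] once [nu - s] reaches [ln k]:
    this is the origin of the [ln k] in the lower bounds on the densities. *)
Lemma sum_large_sets n (nu s u1 : R) : 0 <= s ->
  \sum_(A : {set 'I_n} | u1 <= #|A|%:R) expR (- (nu * #|A|%:R)) <=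
  expR (n%:R * expR (s - nu) - s * u1) :> R.
Proof.
move=> s0; apply: (@le_trans _ _ (\sum_(A : {set 'I_n}) expR (s - nu) ^+ #|A| * expR (- (s * u1)))).
  rewrite big_mkcond; apply: ler_sum => A _; case: ifP => h; last first.
    by rewrite mulr_ge0 ?exprn_ge0 ?expR_ge0.
  rewrite -expRM_natl -expRD ler_expR.
  have : s * u1 <= s * #|A|%:R by apply: ler_wpM2l.
  by rewrite mulrBr (mulrC _ s) (mulrC _ nu); lra.
rewrite -mulr_suml sum_set_pow [leRHS]expRD; apply: ler_wpM2r; first exact: expR_ge0.
rewrite expRM_natl; apply: lerXn2r; rewrite ?nnegrE ?addr_ge0 ?expR_ge0 //.
exact: expR_ge1Dx.
Qed.
End CountingSets.

Lemma bernoulli (R : realType) (x : R) j : 0 <= x -> x <= 1 -> 1 - j%:R * x <= (1 - x) ^+ j.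
Proof.
move=> x0 x1; elim: j => [|j IH]; first by rewrite mul0r subr0 expr0.
have j0 : 0 <= j%:R :> R by [].
rewrite exprS; apply: (@le_trans _ _ ((1 - x) * (1 - j%:R * x))).
  rewrite -natr1; have := mulr_ge0 j0 (mulr_ge0 x0 x0); lra.
by apply: ler_wpM2l => //; lra.
Qed.

Lemma truncn_ge_sub1 (R : realType) (x : R) : x - 1 <= (Num.truncn x)%:R.
Proof. by have := truncnS_gt x; rewrite -natr1; lra. Qed.

(** * Inequalities for large parameters *)

Section Eventually.
Variable R : realType.

Lemma ev_and (P Q : nat -> Prop) :
  (exists K, forall k, (K <= k)%N -> P k) -> (exists K, forall k, (K <= k)%N -> Q k) ->
  exists K, forall k, (K <= k)%N -> P k /\ Q k.
Proof.
move=> [K1 h1] [K2 h2]; exists (maxn K1 K2) => k; rewrite geq_max => /andP[a b].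
by split; [exact: h1|exact: h2].
Qed.

Lemma ev_nat (M : R) : exists K, forall k, (K <= k)%N -> M <= k%:R.
Proof.
exists (Num.truncn M).+1 => k h; apply: le_trans (ltW (truncnS_gt M)) _.
by rewrite ler_nat.
Qed.

Lemma ev_ln (M : R) : exists K, forall k, (K <= k)%N -> M <= ln k%:R.
Proof.
have [K h] := ev_nat (expR M); exists (maxn K 1) => k; rewrite geq_max => /andP[/h h1 k0].
by rewrite -[leLHS]expRK ler_ln ?posrE ?expR_gt0 // ltr0n.
Qed.

(** The base 4/3 serves twice: it is below the base of [2 ^ k], and inverted it controls the (3/4)^k
    in the bound on pairs. *)
Lemma ev_pow (M : R) j : exists K, forall k, (K <= k)%N -> M * k%:R ^+ j <= (4 / 3) ^+ k.
Proof.
have l0 : 0 < ln (4 / 3) :> R by rewrite ln_gt0 //; lra.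
pose C : R := ((2 * j.+1%:R) / (2 * ln (4 / 3))) ^+ j.+1.
have [K h] := ev_nat (`|M| * C); exists (maxn K 1) => k; rewrite geq_max => /andP[/h h1 k0].
have kp : 0 < k%:R :> R by rewrite ltr0n.
have := @pow_le_expR R j.+1 (2 * k%:R * ln (4 / 3)).
rewrite (_ : 2 * k%:R * ln (4 / 3) / 2 = k%:R * ln (4 / 3) :> R); last by field.
rewrite expRM_natl lnK ?posrE ?divr_gt0 //.
move=> /(_ _ isT); rewrite !mulr_ge0 ?(ltW l0) // => /(_ isT) h2.
have h3 : k%:R ^+ j.+1 <= C * (4 / 3) ^+ k :> R.
  rewrite /C exprMn exprVn mulrAC ler_pdivlMr ?exprn_gt0 ?mulr_gt0 //.
  by rewrite -exprMn mulrCA mulrA.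
have C0 : 0 <= C by rewrite exprn_ge0 // divr_ge0 ?mulr_ge0 ?(ltW l0).
rewrite -(ler_pM2l kp); apply: (@le_trans _ _ (`|M| * k%:R ^+ j.+1)).
  by rewrite exprS mulrCA; apply: ler_wpM2r; rewrite ?mulr_ge0 ?exprn_ge0 ?ler_norm.
apply: (@le_trans _ _ (`|M| * (C * (4 / 3) ^+ k))); first by apply: ler_wpM2l.
by rewrite mulrA; apply: ler_wpM2r => //; rewrite exprn_ge0.
Qed.
End Eventually.

(** * Satisfying assignments *)

Section FourierTools.
Variable R : realType.

Lemma prod_1D (I : finType) (y : I -> R) :
  \prod_i (1 + y i) = \sum_(S : {set I}) \prod_(i in S) y i.
Proof.
rewrite (eq_bigr (fun i => y i + 1)) => [|i _]; last by rewrite addrC.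
rewrite bigA_distr; apply: eq_bigr => S _; rewrite [RHS]big_mkcond.
by apply: eq_bigr => i _; case: (i \in S).
Qed.

Lemma sum_singletons (I : finType) (F : {set I} -> R) :
  \sum_(S : {set I} | #|S| == 1%N) F S = \sum_i F [set i]%SET.
Proof.
rewrite [RHS](eq_bigr (fun i => \sum_(S | S == [set i]%SET) F S)); last first.
  by move=> i _; rewrite big_pred1_eq.
rewrite (exchange_big_dep (fun S : {set I} => #|S| == 1%N)) /=; last first.
  by move=> i S _ /eqP ->; rewrite cards1.
apply: eq_bigr => S /cards1P[i ->]; rewrite (big_pred1 i) // => j.
by rewrite /= (inj_eq set1_inj) eq_sym.
Qed.

(** Beyond the square, powers of [r] are at most powers of 1/2. Summed over all sets these give
    (3/2)^k, exponentially smaller than the 2^k of [Hs_quad]. *)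
Lemma Hs_small k (g : nat -> R) (r : R) : g 1%N = 0 -> (forall j, `|g j| <= 2) -> `|r| <= 1 / 2 ->
  Hs k g `|r| <= 16 * r ^+ 2 * (3 / 2) ^+ k.
Proof.
move=> g1 g2 r2.
have -> : (3 / 2) ^+ k = \sum_(S : {set 'I_k}) (1 / 2) ^+ #|S| :> R.
  by rewrite sum_set_pow; congr (_ ^+ _); lra.
rewrite mulr_sumr /Hs big_mkcond; apply: ler_sum => S _.
have e0 : 0 <= 16 * r ^+ 2 * (1 / 2) ^+ #|S| by rewrite mulr_ge0 ?exprn_ge0 // mulr_ge0 // sqr_ge0.
case: ifP => // S0; have [E|S1] := eqVneq #|S| 1%N; first by move: e0; rewrite E g1 expr0n mul0r.
have : (1 < #|S|)%N by move: S0 S1; rewrite -cards_eq0; case: #|S| => [|[]].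
case: #|S| => [|[|j]] // _; rewrite -(add2n j) !exprD real_normK ?num_real //.
have a4 : g (2 + j) ^+ 2 <= 4.
  by rewrite -(real_normK (num_real (g _))); have := g2 (2 + j); have := normr_ge0 (g (2 + j)); nra.
have b1 : `|r| ^+ j <= (1 / 2) ^+ j by rewrite lerXn2r ?nnegrE.
have -> : 16 * r ^+ 2 * ((1 / 2) ^+ 2 * (1 / 2) ^+ j) = 4 * (r ^+ 2 * (1 / 2) ^+ j) by field.
apply: ler_pM => //; first exact: sqr_ge0.
  by apply: mulr_ge0; rewrite ?sqr_ge0 ?exprn_ge0.
by apply: ler_wpM2l; rewrite ?sqr_ge0.
Qed.

Lemma avg_crit k (Lam : finType) (B D : {set Lam}) t (i : 'I_k) :
  \sum_x unif R (X := {ffun 'I_k -> Lam}) t x *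
    ((x i \in B) && [forall j, (j != i) ==> (x j \in D)])%:R =
  (#|B|%:R / #|Lam|%:R) * (#|D|%:R / #|Lam|%:R) ^+ k.-1.
Proof.
rewrite (eq_bigr (fun x : {ffun 'I_k -> Lam} => unif R t x * \prod_j
   (if j == i then (x j \in B)%:R else (x j \in D)%:R))); last first.
  move=> x _; congr (_ * _); rewrite (bigD1 i) //= eqxx.
  case: (x i \in B); last by rewrite mul0r.
  rewrite mul1r /=; case: forallP => h.
    by rewrite big1 // => j ji; rewrite (negbTE ji); have := h j; rewrite ji /= => ->.
  move/forallP: h => /forallPn[j]; rewrite negb_imply => /andP[ji jD].
  by rewrite (bigD1 j) //= (negbTE ji) (negbTE jD) mul0r.
rewrite (avg_prod (fun j l => if j == i then (l \in B)%:R else (l \in D)%:R)).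
rewrite (bigD1 i) //= eqxx sum_indic; congr (_ * _).
rewrite (eq_bigr (fun=> #|D|%:R / #|Lam|%:R)) => [|j ji]; last by rewrite (negbTE ji) sum_indic.
by rewrite prodr_const cardC1 card_ord.
Qed.
End FourierTools.

Section KSAT.
Variables (R : realType) (n k : nat).
Local Notation Lam := ('I_n * bool)%type.
Local Notation X := {ffun 'I_k -> Lam}.
Local Notation Om := {ffun 'I_n -> bool}.
Hypothesis n0 : (0 < n)%N.
Hypothesis k2 : (1 < k)%N.
Hypothesis k_large : 16 * k%:R ^+ 2 <= 2 ^+ k - k%:R :> R.

Definition spb (s : Om) (l : Lam) : R := if s l.1 == l.2 then 1 else -1.
(** The signs are the coefficients of the product of [1 - spb], which is 2^k on a violated clause
    and 0 otherwise. Deleting the linear ones adds the sum of the spins, so clauses with many true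
    literals are penalised; this removes the pull towards the majority assignment that ruins the
    unweighted second moment. *)
Definition gb (j : nat) : R := if j == 1%N then 0 else (-1) ^+ j.
(** On a violated clause [Gs] is [2 ^ k - k]; this choice keeps the weight 0 there. *)
Definition Ab : R := (2 ^+ k - k%:R)^-1.
Definition satx (s : Om) (x : X) : bool := [exists i, s (x i).1 == (x i).2].

Lemma k_ge2 : 2 <= k%:R :> R. Proof. by rewrite (ler_nat R 2). Qed.

Lemma denb_large : 64 <= 2 ^+ k - k%:R :> R.
Proof. by have := k_large; have := k_ge2; nra. Qed.

Lemma denb : 0 < 2 ^+ k - k%:R :> R.
Proof. by have := denb_large; lra. Qed.

Lemma cardLam : #|{: Lam}| = (n * 2)%N.
Proof. by rewrite card_prod card_ord card_bool. Qed.

Lemma spb_mean s : s \in [set: Om]%SET -> \sum_l spb s l = 0.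
Proof.
move=> _; rewrite -(pair_bigA _ (fun v b => spb s (v, b))) big1 //= => v _.
by rewrite big_bool /spb /=; case: (s v); rewrite /= ?subrr ?addNr.
Qed.

Lemma spb_ov s s' : \sum_l spb s l * spb s' l = #|{: Lam}|%:R * ov R s s'.
Proof.
have np : n%:R != 0 :> R by rewrite pnatr_eq0 -lt0n.
rewrite -(pair_bigA _ (fun v b => spb s (v, b) * spb s' (v, b))) /=.
rewrite (eq_bigr (fun v => 2 - 4 * (v \in [set v | s v != s' v]%SET)%:R)); last first.
  by move=> v _; rewrite big_bool /spb inE /=; case: (s v); case: (s' v) => /=; lra.
rewrite sumrB -mulr_sumr sum_indic sumr_const card_ord cardLam natrM /ov -/(hamming s s').
by rewrite -[X in X - _]mulr_natl; field.
Qed.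

Lemma gb_le j : `|gb j| <= 2.
Proof. by rewrite /gb; case: ifP => _; rewrite ?normr0 // normrX normrN1 expr1n ler1n. Qed.

Lemma Gs_gb s (x : X) : Gs spb gb s x =
  \prod_(i : 'I_k) (1 - spb s (x i)) + \sum_(i : 'I_k) spb s (x i).
Proof.
rewrite (eq_bigr (fun i => 1 + (- spb s (x i)))) // prod_1D.
rewrite /Gs [LHS](eq_bigr (fun S : {set 'I_k} => \prod_(i in S) (- spb s (x i)) +
   (if #|S| == 1%N then chr spb s S x else 0))).
  rewrite big_split /= -big_mkcond sum_singletons; congr (_ + _).
  by apply: eq_bigr => i _; rewrite /chr big_set1.
move=> S _; rewrite prodrN /gb /chr.
case: eqP => [E|_]; last by rewrite addr0.
by rewrite E mul0r expr1 mulN1r addNr.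
Qed.

Lemma satN s x : satx s x = false -> forall i, spb s (x i) = -1.
Proof. by move=> /existsPn h i; rewrite /spb (negbTE (h i)). Qed.

Lemma Gs_unsat s x : satx s x = false -> Gs spb gb s x = 2 ^+ k - k%:R.
Proof.
move=> /satN h; rewrite Gs_gb (eq_bigr (fun=> 2)) => [|i _]; last by rewrite h; lra.
rewrite prodr_const card_ord (eq_bigr (fun=> -1)) => [|i _]; last exact: h.
by rewrite sumr_const card_ord mulNrn.
Qed.

Lemma spb_le1 s l : `|spb s l| <= 1.
Proof. by rewrite /spb; case: ifP; rewrite ?normrN1 ?normr1. Qed.

Lemma Gs_sat s x : satx s x -> Gs spb gb s x <= k%:R.
Proof.
move=> /existsP[i h]; rewrite Gs_gb (bigD1 i) //= {1}/spb h subrr mul0r add0r.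
apply: (@le_trans _ _ (\sum_(i < k) 1)); last by rewrite sumr_const card_ord.
by apply: ler_sum => j _; apply: le_trans (ler_norm _) (spb_le1 _ _).
Qed.

Lemma gb0 : gb 0 = 1. Proof. by []. Qed.

Lemma Ab_le : Ab <= 1 / 64.
Proof. by rewrite /Ab mul1r lef_pV2 ?posrE ?denb ?denb_large. Qed.

Lemma Ab_gt0 : 0 < Ab. Proof. by rewrite invr_gt0 denb. Qed.

Lemma Fs_gb0 s (x : X) : s \in [set: Om]%SET -> 0 <= Fs spb gb Ab s x.
Proof.
move=> _; have d := denb; have A64 := Ab_le; have A0 := Ab_gt0.
rewrite /Fs gb0 mulr1; apply: divr_ge0; last by lra.
case sat: (satx s x); last by rewrite Gs_unsat // mulVf ?subrr ?lt0r_neq0.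
rewrite subr_ge0; apply: (@le_trans _ _ (Ab * k%:R)).
  by rewrite ler_pM2l //; exact: Gs_sat.
by rewrite mulrC ler_pdivrMr // mul1r; have := k_large; have := k_ge2; nra.
Qed.

Lemma Fs_unsat s x : satx s x = false -> Fs spb gb Ab s x = 0.
Proof. by move=> h; rewrite /Fs Gs_unsat // mulVf ?subrr ?mul0r ?lt0r_neq0 ?denb. Qed.

Lemma Ak_gb : 2 * Ab * k%:R ^+ 2 <= 1 / 8.
Proof.
have -> : 2 * Ab * k%:R ^+ 2 = 2 * k%:R ^+ 2 / (2 ^+ k - k%:R) by rewrite /Ab; ring.
by rewrite ler_pdivrMr ?denb //; have := k_large; lra.
Qed.

Lemma Hs_gb (r : R) : Hs k gb `|r| <= 1 * (1 + `|r|) ^+ k.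
Proof.
rewrite mul1r -sum_set_pow /Hs big_mkcond; apply: ler_sum => S _.
have e0 : 0 <= `|r| ^+ #|S| by rewrite exprn_ge0.
case: ifP => // _; rewrite /gb; case: ifP => _; first by rewrite expr0n mul0r.
by rewrite sqrr_sign mul1r.
Qed.

Lemma Hs_gb1 : Hs k gb 1 = 2 ^+ k - k%:R - 1.
Proof.
have : \sum_(S : {set 'I_k}) (1 : R) ^+ #|S| = 2 ^+ k by rewrite sum_set_pow; congr (_ ^+ _); lra.
rewrite (eq_bigr (fun S : {set 'I_k} => gb #|S| ^+ 2 * 1 ^+ #|S| + (if #|S| == 1%N then 1 else 0))); last first.
  move=> S _; rewrite expr1n mulr1 /gb; case: eqP => _; first by rewrite expr0n add0r.
  by rewrite sqrr_sign addr0.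
rewrite big_split /= -big_mkcond sum_singletons sumr_const card_ord (bigD1 set0) //=.
by rewrite cards0 expr0 gb0 expr1n mul1r -/(Hs k gb 1); move: (Hs _ _ _) => h hh; lra.
Qed.

Local Notation P := (unif R (X := X)).
Local Notation W := (mass (mu R [set: Om]%SET) (lk [set: Om]%SET spb gb Ab)).

Lemma card_Om : #|[set: Om]%SET|%:R = 2 ^+ n :> R.
Proof. by rewrite cardsT card_ffun card_bool card_ord natrX. Qed.

Lemma wt_gb (xs : seq X) s : weight (mu R [set: Om]%SET) (lk [set: Om]%SET spb gb Ab) xs s =
  2 ^- n * \prod_(x <- xs) Fs spb gb Ab s x.
Proof.
elim: xs => [|x xs IH] /=; first by rewrite big_nil mulr1 /mu inE card_Om mul1r.
by rewrite big_cons IH /lk inE mulrCA.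
Qed.

Definition nsol (xs : seq X) : nat := #|[set s : Om | all (satx s) xs]%SET|.

(** The mass is a weighted count. Cauchy-Schwarz over the satisfying assignments returns to the
    plain count at the price of the sum of squared weights, whose mean is known exactly. *)
Lemma W_nsol xs : (2 ^+ n * W xs) ^+ 2 <=
  (nsol xs)%:R * \sum_s \prod_(x <- xs) Fs spb gb Ab s x ^+ 2.
Proof.
have -> : 2 ^+ n * W xs = \sum_s (s \in [set s | all (satx s) xs]%SET)%:R * \prod_(x <- xs) Fs spb gb Ab s x.
  rewrite /mass mulr_sumr; apply: eq_bigr => s _; rewrite wt_gb inE.
  rewrite mulrA divff ?mul1r ?expf_neq0 ?pnatr_eq0 //.
  case: allP => h; first by rewrite mul1r.
  move/allP: h => /allPn[x xxs /negbTE /Fs_unsat h].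
  by rewrite mul0r (big_rem x) //= h mul0r.
apply: le_trans (cauchy_schwarz _ _) _.
rewrite (eq_bigr (fun s => (s \in [set s | all (satx s) xs]%SET)%:R)); last first.
  by move=> s _; case: (s \in _); rewrite ?expr1n ?expr0n.
rewrite sum_indic; apply: ler_wpM2l => //; apply: ler_sum => s _.
by rewrite prodrXl.
Qed.

(** Mean square of [Fs] under one random clause, that is, the kernel at overlap 1. *)
Definition q2 : R := 1 + 1 / (2 ^+ k - k%:R - 1).

Lemma A'_gb : A' gb Ab = (2 ^+ k - k%:R - 1)^-1.
Proof.
have d := denb_large; rewrite /A' gb0 mulr1 /Ab; field.
by apply/andP; split; rewrite lt0r_neq0 //; lra.
Qed.

Lemma Ex_second m : Ex P m (fun xs => \sum_s \prod_(x <- xs) Fs spb gb Ab s x ^+ 2) = 2 ^+ n * q2 ^+ m.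
Proof.
have L0 : (0 < #|{: Lam}|)%N by rewrite cardLam muln_gt0 n0.
have A64 := Ab_le; have A0 := Ab_gt0.
have Ag4 : Ab * gb 0 <= 1 / 4 by rewrite gb0 mulr1; lra.
have O1 : 2 ^+ n <= n.+1%:R * #|[set: Om]%SET|%:R :> R.
  by rewrite card_Om ler_peMl ?exprn_ge0 // ler1n.
rewrite Ex_sum; [|exact: P_ge0|exact: P_sum1].
rewrite (eq_bigr (fun=> q2 ^+ m)) => [|s _]; first by rewrite sumr_const -card_Om cardsT -[LHS]mulr_natl.
apply: Ex_prod => [|t]; first exact: P_ge0.
have sO : s \in [set: Om]%SET by rewrite inE.
have := Kt_lk k L0 spb_mean spb_ov Ag4 t sO sO.
rewrite /Kt /lk inE; under eq_bigr do rewrite -expr2.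
move=> ->; rewrite /q2; congr (_ + _).
have -> : ov R s s = 1.
  rewrite /ov /hamming (_ : [set v | s v != s v]%SET = set0) ?cards0 ?mulr0 ?mul0r ?subr0 //.
  by apply/setP => v; rewrite !inE eqxx.
rewrite Hs_gb1 A'_gb; field; rewrite lt0r_neq0 //; have := denb_large; lra.
Qed.

(** Either the mass has fallen through its barrier, or a small count forces the sum of squared
    weights to be large by [W_nsol], and Markov's inequality applies to that sum. *)
Lemma nsol_lower (m : nat) (e y L : R) : 0 < e -> e <= 1 -> 0 < L ->
  m%:R * A' gb Ab ^+ 2 * 1 * 2 ^+ k <= (1 - e) * ln 2 * n%:R ->
  16 * (3 / 4) ^+ k <= 1 / 16 :> R ->
  5 * ln (8 / e) <= e / 8 * k%:R ->
  1 <= y -> y ^+ 8 = n%:R ->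
  A' gb Ab ^+ 2 * (4 * 2 ^+ k) * (n%:R ^+ 2 * n.+1%:R ^+ 2 * expR (- y)) <= y / n%:R ->
  Ex P m (fun xs => ((nsol xs)%:R < L)%R%:R) <=
  spin_failure n k gb Ab m (e / 16) y +
  L * expR (2 * spin_loss n k gb Ab m (e / 16) y) * 2 ^- n * q2 ^+ m.
Proof.
move=> e0 e1 L0 Hm Hk1 Hk2 y1 y8 yl.
have Lm0 : (0 < #|{: Lam}|)%N by rewrite cardLam muln_gt0 n0.
have A64 := Ab_le; have A0 := Ab_gt0.
have Ag4 : Ab * gb 0 <= 1 / 4 by rewrite gb0 mulr1; lra.
have O1 : 2 ^+ n <= n.+1%:R * #|[set: Om]%SET|%:R :> R.
  by rewrite card_Om ler_peMl ?exprn_ge0 // ler1n.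
have g1 : gb 1 = 0 by [].
have e16 : 0 < e / 16 by rewrite divr_gt0.
set lo := spin_loss _ _ _ _ _ _ _.
have PB j : (j <= n)%N ->
  'C(n, j)%:R / 2 ^+ n * expR (m%:R * A' gb Ab ^+ 2 * Hs k gb `|1 - 2 * j%:R / n%:R|) <=
  expR (- (e / 16 * (n%:R * (1 - 2 * j%:R / n%:R) ^+ 2))) :> R.
  move=> jn; apply: (@pair_exponent R n j k m 1) => //; rewrite ?sqr_ge0 //.
  - by apply: leq_trans k2.
  - exact: Hs_gb.
  - by move=> h; apply: Hs_small => //; exact: gb_le.
have SL := @spin_lower_bound R n k _ [set: Om]%SET spb gb Ab n0 Lm0 spb_le1 spb_mean spb_ov O1 g1 gb_le (ltW A0) Ag4 Ak_gb Fs_gb0 m (e / 16) e16 PB y y1 y8 yl.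
apply: (@le_trans _ _ (Ex P m (fun xs => (W xs < expR (- lo))%R%:R +
  (L * expR (2 * lo) * 4 ^- n) * \sum_s \prod_(x <- xs) Fs spb gb Ab s x ^+ 2))).
  apply: Ex_le => [|xs _]; first exact: P_ge0.
  have Q0 : 0 <= \sum_s \prod_(x <- xs) Fs spb gb Ab s x ^+ 2.
    by apply: sumr_ge0 => s _; apply: prodr_ge0 => x _; exact: sqr_ge0.
  have C0 : 0 <= L * expR (2 * lo) * 4 ^- n.
    by rewrite mulr_ge0 ?invr_ge0 ?exprn_ge0 // mulr_ge0 ?expR_ge0 // ltW.
  case: (ltP _ L) => hL; last by apply: addr_ge0 => //; exact: mulr_ge0.
  case: (ltP (W xs)) => hW; first by rewrite lerDl mulr_ge0.
  rewrite add0r mulrAC ler_pdivlMr ?exprn_gt0 // mul1r.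
  have -> : 4 ^+ n = (2 ^+ n) ^+ 2 :> R by rewrite exprAC; congr (_ ^+ _); lra.
  apply: (@le_trans _ _ (expR (2 * lo) * (2 ^+ n * W xs) ^+ 2)).
    rewrite exprMn mulrCA ler_peMr ?exprn_ge0 //.
    exact: expR_mass.
  rewrite (mulrC L) -[leRHS]mulrA; apply: ler_wpM2l; first exact: expR_ge0.
  apply: le_trans (W_nsol xs) _; apply: ler_wpM2r => //; exact: ltW.
rewrite ExD; last exact: P_ge0.
rewrite ExZ; last exact: P_ge0.
rewrite Ex_second lerD // le_eqVlt; apply/orP; left; apply/eqP.
have -> : 4 ^- n = 2 ^- n * 2 ^- n :> R by rewrite -invfM -exprMn; congr (_ ^- _); lra.
by field; rewrite expf_neq0.
Qed.

Definition clause_of (x : X) : {set Lam} := [set x i | i : 'I_k]%SET.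
Definition clauses : {set {set Lam}} := [set C | is_kclause k C]%SET.

Lemma cnf_subs m : cnf_formulas k n m = subs clauses m.
Proof.
apply/setP => F; rewrite !inE andbC; congr (_ && _).
apply/forallP/fintype.subsetP => h C.
  by move=> CF; have := h C; rewrite CF inE.
by apply/implyP => CF; have := h C CF; rewrite inE.
Qed.

Lemma clause_fibre C : C \in clauses -> #|[set x | clause_of x == C]%SET| = k`!.
Proof.
rewrite inE => /andP[/eqP cC _].
have := card_inj_ffuns_on 'I_k (mem C); rewrite card_ord cC ffactnn => <-.
apply: eq_card => x; rewrite !inE.
apply/eqP/andP => [xC|[/ffun_onP xC /injectiveP xi]].
  split; first by apply/ffun_onP => i; rewrite -xC; apply: imset_f.
  have /imset_injP h : #|[set x i | i in 'I_k]%SET| == #|'I_k|.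
    rewrite (_ : [set x i | i in 'I_k]%SET = clause_of x) ?xC ?cC ?card_ord //.
  by apply/injectiveP => i j; apply: h.
apply/eqP; rewrite eqEcard; apply/andP; split.
  by apply/fintype.subsetP => l /imsetP[i _ ->]; exact: xC.
by rewrite card_imset // card_ord cC.
Qed.

Lemma var_card_lit (v : 'I_n) : #|[set l : Lam | l.1 == v]%SET| = 2%N.
Proof.
rewrite (_ : [set l : Lam | l.1 == v]%SET = setX [set v] setT).
  by rewrite cardsX cards1 cardsT card_bool.
by apply/setP => l; rewrite !inE andbT.
Qed.

Lemma distinct_clause (x : X) : distinct_vars fst x -> clause_of x \in clauses.
Proof.
move=> /injectiveP xi; rewrite inE; apply/andP; split.
  rewrite card_imset ?card_ord // => i j xij.
  by apply: xi; rewrite /= xij.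
apply/forallP => l; apply/implyP => /imsetP[i _ ->].
apply/forallP => l'; apply/implyP => /imsetP[j _ ->].
by apply/implyP => /eqP /xi ->.
Qed.

Lemma sat_setof s xs : (s \in sat_assignments (setof clause_of xs)) = all (satx s) xs.
Proof.
rewrite inE; apply/forallP/allP => h.
  move=> x xxs; have := h (clause_of x); rewrite inE map_f //=.
  by move=> /existsP[l /andP[/imsetP[i _ ->] sl]]; apply/existsP; exists i.
move=> C; apply/implyP; rewrite inE => /mapP[x xxs ->].
have /existsP[i si] := h x xxs; apply/existsP; exists (x i).
by rewrite si andbT imset_f.
Qed.

Definition critB (s : Om) (A : {set 'I_n}) : {set Lam} := [set l | (l.1 \in A) && (s l.1 == l.2)]%SET.
Definition critD (s : Om) (A : {set 'I_n}) : {set Lam} := [set l | (l.1 \notin A) && (s l.1 != l.2)]%SET.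

Lemma card_critB s A : #|critB s A| = #|A|.
Proof.
have -> : critB s A = [set (v, s v) | v in A]%SET.
  apply/setP => -[v b]; rewrite inE /=; apply/andP/imsetP => [[vA /eqP <-]|[w wA [-> ->]]].
    by exists v.
  by rewrite wA eqxx.
by rewrite card_imset // => v w [].
Qed.

Lemma card_critD s A : #|critD s A| = (n - #|A|)%N.
Proof.
have -> : critD s A = [set (v, ~~ s v) | v in ~: A]%SET.
  apply/setP => -[v b]; rewrite inE /=; apply/andP/imsetP => [[vA sb]|[w wA [-> ->]]].
    exists v; rewrite ?inE //; congr pair; move: sb; by case: (s v); case: b.
  by move: wA; rewrite inE => ->; case: (s w).
rewrite card_imset => [|v w []] //.
have An : (#|A| <= n)%N by rewrite -[n in (_ <= n)%N]card_ord max_card.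
by apply/eqP; rewrite -(eqn_add2l #|A|) cardsC card_ord subnKC.
Qed.

(** The only true literal has its variable in [A], all other variables are outside. A solution that
    agrees with [s] outside [A] cannot flip this variable, so a window of non-rigid variables
    excludes such clauses. *)
Definition crit (s : Om) A (x : X) (i : 'I_k) : bool :=
  (x i \in critB s A) && [forall j, (j != i) ==> (x j \in critD s A)].
Definition okx (s : Om) A (x : X) : bool := satx s x && ~~ [exists i, crit s A x i].

(** Being violated and being critical at one of the [k] positions are mutually exclusive, so the
    indicators add. *)
Lemma okx_le s A x : (okx s A x)%:R <= 1 - (~~ satx s x)%:R - \sum_i (crit s A x i)%:R :> R.
Proof.
have BD l : l \in critB s A -> l \in critD s A -> False.
  by rewrite !inE => /andP[-> _].
have [[i ci]|nc] := pselect (exists i, crit s A x i).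
  have sx : satx s x.
    by apply/existsP; exists i; move: ci => /andP[]; rewrite inE => /andP[_ ->].
  rewrite /okx sx /= (bigD1 i) //= ci big1 => [|j ji].
    by rewrite (_ : [exists i, _] = true) ?subr0 ?addr0 ?subrr //; apply/existsP; exists i.
  case cj: (crit s A x j) => //; exfalso.
  move: ci cj => /andP[iB _] /andP[_ /forallP /(_ i)]; rewrite eq_sym ji /=.
  exact: BD.
rewrite big1 => [|i _]; last by case ci: (crit s A x i) => //; case: nc; exists i.
by rewrite /okx; case: (satx s x); rewrite /= ?subr0 ?subrr //; case: (~~ _).
Qed.

(** About [(a / n) * (k / 2 ^ k)] for small [a]: at density [2 ^ k / k * ln k] a set pays [ln k] for
    each of its elements. *)
Definition pcrit (a : R) : R := k%:R * (a / (n%:R * 2) * ((n%:R - a) / (n%:R * 2)) ^+ k.-1).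

Lemma avg_okx t s A : \sum_x P t x * (okx s A x)%:R <= 1 - 2 ^- k - pcrit #|A|%:R.
Proof.
have L0 : (0 < #|{: Lam}|)%N by rewrite cardLam muln_gt0 n0.
apply: (@le_trans _ _ (\sum_x P t x * (1 - (~~ satx s x)%:R - \sum_i (crit s A x i)%:R))).
  by apply: ler_sum => x _; apply: ler_wpM2l; [exact: P_ge0|exact: okx_le].
under eq_bigr do rewrite !mulrBr mulr1 mulr_sumr.
rewrite !sumrB P_sum1 // exchange_big /= [X in _ - X](eq_bigr (fun=> #|A|%:R / (n%:R * 2) * ((n%:R - #|A|%:R) / (n%:R * 2)) ^+ k.-1)); last first.
  move=> i _; rewrite avg_crit card_critB card_critD cardLam natrM natrB //.
  by rewrite -[n in (_ <= n)%N]card_ord max_card.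
rewrite sumr_const card_ord -[X in _ - X <= _]mulr_natl -/(pcrit _) lerD2r lerD2l lerN2.
rewrite (eq_bigr (fun x : X => P t x * \prod_i (x i \in [set l : Lam | s l.1 != l.2]%SET)%:R)); last first.
  move=> x _; congr (_ * _); rewrite /satx negb_exists; case: forallP => h.
    by rewrite big1 // => i _; rewrite inE h.
  move/forallP: h => /forallPn[i]; rewrite negbK => h.
  by rewrite (bigD1 i) //= inE h mul0r.
rewrite (avg_prod (fun i l => (l \in [set l : Lam | s l.1 != l.2]%SET)%:R)) prodr_const card_ord sum_indic.
have -> : #|[set l : Lam | s l.1 != l.2]%SET| = n.
  transitivity #|critD s set0|; last by rewrite card_critD cards0 subn0.
  by apply: eq_card => l; rewrite !inE.
rewrite cardLam natrM invfM mulrA divff ?mul1r ?exprVn //.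
by rewrite pnatr_eq0 -lt0n.
Qed.

Lemma avg_okx_le t s A : \sum_x P t x * (okx s A x)%:R <= (1 - 2 ^- k) * expR (- pcrit #|A|%:R).
Proof.
apply: le_trans (avg_okx t s A) _.
have An : #|A|%:R <= n%:R :> R by rewrite ler_nat -[n in (_ <= n)%N]card_ord max_card.
have p0 : 0 <= pcrit #|A|%:R.
  by rewrite mulr_ge0 // mulr_ge0 ?exprn_ge0 ?divr_ge0 ?mulr_ge0 ?subr_ge0.
have t1 : 2 ^- k <= 1 :> R by rewrite invf_le1 ?exprn_gt0 // exprn_ege1 // ler1n.
have t0 : 0 <= 2 ^- k :> R by rewrite invr_ge0 exprn_ge0.
apply: (@le_trans _ _ ((1 - 2 ^- k) * (1 - pcrit #|A|%:R))).
  have -> : (1 - 2 ^- k) * (1 - pcrit #|A|%:R) = 1 - 2 ^- k - pcrit #|A|%:R + 2 ^- k * pcrit #|A|%:R by ring.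
  by rewrite lerDl mulr_ge0.
by apply: ler_wpM2l; [lra|have := expR_ge1Dx (- pcrit #|A|%:R)].
Qed.

Lemma bad_okx (c g : R) (u1 : nat) xs s : 0 <= c -> u1%:R <= (1 - g) * n%:R ->
  s \in sat_assignments (setof clause_of xs) ->
  ~~ (g * n%:R <= #|[set v | rigid (sat_assignments (setof clause_of xs)) s (c * n%:R) v]%SET|%:R) ->
  exists A : {set 'I_n}, [/\ (u1 <= #|A|)%N, #|A|%:R <= u1%:R + c * n%:R :> R & all (okx s A) xs].
Proof.
move=> c0 hu sS hb; have [A [A1 A2 A3]] := nonrigid_window c0 hb hu.
exists A; split=> //; apply/allP => x xxs; rewrite sat_setof in sS; rewrite /okx (allP sS) //=.
apply/existsPn => i; apply/negP => /andP[]; rewrite inE => /andP[iA /eqP si] /forallP hj.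
have [t [tS tw tX]] := A3 _ iA.
have /existsP[j tj] := allP (etrans (esym (sat_setof t xs)) tS) x xxs.
have [ji|ji] := eqVneq j i; first by move: tj tw; rewrite ji si => ->.
move: (hj j); rewrite ji inE /= => /andP[jA sj].
have E : t (x j).1 = s (x j).1.
  by apply/eqP; apply: contraNT jA => /tX.
by move: sj; rewrite -E tj.
Qed.

(** For fixed [s] and [A] the clauses are independent, each allowed with probability at most
    [(1 - 2 ^- k) * exp (- pcrit #|A|)]. The first factor reproduces the expected number of
    solutions, and [sum_large_sets] sums the second over [A]. *)
Lemma bad_expectation (m u1 : nat) (c g nu s0 : R) : 0 <= c -> 0 <= s0 -> u1%:R <= (1 - g) * n%:R ->
  (forall a : R, u1%:R <= a -> a <= u1%:R + c * n%:R -> nu * a <= m%:R * pcrit a) ->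
  Ex P m (fun xs => (all (fun x => clause_of x \in clauses) xs)%:R *
    #|[set s in sat_assignments (setof clause_of xs) |
       ~~ (g * n%:R <= #|[set v | rigid (sat_assignments (setof clause_of xs)) s (c * n%:R) v]%SET|%:R)]%SET|%:R)
  <= 2 ^+ n * (1 - 2 ^- k) ^+ m * expR (n%:R * expR (s0 - nu) - s0 * u1%:R).
Proof.
move=> c0 s00 hu hnu.
pose win (A : {set 'I_n}) := (u1 <= #|A|)%N && (#|A|%:R <= u1%:R + c * n%:R)%R.
apply: (@le_trans _ _ (Ex P m (fun xs => \sum_(s : Om) \sum_(A | win A) \prod_(x <- xs) (okx s A x)%:R))).
  apply: Ex_le => [|xs _]; first exact: P_ge0.
  set B := [set s in _ | _]%SET.
  apply: (@le_trans _ _ #|B|%:R); first by case: (all _ _); rewrite ?mul1r ?mul0r.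
  rewrite -(sum_indic R B); apply: ler_sum => s _.
  have pr0 A : 0 <= \prod_(x <- xs) (okx s A x)%:R :> R by apply: prodr_ge0.
  case sB: (s \in B); last by apply: sumr_ge0.
  move: sB; rewrite inE => /andP[sS sb].
  have [A [A1 A2 A3]] := bad_okx c0 hu sS sb.
  rewrite (bigD1 A) /=; last by rewrite /win A1 A2.
  rewrite big_seq big1 => [|x xxs]; last by rewrite (allP A3).
  by rewrite lerDl; apply: sumr_ge0.
have t1 : 0 <= 1 - 2 ^- k :> R by rewrite subr_ge0 invf_le1 ?exprn_gt0 // exprn_ege1 // ler1n.
have L0 : (0 < #|{: Lam}|)%N by rewrite cardLam muln_gt0 n0.
rewrite Ex_sum; [|exact: P_ge0|exact: P_sum1].
apply: (@le_trans _ _ (\sum_(s : Om) (1 - 2 ^- k) ^+ m * expR (n%:R * expR (s0 - nu) - s0 * u1%:R))); last first.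
  by rewrite sumr_const -[leLHS]mulr_natl -mulrA -card_Om cardsT.
apply: ler_sum => s _; rewrite Ex_sum; [|exact: P_ge0|exact: P_sum1].
apply: (@le_trans _ _ (\sum_(A : {set 'I_n} | u1%:R <= #|A|%:R :> R) (1 - 2 ^- k) ^+ m * expR (- (nu * #|A|%:R)))); last first.
  by rewrite -mulr_sumr; apply: ler_wpM2l; [exact: exprn_ge0|exact: sum_large_sets].
rewrite big_mkcond [leRHS]big_mkcond; apply: ler_sum => A _; rewrite ler_nat /win.
case: (leqP u1 #|A|) => //= h1; case: ifP => h2; last by rewrite mulr_ge0 ?exprn_ge0 ?expR_ge0.
have -> : Ex P m (fun xs => \prod_(x <- xs) (okx s A x)%:R) = (\sum_x P 0 x * (okx s A x)%:R) ^+ m.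
  by apply: Ex_prod => //; exact: P_ge0.
apply: (@le_trans _ _ (((1 - 2 ^- k) * expR (- pcrit #|A|%:R)) ^+ m)).
  apply: lerXn2r; rewrite ?nnegrE ?mulr_ge0 ?expR_ge0 //; last exact: avg_okx_le.
  by apply: sumr_ge0 => x _; rewrite mulr_ge0 ?P_ge0.
rewrite exprMn -expRM_natl; apply: ler_wpM2l; first exact: exprn_ge0.
by rewrite ler_expR mulrN lerN2; apply: hnu => //; rewrite ler_nat.
Qed.
End KSAT.

(** * Limits and the criterion for rigidity with high probability *)

Section Limits.
Variable R : realType.

Lemma cvg_to1 (f : nat -> R) : (forall n, f n <= 1) ->
  (forall e : R, 0 < e -> exists N, forall n, (N <= n)%N -> 1 - e <= f n) -> f @ \oo --> (1 : R).
Proof.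
move=> f1 h; apply/cvgrPdist_le => e e0; have [N hN] := h e e0.
near=> n; have := hN n; have := f1 n; rewrite ler_norml => a b.
have {}b : 1 - e <= f n by apply: b; near: n; exact: nbhs_infty_ge.
by apply/andP; split; lra.
Unshelve. all: by end_near.
Qed.

Lemma ev_exp (a b e : R) : 0 < a -> 0 < e -> exists N, forall n, (N <= n)%N ->
  b * expR (- (a * n%:R)) <= e.
Proof.
move=> a0 e0; have [N hN] := ev_nat (`|b| / (a * e)); exists N => n /hN h.
have -> : expR (- (a * n%:R)) = (expR (a * n%:R))^-1 by rewrite expRN.
rewrite ler_pdivrMr ?expR_gt0 //; apply: le_trans (ler_norm b) _.
move: h; rewrite ler_pdivrMr ?mulr_gt0 // => h.
apply: le_trans h _; have := expR_ge1Dx (a * n%:R) => h.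
have -> : n%:R * (a * e) = e * (a * n%:R) by ring.
by rewrite ler_pM2l //; lra.
Qed.

Lemma root8 (n : nat) (Y : R) : (0 < n)%N -> Y ^+ 8 <= n%:R -> 0 <= Y ->
  exists2 y : R, Y <= y & y ^+ 8 = n%:R.
Proof.
move=> n0 hY Y0; have np : 0 < n%:R :> R by rewrite ltr0n.
exists (expR (ln n%:R / 8)); last first.
  by rewrite -expRM_natl (_ : 8%:R * _ = ln n%:R) ?lnK ?posrE //; field.
rewrite leNgt; apply/negP => h.
have : (expR (ln n%:R / 8)) ^+ 8 < Y ^+ 8 by rewrite ltrXn2r ?expR_ge0.
rewrite -expRM_natl (_ : 8%:R * _ = ln n%:R); last by field.
by rewrite lnK ?posrE // ltNge hY.
Qed.

Lemma whp_rigid_intro (Q : finType) (I : nat -> finType)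
    (inst : forall n : nat, nat -> {set I n}) (sol : forall n : nat, I n -> {set {ffun 'I_n -> Q}})
    (m : nat -> nat) (c g : R) :
  (forall e : R, 0 < e -> exists N, forall n, (N <= n)%N ->
    exists L : R, [/\ 0 < L, (0 < #|inst n (m n)|)%N,
     (\sum_(J in inst n (m n)) (#|sol n J|%:R < L)%R%:R) / #|inst n (m n)|%:R <= e &
     (\sum_(J in inst n (m n)) #|[set s in sol n J | ~~ (g * n%:R <= #|[set v | rigid (sol n J) s (c * n%:R) v]%SET|%:R)]%SET|%:R)
       / #|inst n (m n)|%:R <= e * L]) ->
  whp_rigid inst sol m c g.
Proof.
move=> h; apply: cvg_to1 => [n|e e0]; first exact: pair_prob_le1.
have [|N hN] := h (e / 2); first by rewrite divr_gt0.
exists N => n /hN[L [L0 i0 h1 h2]]; apply: le_trans (pair_prob_ge _ _ L0 i0).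
have : (\sum_(J in inst n (m n)) #|[set s in sol n J | ~~ (g * n%:R <= #|[set v | rigid (sol n J) s (c * n%:R) v]%SET|%:R)]%SET|%:R)
       / #|inst n (m n)|%:R / L <= e / 2 by rewrite ler_pdivrMr.
lra.
Qed.
End Limits.

Theorem ksat_rigid (R : realType) (eps : R) : 0 < eps -> eps < 1 / 4 ->
  exists K : nat, forall k, (K <= k)%N -> forall r : R,
  (1 + eps) * (2 ^+ k / k%:R * ln k%:R) <= r -> r <= (1 - eps) * (2 ^+ k * ln 2) ->
  exists2 c : R, 0 < c & whp_rigid (cnf_formulas k) sat_assignments
    (fun n => Num.truncn (r * n%:R)) c (1 - eps).
Proof.
(* Windows have size about [del * n / k]. The slack [e] is only half of [eps] because replacing
   [A' ^ 2 * 2 ^ k] by [2 ^- k] costs a factor [(1 + eps / 8) ^ 2]. *)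
move=> e0 e4; pose del := eps / 16; pose e := eps / 2.
have del0 : 0 < del by rewrite divr_gt0.
have ep0 : 0 < e by rewrite divr_gt0.
have [K HK] := ev_and (ev_nat (2 : R)) (ev_and (ev_pow (32 : R) 2) (ev_and (ev_pow (256 : R) 0)
  (ev_and (ev_nat (40 * ln (8 / e) / e)) (ev_and (ev_pow (2 * (1 + 8 / eps)) 1)
   (ev_ln (1 + 8 / (del * eps))))))).
exists K => k /HK[k2 [kp2 [kp0 [ke [kp1 kln]]]]] r r1 r2.
have kN2 : (1 < k)%N by rewrite -(ltr_nat R); lra.
have kN0 : (0 < k)%N by apply: leq_trans kN2.
have kp : 0 < k%:R :> R by lra.
have ln2_1 : ln 2 <= 1 :> R by have := @le_ln1Dx R 1; rewrite (_ : 1 + 1 = 2 :> R); lra.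
have ln2_0 : 0 < ln 2 :> R by rewrite ln_gt0 // ltr1n.
pose t : R := 2 ^+ k.
have t43 : (4 / 3) ^+ k <= t by apply: lerXn2r; rewrite ?nnegrE //; lra.
have tp : 0 < t by rewrite exprn_gt0.
have kk : k%:R <= k%:R ^+ 2 :> R by rewrite expr2 ler_peMr //; move: k2; clear; lra.
have t32 : 32 * k%:R ^+ 2 <= t by apply: le_trans kp2 t43.
have k_large : 16 * k%:R ^+ 2 <= 2 ^+ k - k%:R :> R by rewrite -/t; lra.
have k4 : 4 <= k%:R ^+ 2 :> R by move: k2; clear; nra.
have td : 0 < t - k%:R - 1 by lra.
have L1 : 1 <= ln k%:R :> R.
  by apply: le_trans kln; rewrite lerDl divr_ge0 // mulr_ge0 // ltW.
have L2 : 2 <= del * (eps / 4) * ln k%:R.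
  have : 8 / (del * eps) <= ln k%:R by lra.
  by rewrite ler_pdivrMr ?mulr_gt0 //; lra.
have r0 : 0 < r.
  apply: lt_le_trans r1; apply: mulr_gt0; first by lra.
  by apply: mulr_gt0; [rewrite divr_gt0|lra].
have rt : r <= t.
  apply: le_trans r2 _; rewrite -/t mulrCA ler_piMr ?(ltW tp) //.
  by move: e0 e4 ln2_1 ln2_0; clear => *; apply: mulr_ile1; lra.
have rk : (1 + eps) * ln k%:R <= r * k%:R / t.
  rewrite ler_pdivlMr // -ler_pdivrMr //; apply: le_trans r1.
  by rewrite -/t le_eqVlt; apply/orP; left; apply/eqP; ring.
(* With this distance a window overshoots by at most its own target size. It stays below
   [2 * del * n / k], and the power [k - 1] of the proportion outside it stays close to 1. *)
exists (del / k%:R); first by rewrite divr_gt0.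
apply: whp_rigid_intro => z z0.
pose M := k`!; pose kappa : R := k%:R ^+ 2.
have Mp : 0 < M%:R :> R by rewrite ltr0n fact_gt0.
pose C0 := expR (2 * kappa * r + 4 * r ^+ 2 * M%:R).
have C0p : 0 < C0 by exact: expR_gt0.
(* The first bound makes the failure of the process at most [z / 2] after the transfer; the second
   keeps its loss, doubled by the squaring of the mass, below [n / (8 * k)]. *)
pose d := Num.min (z / (2 * C0)) (1 / (16 * k%:R)).
have d0 : 0 < d by rewrite lt_min !divr_gt0 ?mulr_gt0.
have dz : d <= z / (2 * C0) by rewrite ge_min lexx.
have dk : d <= 1 / (16 * k%:R) by rewrite ge_min lexx orbT.
have kap0 : 0 < e / 16 by rewrite divr_gt0.
have [Y0 HY] := @spin_asymptotics R k (gb R) (Ab R k) (e / 16) r d kap0 (ltW r0) d0.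
pose s0 := eps / 4 * ln k%:R.
have s00 : 0 <= s0 by rewrite /s0; move: e0 L1; clear => *; rewrite mulr_ge0; lra.
have k4p : 0 < 1 / (4 * k%:R) :> R by rewrite divr_gt0 ?mulr_gt0.
have k2p : 0 < 1 / (2 * k%:R) :> R by rewrite divr_gt0 ?mulr_gt0.
have z2 : 0 < z / 2 by rewrite divr_gt0.
have [N HN] := ev_and (ev_nat (1 : R)) (ev_and (ev_nat (`|Y0| ^+ 8)) (ev_and (ev_nat (2 * kappa))
  (ev_and (ev_nat (4 * r * M%:R)) (ev_and (ev_exp C0 k4p z2) (ev_and (ev_exp (C0 * expR s0) k2p z0)
   (ev_nat (4 / eps))))))).
exists N => n /HN[n1 [nY [nk [nr [nC1 [nC2 ne]]]]]].
have n0 : (0 < n)%N by rewrite -(ltr_nat R); apply: lt_le_trans n1.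
have np : 0 < n%:R :> R by rewrite ltr0n.
pose m := Num.truncn (r * n%:R).
have rn0 : 0 <= r * n%:R by rewrite mulr_ge0 // ltW.
have mr : m%:R <= r * n%:R by rewrite truncn_le.
have mr' : r * n%:R - 1 <= m%:R by exact: truncn_ge_sub1.
have [y Yy y8] := root8 n0 nY (normr_ge0 Y0).
have [y1 yl fail loss] := HY y n m (le_trans (ler_norm _) Yy) y8 mr.
have L0 : (0 < #|{: 'I_n * bool}|)%N by rewrite cardLam muln_gt0 n0.
have Xn : (n ^ 2 <= #|{: {ffun 'I_k -> 'I_n * bool}}|)%N.
  rewrite card_ffun cardLam card_ord; apply: (@leq_trans ((n * 2) ^ 2)).
    by rewrite leq_exp2r // leq_pmulr.
  by rewrite leq_exp2l // (leq_trans _ (leq_pmull 2 n0)).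
have avgC : 1 - kappa / n%:R <= \sum_x unif R (X := {ffun 'I_k -> 'I_n * bool}) 0 x * (clause_of x \in clauses n k)%:R.
  apply: le_trans (@avg_distinct R n k 2 ('I_n * bool)%type fst n0 isT (@var_card_lit n) 0) _.
  apply: ler_sum => x _; apply: ler_wpM2l; first exact: unif0.
  by rewrite ler_nat; case: (boolP (distinct_vars _ x)) => // /distinct_clause ->.
have kap_0 : 0 <= kappa by rewrite exprn_ge0.
have fibr u : u \in clauses n k -> #|[set x : {ffun 'I_k -> 'I_n * bool} | clause_of x == u]%SET| = M by apply: clause_fibre.
have [Cc _ _ mC] := constraint_count (fact_gt0 k) n0 (ltW r0) fibr Xn avgC kap_0 nk mr nr.
have TR g : (forall J, 0 <= g J) -> _ := @subset_le_list_const R _ _ _ _ M n m kappa r g (fact_gt0 k) n0 (ltW r0) fibr Xn avgC kap_0 nk mr nr.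
have p1 : 0 < 1 - t^-1 by rewrite subr_gt0 invf_lt1 //; move: t32 k4; clear; lra.
(* The expected count lowered by [exp (n / (2 * k))]. The planted first moment is smaller than
   expected by about [exp (n / k)], so half of the gain is left for the constants. *)
pose L := 2 ^+ n * (1 - t^-1) ^+ m * expR (- (1 / (2 * k%:R) * n%:R)).
have Lp : 0 < L by rewrite mulr_gt0 ?expR_gt0 // mulr_gt0 ?exprn_gt0.
exists L; split=> //.
- by rewrite cnf_subs card_subs bin_gt0; apply: leq_trans mC; exact: leq_pmull.
- rewrite cnf_subs; apply: le_trans (TR _ _) _ => //; rewrite -/C0.
  apply: (@le_trans _ _ (C0 * (d + expR (- (1 / (4 * k%:R) * n%:R))))); last first.
    rewrite mulrDr; have : C0 * d <= z / 2.
      by rewrite mulrC -ler_pdivlMr //; apply: le_trans dz _; rewrite invfM mulrA.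
    by move: nC1; clear; lra.
  rewrite ler_pM2l //.
  apply: (@le_trans _ _ (Ex (unif R (X := {ffun 'I_k -> 'I_n * bool})) m (fun xs => ((nsol xs)%:R < L)%R%:R))).
    apply: Ex_le => [|xs _]; first exact: unif0.
    have -> : #|sat_assignments (setof (@clause_of n k) xs)| = nsol xs.
      by apply: eq_card => s; rewrite sat_setof inE.
    by case: (all _ _); rewrite ?mul1r ?mul0r.
  apply: le_trans (nsol_lower n0 kN2 k_large ep0 _ Lp _ _ _ y1 y8 yl) _.
  + by rewrite /e; move: e4; clear; lra.
  + rewrite A'_gb // -/t mulr1.
    have ta : t / (t - k%:R - 1) <= 1 + eps / 8.
      rewrite ler_pdivrMr //.
      have : (k%:R + 1) * (8 / eps + 1) <= t.
        apply: le_trans t43; apply: le_trans kp1; rewrite expr1.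
        have : 0 <= 8 / eps by rewrite divr_ge0 // ltW.
        by move: k2; clear; move: (8 / eps) => w k2 w0; have : 0 <= (k%:R - 1) * w by [apply: mulr_ge0; lra]; lra.
      rewrite -(ler_pM2l (x := eps / 8)) ?divr_gt0 //.
      have -> : eps / 8 * ((k%:R + 1) * (8 / eps + 1)) = (k%:R + 1) * (1 + eps / 8).
        by field; rewrite lt0r_neq0.
      by clear; lra.
    have ta0 : 0 <= t / (t - k%:R - 1) by rewrite divr_ge0 // ltW.
    apply: (@le_trans _ _ (r / t * n%:R * (t / (t - k%:R - 1)) ^+ 2)).
      rewrite (_ : m%:R * _ * t = m%:R / t * (t / (t - k%:R - 1)) ^+ 2); last first.
        by field; rewrite !lt0r_neq0.
      apply: ler_wpM2r; first exact: sqr_ge0.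
      by rewrite [leRHS]mulrAC; apply: ler_wpM2r; rewrite ?invr_ge0 ?(ltW tp).
    have rt2 : r / t <= (1 - eps) * ln 2 by rewrite ler_pdivrMr // -mulrA (mulrC _ t).
    apply: (@le_trans _ _ ((1 - eps) * ln 2 * n%:R * (1 + eps / 8) ^+ 2)).
      apply: ler_pM; rewrite ?sqr_ge0 //.
      * by rewrite mulr_ge0 // divr_ge0 // ltW.
      * by rewrite ler_pM2r.
      * by rewrite lerXn2r // nnegrE; move: e0; clear; lra.
    have -> : (1 - eps) * ln 2 * n%:R * (1 + eps / 8) ^+ 2 = (1 - eps) * (1 + eps / 8) ^+ 2 * (ln 2 * n%:R) by ring.
    rewrite -[leRHS]mulrA; apply: ler_wpM2r; first by rewrite mulr_ge0 // ltW.
    by rewrite /e; move: e0 e4; clear; nra.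
  + have -> : (3 / 4) ^+ k = ((4 / 3) ^+ k)^-1 :> R by rewrite -exprVn; congr (_ ^+ _); field.
    rewrite expr0 mulr1 in kp0; move: kp0; clear; move: (_ ^+ k) => w w256.
    by rewrite ler_pdivrMr; lra.
  + by move: ke; rewrite ler_pdivrMr //; clear; lra.
  rewrite lerD //.
  apply: (@le_trans _ _ (expR (1 / (8 * k%:R) * n%:R) * expR (1 / (8 * k%:R) * n%:R) * expR (- (1 / (2 * k%:R) * n%:R)))); last first.
    rewrite -!expRD ler_expR le_eqVlt; apply/orP; left; apply/eqP.
    by field; rewrite lt0r_neq0.
  have -> : L * expR (2 * spin_loss n k (gb R) (Ab R k) m (e / 16) y) * 2 ^- n * q2 R k ^+ m =
    ((1 - t^-1) * q2 R k) ^+ m * expR (2 * spin_loss n k (gb R) (Ab R k) m (e / 16) y) * expR (- (1 / (2 * k%:R) * n%:R)).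
    by rewrite /L exprMn; field; rewrite expf_neq0.
  apply: ler_wpM2r; first exact: expR_ge0.
  apply: ler_pM; rewrite ?expR_ge0 //.
  + rewrite exprn_ge0 // mulr_ge0 ?(ltW p1) // /q2 -/t.
    by rewrite addr_ge0 // divr_ge0 // ltW.
  (* The reweighting costs about [k / t ^ 2] per clause. With at most [t * n] clauses and [t] at
     least [32 * k ^ 2] this stays below [n / (8 * k)]. *)
  + have -> : (1 - t^-1) * q2 R k = 1 + k%:R / (t * (t - k%:R - 1)).
      by rewrite /q2 -/t; field; rewrite !lt0r_neq0.
    apply: (@le_trans _ _ (expR (k%:R / (t * (t - k%:R - 1))) ^+ m)).
      apply: lerXn2r; rewrite ?nnegrE ?expR_ge0 ?expR_ge1Dx //.
      by rewrite addr_ge0 // divr_ge0 // mulr_ge0 // ltW.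
    rewrite -expRM_natl ler_expR.
    apply: (@le_trans _ _ ((t * n%:R) * (k%:R / (t * (t - k%:R - 1))))).
      apply: ler_wpM2r; first by rewrite divr_ge0 // mulr_ge0 // ltW.
      by apply: le_trans mr _; rewrite ler_pM2r.
    have -> : t * n%:R * (k%:R / (t * (t - k%:R - 1))) = k%:R / (t - k%:R - 1) * n%:R.
      by field; rewrite !lt0r_neq0.
    rewrite ler_pM2r // ler_pdivrMr // mul1r mulrC ler_pdivlMr ?mulr_gt0 //.
    by rewrite mulrCA -expr2; move: t32 kk k4; clear; lra.
  + rewrite ler_expR; apply: (@le_trans _ _ (2 * (d * n%:R))); first by rewrite ler_pM2l.
    have -> : 1 / (8 * k%:R) * n%:R = 2 * (1 / (16 * k%:R) * n%:R) :> R.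
      by field; rewrite lt0r_neq0.
    by rewrite ler_pM2l // ler_pM2r.
rewrite cnf_subs; apply: le_trans (TR _ _) _ => //; rewrite -/C0.
pose u1 := Num.truncn (del / k%:R * n%:R).
have u0 : 0 <= del / k%:R * n%:R by rewrite mulr_ge0 // divr_ge0 // ltW.
have u1l : u1%:R <= del / k%:R * n%:R by rewrite truncn_le.
have u1g : del / k%:R * n%:R - 1 <= u1%:R by exact: truncn_ge_sub1.
have dkd : del / k%:R <= del by rewrite ler_pdivrMr // ler_peMr ?(ltW del0) //; move: k2; clear; lra.
(* Half of the excess [eps * ln k] is given to the lower-order corrections. The tilt [s0] takes a
   quarter, enough for windows of size [del * n / k] to pay about [2 * n / k]. *)
pose nu := (1 + eps / 2) * ln k%:R.
apply: (@le_trans _ _ (C0 * (2 ^+ n * (1 - t^-1) ^+ m * expR (n%:R * expR (s0 - nu) - s0 * u1%:R)))).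
  rewrite ler_pM2l //; apply: bad_expectation => //.
  - by rewrite divr_ge0 // ltW.
  - apply: le_trans u1l _; rewrite ler_pM2r //; apply: le_trans dkd _; rewrite /del; move: e0; clear; lra.
  move=> a a1 a2; have a0 : 0 <= a by apply: le_trans a1.
  have an : a <= 2 * (del / k%:R) * n%:R by move: u1l a2; clear; lra.
  have x1 : 2 * (del / k%:R) <= 1 by move: dkd e4; rewrite /del; clear; lra.
  have x0 : 0 <= 2 * (del / k%:R) by rewrite mulr_ge0 // divr_ge0 // ltW.
  have B1 : 1 - 2 * del <= ((n%:R - a) / n%:R) ^+ k.-1.
    apply: (@le_trans _ _ ((1 - 2 * (del / k%:R)) ^+ k.-1)).
      apply: le_trans (bernoulli _ x0 x1).
      have : k.-1%:R * (2 * (del / k%:R)) <= 2 * del.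
        have -> : 2 * del = k%:R * (2 * (del / k%:R)) by field; rewrite lt0r_neq0.
        by apply: ler_wpM2r => //; rewrite ler_nat leq_pred.
      by clear; lra.
    apply: lerXn2r; rewrite ?nnegrE ?subr_ge0 //.
      by rewrite divr_ge0 ?(ltW np) // subr_ge0; apply: le_trans an _; rewrite ler_piMl // ltW.
    by rewrite ler_pdivlMr // mulrBl mul1r; move: an; clear; lra.
  have -> : pcrit n k a = a * (k%:R / t / n%:R * ((n%:R - a) / n%:R) ^+ k.-1).
    have tE : t = 2 * 2 ^+ k.-1 by rewrite /t -exprS prednK.
    rewrite /pcrit tE !expr_div_n exprMn.
    by field; rewrite !expf_neq0 ?lt0r_neq0.
  rewrite mulrCA [leLHS]mulrC; apply: ler_wpM2l => //.
  apply: (@le_trans _ _ ((r * n%:R - 1) * (k%:R / t / n%:R * (1 - 2 * del)))); last first.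
    apply: ler_pM => //.
    - have r1' : 1 <= r.
        apply: le_trans r1; rewrite mulrA; apply: mulr_ege1 => //; apply: mulr_ege1; first by move: e0; clear; lra.
        by rewrite ler_pdivlMr // mul1r; move: t32 kk; rewrite /t; move: k4; clear; lra.
      by rewrite subr_ge0; apply: le_trans n1 _; rewrite ler_peMl // ltW.
    - by rewrite mulr_ge0 ?divr_ge0 // ?(ltW tp) ?(ltW np) //; rewrite /del; move: e4; clear; lra.
    - by apply: ler_wpM2l => //; rewrite !divr_ge0 // ltW.
  have -> : (r * n%:R - 1) * (k%:R / t / n%:R * (1 - 2 * del)) =
    (r * k%:R / t - k%:R / t / n%:R) * (1 - 2 * del) by field; rewrite !lt0r_neq0.
  have kt1 : k%:R / t / n%:R <= eps / 4.
    rewrite ler_pdivrMr //; apply: (@le_trans _ _ 1).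
      by rewrite ler_pdivrMr // mul1r; move: t32 kk k4; clear; lra.
    by move: ne; rewrite ler_pdivrMr //; clear; lra.
  have kt2 : eps / 4 <= eps / 4 * ln k%:R by rewrite ler_peMr // divr_ge0 // ltW.
  apply: (@le_trans _ _ (((1 + eps) * ln k%:R - eps / 4 * ln k%:R) * (1 - 2 * del))); last first.
    by apply: ler_wpM2r; [rewrite /del; move: e4; clear; lra|move: rk kt1 kt2; clear; lra].
  rewrite /nu -mulrBl mulrAC; apply: ler_wpM2r; [move: L1; clear; lra|rewrite /del; move: e0 e4; clear; nra].
have -> : C0 * (2 ^+ n * (1 - t^-1) ^+ m * expR (n%:R * expR (s0 - nu) - s0 * u1%:R)) =
  (C0 * expR (n%:R * expR (s0 - nu) - s0 * u1%:R) * expR (1 / (2 * k%:R) * n%:R)) * L.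
  by rewrite /L expRN; field; rewrite lt0r_neq0 ?expR_gt0.
rewrite ler_pM2r //; apply: le_trans nC2.
rewrite -[leLHS]mulrA -[leRHS]mulrA ler_pM2l // -!expRD ler_expR.
have E1 : expR (s0 - nu) <= 1 / k%:R.
  apply: (@le_trans _ _ (expR (- ln k%:R))).
    have : 0 <= eps * ln k%:R by rewrite mulr_ge0 ?(ltW e0) //; apply: le_trans L1.
    by rewrite ler_expR /s0 /nu; clear; lra.
  by rewrite expRN lnK ?posrE // mul1r.
have E2 : n%:R * expR (s0 - nu) <= n%:R / k%:R.
  by rewrite ler_pM2l //; move: E1; rewrite mul1r.
have E3 : s0 * (del / k%:R * n%:R - 1) <= s0 * u1%:R by apply: ler_wpM2l.
have E4 : 2 * (n%:R / k%:R) <= del * (eps / 4) * ln k%:R * (n%:R / k%:R).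
  by apply: ler_wpM2r; rewrite ?divr_ge0.
have E5 : s0 * (del / k%:R * n%:R - 1) = del * (eps / 4) * ln k%:R * (n%:R / k%:R) - s0 by rewrite /s0; ring.
have E6 : 1 / (2 * k%:R) * n%:R = n%:R / k%:R / 2 :> R by field; rewrite lt0r_neq0.
by rewrite E6; move: E2 E3 E4 E5; clear; lra.
Qed.

(** * Counting proper colourings of a random graph *)

Section Bernoulli.
Variables (R : realType) (n : nat) (p : R).
Hypothesis p0 : 0 < p.
Hypothesis p2 : p <= 1 / 8.
Local Notation X := {ffun 'I_n -> bool}.

Definition odds : R := p / (1 - p).
Definition bern (t : nat) (x : X) : R := \prod_v (if x v then p else 1 - p).
(** The centred edge indicator scaled to be 1 on an edge. Its variance is [odds], and the products
    [zA] form an orthogonal system. *)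
Definition zz (b : bool) : R := if b then 1 else - odds.
Definition zA (A : {set 'I_n}) (x : X) : R := \prod_(v in A) zz (x v).
Definition nbr (x : X) : {set 'I_n} := [set v | x v]%SET.

Lemma odds_gt0 : 0 < odds. Proof. by rewrite divr_gt0 //; move: p2; lra. Qed.

Lemma oddsE : p = (1 - p) * odds.
Proof. by rewrite /odds mulrC divfK // lt0r_neq0 //; move: p2; lra. Qed.

Lemma odds_le : odds <= 1 / 7.
Proof. by rewrite /odds ler_pdivrMr; move: p2; lra. Qed.

Lemma bern_ge0 t x : 0 <= bern t x.
Proof. by apply: prodr_ge0 => v _; case: ifP => _; move: p0 p2; lra. Qed.

Lemma bern_prod t (F : 'I_n -> bool -> R) :
  \sum_x bern t x * \prod_v F v (x v) = \prod_v (p * F v true + (1 - p) * F v false).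
Proof.
rewrite (eq_bigr (fun x : X => \prod_v ((if x v then p else 1 - p) * F v (x v)))); last first.
  by move=> x _; rewrite big_split.
rewrite -(bigA_distr_bigA (fun v b => (if b then p else 1 - p) * F v b)).
by apply: eq_bigr => v _; rewrite big_bool.
Qed.

Lemma bern_sum1 t : \sum_x bern t x = 1.
Proof.
transitivity (\sum_x bern t x * \prod_(v : 'I_n) (fun _ _ => 1 : R) v (x v)).
  by apply: eq_bigr => x _; rewrite big1 ?mulr1.
by rewrite (bern_prod t (fun _ _ => 1)) big1 // => v _; ring.
Qed.

Lemma bern_zA t A B :
  \sum_x bern t x * (zA A x * zA B x) = (A == B)%:R * odds ^+ #|A|.
Proof.
pose F v b := (if v \in A then zz b else 1) * (if v \in B then zz b else 1).
transitivity (\sum_x bern t x * \prod_v F v (x v)).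
  apply: eq_bigr => x _; congr (_ * _); rewrite /zA !(big_mkcond (fun v => v \in _)) -big_split.
  by apply: eq_bigr => v _.
have E := oddsE; rewrite bern_prod; have [AB|AB] := eqVneq A B.
  rewrite mul1r -prodr_const [RHS]big_mkcond; apply: eq_bigr => v _; rewrite /F /zz -AB.
  case: (v \in A); last by ring.
  transitivity (p + (1 - p) * odds * odds); first by ring.
  by rewrite -E; transitivity ((1 - p) * odds + p * odds); [rewrite -E|ring].
have [v vAB] : exists v, (v \in A) != (v \in B).
  apply/existsP; rewrite -[[exists _, _]]negbK negb_exists; apply: contra AB => /forallP h.
  by apply/eqP/setP => v; have := h v; rewrite negbK => /eqP.
rewrite mul0r (bigD1 v) //= /F /zz.
have Z : p * 1 + (1 - p) * - odds = 0 by rewrite mulrN -E; ring.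
rewrite [X in X * _](_ : _ = 0) ?mul0r //.
by case: (v \in A) (v \in B) vAB => [] [] //= _; rewrite ?(mulr1, mul1r); move: Z; rewrite mulr1.
Qed.

Lemma bern_parseval t (F : pred {set 'I_n}) (g : {set 'I_n} -> R) :
  \sum_x bern t x * (\sum_(A | F A) g A * zA A x) ^+ 2 = \sum_(A | F A) odds ^+ #|A| * g A ^+ 2.
Proof.
under eq_bigr do rewrite expr2 mulr_suml mulr_sumr.
rewrite exchange_big /=; apply: eq_bigr => A FA.
transitivity (\sum_(B | F B) g A * g B * \sum_x bern t x * (zA A x * zA B x)).
  under eq_bigr do rewrite mulr_sumr mulr_sumr.
  rewrite exchange_big /=; apply: eq_bigr => B FB; rewrite mulr_sumr.
  by apply: eq_bigr => x _; ring.
rewrite (bigD1 A) //= bern_zA eqxx mul1r big1 ?addr0 => [|B /andP[_ BA]]; first by ring.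
by rewrite bern_zA eq_sym (negbTE BA) mul0r mulr0.
Qed.

Lemma bern_sub t (S : {set 'I_n}) : \sum_x bern t x * (S \subset nbr x)%:R = p ^+ #|S|.
Proof.
transitivity (\sum_x bern t x * \prod_v (fun v b => if v \in S then (b : bool)%:R else 1 : R) v (x v)).
  apply: eq_bigr => x _; congr (_ * _); case: fintype.subsetP => h.
    by rewrite big1 // => v _; case: ifP => // /h; rewrite inE => ->.
  move/fintype.subsetP: h => /subsetPn[v vS]; rewrite inE => xv.
  by rewrite (bigD1 v) //= vS (negbTE xv) mul0r.
rewrite (bern_prod t (fun v b => if v \in S then (b : bool)%:R else 1)) -prodr_const [RHS]big_mkcond.
by apply: eq_bigr => v _; case: ifP => _; rewrite /=; ring.
Qed.

Lemma bern_large t (nu : nat) :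
  \sum_x bern t x * (nu < #|nbr x|)%N%:R <= expR (p * n%:R) / 2 ^+ nu.
Proof.
rewrite ler_pdivlMr ?exprn_gt0 // mulr_suml.
apply: (@le_trans _ _ (\sum_x bern t x * \prod_v (fun (v : 'I_n) b => if b then 2 else 1 : R) v (x v))).
  apply: ler_sum => x _; rewrite -[leLHS]mulrA; apply: ler_wpM2l; first exact: bern_ge0.
  have -> : \prod_v (if x v then 2 else 1 : R) = 2 ^+ #|nbr x|.
    by rewrite -prodr_const [RHS]big_mkcond; apply: eq_bigr => v _; rewrite inE.
  case: ltnP => [h|_]; rewrite ?mul1r ?mul0r ?exprn_ge0 //.
  by rewrite ler_eXn2l ?ltr1n // ltnW.
rewrite (bern_prod t (fun v b => if b then 2 else 1)) (eq_bigr (fun=> 1 + p)) => [|v _]; last by ring.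
rewrite prodr_const card_ord mulrC expRM_natl; apply: lerXn2r; rewrite ?nnegrE ?expR_ge0 ?expR_ge1Dx //.
by move: p0; lra.
Qed.

Lemma sum_pairs (F : {set 'I_n} -> R) :
  \sum_(A : {set 'I_n} | #|A| == 2%N) F A = (\sum_u \sum_(v | v != u) F [set u; v]%SET) / 2.
Proof.
apply: (@mulIf _ 2); first by rewrite pnatr_eq0.
rewrite divfK ?pnatr_eq0 // pair_big_dep /=.
rewrite (partition_big (fun q : 'I_n * 'I_n => [set q.1; q.2]%SET) (fun A => #|A| == 2%N)) /=; last first.
  by move=> [u v] /= uv; rewrite cards2 (eq_sym u) uv.
rewrite mulr_suml; apply: eq_bigr => A /cards2P[u [v [uv ->]]].
rewrite (bigD1 (u, v)) /=; last by rewrite eqxx andbT eq_sym.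
rewrite (bigD1 (v, u)) /=; last first.
  by rewrite setUC eqxx andbT uv /= xpair_eqE negb_and uv orbT.
rewrite big1 ?addr0 => [|[a b] /= /andP[/andP[/andP[ab /eqP E] h1] h2]]; first by rewrite (setUC [set v]%SET); ring.
have : a \in [set u; v]%SET by rewrite -E !inE eqxx.
have : b \in [set u; v]%SET by rewrite -E !inE eqxx orbT.
rewrite !inE => /orP[] /eqP bE /orP[] /eqP aE; move: ab h1 h2; by rewrite aE bE ?eqxx.
Qed.

(** * When a new vertex can halve the mass *)

Section Kill.
Variables (g : {set 'I_n} -> R) (nu : nat) (sg mb Qb Db Tb Ms Mt : R).
Hypothesis g0 : g set0 = 1.
Hypothesis g1 : forall v, g [set v]%SET = 0.
Hypothesis g_lo : forall u v, v != u -> - mb <= g [set u; v]%SET.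
Hypothesis g_sq : \sum_u \sum_(v | v != u) g [set u; v]%SET ^+ 2 <= Qb.
Hypothesis g_row : forall u, \sum_(v | v != u) g [set u; v]%SET ^+ 2 <= Db.
Hypothesis g_tail : \sum_(A : {set 'I_n} | (2 < #|A|)%N) odds ^+ #|A| * g A ^+ 2 <= Tb.
Hypothesis n0 : (0 < n)%N.
Hypothesis sg0 : 0 < sg.
Hypothesis mb0 : 0 <= mb.
Hypothesis Ms0 : 0 <= Ms.
Hypothesis Mt0 : 0 <= Mt.
Hypothesis MsE : n%:R * Db <= Ms ^+ 2.
Hypothesis MtE : n%:R ^+ 2 * Qb <= Mt ^+ 2.
Hypothesis small : 2 * mb + nu%:R ^+ 2 * sg + 2 * odds * nu%:R * Ms + odds ^+ 2 * Mt <= 1 / 4.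

(** Pairs with a noticeably negative coefficient. A single one among the neighbours is tolerable
    since its coefficient is at least [- mb], two are rare, and all other pairs together remove at
    most [nu ^ 2 * sg]. *)
Definition sig (u v : 'I_n) : bool := (v != u) && (g [set u; v]%SET < - sg).
Definition Su (u : 'I_n) : R := \sum_(v | v != u) g [set u; v]%SET.
Definition Qx (x : X) : R := \sum_(A : {set 'I_n} | #|A| == 2%N) g A * zA A x.
Definition Tx (x : X) : R := \sum_(A : {set 'I_n} | (2 < #|A|)%N) g A * zA A x.

Lemma cs_sum (I : finType) (P : pred I) (f : I -> R) :
  (\sum_(i | P i) f i) ^+ 2 <= #|I|%:R * \sum_(i | P i) f i ^+ 2.
Proof.
have := cauchy_schwarz (fun i => if P i then f i else 0) (fun=> 1).
rewrite (eq_bigr (fun i => if P i then f i else 0)) => [|i _]; last by rewrite mulr1.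
rewrite -big_mkcond /= => h; apply: le_trans h _.
rewrite mulrC (eq_bigr (fun=> 1)) => [|i _]; last by rewrite expr1n.
rewrite sumr_const -[X in X * _]mulr_natl mulr1; apply: ler_wpM2l => //.
rewrite [leRHS]big_mkcond; apply: ler_sum => i _; case: ifP => // _.
by rewrite expr0n.
Qed.

Lemma Su_le u : `|Su u| <= Ms.
Proof.
rewrite -(@ler_pXn2r _ 2) ?nnegrE // real_normK ?num_real //; apply: le_trans MsE.
apply: le_trans (cs_sum _ _) _; rewrite card_ord; apply: ler_wpM2l => //; exact: g_row.
Qed.

Lemma Ssum_le : `|\sum_u Su u| <= Mt.
Proof.
rewrite -(@ler_pXn2r _ 2) ?nnegrE // real_normK ?num_real //; apply: le_trans MtE.
apply: le_trans (cs_sum xpredT _) _; rewrite card_ord expr2 -mulrA; apply: ler_wpM2l => //.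
apply: (@le_trans _ _ (\sum_u n%:R * \sum_(v | v != u) g [set u; v]%SET ^+ 2)).
  apply: ler_sum => u _; apply: le_trans (cs_sum _ _) _; by rewrite card_ord.
by rewrite -mulr_sumr; apply: ler_wpM2l.
Qed.

Lemma fxE (x : X) : \sum_A g A * zA A x = 1 + Qx x + Tx x.
Proof.
rewrite (bigD1 set0) //= g0 /zA big_set0 mulr1 -addrA; congr (_ + _).
rewrite (bigID (fun A : {set 'I_n} => #|A| == 1%N)) /= big1 ?add0r; last first.
  by move=> A /andP[_ /cards1P[v ->]]; rewrite g1 mul0r.
rewrite (bigID (fun A : {set 'I_n} => #|A| == 2%N)) /=; congr (_ + _); apply: eq_bigl => A.
  by rewrite -cards_eq0; case: #|A| => [|[|[|j]]].
by rewrite -cards_eq0; case: #|A| => [|[|[|j]]].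
Qed.

(** By [zz = (1 + odds) * b - odds] the quadratic part becomes a sum over pairs of neighbours with
    small linear and constant corrections, controlled by [Su_le] and [Ssum_le]. *)
Lemma QxE (x : X) : Qx x = (1 + odds) ^+ 2 * (\sum_(u in nbr x) \sum_(v in nbr x | v != u) g [set u; v]%SET) / 2
  - odds * (1 + odds) * \sum_(u in nbr x) Su u + odds ^+ 2 * (\sum_u Su u) / 2.
Proof.
pose b (v : 'I_n) : R := (x v)%:R.
have zE v : zz (x v) = (1 + odds) * b v - odds by rewrite /zz /b; case: (x v) => /=; ring.
have E1 : \sum_(u in nbr x) \sum_(v in nbr x | v != u) g [set u; v]%SET =
   \sum_u \sum_(v | v != u) g [set u; v]%SET * b u * b v.
  rewrite big_mkcond; apply: eq_bigr => u _; rewrite inE /b; case: (x u); last first.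
    by rewrite big1 // => v _; rewrite mulr0 mul0r.
  rewrite [RHS]big_mkcond [LHS]big_mkcond; apply: eq_bigr => v _; rewrite inE mulr1.
  by case: (x v); rewrite /= ?mulr1 ?mulr0; case: ifP.
have E2 : \sum_(u in nbr x) Su u = \sum_u \sum_(v | v != u) g [set u; v]%SET * b u.
  rewrite big_mkcond; apply: eq_bigr => u _; rewrite inE /b /Su -mulr_suml.
  by case: (x u); rewrite ?mulr1 ?mulr0.
have E3 : \sum_(u in nbr x) Su u = \sum_u \sum_(v | v != u) g [set u; v]%SET * b v.
  rewrite E2 (exchange_big_dep xpredT) //=; apply: eq_bigr => u _.
  by apply: eq_big => v; rewrite 1?eq_sym // => _; rewrite setUC.
have -> : odds * (1 + odds) * (\sum_(u in nbr x) Su u) =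
   odds * (1 + odds) * (\sum_u \sum_(v | v != u) g [set u; v]%SET * b u) / 2 +
   odds * (1 + odds) * (\sum_u \sum_(v | v != u) g [set u; v]%SET * b v) / 2.
  by rewrite -E2 -E3; field.
rewrite E1 /Qx sum_pairs.
transitivity (((1 + odds) ^+ 2 * (\sum_u \sum_(v | v != u) g [set u; v]%SET * b u * b v)
  - odds * (1 + odds) * (\sum_u \sum_(v | v != u) g [set u; v]%SET * b u)
  - odds * (1 + odds) * (\sum_u \sum_(v | v != u) g [set u; v]%SET * b v) + odds ^+ 2 * (\sum_u Su u)) / 2); last first.
  by field.
congr (_ / 2); rewrite !mulr_sumr -!sumrB -big_split; apply: eq_bigr => u _ /=.
rewrite /Su !mulr_sumr -!sumrB -big_split; apply: eq_bigr => v vu /=.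
rewrite /zA big_setU1 /= ?inE 1?eq_sym // big_set1 !zE; ring.
Qed.

Definition twice (x : X) : R := \sum_(q : ('I_n * 'I_n) * ('I_n * 'I_n)
   | [&& sig q.1.1 q.1.2, sig q.2.1 q.2.2 & [set q.1.1; q.1.2] != [set q.2.1; q.2.2]]%SET)
  ([set q.1.1; q.1.2; q.2.1; q.2.2]%SET \subset nbr x)%:R.

Lemma Qx_lower x : (#|nbr x| <= nu)%N -> twice x < 1 -> - (1 / 4) <= Qx x.
Proof.
move=> xn tw; have o0 := odds_gt0; have o7 := odds_le.
have xn' : #|nbr x|%:R <= nu%:R :> R by rewrite ler_nat.
pose W := \sum_(u in nbr x) \sum_(v in nbr x | v != u) g [set u; v]%SET.
have HW : - (2 * mb + nu%:R ^+ 2 * sg) <= W.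
  have sgm u v : v != u -> ~~ sig u v -> - sg <= g [set u; v]%SET.
    by move=> vu; rewrite /sig vu /= -leNgt.
  have cnt (F : 'I_n -> 'I_n -> R) c : (forall u v, u \in nbr x -> v \in nbr x -> v != u -> - c <= F u v) ->
     0 <= c -> - (nu%:R ^+ 2 * c) <= \sum_(u in nbr x) \sum_(v in nbr x | v != u) F u v.
    move=> hF c0; apply: (@le_trans _ _ (\sum_(u in nbr x) \sum_(v in nbr x) - c)); last first.
      apply: ler_sum => u ux; rewrite [leRHS]big_mkcondr; apply: ler_sum => v vx.
      by case: ifP => h; [exact: hF|rewrite oppr_le0].
    rewrite !sumr_const -mulrnA -[leRHS]mulr_natl mulrN lerN2; apply: ler_wpM2r => //.
    by rewrite natrM expr2; apply: ler_pM.
  case: (boolP [exists q : 'I_n * 'I_n, [&& q.1 \in nbr x, q.2 \in nbr x & sig q.1 q.2]]); last first.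
    move=> /existsPn h; have : - (nu%:R ^+ 2 * sg) <= W.
      apply: cnt; last exact: ltW.
      by move=> u v ux vx vu; apply: sgm => //; have := h (u, v); rewrite /= ux vx.
    by move: mb0; lra.
  move=> /existsP[[a b] /= /and3P[ax bx sab]].
  (* The one significant pair is lifted by [mb]; any other would make [twice] at least 1. Over
     ordered pairs the lift is counted twice, hence [2 * mb]. *)
  pose F u v := g [set u; v]%SET + mb * ([set u; v]%SET == [set a; b]%SET)%:R.
  have HF : - (nu%:R ^+ 2 * sg) <= \sum_(u in nbr x) \sum_(v in nbr x | v != u) F u v.
    apply: cnt; last exact: ltW.
    move=> u v ux vx vu; rewrite /F; case: eqP => [_|/eqP ne].
      by rewrite mulr1; have := g_lo vu; move: sg0; lra.
    rewrite mulr0 addr0; apply: sgm => //; apply/negP => suv.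
    move: tw; rewrite ltNge /twice (bigD1 ((a, b), (u, v))) /=; last first.
      by rewrite sab suv eq_sym.
    rewrite (_ : _ \subset _) ?lerDl ?sumr_ge0 //.
    by apply/fintype.subsetP => w; rewrite !inE -!orbA => /or4P[] /eqP ->; move: ax bx ux vx; rewrite !inE.
  have ba : b != a by case/andP: sab.
  have E : \sum_(u in nbr x) \sum_(v in nbr x | v != u) F u v <= W + 2 * mb.
    rewrite /W /F; under eq_bigr do rewrite big_split /=.
    rewrite big_split /= lerD2l.
    apply: (@le_trans _ _ (\sum_u \sum_(v | v != u) mb * ([set u; v]%SET == [set a; b]%SET)%:R)).
      rewrite big_mkcond; apply: ler_sum => u _; case: ifP => _; last by rewrite sumr_ge0 // => v _; rewrite mulr_ge0.
      rewrite [leLHS]big_mkcond [leRHS]big_mkcond; apply: ler_sum => v _.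
      case: (v \in nbr x) => //=; case: ifP => // _; by rewrite mulr_ge0.
    have := sum_pairs (fun A => mb * (A == [set a; b]%SET)%:R).
    rewrite (bigD1 [set a; b]%SET) /=; last by rewrite cards2 (eq_sym a) ba.
    rewrite eqxx mulr1 big1 ?addr0 => [|A /andP[_ /negbTE ->]]; last by rewrite mulr0.
    by move: (\sum_(u < n) _) => q qE; rewrite qE; apply: eq_ler; field.
  by move: HF E; lra.
have HS : \sum_(u in nbr x) Su u <= nu%:R * Ms.
  apply: (@le_trans _ _ (\sum_(u in nbr x) Ms)).
    by apply: ler_sum => u _; apply: le_trans (ler_norm _) (Su_le u).
  by rewrite sumr_const -[leLHS]mulr_natl; apply: ler_wpM2r.
have HT : - Mt <= \sum_u Su u by have := Ssum_le; rewrite ler_norml => /andP[].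
rewrite QxE -/W.
have c1 : (1 + odds) ^+ 2 <= 2 by move: o0 o7; nra.
have c10 : 0 <= (1 + odds) ^+ 2 by exact: sqr_ge0.
have e1 : - (2 * (2 * mb + nu%:R ^+ 2 * sg)) <= (1 + odds) ^+ 2 * W.
  have b0 : 0 <= 2 * mb + nu%:R ^+ 2 * sg by rewrite addr_ge0 ?mulr_ge0 ?exprn_ge0 // ltW.
  apply: (@le_trans _ _ ((1 + odds) ^+ 2 * - (2 * mb + nu%:R ^+ 2 * sg))); last by apply: ler_wpM2l.
  by rewrite mulrN lerN2; apply: ler_wpM2r.
have e2 : odds * (1 + odds) * (\sum_(u in nbr x) Su u) <= 2 * odds * nu%:R * Ms.
  apply: (@le_trans _ _ (odds * (1 + odds) * (nu%:R * Ms))).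
    by apply: ler_wpM2l => //; apply: mulr_ge0; lra.
  rewrite -[leRHS]mulrA; apply: ler_wpM2r; first exact: mulr_ge0.
  by move: o0 o7; nra.
have e3 : - (odds ^+ 2 * Mt) <= odds ^+ 2 * (\sum_u Su u).
  by rewrite -mulrN; apply: ler_wpM2l => //; exact: sqr_ge0.
have e4 : 0 <= odds ^+ 2 * Mt by rewrite mulr_ge0 ?sqr_ge0.
by move: small e1 e2 e3 e4; lra.
Qed.

Lemma sig_count : \sum_u \sum_v (sig u v)%:R <= Qb / sg ^+ 2.
Proof.
rewrite ler_pdivlMr ?exprn_gt0 // mulr_suml; apply: le_trans g_sq.
apply: ler_sum => u _; rewrite mulr_suml [leRHS]big_mkcond; apply: ler_sum => v _.
rewrite /sig; case: ifP => _ /=; last by rewrite mul0r.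
case: ltP => h; rewrite ?mul1r ?mul0r ?sqr_ge0 //.
by rewrite -[leRHS]sqrrN lerXn2r ?nnegrE; move: sg0 h; lra.
Qed.

Lemma sig_row u : \sum_v (sig u v)%:R <= Db / sg ^+ 2.
Proof.
rewrite ler_pdivlMr ?exprn_gt0 // mulr_suml; apply: le_trans (g_row u).
rewrite [leRHS]big_mkcond; apply: ler_sum => v _.
rewrite /sig; case: ifP => _ /=; last by rewrite mul0r.
case: ltP => h; rewrite ?mul1r ?mul0r ?sqr_ge0 //.
by rewrite -[leRHS]sqrrN lerXn2r ?nnegrE; move: sg0 h; lra.
Qed.

Lemma sigC u v : sig u v = sig v u.
Proof. by rewrite /sig eq_sym setUC. Qed.

(** Two distinct pairs either cover four vertices, with probability [p ^ 4], or share one, with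
    probability [p ^ 3]. The four ways of sharing are each bounded by a row sum. *)
Lemma twice_mean t : \sum_x bern t x * twice x <=
  p ^+ 4 * (Qb / sg ^+ 2) ^+ 2 + 4 * p ^+ 3 * (Qb / sg ^+ 2) * (Db / sg ^+ 2).
Proof.
pose S := Qb / sg ^+ 2; pose D := Db / sg ^+ 2.
have S0 : 0 <= S by apply: le_trans sig_count; apply: sumr_ge0 => u _; apply: sumr_ge0.
under eq_bigr do rewrite mulr_sumr.
rewrite exchange_big /=.
under eq_bigr do rewrite bern_sub.
pose s u v : R := (sig u v)%:R.
have H (a b u v : 'I_n) : sig a b -> sig u v -> [set a; b]%SET != [set u; v]%SET ->
  p ^+ #|[set a; b; u; v]%SET| <= p ^+ 4 + p ^+ 3 * ((u == a)%:R + (u == b)%:R + (v == a)%:R + (v == b)%:R).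
  move=> /andP[ba _] /andP[vu _] ne.
  have p1 : p <= 1 by move: p2; lra.
  have pp j : 0 <= p ^+ j by rewrite exprn_ge0 // ltW.
  have p3 := pp 3; have p4 := pp 4.
  case: (boolP ((u == a) || (u == b) || (v == a) || (v == b))) => h; last first.
    move: h; rewrite !negb_or => /andP[/andP[/andP[ua ub] va] vb].
    rewrite (negbTE ua) (negbTE ub) (negbTE va) (negbTE vb) /= !addr0 mulr0 addr0.
    have -> // : #|[set a; b; u; v]%SET| = 4%N.
    rewrite -!setUA !cardsU1 cards1 !inE (eq_sym a b) (eq_sym a u) (eq_sym a v) (eq_sym b u) (eq_sym b v) (eq_sym u v).
    by rewrite (negbTE va) (negbTE vb) (negbTE vu) (negbTE ua) (negbTE ub) (negbTE ba).
  have c3 : (3 <= #|[set a; b; u; v]%SET|)%N.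
    have sA : [set a; b]%SET \subset [set a; b; u; v]%SET by rewrite -setUA subsetUl.
    have sB : [set u; v]%SET \subset [set a; b; u; v]%SET.
      by apply/fintype.subsetP => w; rewrite !inE => /orP[] ->; rewrite ?orbT.
    have : [set a; b]%SET \proper [set a; b; u; v]%SET.
      rewrite properEneq sA andbT; apply: contra ne => /eqP E; rewrite eq_sym eqEcard E sB /=.
      by rewrite -E !cards2 eq_sym ba eq_sym vu.
    by move=> /proper_card; rewrite cards2 eq_sym ba.
  apply: (@le_trans _ _ (p ^+ 3)); first by apply: ler_wiXn2l => //; exact: ltW.
  have : 1 <= (u == a)%:R + (u == b)%:R + (v == a)%:R + (v == b)%:R :> R.
    by rewrite -!natrD ler1n; case: (u == a) (u == b) (v == a) (v == b) h => [] [] [] [].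
  move: (_ + _ + _ + _) => q q1; have : p ^+ 3 * 1 <= p ^+ 3 * q by apply: ler_wpM2l.
  by move: p4; lra.
apply: (@le_trans _ _ (\sum_(q : ('I_n * 'I_n) * ('I_n * 'I_n)) s q.1.1 q.1.2 * s q.2.1 q.2.2 *
   (p ^+ 4 + p ^+ 3 * ((q.2.1 == q.1.1)%:R + (q.2.1 == q.1.2)%:R + (q.2.2 == q.1.1)%:R + (q.2.2 == q.1.2)%:R)))).
  rewrite [leLHS]big_mkcond; apply: ler_sum => -[[a b] [u v]] _ /=.
  have r0 : 0 <= p ^+ 4 + p ^+ 3 * ((u == a)%:R + (u == b)%:R + (v == a)%:R + (v == b)%:R).
    by rewrite addr_ge0 ?mulr_ge0 ?exprn_ge0 ?addr_ge0 // ltW.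
  case: ifP => [/and3P[h1 h2 h3]|_]; last by rewrite mulr_ge0 // mulr_ge0.
  by rewrite /s h1 h2 !mul1r; exact: H.
rewrite -(pair_bigA _ (fun q1 q2 => s q1.1 q1.2 * s q2.1 q2.2 *
   (p ^+ 4 + p ^+ 3 * ((q2.1 == q1.1)%:R + (q2.1 == q1.2)%:R + (q2.2 == q1.1)%:R + (q2.2 == q1.2)%:R)))) /=.
have inner (a b : 'I_n) : \sum_(q : 'I_n * 'I_n) s a b * s q.1 q.2 *
   (p ^+ 4 + p ^+ 3 * ((q.1 == a)%:R + (q.1 == b)%:R + (q.2 == a)%:R + (q.2 == b)%:R)) <=
   s a b * (p ^+ 4 * S + p ^+ 3 * (4 * D)).
  under eq_bigr do rewrite -mulrA.
  rewrite -mulr_sumr; apply: ler_wpM2l => //.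
  rewrite -(pair_bigA _ (fun u v => s u v * (p ^+ 4 + p ^+ 3 * ((u == a)%:R + (u == b)%:R + (v == a)%:R + (v == b)%:R)))) /=.
  have row c : \sum_u \sum_v s u v * (u == c)%:R <= D.
    rewrite (bigD1 c) //= [X in _ + X]big1 ?addr0 => [|u /negbTE uc]; last by rewrite big1 // => v _; rewrite uc mulr0.
    by under eq_bigr do rewrite eqxx mulr1; exact: sig_row.
  have col c : \sum_u \sum_v s u v * (v == c)%:R <= D.
    rewrite exchange_big /=; apply: le_trans (row c); apply: ler_sum => u _; apply: ler_sum => v _.
    by rewrite /s sigC.
  rewrite (eq_bigr (fun u => p ^+ 4 * (\sum_v s u v) + p ^+ 3 * ((\sum_v s u v * (u == a)%:R) +
     (\sum_v s u v * (u == b)%:R) + (\sum_v s u v * (v == a)%:R) + (\sum_v s u v * (v == b)%:R)))); last first.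
    move=> u _; rewrite -!big_split /= !mulr_sumr -big_split /=; apply: eq_bigr => v _; ring.
  rewrite big_split /= -!mulr_sumr !big_split /=; apply: lerD; apply: ler_wpM2l; rewrite ?exprn_ge0 ?(ltW p0) //.
    exact: sig_count.
  by have := row a; have := row b; have := col a; have := col b; lra.
apply: (@le_trans _ _ (\sum_(q : 'I_n * 'I_n) s q.1 q.2 * (p ^+ 4 * S + p ^+ 3 * (4 * D)))).
  by apply: ler_sum => -[a b] _; exact: inner.
rewrite -mulr_suml -(pair_bigA _ (fun u v => s u v)) /=.
have D0 : 0 <= D by apply: le_trans (sig_row (Ordinal n0)); apply: sumr_ge0.
apply: (@le_trans _ _ (S * (p ^+ 4 * S + p ^+ 3 * (4 * D)))); last by rewrite -/S -/D; apply: eq_ler; ring.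
apply: ler_wpM2r; last exact: sig_count.
by apply: addr_ge0; apply: mulr_ge0; rewrite ?exprn_ge0 ?(ltW p0) // mulr_ge0.
Qed.

(** A value below 1/2 needs a tail below -1/4, two significant pairs, or more than [nu] neighbours.
    The tail is bounded by Chebyshev's inequality, whence the factor 16. *)
Lemma kill_bound t :
  \sum_x bern t x * (\sum_A g A * zA A x < 1 / 2)%R%:R <=
  16 * Tb + (p ^+ 4 * (Qb / sg ^+ 2) ^+ 2 + 4 * p ^+ 3 * (Qb / sg ^+ 2) * (Db / sg ^+ 2))
  + expR (p * n%:R) / 2 ^+ nu.
Proof.
apply: (@le_trans _ _ (\sum_x (16 * (bern t x * Tx x ^+ 2) + bern t x * twice x +
   bern t x * (nu < #|nbr x|)%N%:R))); last first.
  rewrite !big_split /= -mulr_sumr; apply: lerD; last exact: bern_large.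
  apply: lerD; last exact: twice_mean.
  by apply: ler_wpM2l => //; rewrite /Tx bern_parseval.
apply: ler_sum => x _.
have tw0 : 0 <= twice x by apply: sumr_ge0.
have T0 := sqr_ge0 (Tx x).
rewrite (mulrCA 16) -!mulrDr; apply: ler_wpM2l; first exact: bern_ge0.
case: (ltP (\sum_A g A * zA A x) (1 / 2)) => h /=; last by rewrite !addr_ge0 // mulr_ge0.
case: (ltnP nu #|nbr x|) => h1 /=; first by rewrite lerDr addr_ge0 // mulr_ge0.
rewrite addr0; case: (ltP (twice x) 1) => h2; last by move: h2 T0; lra.
have := Qx_lower h1 h2; move: h; rewrite fxE => h h3.
have h4 : Tx x < - (1 / 4) by lra.
have : 0 <= (- Tx x - 1 / 4) * (- Tx x + 1 / 4) by apply: mulr_ge0; lra.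
by move: tw0; lra.
Qed.
End Kill.
End Bernoulli.

(** Valid for all [u]: the remainder is quadratic, and the exponential weight becomes the weight
    [exp (th * sqrt q)] on pairs with large overlap. *)
Lemma expR_quad (R : realType) (u : R) : expR u <= 1 + u + u ^+ 2 * expR `|u|.
Proof.
have h v : expR v * (1 - v) <= 1 :> R.
  by rewrite -ler_pdivlMl ?expR_gt0 // mulr1 -expRN; exact: expR_ge1Dx.
have := h u; case: (leP 0 u) => u0 h1.
  have h2 : u * (expR u * (1 - u)) <= u * 1 by apply: ler_wpM2l.
  by rewrite ger0_norm //; move: h1 h2; move: (expR u) => e; lra.
have v0 : 0 < 1 - u by lra.
have e1 : 1 <= expR (- u) by rewrite -expR0 ler_expR; lra.
apply: (@le_trans _ _ (1 + u + u ^+ 2)); last first.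
  by rewrite ltr0_norm // lerD2l ler_peMr ?sqr_ge0.
rewrite -(ler_pM2r v0); apply: le_trans h1 _.
have : 0 <= (- u) * u ^+ 2 by rewrite mulr_ge0 ?sqr_ge0 //; lra.
by lra.
Qed.

(** * Exposing one vertex *)

Section ColorStep.
Variables (R : realType) (n k : nat) (p : R).
Hypothesis n0 : (0 < n)%N.
Hypothesis k2 : (1 < k)%N.
Hypothesis p0 : 0 < p.
Hypothesis p2 : p <= 1 / 8.
Local Notation X := {ffun 'I_n -> bool}.
Local Notation Om := {ffun 'I_n -> 'I_k}.
Local Notation odds := (odds p).

Definition kk : R := k.-1%:R^-1.
(** Colour correlation centred in each argument. Combined with [zz], an edge has the factor 0 when
    monochromatic and [k / (k - 1)] otherwise. *)
Definition ac (c c' : 'I_k) : R := if c == c' then -1 else kk.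
Definition vertex_at (t : nat) : 'I_n := insubd (Ordinal n0) t.
Definition al (t : nat) (s : Om) (v : 'I_n) : R := if (v < t)%N then ac (s (vertex_at t)) (s v) else 0.
(** Absent edges carry a factor as well, so that each potential edge has mean 1 whatever the
    colouring; the plain indicator of properness would have a mean depending on the class sizes. *)
Definition lc (t : nat) (x : X) (s : Om) : R := \prod_v (1 + al t s v * zz p (x v)).
Definition upd (t : nat) (s : Om) (c : 'I_k) : Om := [ffun v => if v == vertex_at t then c else s v].
(** Up to a scalar, the overlap matrix of the two colourings on the first [t] vertices, centred in
    rows and columns. Its squared norm [qc] plays the role of [n * ov ^ 2] in the spin systems. *)
Definition Bc (t : nat) (s s' : Om) (c c' : 'I_k) : R :=
  \sum_(v : 'I_n) (v < t)%N%:R * (ac c (s v) * ac c' (s' v)).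
Definition qc (t : nat) (s s' : Om) : R := \sum_c \sum_c' Bc t s s' c c' ^+ 2.

Lemma kp_gt0 : 0 < k.-1%:R :> R.
Proof. by rewrite ltr0n -subn1 subn_gt0. Qed.

Lemma kk_gt0 : 0 < kk. Proof. by rewrite invr_gt0 kp_gt0. Qed.

Lemma kk_le1 : kk <= 1.
Proof. by rewrite invf_le1 ?kp_gt0 // ler1n -subn1 subn_gt0. Qed.

Lemma kkE : k%:R * kk = 1 + kk.
Proof.
have E : k%:R = 1 + k.-1%:R :> R by rewrite nat1r prednK // ltnW.
by rewrite E mulrDl mul1r divff ?lt0r_neq0 ?kp_gt0 // addrC.
Qed.

Lemma acE c c' : ac c c' = kk - (1 + kk) * (c == c')%:R.
Proof. by rewrite /ac; case: eqP => _ /=; ring. Qed.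

Lemma acC c c' : ac c c' = ac c' c. Proof. by rewrite /ac eq_sym. Qed.

Lemma ac_ge c c' : -1 <= ac c c'.
Proof. by have := kk_gt0; rewrite /ac; case: ifP => _; lra. Qed.

Lemma ac_le c c' : ac c c' <= kk.
Proof. by have := kk_gt0; rewrite /ac; case: ifP => _; lra. Qed.

Lemma ac_norm c c' : `|ac c c'| <= 1.
Proof. by rewrite ler_norml ac_ge /=; apply: le_trans (ac_le _ _) kk_le1. Qed.

Lemma sum_eq1 (x : 'I_k) : \sum_c (c == x)%:R = 1 :> R.
Proof. by rewrite (bigD1 x) //= eqxx big1 ?addr0 // => c /negbTE ->. Qed.

Lemma sum_ac x : \sum_c ac c x = 0.
Proof.
under eq_bigr do rewrite acE.
rewrite sumrB -mulr_sumr sum_eq1 sumr_const card_ord -[X in X - _]mulr_natl kkE; ring.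
Qed.

Lemma sum_acac x y : \sum_c ac c x * ac c y = - (1 + kk) * ac x y.
Proof.
rewrite (eq_bigr (fun c => ac c x * kk - (1 + kk) * (ac c x * (c == y)%:R))); last first.
  by move=> c _; rewrite (acE c y); ring.
rewrite sumrB -mulr_suml sum_ac mul0r sub0r -mulr_sumr mulNr; congr (- (_ * _)).
rewrite (bigD1 y) //= eqxx mulr1 big1 ?addr0 => [|c /negbTE ->]; last by rewrite mulr0.
exact: acC.
Qed.

Lemma vtE t : (t < n)%N -> vertex_at t = t :> nat.
Proof. by move=> tn; rewrite /vertex_at val_insubd tn. Qed.

Lemma al_norm t s v : `|al t s v| <= 1.
Proof. by rewrite /al; case: ifP => _; rewrite ?normr0 // ac_norm. Qed.

Lemma lc_ge0 t x s : 0 <= lc t x s.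
Proof.
apply: prodr_ge0 => v _; have := al_norm t s v; rewrite ler_norml => /andP[h1 h2].
have := odds_gt0 p0 p2; have := odds_le p2.
by rewrite /zz; case: (x v) => h3 h4; move: h1 h2 h3 h4; [lra|nra].
Qed.

Lemma lc_mean t t' s : \sum_x bern p t' x * lc t x s = 1.
Proof.
rewrite /lc (bern_prod p t' (fun v b => 1 + al t s v * zz p b)) big1 // => v _.
have E := oddsE p2; rewrite /zz; transitivity (1 + al t s v * (p - (1 - p) * odds)); first by ring.
by rewrite -E subrr mulr0 addr0.
Qed.

Lemma lc_pair t t' s s' : \sum_x bern p t' x * (lc t x s * lc t x s') =
  \prod_v (1 + odds * (al t s v * al t s' v)).
Proof.
rewrite (eq_bigr (fun x : X => bern p t' x * \prod_v ((1 + al t s v * zz p (x v)) * (1 + al t s' v * zz p (x v))))); last first.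
  by move=> x _; rewrite big_split.
rewrite (bern_prod p t' (fun v b => (1 + al t s v * zz p b) * (1 + al t s' v * zz p b))).
apply: eq_bigr => v _; have E := oddsE p2; rewrite /zz.
transitivity (1 + (al t s v + al t s' v) * (p - (1 - p) * odds) + (al t s v * al t s' v) * (p + (1 - p) * odds * odds)).
  by ring.
rewrite -E subrr mulr0 addr0; congr (1 + _).
by rewrite mulrC; congr (_ * _); transitivity ((1 - p) * odds + p * odds); [rewrite -E|ring].
Qed.

Lemma qc_ge0 t s s' : 0 <= qc t s s'.
Proof. by apply: sumr_ge0 => c _; apply: sumr_ge0 => c' _; exact: sqr_ge0. Qed.

Lemma Bc_le t s s' c c' : `|Bc t s s' c c'| <= Num.sqrt (qc t s s').
Proof.
rewrite -sqrtr_sqr ler_sqrt ?qc_ge0 // /qc (bigD1 c) //= (bigD1 c') //= -addrA lerDl.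
by rewrite addr_ge0 //; do ?[apply: sumr_ge0 => ? _]; exact: sqr_ge0.
Qed.

Lemma Bc_sum t s s' : \sum_c \sum_c' Bc t s s' c c' = 0.
Proof.
rewrite big1 // => c _; rewrite exchange_big big1 //= => v _.
by rewrite -mulr_sumr -mulr_sumr sum_ac !mulr0.
Qed.

Lemma qcE t s s' : qc t s s' = (1 + kk) ^+ 2 * \sum_(u : 'I_n) \sum_(v : 'I_n)
  (u < t)%N%:R * (v < t)%N%:R * (ac (s u) (s v) * ac (s' u) (s' v)).
Proof.
transitivity (\sum_(u : 'I_n) \sum_(v : 'I_n) (u < t)%N%:R * (v < t)%N%:R *
   ((\sum_c ac c (s u) * ac c (s v)) * (\sum_c ac c (s' u) * ac c (s' v)))).
  rewrite /qc; under eq_bigr => c _ do under eq_bigr => c' _ do rewrite expr2 /Bc mulr_suml.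
  transitivity (\sum_c \sum_c' \sum_(u : 'I_n) \sum_(v : 'I_n) (u < t)%N%:R * (v < t)%N%:R *
     (ac c (s u) * ac c (s v) * (ac c' (s' u) * ac c' (s' v)))).
    apply: eq_bigr => c _; apply: eq_bigr => c' _; apply: eq_bigr => u _; rewrite mulr_sumr.
    by apply: eq_bigr => v _; ring.
  under eq_bigr do rewrite exchange_big /=.
  rewrite exchange_big /=; apply: eq_bigr => u _.
  under eq_bigr do rewrite exchange_big /=.
  rewrite exchange_big /=; apply: eq_bigr => v _.
  rewrite mulr_suml mulr_sumr; apply: eq_bigr => c _; rewrite !mulr_sumr.
  by apply: eq_bigr => c' _.
rewrite mulr_sumr; apply: eq_bigr => u _; rewrite mulr_sumr; apply: eq_bigr => v _.
by rewrite !sum_acac; ring.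
Qed.

Section Measure.
Variables (t : nat) (om : Om -> R).
Hypothesis tn : (t < n)%N.
Hypothesis om0 : forall s, 0 <= om s.
Hypothesis om1 : \sum_s om s = 1.
Hypothesis omU : forall s c, om (upd t s c) = om s.

(** The history does not involve vertex [t], so under [om] its colour is uniform given the others.
    This symmetry makes the linear coefficients vanish. *)
Lemma avg_upd (F : Om -> R) : \sum_s om s * F s = \sum_s om s * ((\sum_c F (upd t s c)) / k%:R).
Proof.
have k0 : k%:R != 0 :> R by rewrite pnatr_eq0 -lt0n ltnW.
pose h (q : Om * 'I_k) := (upd t q.1 q.2, q.1 (vertex_at t)).
have hK : involutive h.
  move=> [s c]; rewrite /h /=; congr (_, _); last by rewrite ffunE eqxx.
  by apply/ffunP => v; rewrite !ffunE; case: eqP => [->|].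
have E : \sum_(q : Om * 'I_k) om q.1 * F (upd t q.1 q.2) = \sum_(q : Om * 'I_k) om q.1 * F q.1.
  rewrite (reindex_inj (inv_inj hK)) /=; apply: eq_bigr => -[s c] _ /=; rewrite omU.
  congr (_ * F _); by have := hK (s, c) => -[].
rewrite [RHS](eq_bigr (fun s => (\sum_c om s * F (upd t s c)) / k%:R)); last first.
  by move=> s _; rewrite mulrA mulr_sumr.
rewrite -mulr_suml (pair_bigA _ (fun s c => om s * F (upd t s c))) /= E.
rewrite -(pair_bigA _ (fun s (c : 'I_k) => om s * F s)) /=.
under [X in _ = X / _]eq_bigr do rewrite sumr_const card_ord -mulr_natr.
by rewrite -mulr_suml mulfK.
Qed.

Lemma upd_other s c (v : 'I_n) : (v < t)%N -> upd t s c v = s v.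
Proof. by move=> vt'; rewrite ffunE; case: eqP => // E; move: vt'; rewrite E vtE // ltnn. Qed.

Lemma al_upd s c v : al t (upd t s c) v = if (v < t)%N then ac c (s v) else 0.
Proof. by rewrite /al; case: ifP => // h; rewrite (upd_other _ _ h) /upd ffunE eqxx. Qed.

Definition gA (A : {set 'I_n}) : R := \sum_s om s * \prod_(v in A) al t s v.

Lemma fbarE x : \sum_s om s * lc t x s = \sum_A gA A * zA p A x.
Proof.
under [RHS]eq_bigr do rewrite /gA mulr_suml.
rewrite exchange_big /=; apply: eq_bigr => s _; rewrite /lc prod_1D mulr_sumr.
by apply: eq_bigr => A _; rewrite big_split /= mulrA.
Qed.

Lemma gA0 : gA set0 = 1.
Proof. by rewrite /gA -[RHS]om1; apply: eq_bigr => s _; rewrite big_set0 mulr1. Qed.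

Lemma gA1 v : gA [set v]%SET = 0.
Proof.
rewrite /gA avg_upd big1 // => s _; rewrite (eq_bigr (fun c => if (v < t)%N then ac c (s v) else 0)) => [|c _]; last first.
  by rewrite big_set1 al_upd.
by case: (v < t)%N; rewrite ?sum_ac ?sumr_const ?mul0rn mul0r mulr0.
Qed.

Definition mab (u v : 'I_n) : R := \sum_s om s * ac (s u) (s v).

Lemma gA2 u v : v != u -> gA [set u; v]%SET = (u < t)%N%:R * (v < t)%N%:R * (- kk * mab u v).
Proof.
move=> vu; have k0 : k%:R != 0 :> R by rewrite pnatr_eq0 -lt0n ltnW.
have kE : (1 + kk) / k%:R = kk by rewrite -kkE mulrC mulKf.
rewrite /gA avg_upd /mab mulr_sumr mulr_sumr; apply: eq_bigr => s _.
rewrite (eq_bigr (fun c => (u < t)%N%:R * (v < t)%N%:R * (ac c (s u) * ac c (s v)))); last first.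
  move=> c _; rewrite big_setU1 /= ?inE 1?eq_sym // big_set1 !al_upd.
  by case: (u < t)%N; case: (v < t)%N; rewrite ?(mul0r, mulr0, mul1r).
by rewrite -mulr_sumr sum_acac -[in RHS]kE; ring.
Qed.

Lemma mab_le u v : mab u v <= kk.
Proof.
apply: (@le_trans _ _ (\sum_s om s * kk)); last by rewrite -mulr_suml om1 mul1r.
by apply: ler_sum => s _; apply: ler_wpM2l => //; exact: ac_le.
Qed.

(** Two neighbours do most harm when they always have different colours, and even then only
    [kk ^ 2]. *)
Lemma gA2_lo u v : v != u -> - kk ^+ 2 <= gA [set u; v]%SET.
Proof.
move=> vu; rewrite gA2 // -natrM; have h := mab_le u v; have k0 := kk_gt0.
have b0 : 0 <= ((u < t) * (v < t))%:R :> R by [].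
have b1 : ((u < t) * (v < t))%:R <= 1 :> R by rewrite mulnb lern1 leq_b1.
move: (_%:R) b0 b1 => b b0 b1.
have e1 : b * (kk * mab u v) <= b * (kk * kk) by apply: ler_wpM2l => //; rewrite ler_pM2l.
have e2 : b * (kk * kk) <= 1 * (kk * kk) by apply: ler_wpM2r => //; rewrite mulr_ge0 // ltW.
by rewrite mulNr mulrN expr2 lerN2; move: e1 e2; lra.
Qed.

Local Notation "'EE' s s' , F" := (\sum_(s : Om) \sum_(s' : Om) om s * om s' * F)
  (at level 200, s name, s' name, F at level 200).

Lemma dbl_le (F G : Om -> Om -> R) : (forall s s', F s s' <= G s s') -> (EE s s', F s s') <= (EE s s', G s s').
Proof. by move=> h; apply: ler_sum => s _; apply: ler_sum => s' _; apply: ler_wpM2l; rewrite ?mulr_ge0. Qed.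

Lemma mab_sq u v : mab u v ^+ 2 = (EE s s', (ac (s u) (s v) * ac (s' u) (s' v))).
Proof.
rewrite expr2 /mab mulr_suml; apply: eq_bigr => s _; rewrite mulr_sumr.
by apply: eq_bigr => s' _; ring.
Qed.

Lemma dbl_exch (I : finType) (P : pred I) (F : I -> Om -> Om -> R) :
  \sum_(i | P i) (EE s s', F i s s') = (EE s s', (\sum_(i | P i) F i s s')).
Proof.
rewrite exchange_big; apply: eq_bigr => s _; rewrite exchange_big; apply: eq_bigr => s' _.
by rewrite mulr_sumr.
Qed.

Lemma gsq_le u v : v != u -> gA [set u; v]%SET ^+ 2 <= (u < t)%N%:R * (v < t)%N%:R * mab u v ^+ 2.
Proof.
move=> vu; rewrite gA2 // exprMn.
have -> : ((u < t)%N%:R * (v < t)%N%:R) ^+ 2 = (u < t)%N%:R * (v < t)%N%:R :> R.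
  by case: (u < t)%N; case: (v < t)%N; rewrite ?(mul0r, mulr0, mul1r, expr0n, expr1n).
apply: ler_wpM2l; first exact: mulr_ge0.
rewrite exprMn sqrrN ler_piMl ?sqr_ge0 // expr_le1 ?kk_le1 // ltW ?kk_gt0 //.
Qed.

Lemma g_sq_q : \sum_u \sum_(v | v != u) gA [set u; v]%SET ^+ 2 <= (EE s s', (qc t s s')).
Proof.
apply: (@le_trans _ _ (\sum_(u : 'I_n) \sum_(v : 'I_n) (u < t)%N%:R * (v < t)%N%:R * mab u v ^+ 2)).
  apply: ler_sum => u _; rewrite [leLHS]big_mkcond; apply: ler_sum => v _.
  case: ifP => [vu|_]; [exact: gsq_le|by rewrite mulr_ge0 ?sqr_ge0 ?mulr_ge0].
apply: (@le_trans _ _ (EE s s', (\sum_(u : 'I_n) \sum_(v : 'I_n)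
    (u < t)%N%:R * (v < t)%N%:R * (ac (s u) (s v) * ac (s' u) (s' v))))).
  apply: eq_ler; rewrite -dbl_exch; apply: eq_bigr => u _; rewrite -dbl_exch; apply: eq_bigr => v _.
  rewrite mab_sq mulr_sumr; apply: eq_bigr => s _; rewrite mulr_sumr; apply: eq_bigr => s' _; ring.
apply: dbl_le => s s'; have := qc_ge0 t s s'; rewrite qcE; set w := \sum_(u : 'I_n) _.
have h : 1 <= (1 + kk) ^+ 2 by have := kk_gt0; nra.
rewrite pmulr_rge0; last by lra.
by move=> w0; rewrite ler_peMl.
Qed.

Lemma g_row_q u : \sum_(v | v != u) gA [set u; v]%SET ^+ 2 <= (EE s s', (Num.sqrt (qc t s s'))).
Proof.
apply: (@le_trans _ _ (\sum_(v : 'I_n) (v < t)%N%:R * mab u v ^+ 2)).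
  rewrite [leLHS]big_mkcond; apply: ler_sum => v _.
  case: ifP => [vu|_]; last by rewrite mulr_ge0 ?sqr_ge0.
  have e0 : 0 <= (v < t)%N%:R * mab u v ^+ 2 by apply: mulr_ge0 => //; exact: sqr_ge0.
  by apply: le_trans (gsq_le vu) _; rewrite -[leLHS]mulrA; apply: ler_piMl => //; rewrite lern1 leq_b1.
apply: (@le_trans _ _ (EE s s', (Bc t s s' (s u) (s' u)))).
  apply: eq_ler; rewrite /Bc -dbl_exch; apply: eq_bigr => v _.
  rewrite mab_sq mulr_sumr; apply: eq_bigr => s _; rewrite mulr_sumr; apply: eq_bigr => s' _; ring.
by apply: dbl_le => s s'; apply: le_trans (ler_norm _) (Bc_le _ _ _ _ _).
Qed.

(** The weighted sum of squared coefficients is an average over pairs of a product over vertices.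
    After averaging over both new colours the products are at most exponentials of the entries of
    [Bc]; these entries sum to zero, so only second-order terms survive. *)
Lemma Phi_bound (lb : R) : 0 <= lb -> lb <= 1 ->
  \sum_(A : {set 'I_n}) lb ^+ #|A| * gA A ^+ 2 <=
  1 + lb ^+ 2 * (EE s s', (qc t s s' * expR (lb * Num.sqrt (qc t s s')))).
Proof.
move=> l0 l1; have k1 : 1 <= k%:R :> R by rewrite ler1n ltnW.
have kp : 0 < k%:R :> R by lra.
have -> : \sum_(A : {set 'I_n}) lb ^+ #|A| * gA A ^+ 2 =
  (EE s s', (\prod_v (1 + lb * (al t s v * al t s' v)))).
  transitivity (\sum_(A : {set 'I_n}) (EE s s', (lb ^+ #|A| * \prod_(v in A) (al t s v * al t s' v)))).
    apply: eq_bigr => A _; rewrite expr2 /gA mulr_suml mulr_sumr; apply: eq_bigr => s _.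
    rewrite !mulr_sumr; apply: eq_bigr => s' _; rewrite big_split /=; ring.
  rewrite dbl_exch; apply: eq_bigr => s _; apply: eq_bigr => s' _; congr (_ * _).
  rewrite prod_1D; apply: eq_bigr => A _; by rewrite [RHS]big_split /= prodr_const.
have -> : (EE s s', (\prod_v (1 + lb * (al t s v * al t s' v)))) =
  (EE s s', ((\sum_c \sum_c' \prod_(v : 'I_n) (1 + lb * ((v < t)%N%:R * (ac c (s v) * ac c' (s' v))))) / k%:R ^+ 2)).
  transitivity (\sum_s om s * \sum_s' om s' * \prod_v (1 + lb * (al t s v * al t s' v))).
    by apply: eq_bigr => s _; rewrite mulr_sumr; apply: eq_bigr => s' _; rewrite mulrA.
  rewrite avg_upd; apply: eq_bigr => s _.
  under eq_bigr do rewrite avg_upd.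
  rewrite exchange_big /= mulr_suml mulr_sumr; apply: eq_bigr => s' _.
  rewrite -mulr_sumr -!mulrA; congr (_ * (_ * _)); rewrite -mulr_suml -mulrA -invfM -expr2; congr (_ / _).
  apply: eq_bigr => c _; apply: eq_bigr => c' _; apply: eq_bigr => v _; rewrite !al_upd.
  by case: (v < t)%N; rewrite ?(mul0r, mulr0, mul1r).
apply: (@le_trans _ _ (EE s s', (1 + lb ^+ 2 * (qc t s s' * expR (lb * Num.sqrt (qc t s s')))))); last first.
  apply: eq_ler; transitivity ((EE s s', 1) + (EE s s', (lb ^+ 2 * (qc t s s' * expR (lb * Num.sqrt (qc t s s')))))).
    by rewrite -big_split; apply: eq_bigr => s _; rewrite -big_split; apply: eq_bigr => s' _ /=; ring.
  congr (_ + _).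
    transitivity (\sum_s om s * \sum_s' om s'); last by rewrite -mulr_suml om1 mul1r.
    by apply: eq_bigr => s _; rewrite mulr_sumr; apply: eq_bigr => s' _; rewrite mulr1.
  rewrite mulr_sumr; apply: eq_bigr => s _; rewrite mulr_sumr; apply: eq_bigr => s' _; ring.
apply: dbl_le => s s'; set q := qc t s s'; have q0 : 0 <= q := qc_ge0 _ _ _.
rewrite ler_pdivrMr ?exprn_gt0 //.
apply: (@le_trans _ _ (\sum_c \sum_c' (1 + lb * Bc t s s' c c' + lb ^+ 2 * expR (lb * Num.sqrt q) * Bc t s s' c c' ^+ 2))).
  apply: ler_sum => c _; apply: ler_sum => c' _; set B := Bc _ _ _ _ _.
  apply: (@le_trans _ _ (expR (lb * B))).
    rewrite /B /Bc mulr_sumr expR_sum; apply: ler_prod => v _; rewrite expR_ge1Dx andbT.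
    case: (v < t)%N; rewrite ?mul0r ?mulr0 ?addr0 // mul1r.
    have : `|ac c (s v) * ac c' (s' v)| <= 1 by rewrite normrM mulr_ile1 ?ac_norm.
    rewrite ler_norml => /andP[h _]; move: (ac c _ * _) h => w h.
    by have : lb * -1 <= lb * w by [apply: ler_wpM2l]; move: l1; lra.
  apply: le_trans (expR_quad _) _; rewrite lerD2l exprMn -[leRHS]mulrA -[leLHS]mulrA; apply: ler_wpM2l; first exact: sqr_ge0.
  rewrite mulrC; apply: ler_wpM2r; first exact: sqr_ge0.
  rewrite ler_expR normrM ger0_norm //; apply: ler_wpM2l => //; exact: Bc_le.
under eq_bigr do rewrite !big_split /= -!mulr_sumr.
rewrite !big_split /= -!mulr_sumr Bc_sum mulr0 addr0 -/(qc t s s') -/q.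
have -> : \sum_(i < k) \sum_(i0 < k) 1 = k%:R ^+ 2 :> R.
  rewrite (eq_bigr (fun=> k%:R)) => [|i _]; last by rewrite sumr_const card_ord.
  by rewrite sumr_const card_ord expr2 mulr_natl.
rewrite mulrDl mul1r lerD2l.
have -> : lb ^+ 2 * expR (lb * Num.sqrt q) * q = lb ^+ 2 * (q * expR (lb * Num.sqrt q)) by ring.
by rewrite ler_peMr ?mulr_ge0 ?sqr_ge0 ?expR_ge0 // expr_ge1 // ltW.
Qed.

Variables (th Qb : R).
Hypothesis th1 : th <= 1.
Hypothesis oth : odds <= th.
Hypothesis Qbd : (EE s s', (qc t s s' * expR (th * Num.sqrt (qc t s s')))) <= Qb.

Lemma th_gt0 : 0 < th. Proof. by apply: lt_le_trans oth; exact: odds_gt0. Qed.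

Lemma q_le_Qb : (EE s s', (qc t s s')) <= Qb.
Proof.
apply: le_trans Qbd; apply: dbl_le => s s'; rewrite ler_peMr ?qc_ge0 //.
by rewrite -expR0 ler_expR mulr_ge0 ?sqrtr_ge0 // ltW ?th_gt0.
Qed.

Lemma step_second : \sum_x bern p t x * (\sum_s om s * lc t x s) ^+ 2 <= 1 + odds ^+ 2 * Qb.
Proof.
under eq_bigr do rewrite fbarE.
have o0 := odds_gt0 p0 p2.
rewrite (bern_parseval p2 t xpredT gA); apply: le_trans (Phi_bound (ltW o0) _) _; first by have := odds_le p2; lra.
rewrite lerD2l; apply: ler_wpM2l; first exact: sqr_ge0.
apply: le_trans Qbd; apply: dbl_le => s s'; apply: ler_wpM2l; first exact: qc_ge0.
by rewrite ler_expR; apply: ler_wpM2r; rewrite ?sqrtr_ge0.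
Qed.

(** [Phi_bound] holds at the larger level [th] too, and passing from [th] down to [odds] gains
    [(odds / th) ^ 3] on sets with at least three elements. *)
Lemma tail_le : \sum_(A : {set 'I_n} | (2 < #|A|)%N) odds ^+ #|A| * gA A ^+ 2 <= odds ^+ 3 * Qb / th.
Proof.
have o0 := odds_gt0 p0 p2; have t0 := th_gt0.
apply: (@le_trans _ _ ((odds / th) ^+ 3 * \sum_(A : {set 'I_n} | (2 < #|A|)%N) th ^+ #|A| * gA A ^+ 2)).
  rewrite mulr_sumr; apply: ler_sum => A A2; rewrite mulrA; apply: ler_wpM2r; first exact: sqr_ge0.
  rewrite -(subnK A2) !exprD [leRHS]mulrCA -[X in _ <= _ * X]exprMn divfK ?lt0r_neq0 //; apply: ler_wpM2r; first by rewrite exprn_ge0 // ltW.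
  by apply: lerXn2r; rewrite ?nnegrE // ltW.
have -> : odds ^+ 3 * Qb / th = (odds / th) ^+ 3 * (th ^+ 2 * Qb) by field; rewrite lt0r_neq0.
apply: ler_wpM2l; first by rewrite exprn_ge0 // divr_ge0 // ltW.
apply: (@le_trans _ _ (\sum_(A : {set 'I_n}) th ^+ #|A| * gA A ^+ 2 - 1)).
  rewrite [in leRHS](bigD1 set0) //= gA0 cards0 expr0 expr1n mulr1 addrAC subrr add0r.
  rewrite big_mkcond [leRHS]big_mkcond; apply: ler_sum => A _.
  have e0 : 0 <= th ^+ #|A| * gA A ^+ 2 by rewrite mulr_ge0 ?sqr_ge0 ?exprn_ge0 // ltW.
  by rewrite -cards_eq0; case: #|A| e0 => [|j] //=; case: ifP.
rewrite lerBlDl; apply: le_trans (Phi_bound (ltW t0) th1) _; rewrite lerD2l.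
by apply: ler_wpM2l => //; exact: sqr_ge0.
Qed.

Lemma step_killed (nu : nat) (sg Db Ms Mt : R) : 0 < sg -> 0 < Db -> Qb <= Db ^+ 2 ->
  0 <= Ms -> 0 <= Mt -> n%:R * Db <= Ms ^+ 2 -> n%:R ^+ 2 * Qb <= Mt ^+ 2 ->
  2 * kk ^+ 2 + nu%:R ^+ 2 * sg + 2 * odds * nu%:R * Ms + odds ^+ 2 * Mt <= 1 / 4 ->
  \sum_x bern p t x * (\sum_s om s * lc t x s < 1 / 2)%R%:R <=
  16 * (odds ^+ 3 * Qb / th) + (p ^+ 4 * (Qb / sg ^+ 2) ^+ 2 + 4 * p ^+ 3 * (Qb / sg ^+ 2) * (Db / sg ^+ 2))
  + expR (p * n%:R) / 2 ^+ nu.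
Proof.
move=> sg0 Db0 QD Ms0 Mt0 hMs hMt small.
under eq_bigr do rewrite fbarE.
apply: (kill_bound p0 p2 gA0 gA1 gA2_lo _ _ tail_le n0 sg0 _ Ms0 Mt0 hMs hMt small).
- exact: le_trans g_sq_q q_le_Qb.
- move=> u; apply: le_trans (g_row_q u) _.
  (* The arithmetic-geometric bound on the square root, balanced at [Db] because [Db ^ 2] bounds the
     mean of [qc]. *)
  apply: (@le_trans _ _ (EE s s', (qc t s s' * (2 * Db)^-1 + Db / 2))).
    apply: dbl_le => s s'; set q := qc t s s'.
    have q0 : 0 <= q := qc_ge0 _ _ _.
    have E : Num.sqrt q ^+ 2 = q by rewrite sqr_sqrtr.
    have -> : q / (2 * Db) + Db / 2 = (q + Db ^+ 2) / (2 * Db) by field; rewrite lt0r_neq0.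
    rewrite ler_pdivlMr ?mulr_gt0 //.
    by have := sqr_ge0 (Num.sqrt q - Db); move: E; lra.
  apply: (@le_trans _ _ (Qb * (2 * Db)^-1 + Db / 2)).
    have -> : (EE s s', (qc t s s' * (2 * Db)^-1 + Db / 2)) = (EE s s', (qc t s s')) * (2 * Db)^-1 + Db / 2.
      transitivity (\sum_s ((\sum_s' om s * om s' * qc t s s') * (2 * Db)^-1 + om s * (Db / 2))).
        apply: eq_bigr => s _; rewrite mulr_suml -[om s * (Db / 2)]mulr1 -om1 mulr_sumr -big_split.
        by apply: eq_bigr => s' _ /=; ring.
      by rewrite big_split /= -!mulr_suml om1 mul1r.
    by rewrite lerD2r; apply: ler_wpM2r; [rewrite invr_ge0 mulr_ge0 // ltW|exact: q_le_Qb].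
  have : Qb * (2 * Db)^-1 <= Db / 2.
    by rewrite ler_pdivrMr ?mulr_gt0 //; move: QD; lra.
  by lra.
- by rewrite exprn_ge0 // ltW ?kk_gt0.
Qed.
End Measure.
End ColorStep.

Lemma expR_le4 (R : realType) (x : R) : `|x| <= 1 -> expR `|x| <= 4.
Proof.
move=> x1; apply: (@le_trans _ _ (expR (2%:R * 2^-1))); first by rewrite ler_expR mulfV ?pnatr_eq0.
rewrite expRM_natl.
have h : expR (2^-1) <= 2 :> R.
  have : (expR 2^-1)^-1 >= 1 - 2^-1 :> R by rewrite -expRN; exact: expR_ge1Dx.
  rewrite (_ : 1 - 2^-1 = 2^-1 :> R); last by field.
  by rewrite lef_pV2 ?posrE ?expR_gt0.
have e0 : 0 <= expR (2^-1) :> R := expR_ge0 _.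
by move: (expR _) h e0 => e h e0; nra.
Qed.

(** * Entropy against squared deviation *)

Section Pointwise.
Variables (R : realType) (k : nat) (cl : R).
Hypothesis k0 : (0 < k)%N.
Hypothesis cl0 : 0 < cl.
Hypothesis clk : 4 * cl <= k%:R.
Hypothesis cll : 1 + cl + ln (4 * cl) <= ln k%:R.

(** The point [x = 1] shows that [cl] cannot exceed [ln k] by more than a bounded amount; the
    hypothesis loses only [1 + ln (4 * cl)]. The factor [ln k] is what brings the range of [d] up to
    nearly [2 * k * ln k]. *)
Lemma xlnx_quad (x : R) : 0 <= x -> x <= 1 ->
  x - k%:R^-1 + cl * (x - k%:R^-1) ^+ 2 <= x * ln (k%:R * x).
Proof.
move=> x0 x1; have kp : 0 < k%:R :> R by rewrite ltr0n.
(* For [x] above [1 / (4 * cl)] the logarithm itself is large enough. Below, entropy is bounded by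
   the Hellinger distance, the square of [sqrt y - 1] with [y = k * x]. *)
have [xs|xl] := leP (k%:R * x) (k%:R / (4 * cl)); last first.
  have xp : 0 < x by rewrite -(pmulr_rgt0 _ kp); apply: lt_trans xl; rewrite divr_gt0 // mulr_gt0.
  have c4 : 0 < 4 * cl by rewrite mulr_gt0.
  have lx : - ln (4 * cl) <= ln x.
    rewrite -lnV ?posrE // ler_ln ?posrE ?invr_gt0 //.
    by rewrite -(ler_pM2l kp) ltW.
  rewrite lnM ?posrE //.
  apply: (@le_trans _ _ (x * (1 + cl))); last first.
    by apply: ler_wpM2l => //; move: cll lx; lra.
  have ki : 0 < k%:R^-1 :> R by rewrite invr_gt0.
  have kx : k%:R^-1 <= x.
    rewrite -(ler_pM2l kp) divff ?lt0r_neq0 //; apply: le_trans (ltW xl).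
    by rewrite ler_pdivlMr // mul1r.
  rewrite mulrDr mulr1 lerD //; first by move: ki; lra.
  rewrite mulrC; apply: ler_wpM2r; first exact: ltW.
  by move: kx ki x1; move: (k%:R^-1) => w kx ki x1; nra.
pose y := k%:R * x; have y0 : 0 <= y by rewrite mulr_ge0 // ltW.
have xE : x = y / k%:R by rewrite /y mulrC mulKf ?lt0r_neq0.
have H : (Num.sqrt y - 1) ^+ 2 <= y * ln y - y + 1.
  have [yp|yz] := ltP 0 y; last first.
    have -> : y = 0 by apply/eqP; rewrite eq_le yz.
    by rewrite sqrtr0 mul0r; lra.
  pose r := Num.sqrt y; have rE : y = r ^+ 2 by rewrite /r sqr_sqrtr // ltW.
  have rp : 0 < r by rewrite sqrtr_gt0.
  have lr : 1 - r^-1 <= ln r.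
    have := @le_ln1Dx R (r^-1 - 1); rewrite addrCA subrr addr0 lnV ?posrE //.
    by move=> /(_ _); have : -1 < r^-1 - 1 by [have : 0 < r^-1 by [rewrite invr_gt0]; lra]; move=> -> /(_ isT); lra.
  have -> : ln y = 2 * ln r by rewrite rE lnXn // mulr_natl.
  rewrite -/r rE.
  have : r ^+ 2 * (2 * (1 - r^-1)) <= r ^+ 2 * (2 * ln r).
    by apply: ler_wpM2l; [exact: sqr_ge0|rewrite ler_pM2l].
  have -> : r ^+ 2 * (2 * (1 - r^-1)) = 2 * r ^+ 2 - 2 * r by field; rewrite lt0r_neq0.
  by lra.
have D : (y - 1) ^+ 2 * cl <= k%:R * (Num.sqrt y - 1) ^+ 2.
  pose r := Num.sqrt y; have rE : y = r ^+ 2 by rewrite /r sqr_sqrtr.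
  have r0 : 0 <= r by exact: sqrtr_ge0.
  rewrite -/r rE (_ : r ^+ 2 - 1 = (r - 1) * (r + 1)); last by ring.
  rewrite exprMn -[leLHS]mulrA [leRHS]mulrC; apply: ler_wpM2l; first exact: sqr_ge0.
  have h1 : (r + 1) ^+ 2 <= 4 * Num.max 1 (r ^+ 2).
    case: (leP 1 (r ^+ 2)) => h.
      have : 1 <= r by rewrite -(@ler_pXn2r _ 2) ?nnegrE // expr1n.
      by nra.
    have : r <= 1 by rewrite -(@ler_pXn2r _ 2) ?nnegrE // expr1n ltW.
    by nra.
  have h2 : Num.max 1 (r ^+ 2) <= k%:R / (4 * cl).
    rewrite ge_max -rE xs andbT ler_pdivlMr ?mulr_gt0 //.
    by rewrite mul1r.
  have : 4 * Num.max 1 (r ^+ 2) <= 4 * (k%:R / (4 * cl)) by rewrite ler_pM2l.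
  have -> : 4 * (k%:R / (4 * cl)) = k%:R / cl by field; rewrite lt0r_neq0.
  move=> h3; rewrite -ler_pdivlMr //; exact: le_trans h1 h3.
rewrite -(ler_pM2l (x := k%:R ^+ 2)) ?exprn_gt0 //.
have -> : k%:R ^+ 2 * (x - k%:R^-1 + cl * (x - k%:R^-1) ^+ 2) = k%:R * (y - 1) + (y - 1) ^+ 2 * cl.
  by rewrite xE; field; rewrite lt0r_neq0.
have -> : k%:R ^+ 2 * (x * ln (k%:R * x)) = k%:R * (y * ln y).
  by rewrite -/y {1}xE; field; rewrite lt0r_neq0.
have : k%:R * (Num.sqrt y - 1) ^+ 2 <= k%:R * (y * ln y - y + 1) by rewrite ler_pM2l.
by move: D; lra.
Qed.
End Pointwise.

(** * Types of pairs of colourings *)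

Section PairTypes.
Variables (R : realType) (n k : nat) (cl : R).
Hypothesis k0 : (0 < k)%N.
Hypothesis cl0 : 0 < cl.
Hypothesis clk : 4 * cl <= k%:R.
Hypothesis cll : 1 + cl + ln (4 * cl) <= ln k%:R.
Local Notation Om := {ffun 'I_n -> 'I_k}.
Local Notation ty := {ffun 'I_k * 'I_k -> 'I_n.+1}.

Definition rowc (Y : ty) (c : 'I_k) : R := \sum_c' (Y (c, c'))%:R.
(** Conditional law of the second colour given the first. The uniform default on empty rows keeps it
    a probability. *)
Definition Pc (Y : ty) (c c' : 'I_k) : R := if rowc Y c == 0 then k%:R^-1 else (Y (c, c'))%:R / rowc Y c.
Definition qv (Y : ty) (t : nat) (v : 'I_n) (c c' : 'I_k) : R :=
  k%:R^-1 * (if (v < t)%N then Pc Y c c' else k%:R^-1).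
Definition typ (t : nat) (s s' : Om) : ty :=
  [ffun q => inord #|[set v : 'I_n | (v < t)%N && ((s v, s' v) == q)]%SET|].
Definition disp (Y : ty) : R := \sum_c rowc Y c * \sum_c' (Pc Y c c' - k%:R^-1) ^+ 2.

Lemma kpos : 0 < k%:R :> R. Proof. by rewrite ltr0n. Qed.

Lemma sum_kinv : \sum_(i < k) k%:R^-1 = 1 :> R.
Proof. by rewrite sumr_const card_ord -[LHS]mulr_natl divff // lt0r_neq0 ?kpos. Qed.

Lemma rowc_ge0 Y c : 0 <= rowc Y c. Proof. by apply: sumr_ge0. Qed.

Lemma Pc_ge0 Y c c' : 0 <= Pc Y c c'.
Proof. by rewrite /Pc; case: ifP => _; rewrite ?invr_ge0 ?divr_ge0 ?rowc_ge0. Qed.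

Lemma Pc_sum Y c : \sum_c' Pc Y c c' = 1.
Proof.
rewrite /Pc; case: (boolP (rowc Y c == 0)) => h; last by rewrite -mulr_suml divff.
exact: sum_kinv.
Qed.

Lemma Pc_le1 Y c c' : Pc Y c c' <= 1.
Proof. by rewrite -(Pc_sum Y c) (bigD1 c') //= lerDl sumr_ge0 // => d _; exact: Pc_ge0. Qed.

Lemma Pc_row (Y : ty) c c' : (Y (c, c'))%:R = rowc Y c * Pc Y c c'.
Proof.
rewrite /Pc; case: ifP => [/eqP h|/negbT h]; last by rewrite mulrC divfK.
rewrite h mul0r; move/eqP: h; rewrite psumr_eq0 // => /allP /(_ c').
by rewrite mem_index_enum => /(_ isT) /eqP.
Qed.

Lemma qv_sum Y t v : \sum_c \sum_c' qv Y t v c c' = 1.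
Proof.
rewrite (eq_bigr (fun=> k%:R^-1)) => [|c _].
  exact: sum_kinv.
rewrite -mulr_sumr; case: (v < t)%N; first by rewrite Pc_sum mulr1.
by rewrite sum_kinv mulr1.
Qed.

Lemma qv_ge0 Y t v c c' : 0 <= qv Y t v c c'.
Proof. by rewrite mulr_ge0 ?invr_ge0 //; case: ifP => _; rewrite ?Pc_ge0 ?invr_ge0. Qed.

Lemma sum_pair_prod (q : 'I_n -> 'I_k -> 'I_k -> R) :
  \sum_(s : Om) \sum_(s' : Om) \prod_v q v (s v) (s' v) = \prod_v \sum_c \sum_c' q v c c'.
Proof.
rewrite (bigA_distr_bigA (fun v c => \sum_c' q v c c')); apply: eq_bigr => s _.
by rewrite (bigA_distr_bigA (fun v c' => q v (s v) c')).
Qed.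

Lemma typE t (s s' : Om) c c' : (typ t s s' (c, c'))%:R =
  \sum_(v : 'I_n) (v < t)%N%:R * ((s v == c) && (s' v == c'))%:R :> R.
Proof.
rewrite ffunE inordK; last by rewrite ltnS -[n in (_ <= n)%N]card_ord max_card.
rewrite -(sum_indic R); apply: eq_bigr => v _; rewrite inE xpair_eqE.
by case: (v < t)%N; rewrite ?mul1r ?mul0r.
Qed.

Lemma sum_typ t (s s' : Om) (F : 'I_k -> 'I_k -> R) :
  \sum_(v : 'I_n) (v < t)%N%:R * F (s v) (s' v) = \sum_c \sum_c' (typ t s s' (c, c'))%:R * F c c'.
Proof.
under [RHS]eq_bigr => c _ do under eq_bigr => c' _ do rewrite typE mulr_suml.
under [RHS]eq_bigr do rewrite exchange_big /=.
rewrite exchange_big /=; apply: eq_bigr => v _.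
rewrite (bigD1 (s v)) //= (bigD1 (s' v)) //= !eqxx mulr1 big1 ?addr0 => [|c' /negbTE h]; last first.
  by rewrite eq_sym h andbF mulr0 mul0r.
rewrite big1 ?addr0 // => c /negbTE h; rewrite big1 // => c' _.
by rewrite eq_sym h mulr0 mul0r.
Qed.

Lemma ent_ge (Y : ty) : cl * disp Y <= \sum_c \sum_c' (Y (c, c'))%:R * ln (k%:R * Pc Y c c').
Proof.
rewrite /disp mulr_sumr; apply: ler_sum => c _.
rewrite [leRHS](eq_bigr (fun c' => rowc Y c * (Pc Y c c' * ln (k%:R * Pc Y c c')))) => [|c' _]; last first.
  by rewrite Pc_row mulrA.
rewrite -[leRHS]mulr_sumr mulrCA; apply: ler_wpM2l; first exact: rowc_ge0.
apply: (@le_trans _ _ (\sum_c' (Pc Y c c' - k%:R^-1 + cl * (Pc Y c c' - k%:R^-1) ^+ 2))).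
  rewrite big_split /= sumrB Pc_sum sum_kinv.
  by rewrite subrr add0r mulr_sumr.
by apply: ler_sum => c' _; apply: xlnx_quad; rewrite ?Pc_ge0 ?Pc_le1.
Qed.

(** Method of types: under the product law [qv] of its own type, a pair has its uniform probability
    multiplied by [exp] of the entropy, which [ent_ge] bounds below. For each type these laws sum to
    1, and there are [n.+1 ^ (k * k)] types. *)
Lemma pair_types t (M : R) (F : Om -> Om -> R) : 0 <= M ->
  (forall s s', F s s' <= M * expR (cl * disp (typ t s s'))) ->
  \sum_s \sum_s' k%:R ^- n * k%:R ^- n * F s s' <= M * n.+1%:R ^+ (k * k).
Proof.
move=> M0 HF; have kp := kpos.
have kn : 0 <= k%:R ^- n :> R by rewrite invr_ge0 exprn_ge0 // ltW.
have key s s' : k%:R ^- n * k%:R ^- n * F s s' <= M * \sum_(Y : ty) \prod_v qv Y t v (s v) (s' v).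
  set Y0 := typ t s s'.
  apply: (@le_trans _ _ (M * \prod_v qv Y0 t v (s v) (s' v))); last first.
    apply: ler_wpM2l => //; rewrite (bigD1 Y0) //= lerDl sumr_ge0 // => Y _.
    by apply: prodr_ge0 => v _; exact: qv_ge0.
  apply: (@le_trans _ _ (k%:R ^- n * k%:R ^- n * (M * expR (\sum_c \sum_c' (Y0 (c, c'))%:R * ln (k%:R * Pc Y0 c c'))))).
    apply: ler_wpM2l; first exact: mulr_ge0.
    by apply: le_trans (HF s s') _; apply: ler_wpM2l => //; rewrite ler_expR; exact: ent_ge.
  rewrite -(sum_typ t s s' (fun c c' => ln (k%:R * Pc Y0 c c'))) expR_sum mulrCA; apply: ler_wpM2l => //.
  have kE : k%:R ^- n = \prod_(v : 'I_n) k%:R^-1 :> R by rewrite prodr_const card_ord exprVn.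
  rewrite kE -!big_split /=; apply: eq_ler; apply: eq_bigr => v _; rewrite /qv.
  case: ifP => h; last by rewrite mul0r expR0 mulr1.
  have P0 : 0 < Pc Y0 (s v) (s' v).
    have hY : 0 < (Y0 (s v, s' v))%:R :> R.
      by rewrite typE (bigD1 v) //= h !eqxx mulr1 ltr_wpDr // sumr_ge0 // => u _; rewrite mulr_ge0.
    rewrite lt0r Pc_ge0 andbT; apply/eqP => E; move: hY; by rewrite Pc_row E mulr0 ltxx.
  by rewrite mul1r lnK ?posrE ?mulr_gt0 // mulrA -(mulrA k%:R^-1) mulVf ?mulr1 ?lt0r_neq0.
apply: (@le_trans _ _ (\sum_(s : Om) \sum_(s' : Om) M * \sum_(Y : ty) \prod_v qv Y t v (s v) (s' v))).
  by apply: ler_sum => s _; apply: ler_sum => s' _; exact: key.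
under eq_bigr do rewrite -mulr_sumr exchange_big /=.
rewrite -mulr_sumr exchange_big /=; apply: ler_wpM2l => //.
rewrite (eq_bigr (fun=> 1)) => [|Y _]; last by rewrite sum_pair_prod big1 // => v _; exact: qv_sum.
rewrite sumr_const card_ffun card_prod !card_ord natrX //.
Qed.

Definition ncol (s : Om) (c : 'I_k) : R := \sum_(v : 'I_n) (s v == c)%:R.

Lemma rowc_typ t (s s' : Om) c : rowc (typ t s s') c <= ncol s c.
Proof.
rewrite /rowc; under eq_bigr do rewrite typE.
rewrite exchange_big /=; apply: ler_sum => v _; rewrite -mulr_sumr.
rewrite (bigD1 (s' v)) //= eqxx andbT big1 ?addr0 => [|c' /negbTE h]; last by rewrite [s' v == c']eq_sym h andbF.
by rewrite -natrM ler_nat; case: (v < t)%N; rewrite ?mul1n ?mul0n.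
Qed.

Hypothesis k2 : (1 < k)%N.
Local Notation kk := (kk R k).

(** Deviations are measured in each row from the uniform law; the further centring over the first
    colour only lowers the norm. The class sizes enter through [s] alone, as row weights. *)
Lemma qc_disp t (s s' : Om) rho : (forall c, ncol s c <= rho) ->
  qc R t s s' <= (1 + kk) ^+ 4 * rho * disp (typ t s s').
Proof.
move=> hr; set Y := typ t s s'.
have kE := kkE R k2; have kp := kpos.
pose Z d c' : R := - (1 + kk) * ((Y (d, c'))%:R - rowc Y d / k%:R).
have BE c c' : Bc R t s s' c c' = \sum_d ac R c d * Z d c'.
  rewrite /Bc (sum_typ t s s' (fun d d' => ac R c d * ac R c' d')); apply: eq_bigr => d _.
  transitivity (ac R c d * \sum_d' (Y (d, d'))%:R * ac R c' d').
    by rewrite mulr_sumr; apply: eq_bigr => d' _; ring.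
  congr (_ * _); rewrite (eq_bigr (fun d' => (Y (d, d'))%:R * kk - (1 + kk) * ((Y (d, d'))%:R * (c' == d')%:R))); last first.
    by move=> d' _; rewrite acE; ring.
  rewrite sumrB -mulr_suml -mulr_sumr [X in _ - _ * X](bigD1 c') //= eqxx mulr1 [X in _ - _ * (_ + X)]big1 ?addr0 => [|d' /negbTE h]; last first.
    by rewrite eq_sym h mulr0.
  have kE' : kk = (1 + kk) / k%:R by rewrite -kE mulrC mulKf ?lt0r_neq0.
  by transitivity (rowc Y d * ((1 + kk) / k%:R) - (1 + kk) * (Y (d, c'))%:R); [rewrite -kE'|rewrite /Z; ring].
have col c' : \sum_c Bc R t s s' c c' ^+ 2 <= (1 + kk) ^+ 2 * \sum_d Z d c' ^+ 2.
  pose S := \sum_d Z d c'.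
  have BE' c : Bc R t s s' c c' = kk * S - (1 + kk) * Z c c'.
    rewrite BE /S mulr_sumr (eq_bigr (fun d => kk * Z d c' - (1 + kk) * (Z d c' * (c == d)%:R))); last first.
      by move=> d _; rewrite acE; ring.
    rewrite sumrB -[X in _ - X]mulr_sumr [X in _ - _ * X](bigD1 c) //= eqxx mulr1 [X in _ - _ * (_ + X)]big1 ?addr0 // => d /negbTE h.
    by rewrite eq_sym h mulr0.
  rewrite (eq_bigr (fun c => kk ^+ 2 * S ^+ 2 - 2 * kk * (1 + kk) * S * Z c c' + (1 + kk) ^+ 2 * Z c c' ^+ 2)); last first.
    by move=> c _; rewrite BE'; ring.
  rewrite big_split /= -mulr_sumr gerDr sumrB sumr_const card_ord -mulr_sumr -/S -[X in X - _]mulr_natl.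
  have -> : k%:R * (kk ^+ 2 * S ^+ 2) = (k%:R * kk) * (kk * S ^+ 2) by ring.
  rewrite kE; have := kk_gt0 R k2; have := sqr_ge0 S; move: (kk) => w S0 w0.
  have : 0 <= (1 + w) * (w * S ^+ 2) by apply: mulr_ge0; [lra|apply: mulr_ge0; [exact: ltW|exact: S0]].
  by lra.
rewrite /qc exchange_big /=.
apply: (@le_trans _ _ (\sum_c' (1 + kk) ^+ 2 * \sum_d Z d c' ^+ 2)); first by apply: ler_sum => c' _; exact: col.
rewrite -mulr_sumr exchange_big /= -[leRHS]mulrA (_ : (1 + kk) ^+ 4 = (1 + kk) ^+ 2 * (1 + kk) ^+ 2); last by ring.
rewrite -[leRHS]mulrA; apply: ler_wpM2l; first exact: sqr_ge0.
rewrite /disp mulr_sumr mulr_sumr; apply: ler_sum => d _.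
rewrite (eq_bigr (fun c' => (1 + kk) ^+ 2 * (rowc Y d * (rowc Y d * (Pc Y d c' - k%:R^-1) ^+ 2)))); last first.
  by move=> c' _; rewrite /Z Pc_row; ring.
rewrite -mulr_sumr; apply: ler_wpM2l; first exact: sqr_ge0.
rewrite -!mulr_sumr; apply: ler_wpM2r.
  by apply: mulr_ge0; [exact: rowc_ge0|apply: sumr_ge0 => c' _; exact: sqr_ge0].
by apply: le_trans (rowc_typ t s s' d) (hr d).
Qed.

Lemma ncol_mgf c (x : R) : `|x| <= 1 ->
  \sum_(s : Om) k%:R ^- n * expR (x * ncol s c) <= expR (n%:R / k%:R * (x + 4 * x ^+ 2)).
Proof.
move=> x1; have kp := kpos.
have -> : \sum_(s : Om) k%:R ^- n * expR (x * ncol s c) = \prod_(v : 'I_n) \sum_(d : 'I_k) k%:R^-1 * expR (x * (d == c)%:R).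
  rewrite (bigA_distr_bigA (fun (v : 'I_n) (d : 'I_k) => k%:R^-1 * expR (x * (d == c)%:R))); apply: eq_bigr => s _.
  by rewrite big_split /= prodr_const card_ord exprVn /ncol mulr_sumr expR_sum.
rewrite prodr_const card_ord -[n%:R / _ * _]mulrA expRM_natl; apply: lerXn2r; rewrite ?nnegrE ?expR_ge0 //.
  by apply: sumr_ge0 => d _; rewrite mulr_ge0 ?invr_ge0 ?expR_ge0.
apply: le_trans (expR_ge1Dx _); rewrite -mulr_sumr (bigD1 c) //= eqxx mulr1.
rewrite (eq_bigr (fun=> 1)) => [|d /negbTE ->]; last by rewrite mulr0 expR0.
rewrite sumr_const cardC1 card_ord.
have kE : k%:R = 1 + k.-1%:R :> R by rewrite nat1r prednK.
have -> : k.-1%:R = k%:R - 1 :> R by rewrite kE; ring.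
have e4 : expR x <= 1 + x + 4 * x ^+ 2.
  apply: le_trans (expR_quad x) _; rewrite lerD2l mulrC; apply: ler_wpM2r; first exact: sqr_ge0.
  exact: expR_le4.
rewrite -(ler_pM2l kp) mulrA divff ?mul1r ?lt0r_neq0 // mulrDr mulr1 mulrA divff ?mul1r ?lt0r_neq0 //.
by move: e4; lra.
Qed.

Definition balc (de : R) (s : Om) : bool :=
  [forall c, (ncol s c <= (1 + de) * (n%:R / k%:R)) && ((1 - de) * (n%:R / k%:R) <= ncol s c)].

Lemma balc_prob de : 0 <= de -> de <= 1 ->
  \sum_(s : Om) k%:R ^- n * (~~ balc de s)%:R <= 2 * k%:R * expR (- (de ^+ 2 / 16 * (n%:R / k%:R))).
Proof.
(* [de / 8] maximises [x * de - 4 * x ^ 2], the exponent given by [ncol_mgf]; the maximum is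
   [de ^ 2 / 16]. *)
move=> d0 d1; have kp := kpos; pose N := n%:R / k%:R : R; pose x := de / 8.
have x1 : `|x| <= 1 by rewrite ger0_norm /x; lra.
have x1' : `|- x| <= 1 by rewrite normrN.
have kn : 0 <= k%:R ^- n :> R by rewrite invr_ge0 exprn_ge0 // ltW.
apply: (@le_trans _ _ (\sum_(s : Om) k%:R ^- n * \sum_c (expR (x * ncol s c) * expR (- x * ((1 + de) * N)) +
    expR (- x * ncol s c) * expR (x * ((1 - de) * N))))).
  apply: ler_sum => s _; apply: ler_wpM2l => //.
  have pos c : 0 <= expR (x * ncol s c) * expR (- x * ((1 + de) * N)) + expR (- x * ncol s c) * expR (x * ((1 - de) * N)).
    by rewrite addr_ge0 // mulr_ge0 ?expR_ge0.
  case: (boolP (balc de s)) => [_|]; first by rewrite sumr_ge0.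
  rewrite /balc negb_forall => /existsP[c]; rewrite negb_and -!ltNge => h.
  rewrite (bigD1 c) //=; apply: (@le_trans _ _ (expR (x * ncol s c) * expR (- x * ((1 + de) * N)) + expR (- x * ncol s c) * expR (x * ((1 - de) * N)))); last first.
    by rewrite lerDl sumr_ge0.
  have x0 : 0 <= x by rewrite /x; lra.
  rewrite -!expRD; case/orP: h => h.
    apply: (@le_trans _ _ (expR (x * ncol s c + - x * ((1 + de) * N)))); last by rewrite lerDl expR_ge0.
    rewrite -[leLHS]expR0 ler_expR mulNr -mulrBr mulr_ge0 // subr_ge0 ltW //.
  apply: (@le_trans _ _ (expR (- x * ncol s c + x * ((1 - de) * N)))); last by rewrite lerDr expR_ge0.
  by rewrite -[leLHS]expR0 ler_expR mulNr addrC -mulrBr mulr_ge0 // subr_ge0 ltW.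
under eq_bigr do rewrite mulr_sumr.
rewrite exchange_big /=.
apply: (@le_trans _ _ (\sum_(c < k) 2 * expR (- (de ^+ 2 / 16 * N)))); last first.
  by rewrite sumr_const card_ord -mulr_natl; apply: eq_ler; ring.
apply: ler_sum => c _; under eq_bigr do rewrite mulrDr !mulrA.
rewrite big_split /= -!mulr_suml mulr2n mulrDl mul1r; apply: lerD.
  apply: (@le_trans _ _ (expR (N * (x + 4 * x ^+ 2)) * expR (- x * ((1 + de) * N)))).
    rewrite (_ : - x * (1 + de) * n%:R / k%:R = - x * ((1 + de) * N)); last by rewrite /N; ring.
    by apply: ler_wpM2r; [exact: expR_ge0|exact: ncol_mgf].
  by rewrite -expRD ler_expR; apply: eq_ler; rewrite /x; field.
apply: (@le_trans _ _ (expR (N * (- x + 4 * (- x) ^+ 2)) * expR (x * ((1 - de) * N)))).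
  rewrite (_ : x * (1 - de) * n%:R / k%:R = x * ((1 - de) * N)); last by rewrite /N; ring.
  by apply: ler_wpM2r; [exact: expR_ge0|exact: ncol_mgf].
by rewrite -expRD ler_expR; apply: eq_ler; rewrite /x; field.
Qed.
End PairTypes.

(** * Lower bound for the mass of colourings *)

Section ColorProcess.
Variables (R : realType) (n k : nat) (p : R).
Hypothesis n0 : (0 < n)%N.
Hypothesis k2 : (1 < k)%N.
Hypothesis p0 : 0 < p.
Hypothesis p2 : p <= 1 / 8.
Local Notation X := {ffun 'I_n -> bool}.
Local Notation Om := {ffun 'I_n -> 'I_k}.
Local Notation odds := (odds p).
Local Notation kk := (kk R k).
Local Notation P := (bern (n := n) p).
Local Notation mu := (fun _ : Om => k%:R ^- n : R).
Local Notation l := (lc p n0 (k := k)).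
Local Notation wt := (weight mu l).
Local Notation Wt := (mass mu l).
Local Notation q := (qc R).

Lemma k0' : (0 < k)%N. Proof. exact: ltnW. Qed.

Lemma uniform_mu_ge0 (s : Om) : 0 <= k%:R ^- n :> R.
Proof. by rewrite invr_ge0 exprn_ge0. Qed.

Lemma uniform_mu_sum1 : \sum_(s : Om) k%:R ^- n = 1 :> R.
Proof.
rewrite sumr_const card_ffun !card_ord -[LHS]mulr_natl natrX divff //.
by rewrite expf_neq0 // pnatr_eq0 -lt0n k0'.
Qed.

Lemma wt_upd t s c xs : (t < n)%N -> (size xs <= t)%N -> wt xs (upd n0 t s c) = wt xs s.
Proof.
move=> tn; elim: xs => [//|x xs IH] /= sx; rewrite IH 1?ltnW //; congr (_ * _).
have sn : (size xs < n)%N by apply: ltn_trans tn.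
have other (v : 'I_n) : (v < t)%N -> upd n0 t s c v = s v by move=> h; apply: upd_other.
apply: eq_bigr => v _; congr (1 + _ * _); rewrite /al; case: ifP => // vx.
by rewrite !other ?vtE // (ltn_trans vx).
Qed.

(** Each pair of exposed vertices is seen once, by the later one, which gives the factor 1/2; the
    diagonal of the full double sum is nonnegative. *)
Lemma pair_sum_le t (s s' : Om) : (t <= n)%N ->
  \sum_(i < t) \sum_v al R n0 i s v * al R n0 i s' v <= q t s s' / 2.
Proof.
move=> tn; pose f (u v : 'I_n) : R := ac R (s u) (s v) * ac R (s' u) (s' v).
have fC u v : f u v = f v u by rewrite /f (acC R (s u)) (acC R (s' u)).
have fd v : 0 <= f v v by rewrite /f /ac !eqxx mulrNN mulr1.
have -> : \sum_(i < t) \sum_v al R n0 i s v * al R n0 i s' v =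
   \sum_(u : 'I_n) \sum_(v : 'I_n) ((u < t)%N && (v < u)%N)%:R * f u v.
  rewrite (big_ord_widen n (fun i => \sum_v al R n0 i s v * al R n0 i s' v) tn) big_mkcond; apply: eq_bigr => u _.
  case: (u < t)%N => /=; last by rewrite big1 // => v _; rewrite mul0r.
  have vu : vertex_at n0 u = u by apply/val_inj; rewrite /= vtE.
  apply: eq_bigr => v _; rewrite /al vu; case: (v < u)%N; by rewrite ?mul1r ?mul0r.
rewrite ler_pdivlMr // mulr2n mulrDr mulr1.
apply: (@le_trans _ _ (\sum_(u : 'I_n) \sum_(v : 'I_n) (u < t)%N%:R * (v < t)%N%:R * f u v)).
  rewrite {2}exchange_big /= -big_split; apply: ler_sum => u _ /=; rewrite -big_split; apply: ler_sum => v _ /=.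
  rewrite (fC v u) -mulrDl; case: (ltngtP v u) => [vu|uv|/val_inj ->].
  - rewrite andbT andbF addr0; case ut: (u < t)%N => /=; rewrite ?mul0r //.
    by rewrite (ltn_trans vu ut) !mul1r.
  - rewrite andbT andbF add0r; case ut: (v < t)%N => /=; rewrite ?mulr0 ?mul0r //.
    by rewrite (ltn_trans uv ut) mulr1.
  - by rewrite !andbF addr0 mul0r mulr_ge0 // mulr_ge0.
have := qc_ge0 R t s s'; rewrite (qcE R k2) -/f; set w := \sum_(u : 'I_n) _.
have h : 1 <= (1 + kk) ^+ 2 by have := kk_gt0 R k2; nra.
rewrite pmulr_rge0; last by lra.
by move=> w0; rewrite ler_peMl.
Qed.

Lemma Kt_prod t (s s' : Om) : (t <= n)%N -> \prod_(i < t) Kt P l i s s' <= expR (odds / 2 * q t s s').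
Proof.
move=> tn; have o0 := odds_gt0 p0 p2; have o1 := odds_le p2.
apply: (@le_trans _ _ (\prod_(i < t) expR (odds * \sum_v al R n0 i s v * al R n0 i s' v))).
  apply: ler_prod => i _; rewrite /Kt lc_pair //.
  have nn v : 0 <= 1 + odds * (al R n0 i s v * al R n0 i s' v).
    have : `|al R n0 i s v * al R n0 i s' v| <= 1 by rewrite normrM mulr_ile1 ?al_norm.
    by rewrite ler_norml => /andP[h _]; move: (al _ _ _ _ _ * _) h => w h; nra.
  rewrite prodr_ge0 //= mulr_sumr expR_sum; apply: ler_prod => v _.
  by rewrite nn expR_ge1Dx.
rewrite -expR_sum ler_expR -mulr_sumr -mulrA; apply: ler_wpM2l; first exact: ltW.
by rewrite mulrC pair_sum_le.
Qed.

Lemma qc_le t (s s' : Om) : q t s s' <= (k%:R * n%:R) ^+ 2.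
Proof.
have B c c' : Bc R t s s' c c' ^+ 2 <= n%:R ^+ 2.
  rewrite -(real_normK (num_real _)); apply: lerXn2r; rewrite ?nnegrE //.
  apply: le_trans (ler_norm_sum _ _ _) _; apply: (@le_trans _ _ (\sum_(v < n) 1)); last by rewrite sumr_const card_ord.
  apply: ler_sum => v _; rewrite normrM mulr_ile1 ?normr_nat ?lern1 ?leq_b1 //.
  by rewrite normrM mulr_ile1 ?ac_norm.
apply: (@le_trans _ _ (\sum_(c < k) \sum_(c' < k) n%:R ^+ 2)); first by apply: ler_sum => c _; apply: ler_sum => c' _.
rewrite (eq_bigr (fun=> k%:R * n%:R ^+ 2)) => [|c _]; last by rewrite sumr_const card_ord mulr_natl.
by rewrite sumr_const card_ord -[leLHS]mulr_natl; apply: eq_ler; ring.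
Qed.

Variables (cl y kap th C0 de U1 ub C4 : R).
Hypothesis cl0 : 0 < cl.
Hypothesis clk : 4 * cl <= k%:R.
Hypothesis cll : 1 + cl + ln (4 * cl) <= ln k%:R.
Hypothesis y1 : 1 <= y.
Hypothesis kap0 : 0 < kap.
Hypothesis th1 : th <= 1.
Hypothesis oth : odds <= th.
Hypothesis Htyp : (1 + kk) ^+ 4 * ((1 + de) * (n%:R / k%:R)) * (odds / 2 + 3 * (kap / n%:R)) <= cl.
Hypothesis de0 : 0 <= de.
Hypothesis C00 : 0 <= C0.
Hypothesis C4E : C4 = expR (4 * C0).
Definition Tn : R := n%:R * (3 * (y * C4) / kap).
Hypothesis Hth1 : (th * n%:R / kap) ^+ 2 <= n%:R * (3 * y / kap).
Hypothesis Hth2 : th ^+ 2 * Tn <= 1.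
Hypothesis Hthr : 1 <= n%:R * (3 * y / kap).
Hypothesis HC0 : odds ^+ 2 * (18 * n%:R / kap) <= C0 / n%:R.
Hypothesis U10 : 0 < U1.
Hypothesis HU : U1 * ((k%:R * n%:R) ^+ 2 * expR (th * (k%:R * n%:R))) * expR (y * C4) <= 1.
Hypothesis Hub : \sum_(s : Om) k%:R ^- n * (~~ balc de s)%:R <= ub.

Definition phi (x : R) : R := x * expR (th * Num.sqrt x).
Definition lamt (t : nat) : R := y * (1 + 4 * C0 / n%:R) ^+ t.
Definition thr (t : nat) : R := n%:R * (3 * lamt t / kap).
(** The entropy comparison needs [s] balanced. Unbalanced colourings have exponentially small prior,
    and [up] only has to keep their mass below [U1]. *)
Definition bp (t : nat) (xs : seq X) : R := \sum_s \sum_s' wt xs s * wt xs s' *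
  ((balc de s && (thr t < q t s s')%R)%:R * phi (q t s s')).
Definition up (xs : seq X) : R := \sum_s wt xs s * (~~ balc de s)%:R.
Definition Gd (xs : seq X) : bool := (bp (size xs) xs <= expR (- (2 * lamt (size xs)))) && (up xs <= U1).

Lemma np : 0 < n%:R :> R. Proof. by rewrite ltr0n. Qed.

Lemma th_pos : 0 < th. Proof. by apply: lt_le_trans oth; exact: odds_gt0. Qed.

Lemma lamt_ge t : y <= lamt t.
Proof.
rewrite /lamt ler_peMr //; first by move: y1; lra.
apply: exprn_ege1; rewrite lerDl; apply: divr_ge0 => //; exact: mulr_ge0.
Qed.

Lemma lamt_le t : (t <= n)%N -> lamt t <= y * C4.
Proof.
move=> tn; rewrite /lamt; apply: ler_wpM2l; first by move: y1; lra.
have c0 : 0 <= 4 * C0 / n%:R by apply: divr_ge0 => //; exact: mulr_ge0.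
apply: (@le_trans _ _ ((1 + 4 * C0 / n%:R) ^+ n)).
  by apply: ler_weXn2l => //; rewrite lerDl.
apply: (@le_trans _ _ (expR (4 * C0 / n%:R) ^+ n)).
  by apply: lerXn2r; rewrite ?nnegrE ?expR_ge0 ?expR_ge1Dx // addr_ge0.
by rewrite -expRM_natl C4E ler_expR mulrC divfK // lt0r_neq0 ?np.
Qed.

Lemma thr_ge t : n%:R * (3 * y / kap) <= thr t.
Proof.
rewrite /thr ler_pM2l ?np // ler_pM2r ?invr_gt0 // ler_pM2l //; exact: lamt_ge.
Qed.

Lemma thr_le t : (t <= n)%N -> thr t <= Tn.
Proof. by move=> tn; rewrite /thr /Tn ler_pM2l ?np // ler_pM2r ?invr_gt0 // ler_pM2l // lamt_le. Qed.

Lemma phi_ge0 x : 0 <= x -> 0 <= phi x.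
Proof. by move=> x0; rewrite mulr_ge0 ?expR_ge0. Qed.

(** [Htyp] reserves [3 * kap / n] times the norm: once for the weight [exp (th * sqrt q)], once for
    the factor [q], and once for the decay [exp (- 3 * lamt t)] beyond the threshold. *)
Lemma Ex_bp t : (t <= n)%N ->
  Ex P t (fun xs => bp t xs) <= n%:R / kap * expR (- (3 * lamt t)) * n.+1%:R ^+ (k * k).
Proof.
move=> tn; have P0 (j : nat) (x : X) : 0 <= P j x by [apply: bern_ge0]; have P1 j : \sum_x P j x = 1 by apply: bern_sum1.
have np' := np; have t0 := th_pos.
rewrite /bp; rewrite Ex_sum //.
apply: (@le_trans _ _ (\sum_(s : Om) \sum_(s' : Om) k%:R ^- n * k%:R ^- n *
   ((balc de s && (thr t < q t s s')%R)%:R * phi (q t s s') * expR (odds / 2 * q t s s')))).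
  apply: ler_sum => s _; rewrite Ex_sum //; apply: ler_sum => s' _.
  rewrite (eq_Ex P0 (G := fun xs => ((balc de s && (thr t < q t s s')%R)%:R * phi (q t s s')) * (wt xs s * wt xs s'))); last first.
    by move=> xs _; rewrite mulrC.
  rewrite ExZ // Ex_wt2 // mulrCA -[leLHS]mulrA -[leRHS]mulrA; apply: ler_wpM2l; first exact: uniform_mu_ge0.
  apply: ler_wpM2l; first exact: uniform_mu_ge0.
  by apply: ler_wpM2l; [apply: mulr_ge0 => //; apply: phi_ge0; exact: qc_ge0|exact: Kt_prod].
apply: (pair_types k0' cl0 clk cll (t := t)).
  by rewrite mulr_ge0 ?expR_ge0 // divr_ge0 // ltW.
move=> s s'; set x := q t s s'; have x0 : 0 <= x := qc_ge0 _ _ _ _.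
case: (boolP (balc de s)) => [bs|_] /=; last first.
  by rewrite !mul0r; apply: mulr_ge0; [apply: mulr_ge0; [rewrite divr_ge0 // ltW|exact: expR_ge0]|exact: expR_ge0].
case: (ltP (thr t) x) => hx /=; last first.
  by rewrite !mul0r; apply: mulr_ge0; [apply: mulr_ge0; [rewrite divr_ge0 // ltW|exact: expR_ge0]|exact: expR_ge0].
rewrite mul1r.
have xd : x <= (1 + kk) ^+ 4 * ((1 + de) * (n%:R / k%:R)) * disp R (typ t s s').
  by apply: (qc_disp k0' k2) => c; case/andP: (forallP bs c).
have d0 : 0 <= disp R (typ t s s').
  rewrite /disp; apply: sumr_ge0 => c _; apply: mulr_ge0; first exact: rowc_ge0.
  by apply: sumr_ge0 => c' _; exact: sqr_ge0.
have ex : (odds / 2 + 3 * (kap / n%:R)) * x <= cl * disp R (typ t s s').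
  apply: (@le_trans _ _ ((odds / 2 + 3 * (kap / n%:R)) * ((1 + kk) ^+ 4 * ((1 + de) * (n%:R / k%:R)) * disp R (typ t s s')))).
    apply: ler_wpM2l => //; apply: addr_ge0; first by rewrite divr_ge0 // ltW // odds_gt0.
    by rewrite mulr_ge0 // divr_ge0 // ltW.
  by rewrite mulrA; apply: ler_wpM2r => //; rewrite mulrC.
have sx : th * Num.sqrt x <= kap / n%:R * x.
  have r0 := sqrtr_ge0 x.
  rewrite -{2}(sqr_sqrtr x0) expr2 mulrA; apply: ler_wpM2r => //.
  rewrite mulrAC ler_pdivlMr // -ler_pdivrMl // mulrC.
  rewrite -(@ler_pXn2r _ 2) ?nnegrE //; last by rewrite divr_ge0 // ?mulr_ge0 // ltW.
  rewrite (sqr_sqrtr x0); apply: le_trans Hth1 _; apply: le_trans (thr_ge t) _; exact: ltW.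
have xe : x <= n%:R / kap * expR (kap / n%:R * x).
  rewrite -ler_pdivrMl ?divr_gt0 // invf_div; apply: le_trans (expR_ge1Dx _); lra.
have tx : 3 * lamt t <= kap / n%:R * x.
  have -> : 3 * lamt t = kap / n%:R * thr t by rewrite /thr; field; rewrite !lt0r_neq0.
  by rewrite ler_pM2l ?divr_gt0 // ltW.
apply: (@le_trans _ _ (n%:R / kap * expR (kap / n%:R * x) * expR (th * Num.sqrt x) * expR (odds / 2 * x))).
  by rewrite /phi; do 2![apply: ler_wpM2r; first exact: expR_ge0].
rewrite -[leLHS]mulrA -[leLHS]mulrA -[leRHS]mulrA ler_pM2l ?divr_gt0 // -!expRD ler_expR.
by move: ex sx tx; rewrite mulrDl; lra.
Qed.

Lemma Ex_up t : Ex P t up <= ub.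
Proof.
have P0 (j : nat) (x : X) : 0 <= P j x by [apply: bern_ge0]; have P1 j : \sum_x P j x = 1 by apply: bern_sum1.
rewrite /up Ex_sum //; apply: le_trans Hub; apply: ler_sum => s _.
rewrite (eq_Ex P0 (G := fun xs => (~~ balc de s)%:R * wt xs s)) => [|xs _]; last by rewrite mulrC.
rewrite ExZ // Ex_wt //; first by rewrite mulrC.
by move=> i s1; apply: lc_mean.
Qed.

Lemma Gd_prob t : (t < n)%N -> Ex P t (fun xs => (~~ Gd xs)%:R) <=
  n%:R / kap * expR (- y) * n.+1%:R ^+ (k * k) + ub / U1.
Proof.
move=> tn; have P0 (j : nat) (x : X) : 0 <= P j x by [apply: bern_ge0]; have P1 j : \sum_x P j x = 1 by apply: bern_sum1.
have l0 i x (s : Om) : 0 <= l i x s by apply: lc_ge0.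
have w0 xs s : 0 <= wt xs s by apply: wt_ge0 => // s1; exact: uniform_mu_ge0.
apply: (@le_trans _ _ (Ex P t (fun xs => (expR (- (2 * lamt t)) < bp t xs)%R%:R + (U1 < up xs)%R%:R))).
  apply: Ex_le => // xs sx; rewrite /Gd sx negb_and -!ltNge.
  by case: (_ < bp _ _); case: (_ < up _) => /=; rewrite ?addr0 ?add0r // lerDl.
rewrite ExD //; apply: lerD.
  apply: le_trans (Ex_markov P0 _ _) _; first exact: expR_gt0.
    move=> xs _; apply: sumr_ge0 => s _; apply: sumr_ge0 => s' _; apply: mulr_ge0; first exact: mulr_ge0.
    by rewrite mulr_ge0 // phi_ge0 // qc_ge0.
  rewrite ler_pdivrMr ?expR_gt0 //; apply: le_trans (Ex_bp (ltnW tn)) _.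
  rewrite -!mulrA ler_pM2l ?np // ler_pM2l ?invr_gt0 //.
  rewrite [leLHS]mulrC [leRHS]mulrCA; apply: ler_wpM2l; first by rewrite exprn_ge0.
  by rewrite -expRD ler_expR; have := lamt_ge t; lra.
apply: le_trans (Ex_markov P0 U10 _) _.
  by move=> xs _; apply: sumr_ge0 => s _; rewrite mulr_ge0.
by apply: ler_wpM2r; [rewrite invr_ge0 ltW|exact: Ex_up].
Qed.

Section Good.
Variable xs : seq X.
Local Notation t := (size xs).
Hypothesis tn : (size xs < n)%N.
Hypothesis Gxs : Gd xs.
Hypothesis Wxs : expR (- lamt (size xs)) <= Wt xs.
Definition omx (s : Om) : R := wt xs s / Wt xs.

Lemma W_gt0 : 0 < Wt xs. Proof. by apply: lt_le_trans Wxs; exact: expR_gt0. Qed.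

Lemma wx_ge0 s : 0 <= wt xs s.
Proof. by apply: wt_ge0 => [s1|i x s1]; [exact: uniform_mu_ge0|apply: lc_ge0]. Qed.

Lemma omx_ge0 s : 0 <= omx s.
Proof. by rewrite divr_ge0 ?wx_ge0 // ltW ?W_gt0. Qed.

Lemma omx_sum : \sum_s omx s = 1.
Proof. by rewrite -mulr_suml divff // lt0r_neq0 ?W_gt0. Qed.

Lemma omx_upd s c : omx (upd n0 t s c) = omx s.
Proof. by rewrite /omx wt_upd. Qed.

Lemma W_ratio x : Wt (x :: xs) / Wt xs = \sum_s omx s * l t x s.
Proof.
rewrite /mass mulr_suml; apply: eq_bigr => s _ /=; rewrite /omx /mass; ring.
Qed.

(** Below the threshold the exponential weight is at most 4; beyond it [bp] and the barrier leave at
    most 1, and [HU] leaves at most 1 for unbalanced colourings. *)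
Lemma good_pairs : \sum_s \sum_s' omx s * omx s' * phi (q t s s') <= 6 * thr t.
Proof.
have Wp := W_gt0; have /andP[Gb Gu] := Gxs; have t0 := th_pos; have tt := ltnW tn.
have T1 : 1 <= thr t by apply: le_trans Hthr (thr_ge t).
have A (s s' : Om) : phi (q t s s') <= 4 * thr t + ((balc de s && (thr t < q t s s')%R)%:R * phi (q t s s')) +
   (~~ balc de s)%:R * phi ((k%:R * n%:R) ^+ 2).
  set x := q t s s'; have x0 : 0 <= x := qc_ge0 _ _ _ _.
  have f0 := phi_ge0 x0; have f1 : 0 <= phi ((k%:R * n%:R) ^+ 2) by apply: phi_ge0; exact: sqr_ge0.
  have T4 : 0 <= 4 * thr t by lra.
  case: (boolP (balc de s)) => _ /=; last first.
    rewrite mul0r addr0 mul1r; apply: (@le_trans _ _ (phi ((k%:R * n%:R) ^+ 2))); last by rewrite lerDr.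
    have qq : x <= (k%:R * n%:R) ^+ 2 := qc_le (size xs) s s'.
    rewrite /phi; apply: ler_pM; [exact: x0|exact: expR_ge0|exact: qq|].
    rewrite ler_expR; apply: ler_wpM2l; first exact: ltW.
    by rewrite ler_sqrt ?sqr_ge0.
  rewrite mul0r addr0; case: (ltP (thr t) x) => hx /=; first by rewrite mul1r lerDr.
  rewrite mul0r addr0 /phi [leLHS]mulrC; apply: ler_pM; [exact: expR_ge0|exact: x0| |exact: hx].
  have r0 := sqrtr_ge0 x.
  have a0 : 0 <= th * Num.sqrt x by rewrite mulr_ge0 // ltW.
  rewrite -[th * _]ger0_norm //; apply: expR_le4; rewrite ger0_norm //.
  rewrite -(@ler_pXn2r _ 2) ?nnegrE // expr1n exprMn sqr_sqrtr //; apply: le_trans Hth2.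
  by apply: ler_wpM2l; [exact: sqr_ge0|apply: le_trans hx (thr_le tt)].
apply: (@le_trans _ _ (\sum_s \sum_s' omx s * omx s' * (4 * thr t + ((balc de s && (thr t < q t s s')%R)%:R * phi (q t s s')) +
   (~~ balc de s)%:R * phi ((k%:R * n%:R) ^+ 2)))).
  apply: ler_sum => s _; apply: ler_sum => s' _; apply: ler_wpM2l => //; by rewrite mulr_ge0 ?omx_ge0.
rewrite (eq_bigr (fun s => omx s * (4 * thr t) + (\sum_s' wt xs s * wt xs s' * ((balc de s && (thr t < q t s s')%R)%:R * phi (q t s s'))) / Wt xs ^+ 2
   + wt xs s * (~~ balc de s)%:R * (phi ((k%:R * n%:R) ^+ 2) / Wt xs))); last first.
  move=> s _; transitivity (\sum_s' (omx s * (4 * thr t) * omx s' + wt xs s * wt xs s' * ((balc de s && (thr t < q t s s')%R)%:R * phi (q t s s')) / Wt xs ^+ 2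
      + wt xs s * (~~ balc de s)%:R * (phi ((k%:R * n%:R) ^+ 2) / Wt xs) * omx s')).
    by apply: eq_bigr => s' _; rewrite /omx; field; rewrite lt0r_neq0.
  have S1 a : \sum_s' a * omx s' = a by rewrite -mulr_sumr omx_sum mulr1.
  by rewrite !big_split /= !S1 -mulr_suml.
have S2 a : \sum_s omx s * a = a by rewrite -mulr_suml omx_sum mul1r.
rewrite !big_split /= S2 -[X in _ + X + _ <= _]mulr_suml -[X in _ + X <= _]mulr_suml -/(bp t xs) -/(up xs).
have e1 : bp t xs / Wt xs ^+ 2 <= 1.
  rewrite ler_pdivrMr ?exprn_gt0 // mul1r; apply: le_trans Gb _.
  rewrite -mulrN expRM_natl; apply: lerXn2r => //; rewrite nnegrE ?expR_ge0 // ltW //.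
have e2 : up xs * (phi ((k%:R * n%:R) ^+ 2) / Wt xs) <= 1.
  rewrite mulrA ler_pdivrMr // mul1r; apply: le_trans Wxs.
  apply: (@le_trans _ _ (expR (- (y * C4)))); last by rewrite ler_expR lerN2 lamt_le.
  rewrite expRN -[leRHS]mul1r ler_pdivlMr ?expR_gt0 //.
  apply: le_trans HU; apply: ler_wpM2r; first exact: expR_ge0.
  have E : phi ((k%:R * n%:R) ^+ 2) = (k%:R * n%:R) ^+ 2 * expR (th * (k%:R * n%:R)).
    by rewrite /phi sqrtr_sqr ger0_norm // mulr_ge0.
  rewrite E; apply: ler_wpM2r => //; by rewrite mulr_ge0 ?sqr_ge0 ?expR_ge0.
by move: e1 e2 T1; lra.
Qed.

Lemma good_pairs_Qb : \sum_s \sum_s' omx s * omx s' * (qc R t s s' * expR (th * Num.sqrt (qc R t s s'))) <= 6 * Tn.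
Proof. by apply: le_trans good_pairs _; rewrite ler_pM2l // thr_le // ltnW. Qed.

Lemma good_var : \sum_x P t x * (Wt (x :: xs) / Wt xs) ^+ 2 <= 1 + C0 * lamt t / n%:R.
Proof.
under eq_bigr do rewrite W_ratio.
apply: le_trans (step_second k2 p0 p2 tn omx_ge0 omx_sum omx_upd oth good_pairs) _.
rewrite lerD2l; have L0 : 0 <= lamt t by apply: le_trans (lamt_ge t); move: y1; lra.
have -> : odds ^+ 2 * (6 * thr t) = odds ^+ 2 * (18 * n%:R / kap) * lamt t.
  by rewrite /thr; field; rewrite lt0r_neq0.
by rewrite [leRHS]mulrAC; apply: ler_wpM2r.
Qed.

Lemma good_kill eta : \sum_x P t x * (\sum_s omx s * l t x s < 1 / 2)%R%:R <= eta ->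
  \sum_x P t x * (Wt (x :: xs) < Wt xs / 2)%R%:R <= eta.
Proof.
move=> h; apply: le_trans h; apply: ler_sum => x _; apply: ler_wpM2l; first exact: bern_ge0.
by rewrite -W_ratio ltr_pdivrMr ?W_gt0 // mul1r mulrC.
Qed.
End Good.

Variables (nu : nat) (sg Db Ms Mt : R).
Hypothesis sg0 : 0 < sg.
Hypothesis Db0 : 0 < Db.
Hypothesis HDb : 6 * Tn <= Db ^+ 2.
Hypothesis Ms0 : 0 <= Ms.
Hypothesis Mt0 : 0 <= Mt.
Hypothesis HMs : n%:R * Db <= Ms ^+ 2.
Hypothesis HMt : n%:R ^+ 2 * (6 * Tn) <= Mt ^+ 2.
Hypothesis small : 2 * kk ^+ 2 + nu%:R ^+ 2 * sg + 2 * odds * nu%:R * Ms + odds ^+ 2 * Mt <= 1 / 4.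

Definition kill_rate : R := 16 * (odds ^+ 3 * (6 * Tn) / th) +
  (p ^+ 4 * (6 * Tn / sg ^+ 2) ^+ 2 + 4 * p ^+ 3 * (6 * Tn / sg ^+ 2) * (Db / sg ^+ 2))
  + expR (p * n%:R) / 2 ^+ nu.

Lemma color_process : Ex P n (fun xs => (Wt xs < expR (- (y * C4)))%R%:R) <=
  n%:R * (n%:R / kap * expR (- y) * n.+1%:R ^+ (k * k) + ub / U1 + kill_rate + expR (- y)).
Proof.
have P0 (j : nat) (x : X) : 0 <= P j x by [apply: bern_ge0]; have P1 j : \sum_x P j x = 1 by apply: bern_sum1.
have l0 i x (s : Om) : 0 <= l i x s by apply: lc_ge0.
have l1 i (s : Om) : \sum_x P i x * l i x s = 1 by apply: lc_mean.
have np' := np; have t0 := th_pos; have y0 : 0 <= y by move: y1; lra.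
apply: (@le_trans _ _ (Ex P n (fun xs => (Wt xs < expR (- lamt n))%R%:R))).
  apply: Ex_le => // xs _; rewrite ler_nat; case: (ltP _ (expR (- (y * C4)))) => // h.
  case: (ltP _ (expR (- lamt n))) => // h2.
  have := le_lt_trans h2 h; rewrite ltr_expR ltrN2 => h3.
  by have := lt_le_trans h3 (lamt_le (leqnn n)); rewrite ltxx.
have Tn0 : 0 <= Tn.
  by rewrite /Tn mulr_ge0 // divr_ge0 ?(ltW kap0) // mulr_ge0 // mulr_ge0 // C4E expR_ge0.
have k_ge0 : 0 <= kill_rate.
  have o0 := ltW (odds_gt0 p0 p2).
  rewrite /kill_rate; apply: addr_ge0; last by rewrite divr_ge0 ?expR_ge0 // exprn_ge0.
  apply: addr_ge0; first by rewrite mulr_ge0 // divr_ge0 ?(ltW t0) // mulr_ge0 ?exprn_ge0 // mulr_ge0.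
  have T6 : 0 <= 6 * Tn / sg ^+ 2 by rewrite divr_ge0 ?sqr_ge0 // mulr_ge0.
  apply: addr_ge0; first by rewrite mulr_ge0 ?sqr_ge0 // exprn_ge0 // ltW.
  apply: mulr_ge0; last by rewrite divr_ge0 ?sqr_ge0 // ltW.
  by rewrite mulr_ge0 // mulr_ge0 // exprn_ge0 // ltW.
have sum_lam t : \sum_(r < t) 2 * (C0 * lamt r / n%:R) = (lamt t - y) / 2.
  elim: t => [|t IH]; first by rewrite big_ord0 /lamt expr0 mulr1 subrr mul0r.
  rewrite big_ord_recr /= IH /lamt exprS.
  by field; rewrite lt0r_neq0.
apply: le_trans (process_lower_bound (G := Gd) (v := fun t => C0 * lamt t / n%:R) (eta := fun=> kill_rate)
  (gamma := fun=> n%:R / kap * expR (- y) * n.+1%:R ^+ (k * k) + ub / U1) P0 P1 uniform_mu_ge0 uniform_mu_sum1 l0 l1 _ _ _ _ _) _.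
- exact: le_trans (lamt_ge 0).
- by move=> xs xn gx wx; exact: good_var.
- move=> xs xn gx wx; apply: good_kill => //.
  exact: (step_killed k2 p0 p2 xn (omx_ge0 wx) (omx_sum wx) (omx_upd xn) th1 oth (good_pairs_Qb xn gx wx) sg0 Db0 HDb Ms0 Mt0 HMs HMt small).
- by [].
- by move=> t tn; exact: Gd_prob.
apply: (@le_trans _ _ (\sum_(s < n) (n%:R / kap * expR (- y) * n.+1%:R ^+ (k * k) + ub / U1 + kill_rate + expR (- y)))).
  apply: ler_sum => s _; rewrite lerD2l ler_expR sum_lam.
  by have := lamt_ge s.+1; lra.
by rewrite sumr_const card_ord -[leLHS]mulr_natl.
Qed.
End ColorProcess.

(** * Choice of the scales for colourings *)

Lemma root32 (R : realType) (n : nat) (Y : R) : (0 < n)%N -> Y ^+ 32 <= n%:R -> 0 <= Y ->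
  exists2 y : R, Y <= y & y ^+ 32 = n%:R.
Proof.
move=> n0 hY Y0; have np : 0 < n%:R :> R by rewrite ltr0n.
have E : expR (ln n%:R / 32) ^+ 32 = n%:R :> R.
  by rewrite -expRM_natl (_ : 32%:R * _ = ln n%:R) ?lnK ?posrE //; field.
exists (expR (ln n%:R / 32)) => //; rewrite leNgt; apply/negP => h.
have : (expR (ln n%:R / 32)) ^+ 32 < Y ^+ 32 by rewrite ltrXn2r ?expR_ge0.
by rewrite E ltNge hY.
Qed.

Lemma poly_exp (R : realType) (M : nat) (y : R) : 0 < y ->
  y ^+ M * expR (- (y / 2)) <= (2 * M.+1%:R) ^+ M.+1 / y.
Proof.
move=> y0; rewrite ler_pdivlMr // mulrAC -exprSr expRN ler_pdivrMr ?expR_gt0 //.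
by apply: pow_le_expR => //; exact: ltW.
Qed.

Definition kconst (R : realType) (A B D0 dd : R) : R :=
  96 * dd ^+ 3 * A * B + dd ^+ 4 * (6 * (256 * A)) ^+ 2 + 4 * dd ^+ 3 * (6 * (256 * A)) * (256 * D0).

Lemma kconst_ge0 (R : realType) (A B D0 dd : R) : 0 <= A -> 0 <= B -> 0 <= D0 -> 0 <= dd ->
  0 <= kconst A B D0 dd.
Proof.
move=> A0 B0 D0' d0; have d3 : 0 <= dd ^+ 3 by exact: exprn_ge0.
have A2 : 0 <= 6 * (256 * A) by apply: mulr_ge0; [exact: ler0n|apply: mulr_ge0; [exact: ler0n|]].
apply: addr_ge0; last first.
  by apply: mulr_ge0; [apply: mulr_ge0 => //; apply: mulr_ge0 => //; exact: ler0n|apply: mulr_ge0 => //; exact: ler0n].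
apply: addr_ge0; last by apply: mulr_ge0; [exact: exprn_ge0|exact: sqr_ge0].
by apply: mulr_ge0 => //; apply: mulr_ge0 => //; apply: mulr_ge0 => //; exact: ler0n.
Qed.

Section ColorRate.
Variables (R : realType) (y p o A B D0 dd sg : R).
Hypothesis y1 : 1 <= y.
Hypothesis p0 : 0 <= p.
Hypothesis po : p <= o.
Hypothesis od : o <= dd / y ^+ 32.
Hypothesis A0 : 0 <= A.
Hypothesis B0 : 0 < B.
Hypothesis D00 : 0 <= D0.
Hypothesis sgE : sg = 1 / (16 * y ^+ 2).

(** Multiplied by the number [y ^ 32] of steps, the tail and the two kinds of double pairs are of
    orders [y ^- 14], [y ^- 22] and [y ^- 6]; [kconst] collects their coefficients. *)
Lemma kill_poly :
  y ^+ 32 * (16 * (o ^+ 3 * (6 * (y ^+ 33 * A)) / (1 / (B * y ^+ 17))) +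
   (p ^+ 4 * (6 * (y ^+ 33 * A) / sg ^+ 2) ^+ 2 +
    4 * p ^+ 3 * (6 * (y ^+ 33 * A) / sg ^+ 2) * (D0 * y ^+ 17 / sg ^+ 2))) <=
  kconst A B D0 dd / y.
Proof.
have yp : 0 < y by move: y1; lra.
have yn : y != 0 by rewrite lt0r_neq0.
have yk j : 0 < y ^+ j by rewrite exprn_gt0.
have o0 : 0 <= o by apply: le_trans po.
have d0 : 0 <= dd by move: (le_trans o0 od); rewrite pmulr_lge0 // invr_gt0.
have w0 : 0 <= dd / y ^+ 32 by rewrite divr_ge0 // ltW.
have inv j (C : R) : 0 <= C -> C / y ^+ j.+1 <= C / y.
  move=> C0; apply: ler_wpM2l => //; rewrite lef_pV2 ?posrE //.
  by rewrite exprS ler_peMr ?(ltW yp) // exprn_ege1.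
have sg2 : (sg ^+ 2)^-1 = 256 * y ^+ 4 by rewrite sgE; field.
have op3 : o ^+ 3 <= (dd / y ^+ 32) ^+ 3 by rewrite lerXn2r ?nnegrE.
have pp : p <= dd / y ^+ 32 by apply: le_trans po od.
have pp3 : p ^+ 3 <= (dd / y ^+ 32) ^+ 3 by rewrite lerXn2r ?nnegrE.
have pp4 : p ^+ 4 <= (dd / y ^+ 32) ^+ 4 by rewrite lerXn2r ?nnegrE.
rewrite mulrDr [X in _ + X <= _]mulrDr [leRHS]mulrDl [X in _ <= X + _]mulrDl -[leRHS]addrA; apply: lerD; last apply: lerD.
- apply: (@le_trans _ _ (y ^+ 32 * (16 * ((dd / y ^+ 32) ^+ 3 * (6 * (y ^+ 33 * A)) / (1 / (B * y ^+ 17)))))).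
    rewrite ler_pM2l // ler_pM2l // ler_pM2r; last by rewrite invr_gt0 divr_gt0 // mulr_gt0.
    by apply: ler_wpM2r => //; rewrite mulr_ge0 // mulr_ge0 // ltW.
  apply: (@le_trans _ _ (96 * dd ^+ 3 * A * B / y ^+ 14)); first by apply: eq_ler; field; rewrite yn lt0r_neq0.
  by apply: inv; apply: mulr_ge0; [apply: mulr_ge0 => //; apply: mulr_ge0; [exact: ler0n|exact: exprn_ge0]|exact: ltW].
- apply: (@le_trans _ _ (y ^+ 32 * ((dd / y ^+ 32) ^+ 4 * (6 * (y ^+ 33 * A) / sg ^+ 2) ^+ 2))).
    by rewrite ler_pM2l //; apply: ler_wpM2r => //; exact: sqr_ge0.
  apply: (@le_trans _ _ (dd ^+ 4 * (6 * (256 * A)) ^+ 2 / y ^+ 22)); first by rewrite sg2; apply: eq_ler; field.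
  by apply: inv; apply: mulr_ge0; [exact: exprn_ge0|exact: sqr_ge0].
- apply: (@le_trans _ _ (y ^+ 32 * (4 * (dd / y ^+ 32) ^+ 3 * (6 * (y ^+ 33 * A) / sg ^+ 2) * (D0 * y ^+ 17 / sg ^+ 2)))).
    rewrite ler_pM2l //; apply: ler_wpM2r.
      by apply: divr_ge0; [apply: mulr_ge0 => //; exact: ltW|exact: sqr_ge0].
    apply: ler_wpM2r.
      by apply: divr_ge0; [apply: mulr_ge0 => //; apply: mulr_ge0 => //; exact: ltW|exact: sqr_ge0].
    by rewrite ler_pM2l.
  apply: (@le_trans _ _ (4 * dd ^+ 3 * (6 * (256 * A)) * (256 * D0) / y ^+ 6)); first by rewrite sg2; apply: eq_ler; field.
  have A2 : 0 <= 6 * (256 * A) by apply: mulr_ge0; [exact: ler0n|apply: mulr_ge0; [exact: ler0n|]].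
  apply: inv; apply: mulr_ge0; last by apply: mulr_ge0 => //; exact: ler0n.
  by apply: mulr_ge0 => //; apply: mulr_ge0; [exact: ler0n|exact: exprn_ge0].
Qed.
End ColorRate.

(** All scales are powers of [y] with [n = y ^ 32]. The barrier ends at exponent [y * C4], below
    every linear rate [d0 * n] for large [n]. *)
Lemma color_mass (R : realType) (k : nat) (cl dd kap de d0 z : R) : (8 < k)%N ->
  0 < cl -> 4 * cl <= k%:R -> 1 + cl + ln (4 * cl) <= ln k%:R ->
  0 < kap -> 0 < de -> de <= 1 -> 0 < dd ->
  (1 + kk R k) ^+ 4 * ((1 + de) / k%:R) * (dd / 2 + 3 * kap) <= cl ->
  0 < d0 -> 0 < z ->
  exists N, forall n (n0 : (0 < n)%N), (N <= n)%N -> forall p : R, 0 < p -> p <= 1 / 8 ->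
    odds p * n%:R <= dd ->
    Ex (bern (n := n) p) n (fun xs => (mass (fun _ : {ffun 'I_n -> 'I_k} => k%:R ^- n) (lc p n0 (k := k)) xs < expR (- (d0 * n%:R)))%R%:R) <= z.
Proof.
move=> k8 cl0 clk cll kap0 de0 de1 dd0 Hcl d00 z0.
have k2 : (1 < k)%N by apply: leq_trans k8.
have kN0 : (0 < k)%N by apply: leq_trans k8.
have kp : 0 < k%:R :> R by rewrite ltr0n.
pose C0 := 18 * dd ^+ 2 / kap; pose C4 := expR (4 * C0); pose A := 3 * C4 / kap.
pose B := 1 + A; pose D0 := 1 + 6 * A; pose c := de ^+ 2 / 16 / k%:R.
have C00 : 0 <= C0 by rewrite divr_ge0 ?(ltW kap0) // mulr_ge0 ?sqr_ge0.
have C40 : 0 < C4 := expR_gt0 _.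
have A0 : 0 < A by rewrite divr_gt0 // mulr_gt0.
have B1 : 1 <= B by rewrite /B; move: A0; clear; lra.
have D1 : 1 <= D0 by rewrite /D0; move: A0; clear; lra.
have B0 : 0 < B by move: B1; clear; lra.
have D00 : 0 < D0 by move: D1; clear; lra.
have c0 : 0 < c by rewrite !divr_gt0 // exprn_gt0.
pose M1 := (64 + 32 * (k * k))%N.
have [Kp [Kp0 KpP]] : exists Kp : nat -> R, (forall M, 0 <= Kp M) /\
    forall M y, 0 < y -> y ^+ M * expR (- (y / 2)) <= Kp M / y.
  exists (fun M => (2 * M.+1%:R) ^+ M.+1); split=> [M|M y]; last exact: poly_exp.
  by apply: exprn_ge0; apply: mulr_ge0; exact: ler0n.
pose E := 2 ^+ (k * k) / kap * Kp M1 + 2 * k%:R ^+ 3 * Kp 96 +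
   kconst A B D0 dd +
   expR (dd + 1) * Kp 32 + Kp 32.
have kc0 : 0 <= kconst A B D0 dd by apply: kconst_ge0; exact: ltW.
have E0 : 0 <= E.
  have a1 : 0 <= 2 ^+ (k * k) / kap * Kp M1.
    by apply: mulr_ge0; [apply: divr_ge0; [apply: exprn_ge0; exact: ler0n|exact: ltW]|exact: Kp0].
  have a2 : 0 <= 2 * k%:R ^+ 3 * Kp 96%N.
    by apply: mulr_ge0; [apply: mulr_ge0; [exact: ler0n|apply: exprn_ge0; exact: ler0n]|exact: Kp0].
  have a3 : 0 <= expR (dd + 1) * Kp 32%N by apply: mulr_ge0; [exact: expR_ge0|exact: Kp0].
  exact: (addr_ge0 (addr_ge0 (addr_ge0 (addr_ge0 a1 a2) kc0) a3) (Kp0 32%N)).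
pose Y0 := 1 + dd * B + kap^-1 + kap + (k%:R + C4 + 1) / c + 32 * dd * D0 + 16 * dd ^+ 2 * D0 + C4 / d0 + E / z.
have n1 : 0 <= dd * B by rewrite mulr_ge0 // ltW.
have n2 : 0 <= kap^-1 by rewrite invr_ge0 ltW.
have n3 : 0 <= (k%:R + C4 + 1) / c by rewrite divr_ge0 ?(ltW c0) // !addr_ge0 // ltW.
have n4 : 0 <= 32 * dd * D0 by rewrite !mulr_ge0 // ltW.
have n5 : 0 <= 16 * dd ^+ 2 * D0 by rewrite !mulr_ge0 ?sqr_ge0 // ltW.
have n6 : 0 <= C4 / d0 by rewrite divr_ge0 // ltW.
have n7 : 0 <= E / z by rewrite divr_ge0 // ltW.
have kap1 := ltW kap0.
have Y00 : 0 <= Y0 by rewrite !addr_ge0.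
have [N HN] := ev_nat (Y0 ^+ 32); exists N => n n0 /HN nY p p0 p2 od.
have [y Yy y32] := root32 n0 nY Y00.
have [y1 yB yk1 yk2 yc] : [/\ 1 <= y, dd * B <= y, kap^-1 <= y, kap <= y & (k%:R + C4 + 1) / c <= y].
  by move: Yy n1 n2 n3 n4 n5 n6 n7 kap1; rewrite /Y0; clear; split; lra.
have [yd1 yd2 yC yE] : [/\ 32 * dd * D0 <= y, 16 * dd ^+ 2 * D0 <= y, C4 / d0 <= y & E / z <= y].
  by move: Yy n1 n2 n3 n4 n5 n6 n7 kap1; rewrite /Y0; clear; split; lra.
have yp : 0 < y by move: y1; clear; lra.
have yn : y != 0 by rewrite lt0r_neq0.
have kan : kap != 0 by rewrite lt0r_neq0.
have Bn : B != 0 by rewrite lt0r_neq0.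
have ypow i j : (i <= j)%N -> y ^+ i <= y ^+ j by move=> ij; apply: ler_weXn2l.
have yk j : 0 < y ^+ j by rewrite exprn_gt0.
have big C i j : C <= y -> (i < j)%N -> C * y ^+ i <= y ^+ j.
  by move=> Cy ij; apply: le_trans (ypow _ _ ij); rewrite exprS ler_pM2r.
have np : 0 < n%:R :> R by rewrite ltr0n.
have od' : odds p <= dd / y ^+ 32 by rewrite y32 ler_pdivlMr.
have o0 := odds_gt0 p0 p2.
have po : p <= odds p.
  rewrite /odds ler_pdivlMr; last by move: p2; clear; lra.
  by rewrite ler_piMr ?(ltW p0) //; move: p0; clear; lra.
(* [th ^ 2 * Tn] must not exceed 1 with [Tn] of order [y ^ 33], hence the exponent 17; [odds], of
   order [y ^- 32], is still far below. *)
pose th := 1 / (B * y ^+ 17).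
have th0 : 0 < th by rewrite divr_gt0 // mulr_gt0.
have TnE : Tn n y kap C4 = y ^+ 33 * A by rewrite /Tn -y32 /A; field.
pose U1 := ((k%:R * n%:R) ^+ 2 * expR (th * (k%:R * n%:R)) * expR (y * C4))^-1.
have kn0 : 0 < k%:R * n%:R :> R by rewrite mulr_gt0.
have U1i : 0 < (k%:R * n%:R) ^+ 2 * expR (th * (k%:R * n%:R)) * expR (y * C4).
  by rewrite !mulr_gt0 ?expR_gt0.
(* Among [y] neighbours the pairs that are not significant then remove at most 1/16. Having more
   neighbours is exponentially unlikely in [y], the mean degree being bounded. *)
pose nu := Num.truncn y; pose sg := 1 / (16 * y ^+ 2).
have nuy : nu%:R <= y by rewrite truncn_le // ltW.
have yC' : y * C4 <= d0 * n%:R.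
  move: yC; rewrite ler_pdivrMr // => h; rewrite -y32.
  apply: (@le_trans _ _ (y * (y * d0))); first by rewrite ler_pM2l.
  by rewrite mulrA mulrC ler_pM2l // -expr2 ypow.
(* Here [8 < k] enters: one significant pair removes at most [2 * kk ^ 2], which must leave room
   below 1/4 for the other three terms. *)
have kk8 : kk R k <= 1 / 8.
  rewrite /kk mul1r lef_pV2 ?posrE ?ltr0n //; first by rewrite (ler_nat R 8) -ltnS prednK.
  by rewrite -ltnS prednK.
have kk0 := ltW (kk_gt0 R k2).
apply: (@le_trans _ _ (Ex (bern (n := n) p) n (fun xs => (mass (fun _ : {ffun 'I_n -> 'I_k} => k%:R ^- n) (lc p n0 (k := k)) xs < expR (- (y * C4)))%R%:R))).
  apply: Ex_le => [t x|xs _]; first exact: bern_ge0.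
  rewrite ler_nat; case: (ltP _ (expR (- (d0 * _)))) => // h; case: (ltP _ (expR (- (y * C4)))) => // h2.
  have := le_lt_trans h2 h; rewrite ltr_expR ltrN2 => h3.
  by have := lt_le_trans h3 yC'; rewrite ltxx.
have Hth1 : (th * n%:R / kap) ^+ 2 <= n%:R * (3 * y / kap).
  rewrite -y32 /th (_ : _ ^+ 2 = (y ^+ 30 / kap) * (1 / B ^+ 2 / kap)); last by field; rewrite kan Bn yn.
  rewrite (_ : y ^+ 32 * _ = (y ^+ 30 / kap) * (3 * y ^+ 3)); last by field.
  rewrite ler_pM2l ?divr_gt0 //; apply: (@le_trans _ _ (1 * kap^-1)).
    rewrite ler_pM2r ?invr_gt0 // ler_pdivrMr ?exprn_gt0 // mul1r.
    by rewrite expr_ge1 // ltW.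
  rewrite mul1r; apply: le_trans yk1 _; apply: (@le_trans _ _ (y ^+ 3)); first by rewrite -[leLHS]expr1 ypow.
  by rewrite ler_peMl // ?ltW // ltr1n.
have Hth2 : th ^+ 2 * Tn n y kap C4 <= 1.
  rewrite TnE /th [leLHS](_ : _ = A / B ^+ 2 / y); last by field; rewrite Bn yn.
  rewrite ler_pdivrMr // mul1r; apply: le_trans y1; rewrite ler_pdivrMr ?exprn_gt0 // mul1r.
  by rewrite /B; move: A0; clear; nra.
have oth : odds p <= th.
  apply: le_trans od' _; rewrite /th ler_pdivrMr // mul1r ler_pdivlMl ?mulr_gt0 //.
  rewrite mulrC mulrA; apply: le_trans (big _ 17 32 yB _); by [].
have th1 : th <= 1.
  by rewrite /th ler_pdivrMr ?mulr_gt0 // mul1r mulr_ege1 // exprn_ege1.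
have CP := @color_process R n k p n0 k2 p0 p2 cl y kap th C0 de U1 (2 * k%:R * expR (- (de ^+ 2 / 16 * (n%:R / k%:R)))) C4 cl0 clk cll y1 kap0 th1 oth.
have Htyp : (1 + kk R k) ^+ 4 * ((1 + de) * (n%:R / k%:R)) * (odds p / 2 + 3 * (kap / n%:R)) <= cl.
  apply: le_trans Hcl.
  rewrite (_ : (1 + kk R k) ^+ 4 * ((1 + de) * (n%:R / k%:R)) * (odds p / 2 + 3 * (kap / n%:R)) =
    (1 + kk R k) ^+ 4 * ((1 + de) / k%:R) * (odds p * n%:R / 2 + 3 * kap)); last by field; rewrite !lt0r_neq0.
  apply: ler_wpM2l; first by rewrite mulr_ge0 ?exprn_ge0 ?divr_ge0 ?addr_ge0 // ltW.
  by move: od; clear; lra.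
have Hthr : 1 <= n%:R * (3 * y / kap).
  rewrite mulrA ler_pdivlMr // mul1r; apply: le_trans yk2 _; rewrite mulrA -y32 mulrAC -exprSr.
  apply: (@le_trans _ _ (y ^+ 33)); first by rewrite -[leLHS]expr1 ypow.
  by rewrite ler_peMr // ?ltW // ltr1n.
have HC0 : odds p ^+ 2 * (18 * n%:R / kap) <= C0 / n%:R.
  apply: (@le_trans _ _ ((dd / n%:R) ^+ 2 * (18 * n%:R / kap))).
    apply: ler_wpM2r; first by rewrite divr_ge0 // mulr_ge0.
    have od2 : odds p <= dd / n%:R by rewrite ler_pdivlMr.
    by apply: lerXn2r => //; rewrite nnegrE ?(ltW o0) // divr_ge0 // ltW.
  by apply: eq_ler; rewrite /C0; field; rewrite !lt0r_neq0.
have HU : U1 * ((k%:R * n%:R) ^+ 2 * expR (th * (k%:R * n%:R))) * expR (y * C4) <= 1.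
  by rewrite -mulrA /U1 mulVf // lt0r_neq0.
have Hub := balc_prob n kN0 (ltW de0) de1.
have sg0 : 0 < sg by rewrite divr_gt0 // mulr_gt0.
have Db0 : 0 < D0 * y ^+ 17 by exact: mulr_gt0.
have HDb : 6 * Tn n y kap C4 <= (D0 * y ^+ 17) ^+ 2.
  rewrite TnE exprMn (_ : (y ^+ 17) ^+ 2 = y ^+ 33 * y); last by ring.
  apply: (@le_trans _ _ (D0 * (y ^+ 33 * y))).
    rewrite mulrCA [leRHS]mulrCA ler_pM2l //; apply: (@le_trans _ _ D0); first by rewrite /D0; clear; lra.
    by rewrite ler_peMr // ltW.
  by rewrite ler_pM2r ?mulr_gt0 // expr2 ler_peMr // ltW.
have HMs : n%:R * (D0 * y ^+ 17) <= (D0 * y ^+ 25) ^+ 2.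
  rewrite -y32 (_ : y ^+ 32 * (D0 * y ^+ 17) = D0 * y ^+ 49); last by ring.
  rewrite exprMn -exprM; apply: ler_pM; [exact: ltW|exact: ltW| |exact: ypow].
  by rewrite expr2 ler_peMr // ltW.
have HMt : n%:R ^+ 2 * (6 * Tn n y kap C4) <= (D0 * y ^+ 49) ^+ 2.
  rewrite TnE -y32 (_ : (y ^+ 32) ^+ 2 * (6 * (y ^+ 33 * A)) = 6 * A * y ^+ 97); last by ring.
  rewrite exprMn -exprM; apply: ler_pM; [by rewrite mulr_ge0 // ltW|exact: ltW| |exact: ypow].
  apply: (@le_trans _ _ D0); first by rewrite /D0; clear; lra.
  by rewrite expr2 ler_peMr // ltW.
have small : 2 * kk R k ^+ 2 + nu%:R ^+ 2 * sg + 2 * odds p * nu%:R * (D0 * y ^+ 25) + odds p ^+ 2 * (D0 * y ^+ 49) <= 1 / 4.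
  have s1 : nu%:R ^+ 2 * sg <= 1 / 16.
    rewrite /sg mulrA mulr1 ler_pdivrMr ?mulr_gt0 // (_ : 1 / 16 * (16 * y ^+ 2) = y ^+ 2); last by field.
    by rewrite lerXn2r ?nnegrE // ltW.
  have s2 : 2 * odds p * nu%:R * (D0 * y ^+ 25) <= 1 / 16.
    apply: (@le_trans _ _ (2 * (dd / y ^+ 32) * y * (D0 * y ^+ 25))).
      apply: ler_wpM2r; first by rewrite mulr_ge0 // ltW.
      by apply: ler_pM; [rewrite mulr_ge0 // ltW|exact: ler0n|rewrite ler_pM2l|exact: nuy].
    rewrite [leLHS](_ : _ = 2 * dd * D0 / y ^+ 6); last by field.
    by rewrite ler_pdivrMr //; have := big _ 0%N 6%N yd1 isT; rewrite expr0 mulr1; clear; lra.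
  have s3 : odds p ^+ 2 * (D0 * y ^+ 49) <= 1 / 16.
    apply: (@le_trans _ _ ((dd / y ^+ 32) ^+ 2 * (D0 * y ^+ 49))).
      apply: ler_wpM2r; first by rewrite mulr_ge0 // ltW.
      by apply: lerXn2r => //; rewrite nnegrE ?(ltW o0) // divr_ge0 // ltW.
    rewrite [leLHS](_ : _ = dd ^+ 2 * D0 / y ^+ 15); last by field.
    by rewrite ler_pdivrMr //; have := big _ 0%N 15%N yd2 isT; rewrite expr0 mulr1; clear; lra.
  have s4 : 2 * kk R k ^+ 2 <= 1 / 32 by move: kk8 kk0; clear; nra.
  by move: s1 s2 s3 s4; clear; lra.
have U10 : 0 < U1 by rewrite invr_gt0.
have Ms0 : 0 <= D0 * y ^+ 25 by rewrite mulr_ge0 // ltW.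
have Mt0 : 0 <= D0 * y ^+ 49 by rewrite mulr_ge0 // ltW.
apply: le_trans (CP Htyp C00 erefl Hth1 Hth2 Hthr HC0 U10 HU Hub nu sg (D0 * y ^+ 17) (D0 * y ^+ 25) (D0 * y ^+ 49) sg0 Db0 HDb Ms0 Mt0 HMs HMt small) _.
rewrite /kill_rate TnE -/th.
have ey : expR (- y) <= expR (- (y / 2)) by rewrite ler_expR; move: yp; clear; lra.
have e20 : 0 <= expR (- (y / 2)) := expR_ge0 _.
have P1 M C : 0 <= C -> C * (y ^+ M * expR (- (y / 2))) <= C * Kp M / y.
  by move=> C0'; rewrite -mulrA; apply: ler_wpM2l => //; exact: KpP.
have f1 : n%:R * (n%:R / kap * expR (- y) * n.+1%:R ^+ (k * k)) <= 2 ^+ (k * k) / kap * Kp M1 / y.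
  apply: le_trans (P1 M1 _ _); last by rewrite divr_ge0 // exprn_ge0.
  apply: (@le_trans _ _ (n%:R * (n%:R / kap * expR (- (y / 2)) * (2 * n%:R) ^+ (k * k)))).
    rewrite ler_pM2l //; apply: ler_pM; rewrite ?exprn_ge0 ?mulr_ge0 ?invr_ge0 ?expR_ge0 //.
      by apply: ler_wpM2l => //; rewrite divr_ge0.
    apply: lerXn2r; rewrite ?nnegrE ?mulr_ge0 // -natr1.
    by have : 1 <= n%:R :> R by [rewrite ler1n]; clear; lra.
  rewrite exprMn -y32 /M1 exprD -!exprM; apply: eq_ler; rewrite (exprM y 32 2); ring.
have f2 : n%:R * (2 * k%:R * expR (- (de ^+ 2 / 16 * (n%:R / k%:R))) / U1) <= 2 * k%:R ^+ 3 * Kp 96 / y.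
  apply: le_trans (P1 96%N _ _); last by rewrite mulr_ge0 // exprn_ge0.
  rewrite /U1 invrK.
  have -> : n%:R * (2 * k%:R * expR (- (de ^+ 2 / 16 * (n%:R / k%:R))) *
     ((k%:R * n%:R) ^+ 2 * expR (th * (k%:R * n%:R)) * expR (y * C4))) =
    2 * k%:R ^+ 3 * (n%:R ^+ 3 * (expR (- (de ^+ 2 / 16 * (n%:R / k%:R))) * expR (th * (k%:R * n%:R)) * expR (y * C4))) by ring.
  apply: ler_wpM2l; first by rewrite mulr_ge0 // exprn_ge0.
  rewrite -y32 -exprM ler_pM2l // -!expRD ler_expR.
  have g1 : th * (k%:R * y ^+ 32) <= k%:R * y ^+ 15.
    rewrite (_ : th * _ = k%:R * y ^+ 15 / B); last by rewrite /th; field; rewrite Bn yn.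
    by rewrite ler_pdivrMr // ler_peMr // mulr_ge0 // ltW.
  have g2 : y * C4 <= C4 * y ^+ 15 by rewrite mulrC ler_pM2l // -[leLHS]expr1 ypow.
  have g3 : y / 2 <= y ^+ 15.
    by apply: (@le_trans _ _ y); [move: yp; clear; lra|rewrite -[leLHS]expr1 ypow].
  have g4 : (k%:R + C4 + 1) * y ^+ 15 <= c * y ^+ 32.
    have : (k%:R + C4 + 1) / c * y ^+ 15 <= y ^+ 32 by exact: big.
    by rewrite mulrAC ler_pdivrMr // [leRHS]mulrC.
  have -> : de ^+ 2 / 16 * (y ^+ 32 / k%:R) = c * y ^+ 32 by rewrite /c; field; rewrite lt0r_neq0.
  by move: g1 g2 g3 g4; clear; lra.
have f3 := @kill_poly R y p (odds p) A B D0 dd sg y1 (ltW p0) po od' (ltW A0) B0 (ltW D00) erefl.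
have f4 : n%:R * (expR (p * n%:R) / 2 ^+ nu) <= expR (dd + 1) * Kp 32 / y.
  apply: le_trans (P1 32%N _ _); last exact: expR_ge0.
  rewrite [leRHS]mulrCA y32 ler_pM2l // ler_pdivrMr ?exprn_gt0 //.
  have h2 : expR (nu%:R * 2^-1) <= 2 ^+ nu :> R.
    rewrite expRM_natl; apply: lerXn2r; rewrite ?nnegrE ?expR_ge0 //.
    have : (expR 2^-1)^-1 >= 1 - 2^-1 :> R by rewrite -expRN; exact: expR_ge1Dx.
    rewrite (_ : 1 - 2^-1 = 2^-1 :> R); last by field.
    by rewrite lef_pV2 ?posrE ?expR_gt0.
  apply: (@le_trans _ _ (expR (dd + 1) * expR (- (y / 2)) * expR (nu%:R * 2^-1))); last first.
    by apply: ler_wpM2l => //; rewrite mulr_ge0 ?expR_ge0.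
  rewrite -!expRD ler_expR; have := truncn_ge_sub1 y; rewrite -/nu.
  have : p * n%:R <= dd by apply: le_trans od; rewrite ler_pM2r.
  by clear; lra.
have f5 : n%:R * expR (- y) <= Kp 32 / y.
  rewrite -[Kp 32]mul1r; apply: le_trans (P1 32%N 1 _); rewrite ?mul1r -?y32 ?ler_pM2l //.
apply: (@le_trans _ _ (E / y)); last first.
  by rewrite ler_pdivrMr // mulrC -ler_pdivrMr.
rewrite /E [leRHS]mulrDl [leLHS]mulrDr; apply: lerD; last exact: f5.
rewrite [X in _ * X <= _]addrA [leRHS]mulrDl [leLHS]mulrDr; apply: lerD; last exact: f4.
rewrite [leRHS]mulrDl [leLHS]mulrDr; apply: lerD; last by move: f3; rewrite y32.
by rewrite [leRHS]mulrDl [leLHS]mulrDr; apply: lerD; [exact: f1|exact: f2].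
Qed.

(** * From binomial edge sets to a fixed number of edges *)

Definition kedges (k n : nat) : {set {set 'I_n}} := [set e : {set 'I_n} | #|e| == k]%SET.

Lemma hypergraph_subs k n m : uniform_hypergraphs k n m = subs (kedges k n) m.
Proof.
apply/setP => F; rewrite !inE andbC; congr (_ && _).
apply/forallP/fintype.subsetP => h C.
  by move=> CF; have := h C; rewrite CF inE.
by apply/implyP => CF; have := h C CF; rewrite inE.
Qed.

Section BernoulliSubsets.
Variables (R : realType) (U : finType) (C : {set U}) (p : R).
Hypothesis p0 : 0 < p.
Hypothesis p1 : p < 1.
Local Notation N := #|C|.

Definition bw (j : nat) : R := p ^+ j * (1 - p) ^+ (N - j).

Lemma sum_subsets_card (F : nat -> R) (g : {set U} -> R) :
  \sum_(J : {set U} | J \subset C) F #|J| * g J = \sum_(j < N.+1) F j * \sum_(J in subs C j) g J.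
Proof.
rewrite (partition_big (fun J : {set U} => inord #|J| : 'I_N.+1) xpredT) //=.
apply: eq_bigr => j _; rewrite mulr_sumr.
apply: eq_big => J.
  rewrite inE; case: (boolP (J \subset C)) => //= JC.
  by rewrite -val_eqE /= inordK // ltnS subset_leq_card.
move=> /andP[JC /eqP <-]; by rewrite inordK // ltnS subset_leq_card.
Qed.

Lemma sum_bw (a : R) : \sum_(j < N.+1) bw j * a ^+ j * 'C(N, j)%:R = (1 - p + p * a) ^+ N.
Proof.
rewrite exprDn; apply: eq_bigr => j _; rewrite /bw exprMn -[RHS]mulr_natr; ring.
Qed.

Lemma bw_ge0 j : 0 <= bw j.
Proof. by rewrite mulr_ge0 // exprn_ge0 //; move: p0 p1; lra. Qed.

Lemma subs_avg_mono_le m j (g : {set U} -> R) :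
  (forall (J : {set U}) u, J \subset C -> u \in C -> g J <= g (u |: J)%SET) ->
  (m <= j)%N -> (j <= N)%N ->
  (\sum_(J in subs C m) g J) / #|subs C m|%:R <= (\sum_(J in subs C j) g J) / #|subs C j|%:R.
Proof.
move=> gm; elim: j => [|j IH]; first by rewrite leqn0 => /eqP ->.
rewrite leq_eqVlt => /orP[/eqP -> //|mj] jN.
by apply: le_trans (IH mj (ltnW jN)) _; apply: subs_avg_mono.
Qed.

(* Lower binomial tail by the exponential moment at [x = de / 8]. *)
Lemma bw_lower (m : nat) (de : R) : 0 <= de -> de <= 1 -> m%:R <= (1 - de) * (p * N%:R) ->
  \sum_(j < N.+1 | (j < m)%N) bw j * 'C(N, j)%:R <= expR (- (de ^+ 2 / 16 * (p * N%:R))).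
Proof.
move=> d0 d1 hm; pose x := de / 8; have x0 : 0 <= x by rewrite /x; lra.
have xn : `|- x| <= 1 by rewrite normrN ger0_norm // /x; lra.
apply: (@le_trans _ _ (\sum_(j < N.+1) bw j * expR (- x) ^+ j * 'C(N, j)%:R * expR (x * m%:R))).
  rewrite big_mkcond; apply: ler_sum => j _.
  have b0 : 0 <= bw j * 'C(N, j)%:R by rewrite mulr_ge0 ?bw_ge0.
  have -> : bw j * expR (- x) ^+ j * 'C(N, j)%:R * expR (x * m%:R) = bw j * 'C(N, j)%:R * (expR (- x) ^+ j * expR (x * m%:R)).
    by ring.
  case: ifP => jm; last by rewrite mulr_ge0 // mulr_ge0 ?exprn_ge0 ?expR_ge0.
  rewrite ler_peMr // -expRM_natl -expRD -[leLHS]expR0 ler_expR.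
  have : x * j%:R <= x * m%:R by apply: ler_wpM2l => //; rewrite ler_nat ltnW.
  by lra.
rewrite -mulr_suml sum_bw.
apply: (@le_trans _ _ (expR (N%:R * (p * (- x + 4 * x ^+ 2))) * expR (x * ((1 - de) * (p * N%:R))))).
  apply: ler_pM; rewrite ?expR_ge0 //.
  - by rewrite exprn_ge0 // addr_ge0 ?mulr_ge0 ?expR_ge0 //; move: p0 p1; lra.
  - rewrite expRM_natl; apply: lerXn2r; rewrite ?nnegrE ?expR_ge0 //.
      by rewrite addr_ge0 ?mulr_ge0 ?expR_ge0 //; move: p0 p1; lra.
    apply: le_trans (expR_ge1Dx _).
    have e4 : expR (- x) <= 1 - x + 4 * x ^+ 2.
      apply: le_trans (expR_quad (- x)) _; rewrite lerD2l sqrrN mulrC; apply: ler_wpM2r; first exact: sqr_ge0.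
      exact: expR_le4.
    have : p * expR (- x) <= p * (1 - x + 4 * x ^+ 2) by rewrite ler_pM2l.
    by lra.
  - by rewrite ler_expR; apply: ler_wpM2l.
by rewrite -expRD ler_expR; apply: eq_ler; rewrite /x; field.
Qed.

(** For an increasing [g] the average grows with the size of the set, and a binomial set with mean
    slightly above [m] reaches size [m] with probability at least 1/2. Having few colourings is such
    an increasing event. *)
Lemma bern_transfer (m : nat) (de : R) (g : {set U} -> R) : 0 <= de -> de <= 1 ->
  m%:R <= (1 - de) * (p * N%:R) -> expR (- (de ^+ 2 / 16 * (p * N%:R))) <= 1 / 2 ->
  (forall J, 0 <= g J) ->
  (forall (J : {set U}) u, J \subset C -> u \in C -> g J <= g (u |: J)%SET) ->
  (\sum_(J in subs C m) g J) / #|subs C m|%:R <=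
  2 * \sum_(J : {set U} | J \subset C) bw #|J| * g J.
Proof.
move=> d0 d1 hm ht g0 gm; set av := _ / _.
have av0 : 0 <= av by rewrite divr_ge0 // sumr_ge0.
have half : 1 / 2 <= \sum_(j < N.+1 | (m <= j)%N) bw j * 'C(N, j)%:R.
  have T := sum_bw 1; move: T; rewrite mulr1 subrK expr1n.
  under eq_bigr do rewrite expr1n mulr1.
  rewrite (bigID (fun j : 'I_N.+1 => (m <= j)%N)) /=.
  have L := bw_lower d0 d1 hm.
  rewrite (eq_bigl (fun j : 'I_N.+1 => ~~ (m <= j)%N)) in L; last by move=> j; rewrite ltnNge.
  by move: L ht; lra.
rewrite sum_subsets_card.
apply: (@le_trans _ _ (2 * (av * \sum_(j < N.+1 | (m <= j)%N) bw j * 'C(N, j)%:R))).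
  have : av * (1 / 2) <= av * \sum_(j < N.+1 | (m <= j)%N) bw j * 'C(N, j)%:R by apply: ler_wpM2l.
  by move: (\sum_(j < _ | _) _) => w; lra.
rewrite ler_pM2l // mulr_sumr big_mkcond; apply: ler_sum => j _.
have S0 : 0 <= \sum_(J in subs C j) g J by apply: sumr_ge0.
case: ifP => mj; last by rewrite mulr_ge0 ?bw_ge0.
rewrite mulrCA; apply: ler_wpM2l; first exact: bw_ge0.
have Cj : 0 < 'C(N, j)%:R :> R by rewrite ltr0n bin_gt0 -ltnS.
rewrite -ler_pdivlMr // -card_subs; apply: subs_avg_mono_le => //; by rewrite -ltnS.
Qed.
End BernoulliSubsets.

(** * The binomial graph read row by row *)

Section GraphOf.
Variables (R : realType) (n k : nat) (p : R).
Hypothesis n0 : (0 < n)%N.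
Hypothesis k2 : (1 < k)%N.
Hypothesis p0 : 0 < p.
Hypothesis p2 : p <= 1 / 8.
Local Notation X := {ffun 'I_n -> bool}.
Local Notation Om := {ffun 'I_n -> 'I_k}.
Local Notation odds := (odds p).
Local Notation kk := (kk R k).
Local Notation P := (bern (n := n) p).
Local Notation mu := (fun _ : Om => k%:R ^- n : R).
Local Notation l := (lc p n0 (k := k)).
Local Notation wt := (weight mu l).
Local Notation Wt := (mass mu l).
Local Notation vt := (vertex_at n0).

Fixpoint gr (xs : seq X) : {set {set 'I_n}} :=
  if xs is x :: ys then [set [set vt (size ys); u]%SET | u : 'I_n in [pred u : 'I_n | (u < size ys)%N && x u]]%SET :|: gr ys
  else set0.

Fixpoint ecount (xs : seq X) : nat :=
  if xs is x :: ys then (#|[set u : 'I_n | (u < size ys)%N && x u]%SET| + ecount ys)%N else 0.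

(** The rows agree with the adjacency of [J] below the diagonal. The remaining entries are free, so
    the event has exactly the binomial probability of [J]. *)
Fixpoint consist (J : {set {set 'I_n}}) (xs : seq X) : bool :=
  if xs is x :: ys then consist J ys && [forall v : 'I_n, (v < size ys)%N ==> (x v == ([set vt (size ys); v]%SET \in J))]
  else true.

Definition okl (x : X) (t : nat) (s : Om) : bool := [forall v : 'I_n, ((v < t)%N && x v) ==> (s (vt t) != s v)].

(** The exponential of [- odds * al] is spread over all earlier vertices, and each edge is repaid by
    [exp (odds * kk)]. The bound then sees the colouring only through properness and the sum of
    [al]. *)
Lemma lc_le t x (s : Om) : l t x s <= (okl x t s)%:R *
  ((1 + kk) * expR (odds * kk)) ^+ #|[set u : 'I_n | (u < t)%N && x u]%SET| * expR (- odds * \sum_v al R n0 t s v).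
Proof.
have o0 := odds_gt0 p0 p2; have o1 := odds_le p2; have kk0 := kk_gt0 R k2.
pose b (v : 'I_n) : R := if (v < t)%N && x v then (s (vt t) != s v)%:R * ((1 + kk) * expR (odds * kk)) else 1.
apply: (@le_trans _ _ (\prod_v (b v * expR (- odds * al R n0 t s v)))).
  apply: ler_prod => v _; have an : `|al R n0 t s v| <= 1 by [apply: al_norm]; move: an; rewrite ler_norml => /andP[a1 a2].
  apply/andP; split.
    by rewrite /zz; case: (x v); [lra|nra].
  rewrite /b /al /zz; case: (v < t)%N => /=; last by rewrite mul0r addr0 mul1r mulr0 expR0.
  case: (x v); last by rewrite mul1r mulrN mulrC -mulNr; exact: expR_ge1Dx.
  rewrite /ac mulr1; case: eqP => [_|_] /=; first by rewrite !mul0r subrr.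
  by rewrite mul1r -mulrA -expRD mulNr subrr expR0 mulr1.
rewrite big_split /= mulr_sumr expR_sum; apply: ler_wpM2r; first by apply: prodr_ge0 => v _; exact: expR_ge0.
case: (boolP (okl x t s)) => [/forallP h|/forallPn[v]].
  rewrite mul1r -prodr_const [leRHS]big_mkcond; apply: eq_ler; apply: eq_bigr => v _; rewrite inE /b.
  by case: ifP => // c; have := h v; rewrite c /= => ->; rewrite mul1r.
rewrite negb_imply => /andP[c1 c2]; rewrite mul0r (bigD1 v) //= /b c1 (negbTE c2) !mul0r //.
Qed.

Lemma proper_cons x ys (s : Om) : s \in proper_colorings k (gr ys) -> okl x (size ys) s -> (size ys < n)%N ->
  s \in proper_colorings k (gr (x :: ys)).
Proof.
rewrite !inE => /forallP h /forallP ok sn; apply/forallP => a; apply/forallP => b; apply/implyP => /andP[ab].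
rewrite /= inE => /orP[|g]; last by have := forallP (h a) b; rewrite ab g.
move=> /imsetP[u]; rewrite inE => /andP[ut xu] E.
have oku : s (vt (size ys)) != s u by have := ok u; rewrite ut xu.
have : a \in [set vt (size ys); u]%SET by rewrite -E !inE eqxx.
have : b \in [set vt (size ys); u]%SET by rewrite -E !inE eqxx orbT.
rewrite !inE => /orP[] /eqP bE /orP[] /eqP aE; move: ab; rewrite aE bE ?eqxx // => _.
by rewrite eq_sym.
Qed.

Lemma wt_le xs (s : Om) : (size xs <= n)%N -> wt xs s <= (s \in proper_colorings k (gr xs))%:R * k%:R ^- n *
  ((1 + kk) * expR (odds * kk)) ^+ ecount xs * expR (- odds * \sum_(i < size xs) \sum_v al R n0 i s v).
Proof.
have kk0 := kk_gt0 R k2; have kn : 0 <= k%:R ^- n :> R by rewrite invr_ge0 exprn_ge0.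
have b0 : 0 <= (1 + kk) * expR (odds * kk) by rewrite mulr_ge0 ?expR_ge0 //; lra.
elim: xs => [|x ys IH] sn /=.
  rewrite big_ord0 mulr0 expR0 expr0 !mulr1 (_ : _ \in _) ?mul1r //.
  by rewrite inE; apply/forallP => a; apply/forallP => b; rewrite inE andbF.
have := IH (ltnW sn); set w := weight _ _ ys s => hw.
have w0 : 0 <= w by apply: wt_ge0 => // *; apply: lc_ge0.
apply: (@le_trans _ _ (((okl x (size ys) s)%:R *
  ((1 + kk) * expR (odds * kk)) ^+ #|[set u : 'I_n | (u < size ys)%N && x u]%SET| * expR (- odds * \sum_v al R n0 (size ys) s v)) *
   ((s \in proper_colorings k (gr ys))%:R * k%:R ^- n *
  ((1 + kk) * expR (odds * kk)) ^+ ecount ys * expR (- odds * \sum_(i < size ys) \sum_v al R n0 i s v)))).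
  by apply: ler_pM => //; [exact: lc_ge0|exact: lc_le].
rewrite big_ord_recr /= mulrDr expRD exprD.
set e1 := _ ^+ #|_|; set e2 := expR _; set e3 := _ ^+ ecount _; set e4 := expR _.
have -> : (okl x (size ys) s)%:R * e1 * e2 * ((s \in proper_colorings k (gr ys))%:R * k%:R ^- n * e3 * e4) =
  ((okl x (size ys) s)%:R * (s \in proper_colorings k (gr ys))%:R) * (k%:R ^- n * (e1 * e3) * (e4 * e2)) by ring.
rewrite -[leRHS]mulrA -[leRHS]mulrA; rewrite [X in _ <= _ * X]mulrA; apply: ler_wpM2r.
  by rewrite !mulr_ge0 ?exprn_ge0 ?expR_ge0.
rewrite -natrM ler_nat mulnb; case: (boolP (_ && _)) => // /andP[h1 h2].
by have := proper_cons h2 h1 sn => /= ->.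
Qed.

(** For equal classes the full double sum of [ac] vanishes; imbalance [de] lowers it by at most
    [kk * de * n ^ 2], and half of it falls on unordered pairs. *)
Lemma al_sum_ge (s : Om) de : 0 <= de -> balc de s ->
  - (kk * de * n%:R ^+ 2 / 2) <= \sum_(i < n) \sum_v al R n0 i s v.
Proof.
move=> d0 bs; have kp : 0 < k%:R :> R by rewrite ltr0n ltnW.
have kk0 := kk_gt0 R k2; have kE := kkE R k2.
pose f (u v : 'I_n) : R := ac R (s u) (s v).
have fC u v : f u v = f v u by rewrite /f acC.
have fd v : f v v = -1 by rewrite /f /ac eqxx.
have E : (\sum_(i < n) \sum_v al R n0 i s v) * 2 = \sum_(u : 'I_n) \sum_(v : 'I_n) f u v + n%:R.
  have -> : \sum_(i < n) \sum_v al R n0 i s v = \sum_(u : 'I_n) \sum_(v : 'I_n) (v < u)%N%:R * f u v.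
    apply: eq_bigr => u _; apply: eq_bigr => v _; rewrite /al.
    have -> : vertex_at n0 u = u by apply/val_inj; rewrite /= vtE.
    by case: (v < u)%N; rewrite ?mul1r ?mul0r.
  rewrite mulr2n mulrDr mulr1 {2}exchange_big /= -big_split.
  have -> : n%:R = \sum_(u < n) 1 :> R by rewrite sumr_const card_ord.
  rewrite -big_split; apply: eq_bigr => u _ /=; rewrite -big_split (bigD1 u) //= [in RHS](bigD1 u) //=.
  rewrite ltnn fd !mul0r addr0 add0r addrAC addNr add0r; apply: eq_bigr => v vu.
  rewrite (fC v u) -mulrDl -natrD; case: (ltngtP v u) => [||/val_inj e]; rewrite ?mul1r //.
  by rewrite e eqxx in vu.
have S : \sum_(u : 'I_n) \sum_(v : 'I_n) f u v = kk * n%:R ^+ 2 - (1 + kk) * \sum_c ncol R s c ^+ 2.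
  rewrite (eq_bigr (fun u => kk * n%:R - (1 + kk) * ncol R s (s u))) => [|u _]; last first.
    rewrite /f; under eq_bigr do rewrite acE.
    rewrite sumrB sumr_const card_ord -[X in X - _]mulr_natr -mulr_sumr /ncol; congr (_ - _ * _).
    by apply: eq_bigr => v _; rewrite eq_sym.
  rewrite sumrB sumr_const card_ord -[X in X - _]mulr_natr -mulr_sumr expr2 mulrA; congr (_ - _ * _).
  rewrite (eq_bigr (fun u => \sum_c (s u == c)%:R * ncol R s c)) => [|u _]; last first.
    rewrite (bigD1 (s u)) //= eqxx mul1r big1 ?addr0 // => c /negbTE h; by rewrite eq_sym h mul0r.
  by rewrite exchange_big /=; apply: eq_bigr => c _; rewrite -mulr_suml expr2.
have nn c : 0 <= ncol R s c by apply: sumr_ge0.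
have Nt : \sum_c ncol R s c = n%:R.
  rewrite /ncol exchange_big /= (eq_bigr (fun=> 1)) ?sumr_const ?card_ord // => v _.
  by rewrite (bigD1 (s v)) //= eqxx big1 ?addr0 // => c /negbTE h; rewrite eq_sym h.
have Q : \sum_c ncol R s c ^+ 2 <= (1 + de) * (n%:R / k%:R) * n%:R.
  rewrite -{2}Nt mulr_sumr; apply: ler_sum => c _; rewrite expr2; apply: ler_wpM2r => //.
  by case/andP: (forallP bs c).
have Q2 : (1 + kk) * \sum_c ncol R s c ^+ 2 <= (1 + de) * kk * n%:R ^+ 2.
  rewrite -kE; apply: (@le_trans _ _ (k%:R * kk * ((1 + de) * (n%:R / k%:R) * n%:R))).
    by apply: ler_wpM2l => //; rewrite mulr_ge0 // ltW.
  by apply: eq_ler; field; rewrite lt0r_neq0.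
have n0' : 0 <= n%:R :> R by [].
by move: E Q2; rewrite S; lra.
Qed.

(** By [wt_le] a balanced proper colouring weighs at most about [k ^- n * (k / (k - 1)) ^ m2], so
    mass on balanced colourings turns into a number of them. This is why the number of edges needs
    an upper bound. *)
Lemma count_lower xs (de w0 : R) (m2 : nat) : size xs = n -> 0 <= de -> (ecount xs <= m2)%N ->
  w0 <= Wt xs -> up k p n0 de xs <= w0 / 2 ->
  w0 / 2 * k%:R ^+ n * (1 - k%:R^-1) ^+ m2 * expR (- (odds * kk * m2%:R + odds * kk * de * n%:R ^+ 2 / 2)) <=
  #|proper_colorings k (gr xs)|%:R.
Proof.
move=> sx d0 em W0 U0; have o0 := odds_gt0 p0 p2; have kk0 := kk_gt0 R k2.
have kp : 0 < k%:R :> R by rewrite ltr0n ltnW.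
have kE : (1 - k%:R^-1) * (1 + kk) = 1.
  by rewrite -(kkE R k2) mulrA mulrBl mul1r mulVf ?lt0r_neq0 // mulrBl mul1r (kkE R k2); ring.
have b1 : 1 <= (1 + kk) * expR (odds * kk).
  have : 1 <= expR (odds * kk) by rewrite -expR0 ler_expR mulr_ge0 // ltW.
  by move: (expR _) => e e1; nra.
have kb : 0 < 1 - k%:R^-1 :> R by rewrite subr_gt0 invf_lt1 // ltr1n.
pose M := k%:R ^- n * ((1 + kk) * expR (odds * kk)) ^+ m2 * expR (odds * kk * de * n%:R ^+ 2 / 2).
have M0 : 0 < M.
  rewrite mulr_gt0 ?expR_gt0 // mulr_gt0 ?invr_gt0 ?exprn_gt0 //; move: b1; lra.
have key : Wt xs - up k p n0 de xs <= #|proper_colorings k (gr xs)|%:R * M.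
  rewrite /mass /up -sumrB -(sum_indic R (proper_colorings k (gr xs))) mulr_suml; apply: ler_sum => s _.
  have w0' : 0 <= wt xs s by apply: wt_ge0 => *; [rewrite invr_ge0 exprn_ge0|apply: lc_ge0].
  case: (boolP (balc de s)) => bs /=; last by rewrite mulr1 subrr mulr_ge0 // ltW.
  rewrite mulr0 subr0; apply: le_trans (wt_le s _) _; first by rewrite sx.
  rewrite /M; set i := (s \in _)%:R; set b := (1 + kk) * _; set E1 := expR (- odds * _); set E2 := expR (_ / 2).
  have -> : i * k%:R ^- n * b ^+ ecount xs * E1 = i * (k%:R ^- n * (b ^+ ecount xs * E1)) by ring.
  have -> : i * (k%:R ^- n * b ^+ m2 * E2) = i * (k%:R ^- n * (b ^+ m2 * E2)) by ring.
  have b0 : 0 <= b by move: b1; rewrite -/b; lra.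
  apply: ler_wpM2l => //; rewrite ler_pM2l ?invr_gt0 ?exprn_gt0 //; apply: ler_pM.
  - exact: exprn_ge0.
  - exact: expR_ge0.
  - by apply: ler_weXn2l.
  - rewrite /E1 /E2 ler_expR sx mulNr -mulrN; have := al_sum_ge d0 bs; move: (\sum_(i < n) _) => S hS.
    have -> : odds * kk * de * n%:R ^+ 2 / 2 = odds * (kk * de * n%:R ^+ 2 / 2) by ring.
    by apply: ler_wpM2l; [exact: ltW|lra].
have h1 : w0 / 2 <= #|proper_colorings k (gr xs)|%:R * M by move: key W0 U0; lra.
pose A := odds * kk * m2%:R; pose B := odds * kk * de * n%:R ^+ 2 / 2.
pose Y := k%:R ^+ n * (1 - k%:R^-1) ^+ m2 * expR (- (A + B)).
have Y0 : 0 <= Y by rewrite mulr_ge0 ?expR_ge0 // mulr_ge0 ?exprn_ge0 // ltW.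
have MY : M * Y = 1.
  transitivity ((k%:R ^- n * k%:R ^+ n) * ((1 - k%:R^-1) * (1 + kk)) ^+ m2 *
     (expR (m2%:R * (odds * kk)) * expR B * expR (- (A + B)))).
    rewrite /M /Y exprMn (exprMn _ (1 - _)) expRM_natl -/B.
    set u := (1 - _) ^+ m2; set v := (1 + kk) ^+ m2; set w := expR (odds * kk) ^+ m2; ring.
  rewrite mulVf ?expf_neq0 ?lt0r_neq0 // kE expr1n !mul1r -!expRD (_ : _ + _ = 0) ?expR0 //.
  by rewrite /A; ring.
have -> : w0 / 2 * k%:R ^+ n * (1 - k%:R^-1) ^+ m2 * expR (- (A + B)) = w0 / 2 * Y by rewrite /Y; ring.
by apply: le_trans (ler_wpM2r Y0 h1) _; rewrite -mulrA MY mulr1.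
Qed.

Lemma ecount_mgf (a : R) : 0 <= a -> forall t, Ex P t (fun xs => a ^+ ecount xs) =
  \prod_(i < t) \prod_(v : 'I_n) (if (v < i)%N then 1 - p + p * a else 1).
Proof.
have P0 (j : nat) (x : X) : 0 <= P j x by apply: bern_ge0.
move=> a0; elim=> [|t IH] /=; first by rewrite big_ord0 expr0.
rewrite big_ord_recr /= -IH mulrC -ExZ //; apply: eq_Ex => // xs sx; rewrite sx.
under eq_bigr do rewrite exprD mulrA.
rewrite -mulr_suml; congr (_ * _).
rewrite (eq_bigr (fun x : X => P t x * \prod_v (fun (v : 'I_n) b => if (v < t)%N && b then a else 1) v (x v))) => [|x _]; last first.
  congr (_ * _); rewrite -prodr_const [LHS]big_mkcond; apply: eq_bigr => v _; by rewrite inE.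
rewrite (bern_prod p t (fun (v : 'I_n) b => if (v < t)%N && b then a else 1)); apply: eq_bigr => v _.
by case: (v < t)%N; rewrite /=; ring.
Qed.

Lemma gr_consist (J : {set {set 'I_n}}) xs : (size xs <= n)%N -> consist J xs ->
  gr xs = [set e in J | [exists u : 'I_n, exists v : 'I_n, [&& (u < size xs)%N, (v < u)%N & e == [set u; v]%SET]]]%SET.
Proof.
elim: xs => [|x ys IH] sn /=.
  by move=> _; apply/setP => e; rewrite !inE; apply/esym/negbTE; rewrite negb_and; apply/orP; right; apply/existsPn => u; apply/existsPn => v.
move=> /andP[cy /forallP cx]; rewrite (IH (ltnW sn) cy); apply/setP => e; rewrite !inE.
apply/orP/andP => [[/imsetP[u]|/andP[eJ /existsP[u /existsP[v /and3P[h1 h2 h3]]]]]|[eJ /existsP[u /existsP[v /and3P[h1 h2 /eqP h3]]]]].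
- rewrite inE => /andP[ut xu] ->; split; first by have := cx u; rewrite ut xu /= => /eqP <-.
  by apply/existsP; exists (vt (size ys)); apply/existsP; exists u; rewrite vtE // ltnSn ut eqxx.
- by split=> //; apply/existsP; exists u; apply/existsP; exists v; rewrite ltnW // h2 h3.
move: h1; rewrite ltnS leq_eqVlt => /orP[/eqP ue|ul]; last first.
  by right; rewrite eJ; apply/existsP; exists u; apply/existsP; exists v; rewrite ul h2 h3 eqxx.
have uE : u = vt (size ys) by apply/val_inj; rewrite /= vtE.
left; apply/imsetP; exists v; last by rewrite h3 uE.
rewrite inE -ue h2 /=; have := cx v; rewrite -ue h2 /= ue -uE -h3 eJ; by move/eqP.
Qed.

Lemma gr_eq (J : {set {set 'I_n}}) xs : size xs = n -> J \subset kedges 2 n -> consist J xs -> gr xs = J.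
Proof.
move=> sx JC cJ; rewrite (gr_consist _ cJ) ?sx //; apply/setP => e; rewrite !inE.
case: (boolP (e \in J)) => //= eJ; have := fintype.subsetP JC e eJ; rewrite inE => /cards2P[u [v [uv ->]]].
apply/existsP; have [h|h|/val_inj h] := ltngtP u v; last by rewrite h eqxx in uv.
  by exists v; apply/existsP; exists u; rewrite ltn_ord h setUC eqxx.
by exists u; apply/existsP; exists v; rewrite ltn_ord h eqxx.
Qed.

Lemma Ex_consist (J : {set {set 'I_n}}) t : Ex P t (fun xs => (consist J xs)%:R) =
  \prod_(i < t) \prod_(v : 'I_n) (if (v < i)%N then (if [set vt i; v]%SET \in J then p else 1 - p) else 1).
Proof.
have P0 (j : nat) (x : X) : 0 <= P j x by apply: bern_ge0.
elim: t => [|t IH] /=; first by rewrite big_ord0.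
rewrite big_ord_recr /= -IH mulrC -ExZ //; apply: eq_Ex => // xs sx; rewrite sx.
rewrite (eq_bigr (fun x : X => (P t x * \prod_v (fun (v : 'I_n) b => if (v < t)%N then (b == ([set vt t; v]%SET \in J))%:R else 1) v (x v)) * (consist J xs)%:R)).
  rewrite -mulr_suml; congr (_ * _).
  rewrite (bern_prod p t (fun (v : 'I_n) b => if (v < t)%N then (b == ([set vt t; v]%SET \in J))%:R else 1)); apply: eq_bigr => v _.
  by case: (v < t)%N; last ring; case: (_ \in J) => /=; ring.
move=> x _; rewrite -mulrA; congr (_ * _); case: (consist J xs); rewrite ?mulr0 //= mulr1.
case: forallP => h.
  by rewrite big1 // => v _; case: ifP => // vt'; have := h v; rewrite vt' /= => ->.
move/forallP: h => /forallPn[v]; rewrite negb_imply => /andP[vt' xv].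
by rewrite (bigD1 v) //= vt' (negbTE xv) mul0r.
Qed.

Lemma consist_bw (J : {set {set 'I_n}}) : J \subset kedges 2 n ->
  Ex P n (fun xs => (consist J xs)%:R) = bw (kedges 2 n) p #|J|.
Proof.
move=> JC; rewrite Ex_consist.
pose h (q : 'I_n * 'I_n) : {set 'I_n} := [set q.1; q.2]%SET.
pose A : {set 'I_n * 'I_n} := [set q : 'I_n * 'I_n | (q.2 < q.1)%N]%SET.
have hA : kedges 2 n = (h @: A)%SET.
  apply/setP => e; rewrite inE; apply/cards2P/imsetP => [[u [v [uv ->]]]|[[u v]]].
    have [lt|lt|/val_inj E] := ltngtP u v; last by rewrite E eqxx in uv.
      by exists (v, u); rewrite ?inE // /h setUC.
    by exists (u, v); rewrite ?inE.
  rewrite inE /= => vu ->; exists u, v; split=> //; apply: contraTneq vu => ->; by rewrite ltnn.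
have hi : {in A &, injective h}.
  move=> [u v] [u' v']; rewrite !inE /= => vu vu' E.
  have : u \in [set u'; v']%SET by rewrite -[[set u'; v']%SET]E !inE eqxx.
  have : v \in [set u'; v']%SET by rewrite -[[set u'; v']%SET]E !inE eqxx orbT.
  rewrite !inE => /orP[] /eqP vE /orP[] /eqP uE; rewrite ?uE ?vE //; move: vu vu'; rewrite uE vE ?ltnn //.
  by move=> a b; have := ltn_trans a b; rewrite ltnn.
have -> : \prod_(i < n) \prod_(v : 'I_n) (if (v < i)%N then (if [set vt i; v]%SET \in J then p else 1 - p) else 1) =
   \prod_(e in kedges 2 n) (if e \in J then p else 1 - p).
  rewrite hA big_imset //= pair_bigA /= [RHS]big_mkcond; apply: eq_bigr => -[u v] _ /=; rewrite inE /=.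
  have -> : vertex_at n0 u = u by apply/val_inj; rewrite /= vtE.
  by [].
rewrite (bigID (fun e => e \in J)) /= /bw; congr (_ * _).
  rewrite -prodr_const; apply: eq_big => e; last by move=> /andP[_ ->].
  by case: (boolP (e \in J)) => [/(fintype.subsetP JC) ->|]; rewrite ?andbF.
rewrite -[(_ - _)%N](cardsDS JC) -prodr_const; apply: eq_big => e; first by rewrite in_setD andbC.
by move=> /andP[_ /negbTE ->].
Qed.

(** A list is consistent with at most one edge set, and then that set is [gr]. *)
Lemma Ex_gr (g : {set {set 'I_n}} -> R) : (forall J, 0 <= g J) ->
  \sum_(J : {set {set 'I_n}} | J \subset kedges 2 n) bw (kedges 2 n) p #|J| * g J <= Ex P n (fun xs => g (gr xs)).
Proof.
have P0 (j : nat) (x : X) : 0 <= P j x by apply: bern_ge0.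
have P1 j : \sum_x P j x = 1 by apply: bern_sum1.
move=> g0; rewrite (eq_bigr (fun J => Ex P n (fun xs => g J * (consist J xs)%:R))) => [|J JC]; last first.
  by rewrite ExZ // consist_bw // mulrC.
rewrite -Ex_sum //; apply: Ex_le => // xs sx.
case: (boolP ((gr xs \subset kedges 2 n) && consist (gr xs) xs)) => h.
  rewrite (bigD1 (gr xs)) /=; last by case/andP: h.
  rewrite big1 ?addr0 => [|J /andP[JC Jg]].
    by case/andP: h => _ ->; rewrite mulr1.
  case c: (consist J xs); rewrite ?mulr0 //; move: Jg; by rewrite (gr_eq sx JC c) eqxx.
rewrite big1 // => J JC; case c: (consist J xs); rewrite ?mulr0 //.
by move: h; rewrite (gr_eq sx JC c) JC c.
Qed.
End GraphOf.

Lemma card_kedges2 n : #|kedges 2 n| = 'C(n, 2).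
Proof. by have := card_draws 'I_n 2; rewrite card_ord => <-. Qed.

Lemma proper_mono k n (J : {set {set 'I_n}}) u :
  (#|proper_colorings k (u |: J)%SET| <= #|proper_colorings k J|)%N.
Proof.
apply: subset_leq_card; apply/fintype.subsetP => s; rewrite !inE => /forallP h.
apply/forallP => a; apply/forallP => b; apply/implyP => /andP[ab eJ].
by have := forallP (h a) b; rewrite ab inE eJ orbT.
Qed.

(** * Number of colourings of the uniform graph *)

Section UpperTail.
Variables (R : realType) (n : nat) (p : R).
Hypothesis n0 : (0 < n)%N.
Hypothesis p0 : 0 < p.
Hypothesis p2 : p <= 1 / 8.

Lemma ecount_tail (de : R) (m2 : nat) : 0 <= de -> de <= 1 -> (1 + de) * (p * 'C(n, 2)%:R) <= m2.+1%:R ->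
  Ex (bern (n := n) p) n (fun xs => (m2 < ecount xs)%N%:R) <= expR (- (de ^+ 2 / 16 * (p * 'C(n, 2)%:R))).
Proof.
move=> d0 d1 hm; pose x := de / 8; have x0 : 0 <= x by rewrite /x; lra.
have xn : `|x| <= 1 by rewrite ger0_norm // /x; lra.
have P0 (j : nat) (y : {ffun 'I_n -> bool}) : 0 <= bern p j y by apply: bern_ge0.
apply: (@le_trans _ _ (Ex (bern (n := n) p) n (fun xs => expR (- (x * m2.+1%:R)) * expR x ^+ ecount xs))).
  apply: Ex_le => // xs _; rewrite -expRM_natl -expRD.
  case: ltnP => h; last exact: expR_ge0.
  rewrite -[leLHS]expR0 ler_expR.
  have : x * m2.+1%:R <= x * (ecount xs)%:R by apply: ler_wpM2l => //; rewrite ler_nat.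
  by lra.
rewrite ExZ // ecount_mgf ?expR_ge0 //.
apply: (@le_trans _ _ (expR (- (x * ((1 + de) * (p * 'C(n, 2)%:R)))) * expR ('C(n, 2)%:R * (p * (x + 4 * x ^+ 2))))).
  apply: ler_pM; rewrite ?expR_ge0 //.
  - apply: prodr_ge0 => i _; apply: prodr_ge0 => v _; case: ifP => _ //.
    by rewrite addr_ge0 ?mulr_ge0 ?expR_ge0 //; move: p0 p2; lra.
  - by rewrite ler_expR lerN2; apply: ler_wpM2l.
  have -> : 'C(n, 2)%:R = \sum_(i < n) \sum_(v : 'I_n) (v < i)%N%:R :> R.
    rewrite -bin2_sum big_mkord natr_sum; apply: eq_bigr => i _.
    rewrite (eq_bigr (fun v : 'I_n => (v \in [set v : 'I_n | (v < i)%N]%SET)%:R)) => [|v _]; last by rewrite inE.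
    rewrite sum_indic; congr (_%:R).
    have inj : injective (fun v : 'I_i => widen_ord (ltnW (ltn_ord i)) v) by move=> a b /(congr1 val) h; apply/val_inj.
    rewrite -[LHS](card_ord i) -(card_imset _ inj); apply: eq_card => v; rewrite inE.
    apply/imsetP/idP => [[w _ ->]|h]; first exact: (ltn_ord w).
    by exists (Ordinal h) => //; apply/val_inj.
  rewrite mulr_suml expR_sum; apply: ler_prod => i _; apply/andP; split.
    apply: prodr_ge0 => v _; case: ifP => _ //.
    by rewrite addr_ge0 ?mulr_ge0 ?expR_ge0 //; move: p0 p2; lra.
  rewrite mulr_suml expR_sum; apply: ler_prod => v _; case: (v < i)%N; last by rewrite mul0r expR0 ler01 lexx.
  apply/andP; split; first by rewrite addr_ge0 ?mulr_ge0 ?expR_ge0 //; move: p0 p2; lra.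
  rewrite mul1r; apply: le_trans (expR_ge1Dx _).
  have e4 : expR x <= 1 + x + 4 * x ^+ 2.
    apply: le_trans (expR_quad x) _; rewrite lerD2l mulrC; apply: ler_wpM2r; first exact: sqr_ge0.
    exact: expR_le4.
  have : p * expR x <= p * (1 + x + 4 * x ^+ 2) by rewrite ler_pM2l.
  by lra.
by rewrite -expRD ler_expR; apply: eq_ler; rewrite /x; field.
Qed.
End UpperTail.

Lemma colors_lower (R : realType) (k : nat) (d cl sl zeta z : R) : (8 < k)%N ->
  0 < cl -> 4 * cl <= k%:R -> 1 + cl + ln (4 * cl) <= ln k%:R ->
  0 < d -> 0 < sl -> (1 + kk R k) ^+ 4 / k%:R * (d / 2) + sl <= cl ->
  0 < zeta -> 0 < z ->
  exists N, forall n, (N <= n)%N ->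
    (\sum_(J in graphs n (Num.truncn (d * n%:R / 2)))
       (#|proper_colorings k J|%:R < k%:R ^+ n * (1 - k%:R^-1) ^+ (Num.truncn (d * n%:R / 2)) * expR (- (zeta * n%:R)))%R%:R)
      / #|graphs n (Num.truncn (d * n%:R / 2))|%:R <= z.
Proof.
move=> k8 cl0 clk cll d0 sl0 Hcl ze0 z0.
have k2 : (1 < k)%N by apply: leq_trans k8.
have kN0 : (0 < k)%N by apply: leq_trans k8.
have kp : 0 < k%:R :> R by rewrite ltr0n.
have k1 : 1 <= k%:R :> R by rewrite ler1n.
(* One parameter serves as tolerance of balance, as rate [kap], and as relative excess of the edge
   probability. It is small against the slack [sl] in the entropy condition and against [zeta]. *)
pose tau := Num.min (1 / 2) (Num.min (sl / (16 * (3 * d + 6))) (zeta / (16 * d))).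
have ta0 : 0 < tau by rewrite !lt_min !divr_gt0 ?mulr_gt0 ?addr_gt0 ?mulr_gt0.
have ta1 : tau <= 1 / 2 by rewrite ge_min lexx.
have ta2 : tau * (16 * (3 * d + 6)) <= sl.
  by rewrite -ler_pdivlMr ?mulr_gt0 ?addr_gt0 ?mulr_gt0 // !ge_min lexx /= orbT.
have ta3 : tau * (16 * d) <= zeta by rewrite -ler_pdivlMr ?mulr_gt0 // !ge_min lexx !orbT.
pose dd := (1 + 2 * tau) * d; pose c := tau ^+ 2 / 16 / k%:R.
have c0 : 0 < c by rewrite !divr_gt0 ?exprn_gt0.
have dd0 : 0 < dd by rewrite mulr_gt0 //; move: ta0; clear; lra.
have dd2 : dd <= 2 * d by rewrite /dd ler_pM2r //; move: ta1; clear; lra.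
(* At most half the rate [c] at which unbalanced colourings are rare, so that with high probability
   they carry at most half of the guaranteed mass. *)
pose d1 := Num.min (zeta / 8) (c / 2).
have d10 : 0 < d1 by rewrite lt_min; apply/andP; split; apply: divr_gt0.
have d1z : d1 <= zeta / 8 by rewrite ge_min lexx.
have d1c : d1 <= c / 2 by rewrite ge_min lexx orbT.
have kk0 := kk_gt0 R k2; have kk1 := kk_le1 R k2.
have tle1 : tau <= 1 by move: ta1; clear; lra.
have Hcl' : (1 + kk R k) ^+ 4 * ((1 + tau) / k%:R) * (dd / 2 + 3 * tau) <= cl.
  apply: le_trans Hcl.
  have -> : (1 + kk R k) ^+ 4 * ((1 + tau) / k%:R) * (dd / 2 + 3 * tau) = (1 + kk R k) ^+ 4 / k%:R * ((1 + tau) * (dd / 2 + 3 * tau)) by ring.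
  have q0 : 0 <= (1 + kk R k) ^+ 4 / k%:R by rewrite divr_ge0 ?exprn_ge0 ?addr_ge0 // ltW.
  have q16 : (1 + kk R k) ^+ 4 / k%:R <= 16.
    rewrite ler_pdivrMr //; apply: (@le_trans _ _ (2 ^+ 4)).
      by apply: lerXn2r; rewrite ?nnegrE ?addr_ge0 ?(ltW kk0) //; move: kk1; clear; lra.
    by rewrite -natrX; move: k1; clear; lra.
  have h1 : (1 + tau) * (dd / 2 + 3 * tau) <= d / 2 + tau * (3 * d + 6).
    by rewrite /dd; move: ta0 ta1 d0; clear => a b c; have : 0 <= tau * d * (1 - tau) by [rewrite !mulr_ge0 //; lra]; nra.
  apply: (@le_trans _ _ ((1 + kk R k) ^+ 4 / k%:R * (d / 2 + tau * (3 * d + 6)))); first by apply: ler_wpM2l.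
  rewrite mulrDr lerD2l; apply: le_trans ta2; rewrite [leRHS]mulrCA; apply: ler_wpM2r => //.
  by rewrite mulr_ge0 ?(ltW ta0) //; move: d0; clear; lra.
have z8 : 0 < z / 8 by rewrite divr_gt0.
have [N1 H1] := color_mass k8 cl0 clk cll ta0 ta0 tle1 dd0 Hcl' d10 z8.
have z1 : 0 < zeta / 8 by rewrite divr_gt0.
have c2 : 0 < c / 2 by apply: divr_gt0.
have tt : 0 < tau ^+ 2 / 64 * (d / 4) by rewrite mulr_gt0 // divr_gt0 // exprn_gt0.
have h12 : 0 < 1 / 2 :> R by rewrite divr_gt0.
have [N2 HN] := ev_and (ev_nat (2 : R)) (ev_and (ev_nat (1 + (2 + 6 * d) / tau)) (ev_and (ev_nat (1 + 16 * d))
  (ev_and (ev_nat (4 / d)) (ev_and (ev_nat (96 * d ^+ 2 / zeta)) (ev_and (ev_exp 2 z1 (ltr01 : 0 < 1 :> R))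
   (ev_and (ev_exp (4 * k%:R) c2 z8)
   (ev_and (ev_exp 1 tt z8)
     (ev_exp 1 tt h12)))))))).
exists (maxn N1 N2) => n; rewrite geq_max => /andP[nN1 /HN[n2 [nt [n16 [n4 [n96 [e2 [ek [ez eh]]]]]]]]].
have n0 : (0 < n)%N by rewrite -(ltr_nat R); move: n2; clear; lra.
have np : 0 < n%:R :> R by rewrite ltr0n.
have n1p : 0 < n%:R - 1 :> R by move: n2; clear; lra.
set m := Num.truncn _.
have dn0 : 0 <= d * n%:R / 2 by rewrite divr_ge0 // mulr_ge0 // ltW.
have mle : m%:R <= d * n%:R / 2 by rewrite truncn_le.
have mge : d * n%:R / 2 - 1 <= m%:R by exact: truncn_ge_sub1.
have dn4 : 4 <= d * n%:R by move: n4; rewrite ler_pdivrMr // mulrC.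
have mge2 : d * n%:R / 4 <= m%:R by move: mge dn4; clear; lra.
have mp : 0 < m%:R :> R by move: mge2 dn4; clear; lra.
pose NN : R := 'C(n, 2)%:R.
have NNE : NN = n%:R * (n%:R - 1) / 2.
  have E' : n%:R * n.-1%:R = 2 * NN by rewrite /NN -!natrM -(mul_bin_diag n 1) bin1.
  have -> : n%:R - 1 = n.-1%:R :> R by rewrite -[in n%:R](prednK n0) -natr1 addrK.
  by rewrite E'; field.
have NNp : 0 < NN by rewrite NNE divr_gt0 // mulr_gt0.
(* The mean number of edges exceeds [m] by the factor [1 + tau], as [bern_transfer] with [tau / 2]
   requires; [m2], with [3 * tau], leaves room for the upper tail. *)
pose p := (1 + tau) * m%:R / NN.
have p0 : 0 < p by rewrite divr_gt0 // mulr_gt0 //; move: ta0; clear; lra.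
have pN : p * NN = (1 + tau) * m%:R by rewrite /p divfK // lt0r_neq0.
have pd : p * (n%:R - 1) <= (1 + tau) * d.
  rewrite -(ler_pM2r (x := n%:R / 2)) ?divr_gt0 //.
  have -> : p * (n%:R - 1) * (n%:R / 2) = p * NN by rewrite NNE; field.
  rewrite pN -mulrA ler_pM2l; last by move: ta0; clear; lra.
  by rewrite mulrA.
have tn : (2 + 6 * d) <= tau * (n%:R - 1).
  by move: nt; rewrite -lerBrDl ler_pdivrMr // [leRHS]mulrC.
have td1 : (1 + tau) * d <= 2 * d by rewrite ler_pM2r //; move: ta1; clear; lra.
have p8 : p <= 1 / 8.
  rewrite -(ler_pM2r n1p); apply: le_trans pd _; apply: le_trans td1 _.
  by move: n16; clear; lra.
have od : odds p * n%:R <= dd.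
  have q : 0 < 1 - p by move: p8; clear; lra.
  rewrite /odds mulrAC ler_pdivrMr // /dd -(ler_pM2r n1p).
  have h1 : p * n%:R * (n%:R - 1) <= (1 + tau) * d * n%:R by rewrite mulrAC; apply: ler_wpM2r.
  have h2 : (1 + 2 * tau) * d * (p * (n%:R - 1)) <= (1 + 2 * tau) * d * (2 * d).
    by apply: ler_wpM2l; [rewrite mulr_ge0 ?(ltW d0) //; move: ta0; clear; lra|apply: le_trans pd td1].
  have h3 : (1 + 2 * tau) * d * (2 * d) <= 2 * d * (2 * d).
    by apply: ler_wpM2r; [rewrite mulr_ge0 // ltW|rewrite ler_pM2r //; move: ta1; clear; lra].
  have h4 : (2 + 6 * d) * d <= tau * (n%:R - 1) * d by rewrite ler_pM2r.
  have h5 : 0 <= d * d by rewrite mulr_ge0 // ltW.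
  have h6 : tau * d <= 1 / 2 * d by rewrite ler_pM2r.
  by move: h1 h2 h3 h4 h5 h6 d0; clear; lra.
have o0 := odds_gt0 p0 p8.
set L := _ * expR (- (zeta * _)).
have p1 : p < 1 by move: p8; clear; lra.
pose m2 := Num.truncn ((1 + 3 * tau) * m%:R).
have m20 : 0 <= (1 + 3 * tau) * m%:R by rewrite mulr_ge0 //; move: ta0; clear; lra.
have m2l : m2%:R <= (1 + 3 * tau) * m%:R by rewrite truncn_le.
have mm2 : (m <= m2)%N by rewrite /m2 truncn_ge_nat // ler_peMl //; move: ta0; clear; lra.
have eM : tau ^+ 2 / 64 * (d / 4) * n%:R <= (tau / 2) ^+ 2 / 16 * (p * NN).
  rewrite pN (_ : (tau / 2) ^+ 2 / 16 * ((1 + tau) * m%:R) = tau ^+ 2 / 64 * ((1 + tau) * m%:R)); last by field.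
  rewrite -mulrA ler_pM2l ?divr_gt0 ?exprn_gt0 //; apply: le_trans (_ : m%:R <= _).
    by move: mge2; clear; lra.
  by rewrite ler_peMl //; move: ta0; clear; lra.
rewrite /graphs hypergraph_subs.
pose g (J : {set {set 'I_n}}) : R := (#|proper_colorings k J|%:R < L)%R%:R.
have P0 (j : nat) (x : {ffun 'I_n -> bool}) : 0 <= bern p j x by apply: bern_ge0.
have t2 : 0 <= tau / 2 by rewrite divr_ge0 // ltW.
have t21 : tau / 2 <= 1 by move: ta1; clear; lra.
have cN : #|kedges 2 n|%:R = NN :> R by rewrite card_kedges2.
have TR := @bern_transfer R _ (kedges 2 n) p p0 p1 m (tau / 2) g t2 t21.
apply: le_trans (TR _ _ _ _) _; rewrite ?cN.
- rewrite pN mulrA ler_peMl //; move: ta0 ta1; clear; nra.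
- apply: le_trans eh; rewrite mul1r ler_expR lerN2; exact: eM.
- by move=> J.
- move=> J u JC uC; rewrite /g ler_nat; case: (ltP _ L) => // h1; case: (ltP _ L) => // h2.
  have := lt_le_trans h1 h2; rewrite ltr_nat ltnNge => /negP[]; exact: proper_mono.
apply: (@le_trans _ _ (2 * Ex (bern (n := n) p) n (fun xs => g (gr n0 xs)))).
  by rewrite ler_pM2l //; exact: Ex_gr.
pose w0 := expR (- (d1 * n%:R)).
have w00 : 0 < w0 := expR_gt0 _.
pose Wx := mass (fun _ : {ffun 'I_n -> 'I_k} => k%:R ^- n) (lc p n0 (k := k)).
apply: (@le_trans _ _ (2 * (Ex (bern (n := n) p) n (fun xs => (Wx xs < w0)%R%:R) +
   (Ex (bern (n := n) p) n (fun xs => (w0 / 2 < up k p n0 tau xs)%R%:R) + Ex (bern (n := n) p) n (fun xs => (m2 < ecount xs)%N%:R))))).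
  rewrite ler_pM2l // -!ExD //; apply: Ex_le => // xs sx; rewrite /g.
  have b1 (b : bool) : b%:R <= 1 :> R by rewrite lern1 leq_b1.
  case: (ltP (Wx xs) w0) => hW; first by apply: le_trans (b1 _) _; rewrite lerDl addr_ge0.
  case: (ltP (w0 / 2) _) => hU; first by apply: le_trans (b1 _) _; rewrite add0r lerDl.
  case: (ltnP m2 _) => hE; first by apply: le_trans (b1 _) _; rewrite !add0r.
  have CL := count_lower k2 p0 p8 sx (ltW ta0) hE hW hU.
  rewrite !add0r (_ : (_ < L) = false) //; apply/negbTE; rewrite -leNgt; apply: le_trans CL.
  pose b : R := 1 - k%:R^-1.
  have b2 : 1 / 2 <= b.
    have : k%:R^-1 <= 2^-1 :> R by rewrite lef_pV2 ?posrE // (ler_nat R 2).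
    by rewrite /b; clear; lra.
  have bp : 0 < b by move: b2; clear; lra.
  have bj j : expR (- j%:R) <= b ^+ j.
    rewrite -[- j%:R]mulr1 mulNr -mulrN expRM_natl; apply: lerXn2r; rewrite ?nnegrE ?expR_ge0 ?(ltW bp) //.
    apply: le_trans b2; rewrite expRN mul1r lef_pV2 ?posrE ?expR_gt0 //.
    by apply: le_trans (expR_ge1Dx _); clear; lra.
  have jm : (m2 - m)%:R <= 3 * tau * m%:R by rewrite natrB //; move: m2l; clear; lra.
  have jn : 3 * tau * m%:R <= 3 * tau * (d * n%:R / 2) by rewrite ler_pM2l // mulr_gt0.
  have tz : tau * d * n%:R <= zeta / 16 * n%:R.
    by rewrite ler_pM2r //; move: ta3; clear; lra.
  have on : odds p <= 2 * d / n%:R by rewrite ler_pdivlMr //; apply: le_trans od dd2.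
  have ok : odds p * kk R k <= 2 * d / n%:R by rewrite -[leRHS]mulr1; apply: ler_pM; rewrite ?(ltW o0) ?(ltW kk0).
  have x1 : odds p * kk R k * m2%:R <= zeta / 8 * n%:R.
    apply: (@le_trans _ _ (2 * d / n%:R * (3 * (d * n%:R / 2)))).
      apply: ler_pM => //; first by rewrite mulr_ge0 // ltW.
      apply: le_trans m2l _; apply: ler_pM => //; first by move: ta0; clear; lra.
      by move: ta1; clear; lra.
    rewrite [leLHS](_ : _ = 3 * d ^+ 2); last by field; rewrite lt0r_neq0.
    have : 0 <= d ^+ 2 by exact: sqr_ge0.
    by move: n96; rewrite ler_pdivrMr //; clear; lra.
  have x2 : odds p * kk R k * tau * n%:R ^+ 2 / 2 <= zeta / 16 * n%:R.
    apply: le_trans tz.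
    apply: (@le_trans _ _ (2 * d / n%:R * tau * n%:R ^+ 2 / 2)).
      rewrite ler_pM2r ?invr_gt0 //; apply: ler_wpM2r; first exact: sqr_ge0.
      by apply: ler_wpM2r; rewrite ?(ltW ta0).
    by apply: eq_ler; field; rewrite lt0r_neq0.
  have e12 : expR (- (zeta / 8 * n%:R)) <= 1 / 2 by move: e2; clear; lra.
  have -> : L = k%:R ^+ n * (b ^+ m * expR (- (zeta * n%:R))) by rewrite /L mulrA.
  have -> : w0 / 2 * k%:R ^+ n * (1 - k%:R^-1) ^+ m2 * expR (- (odds p * kk R k * m2%:R + odds p * kk R k * tau * n%:R ^+ 2 / 2)) =
    k%:R ^+ n * (b ^+ m * ((1 / 2) * w0 * b ^+ (m2 - m) * expR (- (odds p * kk R k * m2%:R + odds p * kk R k * tau * n%:R ^+ 2 / 2)))).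
    have Eb : b ^+ m2 = b ^+ (m2 - m) * b ^+ m by rewrite -exprD subnK.
    by rewrite -/b Eb; set e := expR _; field.
  rewrite ler_pM2l ?exprn_gt0 // ler_pM2l ?exprn_gt0 //.
  apply: (@le_trans _ _ (expR (- (zeta / 8 * n%:R)) * w0 * expR (- (m2 - m)%:R) * expR (- (odds p * kk R k * m2%:R + odds p * kk R k * tau * n%:R ^+ 2 / 2)))).
    rewrite /w0 -!expRD ler_expR.
    have dz : d1 * n%:R <= zeta / 8 * n%:R by rewrite ler_pM2r.
    have zn : 0 <= zeta * n%:R by rewrite mulr_ge0 // ltW.
    by move: dz zn x1 x2 jm jn tz; clear; lra.
  apply: ler_wpM2r; first exact: expR_ge0.
  apply: ler_pM; rewrite ?expR_ge0 ?bj //; first by rewrite mulr_ge0 ?expR_ge0.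
  by rewrite ler_pM2r.
have r1 := H1 n n0 nN1 p p0 p8 od.
have r2 : Ex (bern (n := n) p) n (fun xs => (w0 / 2 < up k p n0 tau xs)%R%:R) <= z / 8.
  have w2 : 0 < w0 / 2 by rewrite divr_gt0.
  apply: le_trans (Ex_markov P0 w2 _) _.
    move=> xs _; apply: sumr_ge0 => s _; rewrite mulr_ge0 //; apply: wt_ge0 => *; first by rewrite invr_ge0 exprn_ge0.
    exact: lc_ge0.
  have EU : Ex (bern (n := n) p) n (up k p n0 tau) <= 2 * k%:R * expR (- (tau ^+ 2 / 16 * (n%:R / k%:R))).
    by apply: Ex_up => //; apply: balc_prob => //; exact: ltW.
  rewrite ler_pdivrMr //; apply: le_trans EU _.
  apply: (@le_trans _ _ (4 * k%:R * expR (- (c / 2 * n%:R)) * (w0 / 2))); last by apply: ler_wpM2r => //; exact: ltW.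
  have -> : 4 * k%:R * expR (- (c / 2 * n%:R)) * (w0 / 2) = 2 * k%:R * (expR (- (c / 2 * n%:R)) * w0) by field.
  rewrite ler_pM2l ?mulr_gt0 // /w0 -expRD ler_expR.
  have -> : tau ^+ 2 / 16 * (n%:R / k%:R) = c * n%:R by rewrite /c; field; rewrite lt0r_neq0.
  have : d1 * n%:R <= c / 2 * n%:R by rewrite ler_pM2r.
  by clear; lra.
have r3 : Ex (bern (n := n) p) n (fun xs => (m2 < ecount xs)%N%:R) <= z / 8.
  have h : (1 + tau) * (p * 'C(n, 2)%:R) <= m2.+1%:R.
    rewrite -/NN pN; apply: le_trans (ltW (truncnS_gt _)); rewrite mulrA; apply: ler_wpM2r => //.
    by move: ta0 tle1; clear; nra.
  apply: le_trans (ecount_tail p0 p8 (ltW ta0) tle1 h) _; apply: le_trans ez.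
  rewrite mul1r ler_expR lerN2 -/NN; apply: le_trans eM _.
  apply: ler_wpM2r; first by rewrite mulr_ge0 // ltW.
  by have := sqr_ge0 tau; clear; lra.
by move: r1 r2 r3 z0; clear; lra.
Qed.

(** * Planted colourings *)

Section Forest.
Variables (n k m : nat) (s : {ffun 'I_n -> 'I_k}) (E : 'I_m -> {set 'I_n}).
Hypothesis E2 : forall i, #|E i| = 2%N.
Variable (vd : 'I_n).
Local Notation V c := [set v | s v == c]%SET.

(** Roots lie in one colour class. Every other vertex had to move because its parent took its colour
    along the edge with index [idx w]. Injectivity of [idx] makes these edges distinct positions of
    the random list, hence independent. *)
Definition forest (j : 'I_k) (X X0 : {set 'I_n}) (col : 'I_n -> 'I_k) (par : 'I_n -> 'I_n) (idx : 'I_n -> 'I_m) : Prop :=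
  [/\ X0 \subset X, X0 \subset V j, (forall w, w \in X -> col w != s w),
      (forall w, w \in X -> w \notin X0 -> [/\ par w \in X, s w = col (par w) & E (idx w) = [set w; par w]%SET]) &
      {in X :\: X0 &, injective idx}].

(** When [w] takes the colour [col w], all its neighbours of that colour have to move too. *)
Definition closedf (X : {set 'I_n}) (col : 'I_n -> 'I_k) : Prop :=
  forall w i w', w \in X -> E i = [set w; w']%SET -> s w' = col w -> w' \in X.

(** The added edge contains the new vertex and no earlier forest edge does, so the indices stay
    distinct. *)
Lemma forest_add j X X0 col par idx (w' : 'I_n) (cw : 'I_k) (w : 'I_n) (i : 'I_m) :
  forest j X X0 col par idx -> w' \notin X -> w \in X -> E i = [set w; w']%SET -> s w' = col w -> cw != s w' ->
  forest j (w' |: X)%SET X0 (fun u => if u == w' then cw else col u)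
    (fun u => if u == w' then w else par u) (fun u => if u == w' then i else idx u).
Proof.
move=> [f1 f2 f3 f4 f5] w'X wX Ei sw cww.
have inX u : u \in X -> (u == w') = false by move=> uX; apply/negbTE; apply: contraNneq w'X => <-.
split=> //.
- by apply: subset_trans f1 _; exact: subsetUr.
- move=> u; rewrite !inE => /orP[/eqP ->|uX]; first by rewrite eqxx.
  by rewrite (inX u uX); exact: f3.
- move=> u; rewrite !inE => /orP[/eqP -> _|uX uX0].
    rewrite eqxx; split; first by rewrite wX orbT.
      by rewrite (inX _ wX).
    by rewrite Ei setUC.
  rewrite (inX u uX); have [p1 p2 p3] := f4 u uX uX0; split=> //; first by rewrite p1 orbT.
  by rewrite (inX _ p1).
have fresh u : u \in X -> u \notin X0 -> idx u != i.
  move=> uX uX0; have [p1 _ p3] := f4 u uX uX0; apply: contraNneq w'X => iu.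
  have : w' \in [set u; par u]%SET by rewrite -p3 iu Ei !inE eqxx orbT.
  by rewrite !inE => /orP[] /eqP ->.
move=> u v; rewrite !inE => /andP[uX0 /orP[/eqP ->|uX]] /andP[vX0 /orP[/eqP ->|vX]] //.
- rewrite eqxx (inX v vX) => e; by move: (fresh v vX vX0); rewrite e eqxx.
- rewrite eqxx (inX u uX) => e; by move: (fresh u uX uX0); rewrite e eqxx.
- by rewrite (inX u uX) (inX v vX); apply: f5; rewrite inE ?uX0 ?vX0.
Qed.

Lemma forest_root j X X0 col par idx (v : 'I_n) (cv : 'I_k) :
  forest j X X0 col par idx -> v \notin X -> s v = j -> cv != s v ->
  forest j (v |: X)%SET (v |: X0)%SET (fun u => if u == v then cv else col u) par idx.
Proof.
move=> [f1 f2 f3 f4 f5] vX sv cvv.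
have inX u : u \in X -> (u == v) = false by move=> uX; apply/negbTE; apply: contraNneq vX => <-.
split.
- by apply: setUS.
- by apply/fintype.subsetP => u; rewrite !inE => /orP[/eqP ->|/(fintype.subsetP f2)]; rewrite ?sv ?inE.
- move=> u; rewrite !inE => /orP[/eqP ->|uX]; first by rewrite eqxx.
  by rewrite (inX u uX); exact: f3.
- move=> u; rewrite !inE negb_or => /orP[/eqP ->|uX]; first by rewrite eqxx.
  move=> /andP[uv uX0]; have [p1 p2 p3] := f4 u uX uX0; split=> //; first by rewrite p1 orbT.
  by rewrite (inX _ p1).
move=> u w; rewrite !inE !negb_or => /andP[/andP[uv uX0] /orP[/eqP uE|uX]]; first by rewrite uE eqxx in uv.
move=> /andP[/andP[wv wX0] /orP[/eqP wE|wX]]; first by rewrite wE eqxx in wv.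
by apply: f5; rewrite inE ?uX0 ?wX0.
Qed.

Variable J : {set {set 'I_n}}.
Hypothesis EJ : forall i, E i \in J.

(** A root is added with its colour under [tau], then every vertex in conflict with its own colour
    under [tau], until the set is closed. Conflicts arise only at new vertices because [X] was
    closed, and properness of [tau] puts each added vertex into its flip set. *)
Lemma forest_phase j X X0 col par idx (v : 'I_n) (tau : {ffun 'I_n -> 'I_k}) :
  forest j X X0 col par idx -> closedf X col -> v \notin X -> s v = j ->
  tau \in proper_colorings k J -> tau v != s v ->
  exists X' X0' col' par' idx', [/\ forest j X' X0' col' par' idx', closedf X' col', v |: X \subset X'
    & X' \subset X :|: [set u | s u != tau u]]%SET.
Proof.
move=> F0 cl vX sv tP tv.
pose T := [set u | s u != tau u]%SET.
suff H r X1 X01 col1 par1 idx1 : (#|~: X1| <= r)%N -> forest j X1 X01 col1 par1 idx1 -> (v |: X \subset X1)%SET ->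
    (X1 \subset X :|: T)%SET -> (forall w, w \in X1 -> w \notin X -> col1 w = tau w) ->
    (forall w, w \in X -> col1 w = col w) ->
    exists X' X0' col' par' idx', [/\ forest j X' X0' col' par' idx', closedf X' col', v |: X \subset X'
      & X' \subset X :|: T]%SET.
  have vT : v \in T by rewrite inE eq_sym.
  apply: (H _ _ _ _ _ _ (leqnn _) (forest_root F0 vX sv tv)) => //.
  - by apply/fintype.subsetP => u; rewrite !inE => /orP[/eqP ->|->//]; move: vT; rewrite inE => ->; rewrite orbT.
  - by move=> w; rewrite !inE => /orP[/eqP ->|->//] _; rewrite eqxx.
  - by move=> w wX; case: eqP => // wv; rewrite wv (negbTE vX) in wX.
elim: r X1 X01 col1 par1 idx1 => [|r IH] X1 X01 col1 par1 idx1 cr f1 vX1 X1T ct cx.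
  exists X1, X01, col1, par1, idx1; split=> // w i w' _ _ _.
  by move: cr; rewrite leqn0 cards_eq0 => /eqP e; have : w' \notin ~: X1 by [rewrite e inE]; rewrite inE negbK.
case: (pselect (closedf X1 col1)) => [c1|nc]; first by exists X1, X01, col1, par1, idx1.
have [w [i [w' [wX1 Ei sw w'X1]]]] : exists w i w', [/\ w \in X1, E i = [set w; w']%SET, s w' = col1 w & w' \notin X1].
  apply: contrapT => h; apply: nc => w i w' wX1 Ei sw; apply: contrapT => h2; apply: h.
  by exists w, i, w'; split=> //; apply/negP.
have XX1 : X \subset X1 by apply: subset_trans vX1; exact: subsetUr.
have wX : w \notin X.
  apply: contra w'X1 => wX; apply: (fintype.subsetP XX1); apply: (cl w i) => //.
  by rewrite sw cx.
have ww' : w != w' by apply: contraNneq w'X1 => <-.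
have tw' : tau w' != s w'.
  rewrite sw (ct w wX1 wX); move: tP; rewrite inE => /forallP /(_ w') /forallP /(_ w).
  by rewrite eq_sym ww' (setUC [set w']%SET) -Ei EJ.
apply: (IH _ _ _ _ _ _ (forest_add f1 w'X1 wX1 Ei sw tw')).
- have : ~: (w' |: X1) \proper ~: X1.
    rewrite setCU; apply/properP; split; first exact: subsetIr.
    by exists w'; rewrite !inE // eqxx.
  by move/proper_card => h; rewrite -ltnS; apply: leq_trans h cr.
- by apply: subset_trans vX1 _; exact: subsetUr.
- apply/fintype.subsetP => u; rewrite in_setU1 => /orP[/eqP ->|/(fintype.subsetP X1T) //].
  by rewrite !inE eq_sym tw' orbT.
- move=> u; rewrite !inE => /orP[/eqP ->|uX1 uX]; first by rewrite eqxx.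
  by case: eqP => [->//|_]; exact: ct.
- move=> u uX; case: eqP => [e|_]; last exact: cx.
  by move: w'X1; rewrite -e (fintype.subsetP XX1).
Qed.

(** Phases are repeated while every class meets the set in fewer than [q] vertices; a root is then
    still available in [Rj]. The last phase adds at most [q] vertices, so no class exceeds [2 * q]
    and most of every class stays outside. *)
Lemma forest_exists (j : 'I_k) (i0 : 'I_m) (q : nat) (Rj : {set 'I_n}) : (0 < q)%N ->
  Rj \subset V j -> (q <= #|Rj|)%N ->
  (forall v, v \in Rj -> exists tau, [/\ tau \in proper_colorings k J, tau v != s v & (hamming s tau <= q)%N]) ->
  exists X X0 col par idx, [/\ forest j X X0 col par idx, closedf X col,
    (q <= #|X|)%N & forall c, (#|X :&: V c| <= 2 * q)%N].
Proof.
move=> q0 RV qR hR.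
suff H r X X0 col par idx : (#|~: X| <= r)%N -> forest j X X0 col par idx -> closedf X col ->
   (forall c, (#|X :&: V c| < q)%N) -> exists X X0 col par idx, [/\ forest j X X0 col par idx, closedf X col,
    (q <= #|X|)%N & forall c, (#|X :&: V c| <= 2 * q)%N].
  apply: (H _ set0 set0 (fun=> j) id (fun=> i0) (leqnn _)).
  - split; rewrite ?sub0set //; try by move=> w; rewrite inE.
    by move=> u v; rewrite setD0 inE.
  - by move=> w i w'; rewrite inE.
  - by move=> c; rewrite set0I cards0.
elim: r X X0 col par idx => [|r IH] X X0 col par idx cr f cl sm.
  have XT : X = setT by apply/setP => v; rewrite inE; have := cr; rewrite leqn0 cards_eq0 => /eqP /setP /(_ v); rewrite !inE => /negbFE.
  have := sm j; rewrite XT setTI ltnNge; move: (leq_trans qR (subset_leq_card RV)) => -> //.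
have [v vR vX] : exists2 v, v \in Rj & v \notin X.
  apply/subsetPn; apply/negP => sub; have := sm j; rewrite ltnNge => /negP[].
  by apply: leq_trans qR _; apply: subset_leq_card; rewrite subsetI sub RV.
have sv : s v = j by have := fintype.subsetP RV v vR; rewrite inE => /eqP.
have [tau [tP tv ht]] := hR v vR.
have [X' [X0' [col' [par' [idx' [f' cl' sub1 sub2]]]]]] := forest_phase f cl vX sv tP tv.
have cX c : (#|X' :&: V c| <= 2 * q)%N.
  apply: (@leq_trans #|(X :&: V c) :|: [set u | s u != tau u]%SET|).
    apply: subset_leq_card; apply/fintype.subsetP => u; rewrite !inE => /andP[/(fintype.subsetP sub2)].
    by rewrite !inE => /orP[] -> ->; rewrite ?orbT.
  apply: leq_trans (leq_card_setU _ _) _; rewrite mul2n -addnn leq_add //; exact: ltnW.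
case: (boolP [forall c, (#|X' :&: V c| < q)%N]) => [/forallP sm'|/forallPn[c]].
  apply: (IH X' X0' col' par' idx') => //.
  have : ~: X' \proper ~: X.
    apply/properP; split; first by rewrite setCS; apply: subset_trans sub1; exact: subsetUr.
    by exists v; rewrite !inE // (fintype.subsetP sub1) // !inE eqxx.
  by move/proper_card => h; rewrite -ltnS; apply: leq_trans h cr.
rewrite -leqNgt => hc; exists X', X0', col', par', idx'; split=> //.
by apply: leq_trans hc _; apply: subset_leq_card; exact: subsetIl.
Qed.
End Forest.

Section Indep.
Variables (R : realType) (X : finType) (P : nat -> X -> R) (x0 : X).
Hypothesis P0 : forall t x, 0 <= P t x.
(** Position in the order of drawing; lists carry the newest draw first. *)
Definition at_ (xs : seq X) (i : nat) : X := nth x0 (rev xs) i.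

Lemma Ex_indep t (h : nat -> X -> R) :
  Ex P t (fun xs => \prod_(i < t) h i (at_ xs i)) = \prod_(i < t) \sum_x P i x * h i x.
Proof.
elim: t => [|t IH] /=; first by rewrite !big_ord0.
rewrite big_ord_recr /= -IH mulrC -ExZ //; apply: eq_Ex => // xs sx.
rewrite mulr_suml; apply: eq_bigr => x _; rewrite -mulrA; congr (_ * _).
rewrite big_ord_recr /= mulrC; congr (_ * _).
  by rewrite /at_ rev_cons nth_rcons size_rev sx ltnn eqxx.
by apply: eq_bigr => i _; rewrite /at_ rev_cons nth_rcons size_rev sx ltn_ord.
Qed.
End Indep.

(** * First moment over coloured forests *)

Section Planted.
Variables (R : realType) (n k m : nat) (s : {ffun 'I_n -> 'I_k}) (vd : 'I_n) (c0 : 'I_k).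
Local Notation V c := [set v | s v == c]%SET.
Local Notation Y := ('I_n * 'I_n)%type.
Variables (rho lo : R) (q : nat).
Hypothesis k1 : (1 < k)%N.
Hypothesis rhoP : forall c, #|V c|%:R <= rho.
Hypothesis loP : forall c, lo <= #|V c|%:R.
Hypothesis lo_q : 2 * q%:R <= lo.

Definition epair (e : Y) : {set 'I_n} := [set e.1; e.2]%SET.

Lemma n_gt0 : 0 < n%:R :> R. Proof. by rewrite ltr0n; case: n vd => [[]|]. Qed.

Lemma avg_pair t (a b : 'I_n) : \sum_e unif R t e * (epair e == [set a; b]%SET)%:R <= 2 / n%:R ^+ 2.
Proof.
have np := n_gt0.
rewrite -mulr_sumr /unif card_prod card_ord natrM -expr2 mulrC; apply: ler_wpM2r; first by rewrite invr_ge0 exprn_ge0.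
rewrite (eq_bigr (fun e => (e \in [set e | epair e == [set a; b]%SET]%SET)%:R)) => [|e _]; last by rewrite inE.
rewrite sum_indic (ler_nat R _ 2); apply: (@leq_trans #|[set (a, b); (b, a)]%SET|); last by rewrite cards2; case: (_ != _).
apply: subset_leq_card; apply/fintype.subsetP => -[u v]; rewrite !inE /epair /= => /eqP e.
have : u \in [set a; b]%SET by rewrite -e !inE eqxx.
have : v \in [set a; b]%SET by rewrite -e !inE eqxx orbT.
have : a \in [set u; v]%SET by rewrite e !inE eqxx.
have : b \in [set u; v]%SET by rewrite e !inE eqxx orbT.
by rewrite !inE !xpair_eqE !(eq_sym _ u) !(eq_sym _ v); do 4![case/orP => /eqP ?]; subst; rewrite ?eqxx ?orbT.
Qed.

Definition okp (X : {set 'I_n}) (col : 'I_n -> 'I_k) (e : Y) : bool :=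
  [&& s e.1 != s e.2, ((e.1 \in X) && (s e.2 == col e.1)) ==> (e.2 \in X) &
      ((e.2 \in X) && (s e.1 == col e.2)) ==> (e.1 \in X)].

Lemma sum_V : \sum_c #|V c|%:R = n%:R :> R.
Proof.
under eq_bigr do rewrite -(sum_indic R).
rewrite exchange_big /= (eq_bigr (fun=> 1)) ?sumr_const ?card_ord // => v _.
by rewrite (bigD1 (s v)) //= inE eqxx big1 ?addr0 // => c /negbTE h; rewrite inE eq_sym h.
Qed.

(** [1 / k] bounds the proportion of monochromatic pairs from below. Each vertex of [X] has at least
    [lo - 2 * q] forbidden partners outside, and the factor 2 is the order of the pair. *)
Definition qx (x : R) : R := 1 - k%:R^-1 - 2 * x * (lo - 2 * q%:R) / n%:R ^+ 2.

Lemma avg_okp t (X : {set 'I_n}) col : (forall w, w \in X -> col w != s w) ->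
  (forall c, (#|X :&: V c| <= 2 * q)%N) ->
  \sum_e unif R t e * (okp X col e)%:R <= qx #|X|%:R.
Proof.
move=> cs cX; have np := n_gt0; have kp : 0 < k%:R :> R by rewrite ltr0n ltnW.
pose a1 (e : Y) := [&& e.1 \in X, e.2 \notin X & s e.2 == col e.1].
pose a2 (e : Y) := [&& e.2 \in X, e.1 \notin X & s e.1 == col e.2].
have pw e : (okp X col e)%:R <= 1 - (s e.1 == s e.2)%:R - (a1 e)%:R - (a2 e)%:R :> R.
  rewrite /okp /a1 /a2; case x1: (e.1 \in X); case x2: (e.2 \in X) => /=; rewrite ?subr0.
  - by rewrite !implybT !andbT; case: (s e.1 == s e.2); rewrite ?subrr ?subr0.
  - have := cs _ x1; rewrite andbT implybF; case: (eqVneq (s e.1) (s e.2)) => [<-|_] /=.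
      by rewrite eq_sym => /negbTE ->; rewrite subrr subr0.
    by case: (s e.2 == _); rewrite /= ?subr0 ?subrr.
  - have := cs _ x2; rewrite implybF; case: (eqVneq (s e.1) (s e.2)) => [->|_] /=.
      by rewrite eq_sym => /negbTE ->; rewrite subrr subr0.
    by case: (s e.1 == _); rewrite /= ?subr0 ?subrr.
  - by case: (s e.1 == s e.2); rewrite ?subrr ?subr0.
have S1 : n%:R ^+ 2 / k%:R <= \sum_(e : Y) (s e.1 == s e.2)%:R :> R.
  have -> : \sum_(e : Y) (s e.1 == s e.2)%:R = \sum_c #|V c|%:R ^+ 2 :> R.
    rewrite -(pair_bigA _ (fun u v => (s u == s v)%:R)) /=.
    rewrite (eq_bigr (fun u => \sum_c (u \in V c)%:R * #|V c|%:R)) => [|u _]; last first.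
      rewrite [RHS](bigD1 (s u)) //= inE eqxx mul1r [X in _ + X]big1 ?addr0 => [|c /negbTE h]; last by rewrite inE eq_sym h mul0r.
      by rewrite -(sum_indic R); apply: eq_bigr => v _; rewrite inE eq_sym.
    rewrite exchange_big /=; apply: eq_bigr => c _; by rewrite -mulr_suml sum_indic expr2.
  have := cauchy_schwarz (fun c : 'I_k => #|V c|%:R : R) (fun=> 1).
  rewrite (eq_bigr (fun c => #|V c|%:R)) => [|c _]; last by rewrite mulr1.
  rewrite sum_V [X in _ <= _ * X](eq_bigr (fun=> 1)) => [|c _]; last by rewrite expr1n.
  by rewrite sumr_const card_ord ler_pdivrMr.
have S2 (f : 'I_n -> 'I_n -> bool) : (forall w u, f w u = [&& w \in X, u \notin X & s u == col w]) ->
    #|X|%:R * (lo - 2 * q%:R) <= \sum_w \sum_u (f w u)%:R :> R.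
  move=> fE; have -> : #|X|%:R * (lo - 2 * q%:R) = \sum_(w in X) (lo - 2 * q%:R) by rewrite sumr_const mulr_natl.
  rewrite big_mkcond; apply: ler_sum => w _; case: ifP => wX; last by apply: sumr_ge0.
  have -> : \sum_u (f w u)%:R = #|V (col w)|%:R - #|X :&: V (col w)|%:R :> R.
    rewrite -!(sum_indic R) -sumrB; apply: eq_bigr => u _; rewrite fE wX !inE.
    by case: (u \in X); case: (_ == _); rewrite /= ?subr0 ?subrr.
  by apply: lerB => //; rewrite -natrM ler_nat.
rewrite -mulr_sumr /unif card_prod card_ord natrM -expr2 mulrC ler_pdivrMr ?exprn_gt0 //.
apply: (@le_trans _ _ (\sum_(e : Y) (1 - (s e.1 == s e.2)%:R - (a1 e)%:R - (a2 e)%:R))); first by apply: ler_sum => e _.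
rewrite !sumrB sumr_const card_prod card_ord.
have T1 : #|X|%:R * (lo - 2 * q%:R) <= \sum_(e : Y) (a1 e)%:R :> R.
  by rewrite -(pair_bigA _ (fun u v => (a1 (u, v))%:R)) /=; apply: S2.
have T2 : #|X|%:R * (lo - 2 * q%:R) <= \sum_(e : Y) (a2 e)%:R :> R.
  by rewrite -(pair_bigA _ (fun u v => (a2 (u, v))%:R)) /= exchange_big /=; apply: S2.
have -> : qx #|X|%:R * n%:R ^+ 2 = n%:R ^+ 2 - n%:R ^+ 2 / k%:R - 2 * (#|X|%:R * (lo - 2 * q%:R)).
  by rewrite /qx; field; rewrite !lt0r_neq0.
by rewrite natrM -expr2; move: S1 T1 T2; lra.
Qed.

Local Notation Lb := ('I_m + 'I_n)%type.
(** A root is labelled by itself, any other vertex by the list position of its parent edge. The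
    probability of that edge then pays for the choice of position, parent and vertex. *)
Definition labs (X0 : {set 'I_n}) (I : {set 'I_m}) : {set Lb} :=
  [set l : Lb | match l with inl i => i \in I | inr v => v \in X0 end]%SET.
Definition vert (w : {ffun 'I_m -> 'I_n}) (l : Lb) : 'I_n := match l with inl i => w i | inr v => v end.
Definition Xs (X0 : {set 'I_n}) (I : {set 'I_m}) (w : {ffun 'I_m -> 'I_n}) : {set 'I_n} := [set vert w l | l in labs X0 I]%SET.
Definition colv (X0 : {set 'I_n}) (I : {set 'I_m}) (c : {ffun Lb -> 'I_k}) (w : {ffun 'I_m -> 'I_n}) (v : 'I_n) : 'I_k :=
  if [pick l in labs X0 I | vert w l == v] is Some l then c l else s v.
Definition valid (X0 : {set 'I_n}) (I : {set 'I_m}) (c : {ffun Lb -> 'I_k}) (w : {ffun 'I_m -> 'I_n}) : bool :=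
  [&& #|Xs X0 I w| == (#|X0| + #|I|)%N, (q <= #|X0| + #|I|)%N, [forall d, (#|Xs X0 I w :&: V d| <= 2 * q)%N] &
      [forall v in Xs X0 I w, colv X0 I c w v != s v]].
(** At a forest position the prescribed edge, elsewhere an edge allowed by [okp]; these are
    conditions on separate independent draws. The default [true] concerns only indices beyond the
    list. *)
Definition hev (X0 : {set 'I_n}) (I : {set 'I_m}) (g : {ffun 'I_m -> Lb}) (c : {ffun Lb -> 'I_k}) (w : {ffun 'I_m -> 'I_n}) (i : nat) (e : Y) : bool :=
  if insub i is Some j then
    if (j : 'I_m) \in I then epair e == [set w j; vert w (g j)]%SET else okp (Xs X0 I w) (colv X0 I c w) e
  else true.

Lemma card_labs (X0 : {set 'I_n}) (I : {set 'I_m}) : #|labs X0 I| = (#|X0| + #|I|)%N.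
Proof.
have -> : labs X0 I = ([set inl i | i in I] :|: [set inr v | v in X0])%SET.
  apply/setP => -[i|v]; rewrite !inE.
    apply/idP/orP => [iI|[/imsetP[j jI [->]] //|/imsetP[j _] //]]; by left; apply: imset_f.
  apply/idP/orP => [iI|[/imsetP[j _] //|/imsetP[j jI [->]] //]]; by right; apply: imset_f.
rewrite cardsU !card_imset; [|by move=> a b []..].
rewrite (_ : _ :&: _ = set0) ?cards0 ?subn0 1?addnC //.
by apply/setP => l; rewrite !inE; apply/negP => /andP[/imsetP[i _ ->] /imsetP[v _]].
Qed.

Variable nuk : R.
Hypothesis nuP : forall x x' : nat, (x' <= x)%N -> (q <= x)%N -> (x <= k * (2 * q))%N ->
  nuk * x%:R <= (m%:R - x'%:R) * (2 * x%:R * (lo - 2 * q%:R) / n%:R ^+ 2).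

Lemma valid_size (X0 : {set 'I_n}) (I : {set 'I_m}) c w : valid X0 I c w -> (#|X0| + #|I| <= k * (2 * q))%N.
Proof.
move=> /and4P[/eqP <- _ /forallP cX _].
apply: (@leq_trans (\sum_(d < k) #|Xs X0 I w :&: V d|)); last first.
  apply: (@leq_trans (\sum_(d < k) (2 * q))); first by apply: leq_sum => d _.
  by rewrite sum_nat_const card_ord.
rewrite -sum1_card (partition_big s xpredT) //=; apply: leq_sum => d _.
by rewrite sum1dep_card; apply: subset_leq_card; apply/fintype.subsetP => v; rewrite !inE.
Qed.

Lemma hev_mean (X0 : {set 'I_n}) (I : {set 'I_m}) g c w : valid X0 I c w ->
  Ex (unif R (X := Y)) m (fun xs => \prod_(i < m) (hev X0 I g c w i (at_ (vd, vd) xs i))%:R) <=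
  (1 - k%:R^-1) ^+ m * (4 / n%:R ^+ 2) ^+ #|I| * expR (- (nuk * (#|X0| + #|I|)%:R)).
Proof.
move=> vl; have np := n_gt0; have kp : 0 < k%:R :> R by rewrite ltr0n ltnW.
have xk := valid_size vl; have /and4P[/eqP cXs qxx /forallP cX /forallP cs] := vl.
pose b : R := 1 - k%:R^-1.
have b2 : 1 / 2 <= b.
  have : k%:R^-1 <= 2^-1 :> R by rewrite lef_pV2 ?posrE // (ler_nat R 2).
  by rewrite /b; lra.
rewrite (Ex_indep (vd, vd) (@unif0 R Y) m (fun i e => (hev X0 I g c w i e)%:R)).
set x := (#|X0| + #|I|)%N in cXs qxx xk *.
have u0 t e : 0 <= unif R (X := Y) t e by exact: unif0.
have qx0 : 0 <= qx x%:R.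
  have A := avg_okp 0 (X := Xs X0 I w) (col := colv X0 I c w) _ cX.
  rewrite cXs in A; apply: le_trans (A _); first by apply: sumr_ge0 => e _; rewrite mulr_ge0.
  by move=> v vX; have := cs v; rewrite vX.
apply: (@le_trans _ _ (\prod_(i < m) (if i \in I then 2 / n%:R ^+ 2 else qx x%:R))).
  apply: ler_prod => i _; apply/andP; split; first by apply: sumr_ge0 => e _; rewrite mulr_ge0.
  have E : insub (nat_of_ord i) = Some i :> option 'I_m by rewrite valK.
  rewrite /hev E; case: ifP => iI; first exact: avg_pair.
  rewrite -cXs; apply: avg_okp => // v vX; by have := cs v; rewrite vX.
rewrite (bigID (fun i => i \in I)) /= (eq_bigr (fun=> 2 / n%:R ^+ 2)) => [|i -> //].
rewrite [X in _ * X](eq_bigr (fun=> qx x%:R)) => [|i /negbTE -> //].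
rewrite !prodr_const.
have Im : (#|I| <= m)%N by rewrite -[m in (_ <= m)%N]card_ord max_card.
have cI : #|[pred i : 'I_m | i \notin I]| = (m - #|I|)%N.
  have CC : (#|I| + #|[pred i : 'I_m | i \notin I]|)%N = m := etrans (cardC (mem I)) (card_ord m).
  by apply/eqP; rewrite -(eqn_add2l #|I|) subnKC //; apply/eqP.
rewrite [X in _ ^+ #|I| * _ ^+ X <= _](_ : _ = (m - #|I|)%N); last by rewrite -cI; apply: eq_card => i; rewrite !inE.
have tq : 0 <= 2 * x%:R * (lo - 2 * q%:R) / n%:R ^+ 2.
  by rewrite divr_ge0 ?exprn_ge0 ?(ltW np) // mulr_ge0 ?mulr_ge0 // subr_ge0.
set tt := 2 * x%:R * _ / _ in tq.
have qb : qx x%:R <= b * expR (- tt).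
  have : 1 - tt <= expR (- tt) := expR_ge1Dx _.
  have b1 : b <= 1 by rewrite /b gerBl invr_ge0 ltW.
  rewrite /qx -/tt -/b => h; apply: (@le_trans _ _ (b * (1 - tt))); last by apply: ler_wpM2l => //; lra.
  by have : b * tt <= tt by [rewrite ler_piMl]; lra.
apply: (@le_trans _ _ ((2 / n%:R ^+ 2) ^+ #|I| * (b * expR (- tt)) ^+ (m - #|I|))).
  apply: ler_wpM2l; first by rewrite exprn_ge0 // divr_ge0 // exprn_ge0 // ltW.
  by apply: lerXn2r => //; rewrite nnegrE mulr_ge0 ?expR_ge0 //; lra.
rewrite [X in _ * X <= _]exprMn -expRM_natl natrB //.
(* Forest positions lack the factor [b]. Restoring [b ^ m] costs at most 2 for each, which turns
   [2 / n ^ 2] into [4 / n ^ 2]. *)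
have bI : b ^+ (m - #|I|) <= b ^+ m * 2 ^+ #|I|.
  rewrite -[in b ^+ m](subnK Im) exprD -mulrA ler_peMr ?exprn_ge0 //; first by lra.
  by rewrite -exprMn exprn_ege1 //; lra.
rewrite (_ : (4 / n%:R ^+ 2) ^+ #|I| = (2 / n%:R ^+ 2) ^+ #|I| * 2 ^+ #|I|); last first.
  by rewrite -exprMn; congr (_ ^+ _); field; rewrite lt0r_neq0.
have w0 : 0 <= (2 / n%:R ^+ 2) ^+ #|I| :> R by rewrite exprn_ge0 // divr_ge0 // exprn_ge0 // ltW.
have -> : b ^+ m * ((2 / n%:R ^+ 2) ^+ #|I| * 2 ^+ #|I|) * expR (- (nuk * x%:R)) =
  (2 / n%:R ^+ 2) ^+ #|I| * ((b ^+ m * 2 ^+ #|I|) * expR (- (nuk * x%:R))) by ring.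
apply: ler_wpM2l => //; apply: ler_pM; rewrite ?expR_ge0 ?exprn_ge0 //; first by lra.
rewrite ler_expR mulrN lerN2; apply: nuP => //; exact: leq_addl.
Qed.

(** The vertex [w i] ranges only over the class of the colour taken by its parent. This saves a
    factor of about [k] per edge, so that an edge costs only [H], of order ln k. *)
Definition bad_sum (j : 'I_k) (xs : seq Y) : R :=
  \sum_(X0 : {set 'I_n} | X0 \subset V j) \sum_(I : {set 'I_m})
  \sum_(g in pffun_on (inr vd) I (labs X0 I)) \sum_(c in pffun_on c0 (labs X0 I) predT)
  \sum_(w in pfamily vd I (fun i => V (c (g i)))) (valid X0 I c w)%:R *
    \prod_(i < m) (hev X0 I g c w i (at_ (vd, vd) xs i))%:R.

Lemma card_pfamily_le (I : {set 'I_m}) (F : 'I_m -> {set 'I_n}) :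
  (forall i, #|F i|%:R <= rho) -> #|pfamily vd I F|%:R <= rho ^+ #|I|.
Proof.
move=> hF; have r0 : 0 <= rho by apply: le_trans (rhoP c0).
rewrite card_pfamily [X in rho ^+ X]cardE -[X in rho ^+ X](size_map (fun i => #|F i|)) /image_mem.
have hF' : all (fun x : nat => x%:R <= rho) [seq #|F x| | x <- enum I] by apply/allP => x /mapP[i _ ->].
elim: [seq _ | x <- enum I] hF' => [|a l IH] /=; first by rewrite expr0.
by move=> /andP[h1 h2]; rewrite natrM exprS; apply: ler_pM => //; exact: IH.
Qed.

Variables (H sigma : R).
Hypothesis H1 : 1 <= H.
Hypothesis HP : 4 * rho * m%:R / n%:R ^+ 2 <= H.
Hypothesis sig0 : 0 <= sigma.
Hypothesis sigP : sigma + 1 + ln k%:R + ln H <= nuk.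

(** [x ^ j / j!] is at most [exp x]: choosing the positions as an unordered set compensates for the
    choice of the parents. *)
Lemma bin_pow_le (x j : nat) : 'C(m, j)%:R * x%:R ^+ j <= m%:R ^+ j * expR x%:R :> R.
Proof.
have f0 : 0 < j`!%:R :> R by rewrite ltr0n fact_gt0.
have e1 : x%:R ^+ j / j`!%:R <= expR x%:R :> R.
  case: j {f0} => [|j]; first by rewrite expr0 fact0 divr1; apply: le_trans (expR_ge1Dx _); rewrite lerDl.
  by apply: le_trans (expR_ge1Dxn j _) => //; rewrite lerDr.
have e2 : 'C(m, j)%:R * j`!%:R <= m%:R ^+ j :> R.
  rewrite -natrM bin_ffact -natrX ler_nat; elim: j {f0 e1} => [|j IH]; first by rewrite ffactn0.
  by rewrite ffactnSr expnSr leq_mul // leq_subr.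
have -> : 'C(m, j)%:R * x%:R ^+ j = ('C(m, j)%:R * j`!%:R) * (x%:R ^+ j / j`!%:R) :> R by field; rewrite lt0r_neq0.
by apply: ler_pM; rewrite ?mulr_ge0 ?divr_ge0 ?exprn_ge0.
Qed.

(** Per vertex, colours cost [ln k], parents 1 and edges at most [ln H], against the gain [nuk]; the
    surplus is [sigma]. Root sets cost at most [exp rho] in total, because they are subsets of a
    single class. *)
Lemma bad_sum_mean j : Ex (unif R (X := Y)) m (bad_sum j) <=
  (1 - k%:R^-1) ^+ m * (m.+1%:R * expR (rho - sigma * q%:R)).
Proof.
have np := n_gt0; have kp : 0 < k%:R :> R by rewrite ltr0n ltnW.
have r0 : 0 <= rho by apply: le_trans (rhoP c0).
have U0 : forall t e, 0 <= unif R (X := Y) t e by exact: unif0.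
have U1 t : \sum_e unif R (X := Y) t e = 1.
  by apply: unif1; rewrite card_prod !card_ord muln_gt0; move: np; rewrite ltr0n => ->.
pose b : R := 1 - k%:R^-1.
have b0 : 0 <= b by rewrite /b subr_ge0 invf_le1 // ler1n ltnW.
pose B (x0 x' : nat) : R := b ^+ m * (4 / n%:R ^+ 2) ^+ x' * expR (- (nuk * (x0 + x')%:R)) * (q <= x0 + x')%N%:R.
have B0 x0 x' : 0 <= B x0 x' by rewrite !mulr_ge0 ?expR_ge0 ?exprn_ge0 // divr_ge0 // exprn_ge0 // ltW.
rewrite /bad_sum Ex_sum //.
apply: (@le_trans _ _ (\sum_(X0 : {set 'I_n} | X0 \subset V j) \sum_(I : {set 'I_m})
   (#|X0| + #|I|)%:R ^+ #|I| * (k%:R ^+ (#|X0| + #|I|) * (rho ^+ #|I| * B #|X0| #|I|)))).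
  apply: ler_sum => X0 _; rewrite Ex_sum //; apply: ler_sum => I _; rewrite Ex_sum //.
  apply: (@le_trans _ _ (\sum_(g in pffun_on (inr vd) I (labs X0 I)) (k%:R ^+ (#|X0| + #|I|) * (rho ^+ #|I| * B #|X0| #|I|)))); last first.
    by rewrite sumr_const card_pffun_on card_labs -[leLHS]mulr_natl natrX.
  apply: ler_sum => g _; rewrite Ex_sum //.
  apply: (@le_trans _ _ (\sum_(c in pffun_on c0 (labs X0 I) predT) (rho ^+ #|I| * B #|X0| #|I|))); last first.
    by rewrite sumr_const card_pffun_on card_labs -[leLHS]mulr_natl natrX cardT size_enum_ord.
  apply: ler_sum => c _; rewrite Ex_sum //.
  apply: (@le_trans _ _ (\sum_(w in pfamily vd I (fun i => V (c (g i)))) B #|X0| #|I|)); last first.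
    by rewrite sumr_const -[leLHS]mulr_natl; apply: ler_wpM2r => //; apply: card_pfamily_le => i; exact: rhoP.
  apply: ler_sum => w _; rewrite ExZ //; case: (boolP (valid X0 I c w)) => [vl|_]; last by rewrite mul0r.
  rewrite mul1r /B; have /and4P[_ -> _ _] := vl; rewrite mulr1; exact: hev_mean.
apply: (@le_trans _ _ (\sum_(X0 : {set 'I_n} | X0 \subset V j) b ^+ m * (m.+1%:R * expR (- (sigma * q%:R))))); last first.
  rewrite sumr_const -[leLHS]mulr_natl (_ : #|_| = 2 ^ #|V j|)%N; last first.
    by rewrite -card_powerset; apply: eq_card => A; rewrite inE.
  rewrite -/b mulrCA; apply: ler_wpM2l; first exact: exprn_ge0.
  rewrite mulrCA ler_pM2l ?ltr0n // expRD; apply: ler_wpM2r; first exact: expR_ge0.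
  apply: (@le_trans _ _ (expR #|V j|%:R)); last by rewrite ler_expR.
  rewrite natrX -[X in expR X]mulr1 expRM_natl; apply: lerXn2r; rewrite ?nnegrE ?expR_ge0 //.
  by apply: le_trans (expR_ge1Dx _); lra.
apply: ler_sum => X0 _; set x0 := #|X0|.
have := @sum_subsets_card R 'I_m [set: 'I_m]%SET (fun x' => (x0 + x')%:R ^+ x' * (k%:R ^+ (x0 + x') * (rho ^+ x' * B x0 x'))) (fun=> 1).
rewrite (eq_bigl xpredT) => [|I]; last by rewrite subsetT.
under eq_bigr do rewrite mulr1.
move=> ->; rewrite cardsT card_ord.
apply: (@le_trans _ _ (\sum_(x' < m.+1) b ^+ m * expR (- (sigma * q%:R)))); last first.
  by rewrite sumr_const card_ord -[leLHS]mulr_natl; apply: eq_ler; ring.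
apply: ler_sum => -[x' xm] _ /=; rewrite sumr_const card_subs cardsT card_ord.
rewrite /B; case: (leqP q (x0 + x')) => qx'; last by rewrite !mulr0 mul0r mulr_ge0 ?expR_ge0 ?exprn_ge0.
rewrite mulr1; set x := (x0 + x')%N.
have -> : x%:R ^+ x' * (k%:R ^+ x * (rho ^+ x' * (b ^+ m * (4 / n%:R ^+ 2) ^+ x' * expR (- (nuk * x%:R))))) * ('C(m, x')%:R : R) =
  b ^+ m * (('C(m, x')%:R * x%:R ^+ x') * ((rho ^+ x' * (4 / n%:R ^+ 2) ^+ x') * (k%:R ^+ x * expR (- (nuk * x%:R))))).
  by ring.
apply: ler_wpM2l; first exact: exprn_ge0.
have q4 : 0 <= 4 / n%:R ^+ 2 :> R by rewrite divr_ge0 // exprn_ge0 // ltW.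
apply: (@le_trans _ _ ((m%:R ^+ x' * expR x%:R) * ((rho ^+ x' * (4 / n%:R ^+ 2) ^+ x') * (k%:R ^+ x * expR (- (nuk * x%:R)))))).
  by apply: ler_wpM2r; [rewrite !mulr_ge0 ?exprn_ge0 ?expR_ge0 // ltW|exact: bin_pow_le].
have -> : m%:R ^+ x' * expR x%:R * ((rho ^+ x' * (4 / n%:R ^+ 2) ^+ x') * (k%:R ^+ x * expR (- (nuk * x%:R)))) =
  (4 * rho * m%:R / n%:R ^+ 2) ^+ x' * (expR x%:R * (k%:R ^+ x * expR (- (nuk * x%:R)))).
  rewrite (_ : 4 * rho * m%:R / n%:R ^+ 2 = m%:R * (rho * (4 / n%:R ^+ 2))); last by ring.
  by rewrite !exprMn; ring.
have Hp : 0 < H by move: H1; lra.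
apply: (@le_trans _ _ (H ^+ x * (expR x%:R * (k%:R ^+ x * expR (- (nuk * x%:R)))))).
  apply: ler_wpM2r; first by rewrite !mulr_ge0 ?expR_ge0 ?exprn_ge0.
  apply: (@le_trans _ _ (H ^+ x')); last by apply: ler_weXn2l => //; exact: leq_addl.
  by apply: lerXn2r => //; rewrite nnegrE ?(ltW Hp) // divr_ge0 ?exprn_ge0 ?(ltW np) // !mulr_ge0.
have -> : H ^+ x = expR (x%:R * ln H) by rewrite expRM_natl lnK.
have -> : k%:R ^+ x = expR (x%:R * ln k%:R) :> R by rewrite expRM_natl lnK.
rewrite -!expRD ler_expR.
have x0' : 0 <= x%:R :> R by [].
have s1 : x%:R * (sigma + 1 + ln k%:R + ln H) <= x%:R * nuk by apply: ler_wpM2l.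
have s2 : sigma * q%:R <= sigma * x%:R by apply: ler_wpM2l => //; rewrite ler_nat.
by move: s1 s2; lra.
Qed.

Lemma term_le_sum (T : finType) (P : pred T) (F : T -> R) i :
  (forall j, 0 <= F j) -> P i -> F i <= \sum_(j | P j) F j.
Proof. by move=> F0 Pi; rewrite (bigD1 i) //= lerDl sumr_ge0. Qed.

Lemma bad_sum_ge0 j xs : 0 <= bad_sum j xs.
Proof.
do 5![apply: sumr_ge0 => ? _]; apply: mulr_ge0 => //; by apply: prodr_ge0.
Qed.

(* The edge indices label the non-root vertices of the forest. *)
Lemma bad_sum_ge1 j (xs : seq Y) X X0 col par idx :
  (forall i : 'I_m, s (at_ (vd, vd) xs i).1 != s (at_ (vd, vd) xs i).2) ->
  forest s (fun i : 'I_m => epair (at_ (vd, vd) xs i)) j X X0 col par idx ->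
  closedf s (fun i : 'I_m => epair (at_ (vd, vd) xs i)) X col ->
  (q <= #|X|)%N -> (forall d, (#|X :&: V d| <= 2 * q)%N) -> 1 <= bad_sum j xs.
Proof.
move=> bi [f1 f2 f3 f4 f5] cl qX cX.
pose I : {set 'I_m} := [set idx u | u in X :\: X0]%SET.
pose w : {ffun 'I_m -> 'I_n} := [ffun i => if [pick u in X :\: X0 | idx u == i] is Some u then u else vd].
have wE u : u \in X :\: X0 -> w (idx u) = u.
  move=> uX; rewrite ffunE; case: pickP => [u' /andP[u'X /eqP e]|h]; first exact: f5.
  by have := h u; rewrite uX eqxx.
have wI i : i \in I -> w i \in X :\: X0 /\ idx (w i) = i.
  by move=> /imsetP[u uX ->]; rewrite wE.
pose lab u : Lb := if u \in X0 then inr u else inl (idx u).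
have labP u : u \in X -> lab u \in labs X0 I /\ vert w (lab u) = u.
  move=> uX; rewrite /lab; case: ifP => uX0; first by rewrite inE.
  have uD : u \in X :\: X0 by rewrite inE uX uX0.
  by split; [rewrite inE; apply: imset_f|exact: wE].
pose g : {ffun 'I_m -> Lb} := [ffun i => if i \in I then lab (par (w i)) else inr vd].
pose c : {ffun Lb -> 'I_k} := [ffun l => if l \in labs X0 I then col (vert w l) else c0].
have parX i : i \in I -> [/\ w i \in X, par (w i) \in X, s (w i) = col (par (w i)) & epair (at_ (vd, vd) xs i) = [set w i; par (w i)]%SET].
  move=> iI; have [wD wi] := wI i iI; move: wD; rewrite inE => /andP[wX0 wX].
  by have [p1 p2 p3] := f4 _ wX wX0; split=> //; rewrite -p3 wi.
have gE i : i \in I -> vert w (g i) = par (w i) /\ g i \in labs X0 I.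
  by move=> iI; rewrite ffunE iI; have [_ pX _ _] := parX i iI; have [] := labP _ pX.
have XsE : Xs X0 I w = X.
  apply/setP => v; apply/imsetP/idP => [[[i|u]]|vX].
  - by rewrite inE => /wI[]; rewrite inE => /andP[_ wX] _ ->.
  - by rewrite inE => uX0 ->; exact: (fintype.subsetP f1).
  - by have [h1 h2] := labP v vX; exists (lab v).
have colE v : v \in X -> colv X0 I c w v = col v.
  move=> vX; rewrite /colv; case: pickP => [l /andP[lL /eqP lv]|h].
    by rewrite ffunE lL lv.
  by have [h1 h2] := labP v vX; have := h (lab v); rewrite h1 h2 eqxx.
have cardX : #|X| = (#|X0| + #|I|)%N.
  by rewrite card_in_imset // -(cardsID X0 X) (setIidPr f1).
have vl : valid X0 I c w.
  apply/and4P; split; rewrite ?XsE -?cardX ?eqxx //; first by apply/forallP.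
  by apply/forallP => v; apply/implyP => vX; rewrite colE // f3.
rewrite /bad_sum.
have p0 X0' I' g' c' w' : 0 <= (valid X0' I' c' w')%:R * \prod_(i < m) (hev X0' I' g' c' w' i (at_ (vd, vd) xs i))%:R.
  by apply: mulr_ge0 => //; apply: prodr_ge0.
apply: le_trans (term_le_sum _ f2); last first.
  by move=> ?; do 4![apply: sumr_ge0 => ? _].
apply: le_trans (@term_le_sum _ xpredT _ I _ isT); last first.
  by move=> ?; do 3![apply: sumr_ge0 => ? _].
apply: le_trans (@term_le_sum _ (mem (pffun_on (inr vd) I (labs X0 I))) _ g _ _); last first.
- apply/pffun_onP; split.
    by apply/fintype.subsetP => i; rewrite -topredE /= ffunE; case: ifP; rewrite ?eqxx.
  by move=> _ /imageP[i iI ->]; have [] := gE i iI.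
- by move=> ?; do 2![apply: sumr_ge0 => ? _].
apply: le_trans (@term_le_sum _ (mem (pffun_on c0 (labs X0 I) predT)) _ c _ _); last first.
- apply/pffun_onP; split; last by [].
  by apply/fintype.subsetP => l; rewrite -topredE /= ffunE; case: ifP; rewrite ?eqxx.
- by move=> ?; apply: sumr_ge0.
apply: le_trans (@term_le_sum _ (mem (pfamily vd I (fun i => V (c (g i))))) _ w _ _); last first.
- apply/pfamilyP; split.
    apply/fintype.subsetP => i; rewrite -topredE /= ffunE; case: pickP => [u /andP[uX /eqP <-] _|]; last by rewrite eqxx.
    exact: imset_f.
  move=> i iI; have [wX pX sw _] := parX i iI; have [h1 h2] := gE i iI.
  by rewrite inE [c _]ffunE h2 h1 sw.
- by move=> w'; exact: p0.
rewrite vl mul1r big1 // => i _; rewrite /hev valK; case: ifP => iI.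
  by have [_ _ _ ->] := parX i iI; have [-> _] := gE i iI; rewrite eqxx.
rewrite /okp XsE bi /=.
set e := at_ _ _ _; have Ee : epair (at_ (vd, vd) xs i) = [set e.1; e.2]%SET by [].
have h1 : ((e.1 \in X) && (s e.2 == colv X0 I c w e.1)) ==> (e.2 \in X).
  apply/implyP => /andP[x1]; rewrite colE // => /eqP; exact: (cl _ _ _ x1 Ee).
have h2 : ((e.2 \in X) && (s e.1 == colv X0 I c w e.2)) ==> (e.1 \in X).
  apply/implyP => /andP[x1]; rewrite colE // => /eqP; apply: (cl _ i _ x1); by rewrite Ee setUC.
by rewrite h1 h2.
Qed.
End Planted.

Lemma all_prod (R : realType) (T : Type) (P : pred T) (xs : seq T) :
  (all P xs)%:R = \prod_(x <- xs) (P x)%:R :> R.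
Proof.
elim: xs => [|x xs IH] /=; first by rewrite big_nil.
by rewrite big_cons -IH -natrM mulnb.
Qed.

Lemma epair_fibre n (u : {set 'I_n}) : u \in kedges 2 n -> #|[set x | epair x == u]%SET| = 2%N.
Proof.
rewrite inE => /cards2P[a [b [ab ->]]].
rewrite (_ : [set x | epair x == [set a; b]%SET]%SET = [set (a, b); (b, a)]%SET).
  by rewrite cards2 xpair_eqE negb_and ab.
apply/setP => -[u' v]; rewrite !inE /epair /= !xpair_eqE; apply/eqP/idP => [e|].
  have : u' \in [set a; b]%SET by rewrite -e !inE eqxx.
  have : v \in [set a; b]%SET by rewrite -e !inE eqxx orbT.
  have : a \in [set u'; v]%SET by rewrite e !inE eqxx.
  have : b \in [set u'; v]%SET by rewrite e !inE eqxx orbT.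
  by rewrite !inE !(eq_sym _ u') !(eq_sym _ v); do 4![case/orP => /eqP ?]; subst; rewrite ?eqxx ?orbT.
by case/orP => /andP[/eqP -> /eqP ->] //; rewrite setUC.
Qed.

Lemma epair_edge n (e : 'I_n * 'I_n) : (epair e \in kedges 2 n) = (e.1 != e.2).
Proof. by rewrite inE /epair cards2; case: (_ != _). Qed.

Lemma avg_epair (R : realType) n t : (0 < n)%N ->
  1 - 1 / n%:R <= \sum_(x : 'I_n * 'I_n) unif R t x * (epair x \in kedges 2 n)%:R.
Proof.
move=> n0; have np : 0 < n%:R :> R by rewrite ltr0n.
rewrite -mulr_sumr /unif card_prod card_ord natrM.
rewrite -(pair_bigA _ (fun u v => (epair (u, v) \in kedges 2 n)%:R)) /=.
rewrite (eq_bigr (fun=> n%:R - 1)) => [|u _].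
  rewrite sumr_const card_ord; have -> : (n%:R - 1) *+ n = n%:R * (n%:R - 1) :> R by rewrite mulr_natl.
  by apply: eq_ler; field; rewrite lt0r_neq0.
under eq_bigr do rewrite epair_edge /=.
rewrite (eq_bigr (fun v => 1 - (v == u)%:R)) => [|v _]; last by rewrite eq_sym; case: (v == u); rewrite /= ?subr0 ?subrr.
rewrite sumrB sumr_const card_ord (bigD1 u) //= eqxx big1 ?addr0 // => v /negbTE -> //.
Qed.

Lemma ncolE (R : realType) n k (s : {ffun 'I_n -> 'I_k}) c : ncol R s c = #|[set v | s v == c]%SET|%:R.
Proof. by rewrite /ncol -(sum_indic R); apply: eq_bigr => v _; rewrite inE. Qed.

(** * Mean number of colourings with many non-rigid vertices *)

Section ColorBad.
Variables (R : realType) (n k m : nat) (vd : 'I_n) (c0 : 'I_k) (i0 : 'I_m) (eps del cc : R) (q : nat).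
Hypothesis k1 : (1 < k)%N.
Hypothesis q0 : (0 < q)%N.
Hypothesis eps0 : 0 < eps.
Hypothesis ccq : forall h : nat, h%:R < cc * n%:R -> (h <= q)%N.
Hypothesis qe : q%:R <= eps * (n%:R / k%:R).
Local Notation Y := ('I_n * 'I_n)%type.
Local Notation N := (n%:R / k%:R : R).
Local Notation badset J := [set s in proper_colorings k J | ~~ ((1 - eps) * n%:R <= #|[set v | rigid (proper_colorings k J) s (cc * n%:R) v]%SET|%:R)]%SET.

(** Unbalanced colourings are charged to the first summand. For a balanced bad colouring the
    pigeonhole principle gives a class with at least [q] non-rigid vertices, from which a forest is
    grown. *)
Lemma bad_pointwise (xs : seq Y) : size xs = m -> all (fun x => epair x \in kedges 2 n) xs ->
  #|badset (setof (@epair n) xs)|%:R <= \sum_(s : {ffun 'I_n -> 'I_k})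
    ((~~ balc del s)%:R * (all (fun e : Y => s e.1 != s e.2) xs)%:R +
     (balc del s)%:R * \sum_j bad_sum R m s vd c0 q j xs).
Proof.
move=> sx ae; rewrite -(sum_indic R); apply: ler_sum => s _.
have bs0 : 0 <= \sum_j bad_sum R m s vd c0 q j xs by apply: sumr_ge0 => j _; exact: bad_sum_ge0.
case: (boolP (s \in _)) => [|_]; last by rewrite addr_ge0 // mulr_ge0.
rewrite inE -ltNge => /andP[sP nr].
have atx i : (i < m)%N -> at_ (vd, vd) xs i \in xs by move=> im; rewrite -mem_rev mem_nth // size_rev sx.
have bi e : e \in xs -> s e.1 != s e.2.
  move=> exs; move: sP; rewrite inE => /forallP /(_ e.1) /forallP /(_ e.2).
  have := allP ae e exs; rewrite epair_edge => -> /=.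
  by rewrite (_ : [set e.1; e.2]%SET \in setof (@epair n) xs) // inE; apply/mapP; exists e.
case: (boolP (balc del s)) => bal /=; last first.
  by rewrite mul0r addr0 mul1r (_ : all _ xs) //; apply/allP.
rewrite mul0r add0r mul1r.
set J := setof _ xs in sP nr *.
pose NR := [set v | ~~ rigid (proper_colorings k J) s (cc * n%:R) v]%SET.
have nNR : eps * n%:R <= #|NR|%:R.
  have E : #|[set v | rigid (proper_colorings k J) s (cc * n%:R) v]%SET|%:R + #|NR|%:R = n%:R :> R.
    rewrite -!(sum_indic R) -big_split (eq_bigr (fun=> 1)) ?sumr_const ?card_ord // => v _.
    by rewrite !inE; case: (rigid _ _ _ v); rewrite /= ?addr0 ?add0r.
  by move: E nr; lra.
have kp : 0 < k%:R :> R by rewrite ltr0n ltnW.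
have [j hj] : exists j, (q <= #|NR :&: [set v | s v == j]%SET|)%N.
  apply/existsP; rewrite -[[exists _, _]]negbK negb_exists; apply/negP => /forallP h.
  have : #|NR|%:R < eps * n%:R.
    have -> : #|NR|%:R = \sum_j #|NR :&: [set v | s v == j]%SET|%:R :> R.
      rewrite -natr_sum; congr (_%:R); rewrite -sum1_card (partition_big s xpredT) //=; apply: eq_bigr => d _.
      by rewrite sum1dep_card; apply: eq_card => v; rewrite !inE.
    apply: (@lt_le_trans _ _ (\sum_(j < k) q%:R)).
      apply: ltr_sum; last by move=> d _; rewrite ltr_nat ltnNge h.
      by apply/hasP; exists c0; rewrite ?mem_index_enum.
    rewrite sumr_const card_ord -[leLHS]mulr_natl mulrC -ler_pdivlMr //.
    by apply: le_trans qe _; rewrite mulrA.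
  by rewrite ltNge nNR.
have EJ (i : 'I_m) : epair (at_ (vd, vd) xs i) \in J.
  by rewrite inE; apply/mapP; exists (at_ (vd, vd) xs i) => //; apply: atx.
have hR v : v \in NR :&: [set v | s v == j]%SET ->
   exists tau, [/\ tau \in proper_colorings k J, tau v != s v & (hamming s tau <= q)%N].
  rewrite !inE => /andP[/forallPn[tau]]; rewrite negb_imply => /andP[tP]; rewrite negb_imply -ltNge => /andP[tv ht] _.
  by exists tau; split=> //; exact: ccq.
have [X [X0 [col [par [idx [f cl qX cX]]]]]] := forest_exists EJ i0 q0 (subsetIr _ _) hj hR.
apply: (@le_trans _ _ (bad_sum R m s vd c0 q j xs)); last first.
  by rewrite [leRHS](bigD1 j) //= lerDl sumr_ge0 // => d _; exact: bad_sum_ge0.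
apply: (bad_sum_ge1 R c0 _ f cl qX cX) => i; apply: bi; exact: atx.
Qed.

Hypothesis del0 : 0 <= del.
Hypothesis lo_q : 2 * q%:R <= (1 - del) * N.
Variables (nuk H sigma ub : R).
Hypothesis nuP : forall x x' : nat, (x' <= x)%N -> (q <= x)%N -> (x <= k * (2 * q))%N ->
 nuk * x%:R <= (m%:R - x'%:R) * (2 * x%:R * ((1 - del) * N - 2 * q%:R) / n%:R ^+ 2).
Hypothesis H1 : 1 <= H.
Hypothesis HP : 4 * ((1 + del) * N) * m%:R / n%:R ^+ 2 <= H.
Hypothesis sig0 : 0 <= sigma.
Hypothesis sigP : sigma + 1 + ln k%:R + ln H <= nuk.
Hypothesis Hub : \sum_(s : {ffun 'I_n -> 'I_k}) k%:R ^- n * (~~ balc del s)%:R <= ub.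

Lemma color_bad_mean : Ex (unif R (X := Y)) m (fun xs => (all (fun x => epair x \in kedges 2 n) xs)%:R *
    #|badset (setof (@epair n) xs)|%:R) <=
  k%:R ^+ n * (1 - k%:R^-1) ^+ m * (ub + k%:R * (m.+1%:R * expR ((1 + del) * N - sigma * q%:R))).
Proof.
have U0 : forall t e, 0 <= unif R (X := Y) t e by exact: unif0.
have n0 : (0 < n)%N by case: (n) vd => [[]|].
have U1 t : \sum_e unif R (X := Y) t e = 1 by apply: unif1; rewrite card_prod !card_ord muln_gt0 n0.
have kp : 0 < k%:R :> R by rewrite ltr0n ltnW.
have b0 : 0 <= 1 - k%:R^-1 :> R by rewrite subr_ge0 invf_le1 // ler1n ltnW.
have kn : 0 < k%:R ^+ n :> R by rewrite exprn_gt0.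
apply: (@le_trans _ _ (Ex (unif R (X := Y)) m (fun xs => \sum_(s : {ffun 'I_n -> 'I_k})
    ((~~ balc del s)%:R * (all (fun e : Y => s e.1 != s e.2) xs)%:R +
     (balc del s)%:R * \sum_j bad_sum R m s vd c0 q j xs)))).
  apply: Ex_le => // xs sx; case: (boolP (all _ xs)) => ae.
    by rewrite mul1r; exact: bad_pointwise.
  rewrite mul0r; apply: sumr_ge0 => s _; rewrite addr_ge0 // mulr_ge0 //.
  by apply: sumr_ge0 => j _; exact: bad_sum_ge0.
rewrite Ex_sum //.
apply: (@le_trans _ _ (\sum_(s : {ffun 'I_n -> 'I_k}) ((~~ balc del s)%:R * (1 - k%:R^-1) ^+ m +
    (1 - k%:R^-1) ^+ m * (k%:R * (m.+1%:R * expR ((1 + del) * N - sigma * q%:R)))))).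
  apply: ler_sum => s _; rewrite ExD // !ExZ //; apply: lerD.
    apply: ler_wpM2l => //.
    pose a : R := \sum_e unif R (X := Y) 0 e * (s e.1 != s e.2)%:R.
    have -> : Ex (unif R (X := Y)) m (fun xs => (all (fun e : Y => s e.1 != s e.2) xs)%:R) = a ^+ m.
      rewrite -(Ex_prod U0 m (h := fun e : Y => (s e.1 != s e.2)%:R) (q := a)) //.
      by apply: eq_Ex => // xs _; exact: all_prod.
    have loP c : 0 <= #|[set v | s v == c]%SET|%:R :> R by [].
    (* For the empty set [okp] is plain properness of the edge. *)
    have A := @avg_okp R n k s vd 0 0%N k1 loP 0%N set0 s.
    apply: lerXn2r; rewrite ?nnegrE //; first by apply: sumr_ge0 => e _; rewrite mulr_ge0.
    have -> : a = \sum_e unif R (X := Y) 0 e * (okp s set0 s e)%:R.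
      by apply: eq_bigr => e _; rewrite /okp !inE /= andbT.
    apply: le_trans (A _ _) _.
    - by move=> w; rewrite inE.
    - by move=> c; rewrite set0I cards0.
    - by rewrite /qx cards0 mulr0 mul0r mul0r subr0.
  case: (boolP (balc del s)) => [bal|_]; last by rewrite mul0r !mulr_ge0 ?exprn_ge0 ?expR_ge0 // ltW.
  rewrite mul1r Ex_sum //.
  apply: (@le_trans _ _ (\sum_(j < k) (1 - k%:R^-1) ^+ m * (m.+1%:R * expR ((1 + del) * N - sigma * q%:R)))); last first.
    by rewrite sumr_const card_ord -[leLHS]mulr_natl; apply: eq_ler; ring.
  apply: ler_sum => j _.
  have rP c : #|[set v | s v == c]%SET|%:R <= (1 + del) * N by rewrite -ncolE; case/andP: (forallP bal c).
  have lP c : (1 - del) * N <= #|[set v | s v == c]%SET|%:R by rewrite -ncolE; case/andP: (forallP bal c).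
  exact: (bad_sum_mean vd c0 k1 rP lP lo_q nuP H1 HP sig0 sigP).
rewrite big_split /= -mulr_suml sumr_const card_ffun !card_ord -[X in _ + X]mulr_natl natrX.
have -> : k%:R ^+ n * (1 - k%:R^-1) ^+ m * (ub + k%:R * (m.+1%:R * expR ((1 + del) * N - sigma * q%:R))) =
  k%:R ^+ n * ub * (1 - k%:R^-1) ^+ m + k%:R ^+ n * ((1 - k%:R^-1) ^+ m * (k%:R * (m.+1%:R * expR ((1 + del) * N - sigma * q%:R)))) by ring.
rewrite lerD2r; apply: ler_wpM2r; first exact: exprn_ge0.
rewrite mulrC -ler_pdivrMr // mulr_suml; apply: le_trans Hub; apply: ler_sum => s _; by rewrite mulrC.
Qed.
End ColorBad.

Lemma ln_lin (R : realType) (a x : R) : 0 < a -> 0 < x -> ln x <= ln (1 / a) + a * x.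
Proof.
move=> a0 x0; have -> : x = 1 / a * (a * x) by field; rewrite lt0r_neq0.
rewrite lnM ?posrE ?divr_gt0 ?mulr_gt0 // (_ : a * (1 / a * (a * x)) = a * x); last by field; rewrite lt0r_neq0.
rewrite lerD2l; have := @le_ln1Dx R (a * x - 1); rewrite (_ : 1 + (a * x - 1) = a * x); last by ring.
have ax : 0 < a * x by rewrite mulr_gt0.
by move=> h; have := h _; lra.
Qed.

Lemma color_rigid_large (R : realType) (eps : R) (k : nat) (d : R) : 0 < eps -> eps < 1 / 4 ->
  (8 < k)%N -> 8 <= ln k%:R :> R -> 16 <= eps * (eps / 64) * ln k%:R ->
  1 + ln (16 * ln k%:R) <= eps / 8 * ln k%:R -> (1 + kk R k) ^+ 4 <= 1 + eps / 8 ->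
  (1 + eps) * (k%:R * ln k%:R) <= d -> d <= (2 - eps) * (k%:R * ln k%:R) ->
  exists2 c : R, 0 < c & whp_rigid graphs (proper_colorings k)
    (fun n => Num.truncn (d * n%:R / 2)) c (1 - eps).
Proof.
move=> e0 e4; pose del := eps / 64; rewrite -/del => k9N L8 Ld Ll kk4 d1 d2.
have del0 : 0 < del by rewrite divr_gt0.
have dele : del = eps / 64 by [].
have k2 : (1 < k)%N by apply: leq_trans k9N.
have kN0 : (0 < k)%N by apply: leq_trans k9N.
have kp : 0 < k%:R :> R by rewrite ltr0n.
have k1 : 1 <= k%:R :> R by rewrite ler1n.
have kn0 : k%:R != 0 :> R by rewrite lt0r_neq0.
set L := ln k%:R in L8 Ld Ll d1 d2.
have L0 : 0 < L by move: L8; clear; lra.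
have d8 : 8 <= d.
  apply: le_trans d1; have : 1 * 8 <= k%:R * L by apply: ler_pM.
  move: (k%:R * L) => w w8; have : 0 <= eps * w by apply: mulr_ge0; [exact: ltW|move: w8; clear; lra].
  by move: w8; clear; lra.
have dp : 0 < d by move: d8; clear; lra.
have dk1 : (1 + eps) * L <= d / k%:R by rewrite ler_pdivlMr // -mulrA (mulrC L).
have dk2 : d / k%:R <= (2 - eps) * L by rewrite ler_pdivrMr // -mulrA (mulrC L).
(* The deficit [eps / 8 * L] covers [1 + ln (4 * cl)], while [d / (2 * k)] at most
   [(1 - eps / 2) * L] leaves room for the slack [eps / 8 * L]. *)
pose cl := (1 - eps / 8) * L.
have cl0 : 0 < cl by rewrite mulr_gt0 //; move: e4; clear; lra.
have eL : 0 <= eps * L by rewrite mulr_ge0 // ltW.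
have cl4 : 4 * cl <= 16 * L by rewrite /cl; move: L0 eL; clear; lra.
have lcl : ln (4 * cl) <= ln (16 * L) by rewrite ler_ln // posrE; apply: mulr_gt0.
have clk : 4 * cl <= k%:R.
  have E1 : expR (ln (4 * cl)) = 4 * cl by rewrite lnK // posrE mulr_gt0.
  have E2 : expR L = k%:R by rewrite lnK.
  rewrite -E1 -E2 ler_expR.
  have : eps * L <= 1 * L by rewrite ler_pM2r //; move: e4; clear; lra.
  by move: lcl Ll eL L0; clear; lra.
have cll : 1 + cl + ln (4 * cl) <= ln k%:R by rewrite -/L; move: lcl Ll; rewrite /cl; clear; lra.
have sl0 : 0 < eps / 8 * L by rewrite mulr_gt0 // divr_gt0.
have Hcl : (1 + kk R k) ^+ 4 / k%:R * (d / 2) + eps / 8 * L <= cl.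
  have -> : (1 + kk R k) ^+ 4 / k%:R * (d / 2) = (1 + kk R k) ^+ 4 * (d / k%:R / 2) by field.
  have : (1 + kk R k) ^+ 4 * (d / k%:R / 2) <= (1 + eps / 8) * ((2 - eps) * L / 2).
    apply: ler_pM => //; first by rewrite exprn_ge0 // addr_ge0 // invr_ge0.
      by rewrite !divr_ge0 // ltW.
    by move: dk2; clear; lra.
  have : 0 <= eps * (eps * L) by rewrite mulr_ge0 // ltW.
  by rewrite /cl; move: eL; clear; lra.
(* Half the rate of [balc_prob], so that unbalanced colourings are negligible against the lower
   bound on the count. *)
pose zeta := del ^+ 2 / (32 * k%:R).
have z_0 : 0 < zeta by rewrite divr_gt0 ?exprn_gt0 // mulr_gt0.
have zk : zeta <= 1 / (2 * k%:R).
  rewrite /zeta ler_pdivrMr ?mulr_gt0 // (_ : 1 / (2 * k%:R) * (32 * k%:R) = 16); last by field.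
  have : del ^+ 2 <= 1 by rewrite expr_le1 ?(ltW del0) //; move: e4; rewrite /del; clear; lra.
  by clear; lra.
exists (del / k%:R); first by rewrite divr_gt0.
apply: whp_rigid_intro => z z0.
pose C0 := expR (2 * 1 * (d / 2) + 4 * (d / 2) ^+ 2 * 2%:R) : R.
have C0p : 0 < C0 by exact: expR_gt0.
(* By the hypothesis on [L] the product [sigma * del] is at least 4, so [sigma * q] is about
   [4 * n / k] or more and exceeds the cost of the roots, of the polynomial factors and of
   [zeta]. *)
pose sigma := eps / 4 * L.
have s0 : 0 <= sigma by rewrite mulr_ge0 ?divr_ge0 // ltW.
pose B := C0 * (2 * k%:R + d * k%:R ^+ 2 * expR sigma).
have [N1 HN1] := colors_lower k9N cl0 clk cll dp sl0 Hcl z_0 z0.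
have [N2 HN2] := ev_and (ev_nat (2 : R)) (ev_and (ev_nat (4 * d)) (ev_and (ev_nat (k%:R / del))
  (ev_and (ev_nat (1 / (2 * del))) (ev_exp B z_0 z0)))).
exists (maxn N1 N2) => n; rewrite geq_max => /andP[/HN1 HL /HN2[n2 [n4 [nk [nd nB]]]]].
have np : 0 < n%:R :> R by move: n2; clear; lra.
have n0 : (0 < n)%N by rewrite -(ltr_nat R).
pose m := Num.truncn (d * n%:R / 2).
rewrite -/m in HL *.
have dn0 : 0 <= d * n%:R / 2 by rewrite divr_ge0 // mulr_ge0 // ltW.
have mr : m%:R <= d / 2 * n%:R by rewrite mulrAC truncn_le.
have mr' : d * n%:R / 2 - 1 <= m%:R by exact: truncn_ge_sub1.
have dn8 : 8 * n%:R <= d * n%:R by rewrite ler_pM2r.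
have m0 : (0 < m)%N by rewrite -(ltr_nat R); move: mr' dn8 n2; clear; lra.
pose vd := Ordinal n0; pose c0 := Ordinal kN0; pose i0 := Ordinal m0.
have b0 : 0 < 1 - k%:R^-1 :> R by rewrite subr_gt0 invf_lt1 // ltr1n.
pose L' := k%:R ^+ n * (1 - k%:R^-1) ^+ m * expR (- (zeta * n%:R)).
have L'p : 0 < L' by rewrite mulr_gt0 ?expR_gt0 // mulr_gt0 // exprn_gt0.
have Xn : (n ^ 2 <= #|{: 'I_n * 'I_n}|)%N by rewrite card_prod card_ord mulnn.
have avgC := @avg_epair R n 0 n0.
have fibr u : u \in kedges 2 n -> #|[set x : 'I_n * 'I_n | epair x == u]%SET| = 2%N := @epair_fibre n u.
have d20 : 0 <= d / 2 by rewrite divr_ge0 // ltW.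
have nk' : 2 * 1 <= n%:R :> R by rewrite mulr1.
have nr : 4 * (d / 2) * 2%:R <= n%:R by move: n4; clear; lra.
have [Cc _ _ mC] := @constraint_count R _ _ (kedges 2 n) (@epair n) 2 n m 1 (d / 2) isT n0 d20 fibr Xn avgC ler01 nk' mr nr.
exists L'; split=> //.
  by rewrite /graphs hypergraph_subs card_subs bin_gt0; apply: leq_trans mC; exact: leq_pmull.
rewrite /graphs hypergraph_subs.
apply: le_trans (@subset_le_list_const R _ _ (kedges 2 n) (@epair n) 2 n m 1 (d / 2) _ isT n0 d20 fibr Xn avgC ler01 nk' mr nr _) _.
  by move=> J; exact: ler0n.
rewrite -/C0.
pose q := Num.truncn (del / k%:R * n%:R).
have u0 : 0 <= del / k%:R * n%:R by rewrite mulr_ge0 // divr_ge0 // ltW.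
have qE : del / k%:R * n%:R = del * (n%:R / k%:R) by ring.
have ql : q%:R <= del * (n%:R / k%:R) by rewrite -qE truncn_le.
have qg : del * (n%:R / k%:R) - 1 <= q%:R by rewrite -qE; exact: truncn_ge_sub1.
pose Nk := n%:R / k%:R : R.
have Nk0 : 0 < Nk by rewrite divr_gt0.
rewrite -/Nk in ql qg.
have nE : n%:R = Nk * k%:R by rewrite /Nk; field.
have q0 : (0 < q)%N.
  rewrite truncn_ge_nat // qE -ler_pdivrMl // mulr1 /Nk ler_pdivlMr // mulrC.
  by move: nk.
have ccq (h : nat) : h%:R < del / k%:R * n%:R -> (h <= q)%N by move=> hh; rewrite truncn_ge_nat // ltW.
have dN : 0 <= del * Nk by rewrite mulr_ge0 // ltW.
have qe : q%:R <= eps * (n%:R / k%:R) by apply: le_trans ql _; rewrite ler_pM2r // dele; move: e0; clear; lra.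
have lo_q : 2 * q%:R <= (1 - del) * (n%:R / k%:R).
  have : del * Nk <= 1 / 4 * Nk by rewrite ler_pM2r //; move: e4; rewrite dele; clear; lra.
  by rewrite -/Nk; move: ql Nk0; clear; lra.
pose nuk := (1 + eps / 2) * L.
have nuP (x x' : nat) : (x' <= x)%N -> (q <= x)%N -> (x <= k * (2 * q))%N ->
   nuk * x%:R <= (m%:R - x'%:R) * (2 * x%:R * ((1 - del) * (n%:R / k%:R) - 2 * q%:R) / n%:R ^+ 2).
  move=> xx _ xq; have x0 : 0 <= x%:R :> R by [].
  have x'b : x'%:R <= 2 * del * n%:R.
    apply: (@le_trans _ _ (k * (2 * q))%:R); first by rewrite ler_nat; apply: leq_trans xq.
    rewrite !natrM nE; have := ql; rewrite -(ler_pM2l kp).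
    by clear; lra.
  have mb : d * n%:R / 2 * (1 - del) <= m%:R - x'%:R.
    have h1 : 1 <= 2 * del * n%:R by move: nd; rewrite ler_pdivrMr ?mulr_gt0 //; clear; lra.
    have h2 : del * (8 * n%:R) <= del * (d * n%:R) by rewrite ler_pM2l.
    by move: mr' x'b h1 h2; clear; lra.
  have lb : (1 - 3 * del) * Nk <= (1 - del) * (n%:R / k%:R) - 2 * q%:R by rewrite -/Nk; move: ql; clear; lra.
  apply: (@le_trans _ _ (d * n%:R / 2 * (1 - del) * (2 * x%:R * ((1 - 3 * del) * Nk) / n%:R ^+ 2))); last first.
    have g1 : 0 <= 1 - del by move: e4; rewrite dele; clear; lra.
    have g3 : 0 <= 1 - 3 * del by move: e4; rewrite dele; clear; lra.
    apply: ler_pM => //.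
    - by rewrite mulr_ge0.
    - by rewrite divr_ge0 ?sqr_ge0 // mulr_ge0 ?mulr_ge0 // ltW.
    - apply: ler_wpM2r; first by rewrite invr_ge0 sqr_ge0.
      by apply: ler_wpM2l; rewrite ?mulr_ge0.
  have -> : d * n%:R / 2 * (1 - del) * (2 * x%:R * ((1 - 3 * del) * Nk) / n%:R ^+ 2) =
     (d / k%:R) * ((1 - del) * (1 - 3 * del)) * x%:R.
    by rewrite /Nk; field; rewrite kn0 lt0r_neq0.
  apply: ler_wpM2r => //.
  apply: (@le_trans _ _ ((1 + eps) * L * (1 - 4 * del))).
    rewrite /nuk (_ : (1 + eps) * L * (1 - 4 * del) = (1 + eps) * (1 - 4 * del) * L); last by ring.
    by rewrite ler_pM2r // dele; move: e0 e4; clear; nra.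
  apply: ler_pM => //.
  - by rewrite mulr_ge0 // ?(ltW L0) //; move: e0; clear; lra.
  - by move: e4; rewrite dele; clear; lra.
  - by move: del0; clear; nra.
have H1 : 1 <= 16 * L by move: L8; clear; lra.
have HP : 4 * ((1 + del) * (n%:R / k%:R)) * m%:R / n%:R ^+ 2 <= 16 * L.
  apply: (@le_trans _ _ (4 * ((1 + del) * (n%:R / k%:R)) * (d / 2 * n%:R) / n%:R ^+ 2)).
    apply: ler_wpM2r; first by rewrite invr_ge0 sqr_ge0.
    apply: ler_wpM2l => //; rewrite mulr_ge0 // mulr_ge0 ?divr_ge0 // addr_ge0 // ltW //.
  have -> : 4 * ((1 + del) * (n%:R / k%:R)) * (d / 2 * n%:R) / n%:R ^+ 2 = 2 * (1 + del) * (d / k%:R).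
    by field; rewrite kn0 lt0r_neq0.
  apply: (@le_trans _ _ (4 * (2 * L))); last by move: L0; clear; lra.
  apply: ler_pM.
  - by rewrite mulr_ge0 // addr_ge0 // ltW.
  - by rewrite divr_ge0 // ltW.
  - by move: e4; rewrite dele; clear; lra.
  - by move: dk2 eL; clear; lra.
have sigP : sigma + 1 + ln k%:R + ln (16 * L) <= nuk.
  by rewrite -/L /sigma /nuk; move: Ll eL; clear; lra.
have del1 : del <= 1 by rewrite dele; move: e4; clear; lra.
have Hub := @balc_prob R n k kN0 del (ltW del0) del1.
have BM := @color_bad_mean R n k m vd c0 i0 eps del (del / k%:R) q k2 q0 ccq qe lo_q
  nuk (16 * L) sigma _ nuP H1 HP s0 sigP Hub.
apply: le_trans (ler_wpM2l (ltW C0p) BM) _.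
apply: (@le_trans _ _ (B * expR (- (zeta * n%:R)) * L')); last by rewrite ler_pM2r.
have -> : B * expR (- (zeta * n%:R)) * L' = C0 * (k%:R ^+ n * (1 - k%:R^-1) ^+ m *
   ((2 * k%:R + d * k%:R ^+ 2 * expR sigma) * (expR (- (zeta * n%:R)) * expR (- (zeta * n%:R))))) by rewrite /B /L'; ring.
rewrite ler_pM2l // ler_pM2l; last by rewrite mulr_gt0 // exprn_gt0.
rewrite -expRD [leRHS]mulrDl; apply: lerD.
  apply: ler_wpM2l; first by rewrite mulr_ge0 // ltW.
  rewrite ler_expR; apply: eq_ler; rewrite /zeta; field; exact: kn0.
have m1 : m.+1%:R <= d * (k%:R * expR Nk).
  have h : Nk <= expR Nk by have := expR_ge1Dx Nk; clear; lra.
  apply: (@le_trans _ _ (d * n%:R)).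
    by rewrite -natr1; move: mr dn8 n2; clear; lra.
  by rewrite ler_pM2l // nE mulrC ler_pM2l.
have -> : d * k%:R ^+ 2 * expR sigma * expR (- (zeta * n%:R) + - (zeta * n%:R)) =
   k%:R * (d * (k%:R * expR Nk) * expR (sigma - Nk - 2 * (zeta * n%:R))).
  rewrite (_ : sigma - Nk - 2 * (zeta * n%:R) = sigma + (- (zeta * n%:R) + - (zeta * n%:R)) - Nk); last by ring.
  rewrite !expRD [expR (- Nk)]expRN; field; rewrite lt0r_neq0 // expR_gt0 //.
rewrite ler_pM2l //; apply: ler_pM; rewrite ?expR_ge0 //.
rewrite ler_expR -/Nk.
have zn : 2 * (zeta * n%:R) <= Nk.
  have : zeta * n%:R <= 1 / (2 * k%:R) * n%:R by rewrite ler_pM2r.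
  rewrite (_ : 1 / (2 * k%:R) * n%:R = Nk / 2); last by rewrite /Nk; field.
  by clear; lra.
have E1 : sigma * (del * Nk - 1) <= sigma * q%:R by apply: ler_wpM2l.
have E2 : 4 * Nk <= sigma * del * Nk by rewrite ler_pM2r // /sigma; move: Ld; clear; lra.
have E3 : del * Nk <= 1 * Nk by rewrite ler_pM2r.
by move: E1 E2 E3 zn; clear; lra.
Qed.

Theorem color_rigid (R : realType) (eps : R) : 0 < eps -> eps < 1 / 4 ->
  exists K : nat, forall k, (K <= k)%N -> forall d : R,
  (1 + eps) * (k%:R * ln k%:R) <= d -> d <= (2 - eps) * (k%:R * ln k%:R) ->
  exists2 c : R, 0 < c & whp_rigid graphs (proper_colorings k)
    (fun n => Num.truncn (d * n%:R / 2)) c (1 - eps).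
Proof.
(* With this [a] the linear term of [ln_lin] at [16 * L] is [eps / 16 * L]; [C] is the size of [L]
   that makes the constant term as small. *)
move=> e0 e4; pose a := eps / 256; have a0 : 0 < a by rewrite divr_gt0.
pose C := `|1 + ln (1 / a)| / (eps / 16).
have e16 : 0 < eps / 16 by rewrite divr_gt0.
have [K HK] := ev_and (ev_nat (9 : R)) (ev_and (ev_nat (1 + 120 / eps))
  (ev_ln (8 + 16 / (eps * (eps / 64)) + C))).
exists K => k /HK[k9 [ke kl]] d.
have k9N : (8 < k)%N by rewrite -(ler_nat R).
set L := ln k%:R in kl *.
have c1 : 0 <= 16 / (eps * (eps / 64)) by rewrite divr_ge0 // mulr_ge0 ?divr_ge0 // ltW.
have c2 : 0 <= C by rewrite divr_ge0 // ltW.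
have L8 : 8 <= L by move: kl c1 c2; clear; lra.
have L0 : 0 < L by move: L8; clear; lra.
have Ld : 16 <= eps * (eps / 64) * L.
  have : 16 / (eps * (eps / 64)) <= L by move: kl c1 c2; clear; lra.
  by rewrite ler_pdivrMr ?mulr_gt0 ?divr_gt0 // mulrC.
have LC : C <= L by move: kl c1; clear; lra.
apply: color_rigid_large => //.
  have h1 : 1 + ln (1 / a) <= eps / 16 * L.
    by apply: le_trans (ler_norm _) _; move: LC; rewrite /C ler_pdivrMr // [L * _]mulrC.
  have := ln_lin a0 (mulr_gt0 (ltr0n _ 16) L0); rewrite /a -/L in h1 *.
  by move: h1; clear; lra.
have km : k.-1%:R = k%:R - 1 :> R by rewrite -subn1 natrB //; apply: leq_trans k9N.
have k0 : 0 < k%:R - 1 :> R by move: k9; clear; lra.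
have x0 : 0 <= kk R k by rewrite invr_ge0.
have xe : kk R k <= eps / 120.
  rewrite /kk km -[leLHS]mul1r ler_pdivrMr //.
  have : 120 / eps <= k%:R - 1 by move: ke; clear; lra.
  by rewrite ler_pdivrMr //; clear; lra.
have x1 : kk R k <= 1 by move: xe e4; clear; lra.
move: (kk R k) x0 xe x1 => x x0 xe x1.
(* 15 = 4 + 6 + 4 + 1, since higher powers of [x] are at most [x]; with [eps / 120] this gives
   [eps / 8]. *)
apply: (@le_trans _ _ (1 + 15 * x)); last by move: xe; clear; lra.
have x2 : x ^+ 2 <= x by rewrite expr2 ler_piMl.
have x3 : x ^+ 3 <= x by rewrite exprS ler_piMr // exprn_ile1.
have x4 : x ^+ 4 <= x by rewrite exprS ler_piMr // exprn_ile1.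
have -> : (1 + x) ^+ 4 = 1 + 4 * x + 6 * x ^+ 2 + 4 * x ^+ 3 + x ^+ 4 by ring.
by move: x2 x3 x4; clear; lra.
Qed.

(** * Two-colourings of hypergraphs *)

(** The central coefficient is the largest of [2 * h + 1]. It makes the balanced colourings a
    polynomial fraction of all, as [Om0_card] demands. *)
Lemma central_bin h : (4 ^ h <= (2 * h).+1 * 'C(2 * h, h))%N.
Proof.
elim: h => [//|h IH].
have E1 : ((h.+1) * 'C((2 * h).+1, h.+1) = (2 * h).+1 * 'C(2 * h, h))%N.
  by rewrite -mul_bin_diag.
have E2 : 'C(2 * h.+1, h.+1) = (2 * 'C((2 * h).+1, h.+1))%N.
  rewrite (_ : 2 * h.+1 = (2 * h).+2)%N; last by lia.
  rewrite binS -(@bin_sub (2 * h).+1 h); last by lia.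
  by rewrite (_ : (2 * h).+1 - h = h.+1)%N; lia.
rewrite expnS E2; apply: (@leq_trans (4 * ((2 * h).+1 * 'C(2 * h, h)))); first by rewrite leq_mul2l IH orbT.
rewrite -E1; move: 'C(_, _) => w; nia.
Qed.

Section Hypergraph.
Variables (R : realType) (n N k : nat).
Hypothesis nN : (n <= N)%N.
Hypothesis NS : (N <= n.+1)%N.
Hypothesis n0 : (0 < n)%N.
Hypothesis k3 : (2 < k)%N.
Hypothesis k_large : 64 * k%:R ^+ 2 <= 2 ^+ k :> R.
Local Notation X := {ffun 'I_k -> 'I_N}.

(** [N] is [n] rounded up to an even number, so that exact balance is possible. A possible extra
    point is dropped; a tuple that hits it keeps fewer than [k] points and encodes no edge. *)
Definition edge_of (x : X) : {set 'I_n} := [set v : 'I_n | [exists i, x i == widen_ord nN v]]%SET.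
Local Notation edges := (kedges k n).

Lemma edge_of_im (x : X) : edge_of x = [set v | widen_ord nN v \in [set x i | i in 'I_k]%SET]%SET.
Proof.
apply/setP => v; rewrite !inE; apply/existsP/imsetP => [[i /eqP <-]|[i _ ->]]; by exists i.
Qed.

Lemma widen_inj : injective (widen_ord nN).
Proof. by move=> u v /(congr1 val) /= uv; apply/val_inj. Qed.

Lemma edge_fibre u : u \in edges -> #|[set x | edge_of x == u]%SET| = k`!.
Proof.
rewrite inE => /eqP cu; pose u' := [set widen_ord nN v | v in u]%SET.
have cu' : #|u'| = k by rewrite card_imset ?cu //; exact: widen_inj.
have := card_inj_ffuns_on 'I_k (mem u'); rewrite card_ord cu' ffactnn => <-.
apply: eq_card => x; rewrite !inE.
apply/eqP/andP => [xu|[/ffun_onP xC /injectiveP xi]].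
  have su : u' \subset [set x i | i in 'I_k]%SET.
    apply/fintype.subsetP => w /imsetP[v vu ->]; move: vu; rewrite -xu inE.
    by move=> /existsP[i /eqP <-]; apply: imset_f.
  have ci : #|[set x i | i in 'I_k]%SET| == #|'I_k|.
    rewrite eqn_leq leq_imset_card card_ord -[X in (X <= _)%N]cu' subset_leq_card //.
  have eu : u' = [set x i | i in 'I_k]%SET.
    by apply/eqP; rewrite eqEcard su (eqP ci) card_ord cu' /=.
  split; first by apply/ffun_onP => i; rewrite -topredE /= eu imset_f.
  by move/imset_injP: ci => h; apply/injectiveP => i j; apply: h.
have eu : [set x i | i in 'I_k]%SET = u'.
  apply/eqP; rewrite eqEcard; apply/andP; split.
    by apply/fintype.subsetP => l /imsetP[i _ ->]; exact: xC.
  by rewrite (card_imset _ xi) card_ord cu'.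
rewrite edge_of_im eu; apply/setP => v; rewrite inE; apply/imsetP/idP => [[w wu /widen_inj ->]//|vu].
by exists v.
Qed.

Lemma good_edge (x : X) : distinct_vars id x -> (forall i, (x i < n)%N) -> edge_of x \in edges.
Proof.
move=> /injectiveP xi xn; rewrite inE.
have -> : edge_of x = [set Ordinal (xn i) | i in 'I_k]%SET.
  apply/setP => v; rewrite inE; apply/existsP/imsetP => [[i /eqP xv]|[i _ ->]]; exists i => //.
    by apply/val_inj; rewrite /= xv.
  by apply/eqP/val_inj.
rewrite card_imset ?card_ord // => i j /(congr1 val) /= xij; apply: xi.
exact/val_inj.
Qed.

Lemma N0 : (0 < N)%N. Proof. exact: leq_trans n0 nN. Qed.

Lemma avg_edge t : 1 - (k%:R ^+ 2 + k%:R) / n%:R <=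
  \sum_x unif R (X := X) t x * (edge_of x \in edges)%:R.
Proof.
have np : 0 < n%:R :> R by rewrite ltr0n.
have Np : 0 < N%:R :> R by rewrite ltr0n N0.
have vc (v : 'I_N) : #|[set l : 'I_N | id l == v]%SET| = 1%N.
  by rewrite (_ : [set l | id l == v]%SET = [set v]%SET) ?cards1 //; apply/setP => l; rewrite !inE.
have h1 := @avg_distinct R N k 1 'I_N id N0 isT vc t.
have h2 (i : 'I_k) : \sum_x unif R (X := X) t x * (n <= x i)%N%:R <= N%:R^-1.
  rewrite (eq_bigr (fun x : X => unif R t x * \prod_j (if j == i then (n <= x j)%N%:R else 1))); last first.
    move=> x _; congr (_ * _); rewrite (bigD1 i) //= eqxx [X in _ * X]big1 ?mulr1 // => j ji.
    by rewrite (negbTE ji).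
  rewrite (avg_prod (fun j (l : 'I_N) => if j == i then (n <= l)%N%:R else 1)).
  rewrite (bigD1 i) //= eqxx [X in _ * X]big1 ?mulr1 => [|j ji]; last first.
    by rewrite (negbTE ji) sumr_const -[X in X / _]mulr_natl mulr1 divff // card_ord lt0r_neq0.
  rewrite card_ord -[leRHS]mul1r; apply: ler_wpM2r; first by rewrite invr_ge0.
  rewrite (eq_bigr (fun l : 'I_N => (l \in [set l : 'I_N | (n <= l)%N]%SET)%:R)) => [|l _]; last by rewrite inE.
  rewrite sum_indic (ler_nat R _ 1); apply/card_le1P => /= a; rewrite inE => na b; rewrite !inE.
  apply/idP/eqP => [nb|->//]; apply/val_inj => /=; have := ltn_ord a; have := ltn_ord b; lia.
apply: (@le_trans _ _ (\sum_x unif R (X := X) t x * ((distinct_vars id x)%:R - \sum_(i : 'I_k) (n <= x i)%N%:R))).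
  under eq_bigr do rewrite mulrBr mulr_sumr.
  rewrite sumrB exchange_big /=.
  have : \sum_(i < k) \sum_x unif R (X := X) t x * (n <= x i)%N%:R <= k%:R / N%:R.
    apply: (@le_trans _ _ (\sum_(i < k) N%:R^-1)); first by apply: ler_sum => i _.
    by rewrite sumr_const card_ord -[leLHS]mulr_natl.
  have : (k%:R ^+ 2 + k%:R) / N%:R <= (k%:R ^+ 2 + k%:R) / n%:R :> R.
    by rewrite ler_pM2l ?lef_pV2 ?posrE ?ler_nat // ltr_pwDr ?exprn_ge0 // ltr0n; apply: leq_trans k3.
  by rewrite mulrDl; lra.
apply: ler_sum => x _; apply: ler_wpM2l; first exact: unif0.
case d: (distinct_vars id x) => /=; last first.
  by rewrite sub0r; apply: (@le_trans _ _ 0) => //; rewrite oppr_le0 sumr_ge0.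
have [h|] := boolP [forall i, (x i < n)%N].
  by rewrite good_edge ?gerBl ?sumr_ge0 // => i; exact: (forallP h).
move=> /forallPn[i]; rewrite -leqNgt => h; rewrite (bigD1 i) //= h.
by apply: (@le_trans _ _ 0) => //; rewrite subr_le0 lerDl sumr_ge0.
Qed.

Definition c2 (b : bool) : 'I_2 := if b then ord_max else ord0.
Definition monox (T : eqType) (s : 'I_N -> T) (x : X) : bool := [forall i, forall j, s (x i) == s (x j)].

Definition ext (s : {ffun 'I_N -> bool}) : {ffun 'I_n -> 'I_2} := [ffun v => c2 (s (widen_ord nN v))].

Lemma ext_sol (xs : seq X) (s : {ffun 'I_N -> bool}) : all (fun x => edge_of x \in edges) xs ->
  all (fun x => ~~ monox s x) xs -> ext s \in hypergraph_2colorings (setof edge_of xs).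
Proof.
move=> ae am; rewrite inE; apply/forallP => e; apply/implyP; rewrite inE => /mapP[x xxs ->].
have := allP am x xxs; apply: contra => /forallP mo; apply/forallP => i; apply/forallP => j.
have nx a : (x a < n)%N.
  have := allP ae x xxs; rewrite inE edge_of_im => /eqP h.
  rewrite ltnNge; apply/negP => na.
  have : (#|[set widen_ord nN v | v in [set v | widen_ord nN v \in [set x i | i in 'I_k]]]%SET| < #|[set x i | i in 'I_k]%SET|)%N.
    apply: proper_card; apply/properP; split.
      by apply/fintype.subsetP => w /imsetP[v]; rewrite inE => vu ->.
    exists (x a); first exact: imset_f.
    by apply/imsetP => -[v _ xv]; move: na; rewrite xv /= leqNgt ltn_ord.
  rewrite card_imset ?h; last exact: widen_inj.
  by move=> /leq_trans /(_ (leq_imset_card _ _)); rewrite card_ord ltnn.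
have inx a : Ordinal (nx a) \in edge_of x.
  by rewrite inE; apply/existsP; exists a; apply/eqP/val_inj.
have := mo (Ordinal (nx i)); rewrite inx /= => /forallP /(_ (Ordinal (nx j))); rewrite inx /=.
rewrite !ffunE; have w a : widen_ord nN (Ordinal (nx a)) = x a by apply/val_inj.
by rewrite !w; case: (s (x i)); case: (s (x j)).
Qed.

(** Restriction to ['I_n] forgets the colour of at most one point. *)
Lemma ext_card (A : {set {ffun 'I_N -> bool}}) (B : {set {ffun 'I_n -> 'I_2}}) :
  (forall s, s \in A -> ext s \in B) -> (#|A| <= 2 * #|B|)%N.
Proof.
move=> AB; have lN : (N.-1 < N)%N by rewrite prednK ?N0.
pose f s := (ext s, s (Ordinal lN)).
have fi : injective f.
  move=> s s' [/ffunP e1 e2]; apply/ffunP => v.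
  have [vn|vn] := ltnP v n.
    have := e1 (Ordinal vn); rewrite !ffunE.
    have -> : widen_ord nN (Ordinal vn) = v by apply/val_inj.
    by case: (s v); case: (s' v).
  have -> : v = Ordinal lN by apply/val_inj => /=; have := ltn_ord v; lia.
  exact: e2.
rewrite -(card_imset _ fi); apply: (@leq_trans #|setX B [set: bool]|); last first.
  by rewrite cardsX cardsT card_bool mulnC.
apply: subset_leq_card; apply/fintype.subsetP => p /imsetP[s sA ->].
by rewrite !inE AB.
Qed.

Variable h : nat.
Hypothesis Nh : N = (2 * h)%N.
(** Exact balance gives a single spin mean 0, hence orthogonal characters. *)
Definition balanced : {set {ffun 'I_N -> bool}} := [set s : {ffun 'I_N -> bool} | #|[set v | s v]%SET| == h]%SET.
Definition spc (s : {ffun 'I_N -> bool}) (v : 'I_N) : R := if s v then 1 else -1.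
(** Coefficients of the product of [1 - spc] plus the product of [1 + spc], which is 2^k on
    monochromatic tuples and 0 otherwise. Symmetry of the colours already kills the odd ones, so the
    mass counts balanced colourings without reweighting. *)
Definition gc (j : nat) : R := if odd j then 0 else 2.
Definition Ac : R := (2 ^+ k)^-1.

Lemma spc_mean s : s \in balanced -> \sum_v spc s v = 0.
Proof.
rewrite inE => /eqP hs.
rewrite (eq_bigr (fun v => 2 * (v \in [set v | s v]%SET)%:R - 1)) => [|v _]; last first.
  by rewrite /spc inE; case: (s v) => /=; lra.
by rewrite sumrB -mulr_sumr sum_indic sumr_const card_ord hs Nh natrM; lra.
Qed.

Lemma spc_ov s s' : \sum_v spc s v * spc s' v = #|'I_N|%:R * ov R s s'.
Proof.
have np : N%:R != 0 :> R by rewrite pnatr_eq0 -lt0n N0.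
rewrite (eq_bigr (fun v => 1 - 2 * (v \in [set v | s v != s' v]%SET)%:R)); last first.
  by move=> v _; rewrite /spc inE; case: (s v); case: (s' v) => /=; lra.
by rewrite sumrB -mulr_sumr sum_indic sumr_const card_ord /ov -/(hamming s s'); field.
Qed.

Lemma spc_le1 s l : `|spc s l| <= 1.
Proof. by rewrite /spc; case: ifP; rewrite ?normrN1 ?normr1. Qed.

Lemma gc_le j : `|gc j| <= 2.
Proof. by rewrite /gc; case: ifP => _; rewrite ?normr0 // ger0_norm. Qed.

Lemma balanced_card : 2 ^+ N <= N.+1%:R * #|balanced|%:R :> R.
Proof.
have -> : #|balanced| = 'C(N, h).
  have := card_draws 'I_N h; rewrite card_ord => <-.
  pose f (s : {ffun 'I_N -> bool}) := [set v | s v]%SET.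
  have fi : injective f.
    by move=> s s' /setP e; apply/ffunP => v; have := e v; rewrite !inE.
  rewrite -(card_imset _ fi); apply: eq_card => A; rewrite inE.
  apply/imsetP/idP => [[s]|hA]; first by rewrite inE => /eqP sh ->; rewrite sh.
  exists [ffun v => v \in A].
    by rewrite inE -(eqP hA); apply/eqP/eq_card => v; rewrite inE ffunE.
  by apply/setP => v; rewrite inE ffunE.
by rewrite -natrM -natrX ler_nat Nh expnM central_bin.
Qed.

Lemma Gs_gc (s : {ffun 'I_N -> bool}) (x : X) : Gs spc gc s x = \prod_i (1 - spc s (x i)) + \prod_i (1 + spc s (x i)).
Proof.
rewrite (eq_bigr (fun i => 1 + (- spc s (x i)))) // !prod_1D -big_split /=.
apply: eq_bigr => S _; rewrite prodrN /gc /chr -signr_odd.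
by case: (odd _); rewrite ?expr1 ?expr0; ring.
Qed.

Lemma Gs_mono (s : {ffun 'I_N -> bool}) (x : X) : monox s x -> Gs spc gc s x = 2 ^+ k.
Proof.
move=> /forallP mo; rewrite Gs_gc.
have k0 : (0 < k)%N by apply: leq_trans k3.
have E i : spc s (x i) = spc s (x (Ordinal k0)).
  by have := forallP (mo i) (Ordinal k0); rewrite /spc => /eqP ->.
rewrite (eq_bigr (fun=> 1 - spc s (x (Ordinal k0)))) => [|i _]; last by rewrite E.
rewrite [X in _ + X](eq_bigr (fun=> 1 + spc s (x (Ordinal k0)))) => [|i _]; last by rewrite E.
rewrite !prodr_const card_ord /spc; case: (s _).
  by rewrite subrr expr0n -[k == 0]negbK -lt0n k0 add0r.
by rewrite opprK subrr expr0n -[k == 0]negbK -lt0n k0 addr0.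
Qed.

Lemma Gs_nonmono (s : {ffun 'I_N -> bool}) (x : X) : ~~ monox s x -> Gs spc gc s x = 0.
Proof.
move=> /forallPn[i /forallPn[j sij]]; rewrite Gs_gc.
wlog si : i j sij / s (x i).
  move=> hw; case si : (s (x i)); first exact: (hw i j).
  by apply: (hw j i); rewrite 1?eq_sym //; move: sij; rewrite si; case: (s (x j)).
have sj : s (x j) = false by move: sij; rewrite si; case: (s (x j)).
rewrite (bigD1 i) //= {1}/spc si subrr mul0r add0r.
by rewrite (bigD1 j) //= {1}/spc sj subrr mul0r.
Qed.

Definition pm : R := 1 - 2 / 2 ^+ k.

Lemma two_k : 64 * 9 <= 2 ^+ k :> R.
Proof.
have k3' : 3 <= k%:R :> R by rewrite (ler_nat R 3).
apply: le_trans k_large; rewrite ler_pM2l //; nra.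
Qed.

Lemma pm_bounds : 1 / 2 <= pm /\ pm <= 1.
Proof.
have t := two_k; have tp : 0 < 2 ^+ k :> R by lra.
rewrite /pm; split; last by rewrite gerBl divr_ge0 // ltW.
have : 2 / 2 ^+ k <= 1 / 2 :> R by rewrite ler_pdivrMr //; lra.
lra.
Qed.

Lemma Fs_gc (s : {ffun 'I_N -> bool}) (x : X) : Fs spc gc Ac s x = (~~ monox s x)%:R / pm.
Proof.
have t := two_k; have tp : 0 < 2 ^+ k :> R by lra.
rewrite /Fs (_ : 1 - Ac * gc 0 = pm); last by rewrite /gc /Ac /pm /= mulrC.
case: (boolP (monox s x)) => [/Gs_mono|/Gs_nonmono] ->; rewrite /= ?mulr0 ?subr0 //.
by rewrite /Ac mulVf ?lt0r_neq0 // subrr.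
Qed.

Lemma Hs_gc (r : R) : `|r| <= 1 -> Hs k gc `|r| <= 2 * (1 + `|r|) ^+ k.
Proof.
move=> r1; have r0 := normr_ge0 r; move: `|r| r0 r1 => {}r r0 r1.
have : \sum_(S : {set 'I_k}) gc #|S| ^+ 2 * r ^+ #|S| = 2 * (1 + r) ^+ k + 2 * (1 - r) ^+ k.
  rewrite -[1 - r]/(1 + - r) -!sum_set_pow !mulr_sumr -big_split; apply: eq_bigr => S _ /=.
  by rewrite exprNn -signr_odd /gc; case: (odd _); rewrite ?expr1 ?expr0; ring.
rewrite (bigD1 set0) //= -/(Hs k gc r) cards0 expr0 /gc /= => E.
have : (1 - r) ^+ k <= 1 by rewrite exprn_ile1 //; lra.
lra.
Qed.

Local Notation P := (unif R (X := X)).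
Local Notation W := (mass (mu R balanced) (lk balanced spc gc Ac)).

Lemma W_colorings xs : all (fun x => edge_of x \in edges) xs ->
  #|balanced|%:R * pm ^+ size xs * W xs <= 2 * #|hypergraph_2colorings (setof edge_of xs)|%:R.
Proof.
move=> ae; have [pm2 pm1] := pm_bounds; have pmp : 0 < pm by lra.
have B0 : 0 < #|balanced|%:R :> R by apply: Om0_gt0; exact: balanced_card.
have wE s : weight (mu R balanced) (lk balanced spc gc Ac) xs s =
   (s \in [set s in balanced | all (fun x => ~~ monox s x) xs]%SET)%:R / #|balanced|%:R / pm ^+ size xs.
  rewrite inE; elim: xs {ae} => [|x xs IH] /=.
    by rewrite /mu andbT expr0 divr1.
  rewrite IH /lk; case: (s \in balanced) => /=; last by rewrite mul1r !mul0r.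
  rewrite Fs_gc exprS invfM; case: (monox s x) => /=; first by rewrite !mul0r.
  by rewrite mul1r [RHS]mulrCA mulrA.
rewrite /mass; under eq_bigr do rewrite wE.
rewrite -!mulr_suml sum_indic.
have -> (a : R) : #|balanced|%:R * pm ^+ size xs * (a / #|balanced|%:R / pm ^+ size xs) = a.
  by field; rewrite expf_neq0 ?lt0r_neq0.
rewrite -natrM ler_nat; apply: ext_card => s; rewrite inE => /andP[_ am].
exact: ext_sol.
Qed.

Lemma colorings_lower (m : nat) (e y L : R) : 0 < e -> e <= 1 ->
  m%:R * A' gc Ac ^+ 2 * 2 * 2 ^+ k <= (1 - e) * ln 2 * N%:R ->
  16 * (3 / 4) ^+ k <= 1 / 16 :> R ->
  5 * ln (8 / e) <= e / 8 * k%:R ->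
  1 <= y -> y ^+ 8 = N%:R ->
  A' gc Ac ^+ 2 * (4 * 2 ^+ k) * (N%:R ^+ 2 * N.+1%:R ^+ 2 * expR (- y)) <= y / N%:R ->
  2 * N.+1%:R * L <= 2 ^+ N * pm ^+ m * expR (- spin_loss N k gc Ac m (e / 16) y) ->
  Ex P m (fun xs => (all (fun x => edge_of x \in edges) xs)%:R *
     (#|hypergraph_2colorings (setof edge_of xs)|%:R < L)%R%:R) <=
  spin_failure N k gc Ac m (e / 16) y.
Proof.
move=> e0 e1 Hm Hk1 Hk2 y1 y8 yl HL.
have [pm2 pm1] := pm_bounds; have pmp : 0 < pm by lra.
have t := two_k; have tp : 0 < 2 ^+ k :> R by lra.
have L0 : (0 < #|'I_N|)%N by rewrite card_ord N0.
have A0 : 0 <= Ac by rewrite invr_ge0 ltW.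
have Ag4 : Ac * gc 0 <= 1 / 4 by rewrite /Ac /gc /= mulrC ler_pdivrMr //; lra.
have Ak : 2 * Ac * k%:R ^+ 2 <= 1 / 8.
  by rewrite mulrAC ler_pdivrMr //; have := k_large; lra.
have g1 : gc 1 = 0 by [].
have e16 : 0 < e / 16 by rewrite divr_gt0.
have F0 s (x : X) : s \in balanced -> 0 <= Fs spc gc Ac s x.
  by move=> _; rewrite Fs_gc divr_ge0 // ltW.
have k0 : (0 < k)%N by apply: leq_trans k3.
have PB j : (j <= N)%N ->
  'C(N, j)%:R / 2 ^+ N * expR (m%:R * A' gc Ac ^+ 2 * Hs k gc `|1 - 2 * j%:R / N%:R|) <=
  expR (- (e / 16 * (N%:R * (1 - 2 * j%:R / N%:R) ^+ 2))) :> R.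
  move=> jn.
  have r1 : `|1 - 2 * j%:R / N%:R| <= 1 :> R.
    have Np : 0 < N%:R :> R by rewrite ltr0n N0.
    have q1 : j%:R / N%:R <= 1 :> R by rewrite ler_pdivrMr // mul1r ler_nat.
    have q0 : 0 <= j%:R / N%:R :> R by rewrite divr_ge0.
    by rewrite -mulrA ler_norml; apply/andP; split; lra.
  apply: (@pair_exponent R N j k m 2) => //; rewrite ?sqr_ge0 ?N0 //.
  - by rewrite ler1n.
  - exact: Hs_gc.
  - by move=> hh; apply: Hs_small => //; exact: gc_le.
have SL := @spin_lower_bound R N k _ balanced spc gc Ac N0 L0 spc_le1 spc_mean spc_ov balanced_card g1 gc_le A0 Ag4 Ak F0 m (e / 16) e16 PB y y1 y8 yl.
apply: le_trans SL; apply: Ex_le => [|xs sx]; first exact: P_ge0.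
case ae: (all _ xs); rewrite ?mul0r ?mul1r //.
rewrite ler_nat; case: ltP => // hL; case: ltP => // hW.
have := W_colorings ae; rewrite sx leNgt => /negP []; rewrite -(ltr_pM2l (x := N.+1%:R)) ?ltr0n //.
apply: (@lt_le_trans _ _ (2 * N.+1%:R * L)).
  by rewrite mulrCA mulrA ltr_pM2l // mulr_gt0 // ltr0n.
apply: le_trans HL _; rewrite mulrA mulrA; apply: ler_pM; rewrite ?expR_ge0 //.
  by rewrite mulr_ge0 ?exprn_ge0 // ltW.
by apply: ler_wpM2r; [rewrite exprn_ge0 // ltW|exact: balanced_card].
Qed.
End Hypergraph.

Lemma two_colors (a b c : 'I_2) : a != c -> b != c -> a = b.
Proof.
move=> ac bc; apply/val_inj; move: ac bc; rewrite -!val_eqE /=.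
by case: a b c => [[|[|a]] ?] [[|[|b]] ?] [[|[|c]] ?].
Qed.

(** By convexity a random tuple is monochromatic with least probability when the classes are equal,
    so one factor [pm ^ m] bounds all colourings. *)
Lemma power_mean2 (R : realType) (x y : R) k : 0 <= x -> 0 <= y -> x + y = 1 ->
  2 / 2 ^+ k <= x ^+ k + y ^+ k.
Proof.
move=> x0 y0 xy; elim: k => [|k IH]; first by rewrite !expr0 divr1; lra.
have h : 0 <= (x ^+ k - y ^+ k) * (x - y).
  case: (lerP y x) => h.
    by rewrite mulr_ge0 ?subr_ge0 // lerXn2r.
  by apply: mulr_le0; rewrite subr_le0 ?lerXn2r // ltW.
have t0 : 2 ^+ k != 0 :> R by rewrite expf_neq0.
have -> : 2 / 2 ^+ k.+1 = (2 / 2 ^+ k) / 2 :> R by rewrite exprS; field.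
have E : y = 1 - x by lra.
rewrite !exprS; move: h IH; rewrite E; move: (_ ^+ k) ((1 - x) ^+ k) (2 / _) => u v w.
by lra.
Qed.

(** * Planted 2-colourings *)

Section PlantedHypergraph.
Variables (R : realType) (n k : nat).
Hypothesis n0 : (0 < n)%N.
Hypothesis k3 : (2 < k)%N.
Local Notation X := {ffun 'I_k -> 'I_n}.
Local Notation Om := {ffun 'I_n -> 'I_2}.
Local Notation eo := (edge_of (leqnn n)).
Local Notation P := (unif R (X := X)).
Local Notation pm := (1 - 2 / 2 ^+ k : R).

Definition hmono (s : Om) (b : 'I_2) (x : X) : bool := [forall j, s (x j) == b].
Definition hcritB (s : Om) (A : {set 'I_n}) (b : 'I_2) := [set v in A | s v == b]%SET.
Definition hcritD (s : Om) (A : {set 'I_n}) (b : 'I_2) := [set v | (v \notin A) && (s v != b)]%SET.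
(** One vertex lies in [A] and has the colour [p.1] alone; the others lie outside [A]. A change
    confined to [A] that flips it makes the edge monochromatic. *)
Definition hcrit (s : Om) A (x : X) (p : 'I_2 * 'I_k) : bool :=
  (x p.2 \in hcritB s A p.1) && [forall j, (j != p.2) ==> (x j \in hcritD s A p.1)].
Definition hok (s : Om) A (x : X) : bool := ~~ [exists b, hmono s b x] && ~~ [exists p, hcrit s A x p].

Lemma hok_le s A x :
  (hok s A x)%:R <= 1 - \sum_b (hmono s b x)%:R - \sum_p (hcrit s A x p)%:R :> R.
Proof.
have k0 : (0 < k)%N by apply: leq_trans k3.
pose i0 : 'I_k := Ordinal k0.
have other (i : 'I_k) : exists j, j != i.
  have k1 : (1 < k)%N by apply: leq_trans k3.
  have [e|] := eqVneq i i0; last by rewrite eq_sym; exists i0.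
  by exists (Ordinal k1); rewrite e -val_eqE.
rewrite /hok; case: (boolP [exists p, hcrit s A x p]) => [/existsP[p cp]|/existsPn nc].
  rewrite andbF; case/andP: (cp); rewrite inE => /andP[pA /eqP sp] /forallP pD.
  have pj j : j != p.2 -> (x j \notin A) && (s (x j) != p.1) by move=> jp; have := pD j; rewrite jp inE.
  have [j jp] := other p.2; have /andP[jA sj] := pj j jp.
  rewrite [X in 1 - X]big1 => [|b _]; last first.
    case: (boolP (hmono s b x)) => // /forallP h; move: sj.
    by rewrite (eqP (h j)) -sp (eqP (h p.2)) eqxx.
  rewrite (bigD1 p) //= cp big1 ?subr0 ?addr0 ?subrr // => p' pp.
  case: (boolP (hcrit s A x p')) => // /andP[]; rewrite inE => /andP[p'A /eqP sp'] _.
  have E2 : p'.2 = p.2 by apply/eqP; apply: contraT => /pj /andP[]; rewrite p'A.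
  by case/negP: pp; rewrite -pair_eqE /pair_eq /= E2 eqxx andbT -sp -sp' E2.
rewrite andbT [X in _ - X]big1 => [|p _]; last by rewrite (negbTE (nc p)).
rewrite subr0; case: (boolP [exists b, hmono s b x]) => [/existsP[b hb]|/existsPn nb] /=.
  rewrite (bigD1 b) //= hb [X in 1 - (_ + X)]big1 ?addr0 ?subrr // => b' bb.
  case: (boolP (hmono s b' x)) => // /forallP h; move/forallP: hb => /(_ i0) /eqP e.
  by move: bb; rewrite -(eqP (h i0)) e eqxx.
by rewrite big1 ?subr0 // => b _; rewrite (negbTE (nb b)).
Qed.

Lemma avg_hmono t s : 2 / 2 ^+ k <= \sum_x P t x * \sum_b (hmono s b x)%:R.
Proof.
have np : 0 < n%:R :> R by rewrite ltr0n.
under eq_bigr do rewrite mulr_sumr.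
rewrite exchange_big /=.
have E (b : 'I_2) : \sum_x P t x * (hmono s b x)%:R = (ncol R s b / n%:R) ^+ k.
  rewrite (eq_bigr (fun x : X => P t x * \prod_i (s (x i) == b)%:R)); last first.
    move=> x _; congr (_ * _); case: (boolP (hmono s b x)) => [/forallP h|/forallPn[i h]].
      by rewrite big1 // => i _; rewrite h.
    by rewrite (bigD1 i) //= (negbTE h) mul0r.
  by rewrite (avg_prod (fun i l => (s l == b)%:R)) prodr_const !card_ord.
rewrite !big_ord_recl big_ord0 addr0 !E; apply: power_mean2; rewrite ?divr_ge0 ?sumr_ge0 //.
rewrite -mulrDl -big_split /= (eq_bigr (fun=> 1)).
  by rewrite sumr_const card_ord divff ?lt0r_neq0.
move=> v _; have [e|e] := eqVneq (s v) ord0.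
  by rewrite e (_ : ord0 == lift ord0 ord0 = false) // addr0.
by rewrite (@two_colors (s v) (lift ord0 ord0) ord0 e isT) eqxx add0r.
Qed.

Variable lo : R.
Definition hpcrit (a : R) : R := k%:R * (a / n%:R * ((lo - a) / n%:R) ^+ k.-1).

(** Unlike for clauses, the critical probability depends on the class sizes: at least [lo - #|A|]
    vertices of the opposite colour lie outside [A], and lower bounds on the classes enter here. *)
Lemma avg_hok t s (A : {set 'I_n}) : (forall b, lo <= ncol R s b) -> #|A|%:R <= lo ->
  \sum_x P t x * (hok s A x)%:R <= pm * expR (- hpcrit #|A|%:R).
Proof.
move=> slo Alo; have np : 0 < n%:R :> R by rewrite ltr0n.
have X0 : (0 < #|{: X}|)%N by rewrite card_ffun !card_ord expn_gt0 n0.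
have C : hpcrit #|A|%:R <= \sum_x P t x * \sum_p (hcrit s A x p)%:R.
  under [leRHS]eq_bigr do rewrite mulr_sumr.
  rewrite exchange_big /=.
  have E (p : 'I_2 * 'I_k) : #|hcritB s A p.1|%:R / n%:R * ((lo - #|A|%:R) / n%:R) ^+ k.-1 <=
     \sum_x P t x * (hcrit s A x p)%:R.
    rewrite (avg_crit R (hcritB s A p.1) (hcritD s A p.1) t p.2) card_ord; apply: ler_wpM2l; first by rewrite divr_ge0.
    apply: lerXn2r; rewrite ?nnegrE ?divr_ge0 ?subr_ge0 // ler_pM2r ?invr_gt0 // lerBlDr.
    pose b' : 'I_2 := if p.1 == ord0 then ord_max else ord0.
    have bb : b' != p.1 by rewrite /b'; case: (eqVneq p.1 ord0) => [->|]; rewrite // eq_sym.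
    apply: le_trans (slo b') _; rewrite ncolE -natrD ler_nat.
    apply: leq_trans (leq_card_setU _ _); apply: subset_leq_card; apply/fintype.subsetP => v.
    rewrite !inE => /eqP sv; case: (boolP (v \in A)) => //= _; by rewrite ?orbT ?sv ?bb.
  apply: le_trans (ler_sum _ (fun p _ => E p)).
  rewrite -mulr_suml -mulr_suml.
  have -> : \sum_(p : 'I_2 * 'I_k) #|hcritB s A p.1|%:R = k%:R * #|A|%:R :> R.
    rewrite -(pair_bigA _ (fun b (i : 'I_k) => #|hcritB s A b|%:R)) /=.
    under eq_bigr do rewrite sumr_const card_ord -[_ *+ _]mulr_natl.
    rewrite -mulr_sumr; congr (_ * _); rewrite -natr_sum; congr (_%:R).
    rewrite -[in RHS]sum1_card (partition_big s xpredT) //=; apply: eq_bigr => b _.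
    by rewrite sum1dep_card; apply: eq_card => v; rewrite !inE.
  by rewrite /hpcrit; apply: eq_ler; ring.
have p0 : 0 <= hpcrit #|A|%:R by rewrite mulr_ge0 // mulr_ge0 ?exprn_ge0 ?divr_ge0 ?subr_ge0.
have t4 : 4 <= 2 ^+ k :> R.
  rewrite (_ : 4 = 2 ^+ 2 :> R); last by ring.
  by apply: ler_weXn2l; [rewrite ler1n|apply: leq_trans k3].
have t2 : 2 / 2 ^+ k <= 1 / 2 :> R by rewrite ler_pdivrMr; lra.
have t0 : 0 <= 2 / 2 ^+ k :> R by rewrite divr_ge0 // exprn_ge0.
apply: (@le_trans _ _ (1 - 2 / 2 ^+ k - hpcrit #|A|%:R)).
  apply: (@le_trans _ _ (\sum_x P t x * (1 - \sum_b (hmono s b x)%:R - \sum_p (hcrit s A x p)%:R))).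
    by apply: ler_sum => x _; apply: ler_wpM2l; [exact: unif0|exact: hok_le].
  under eq_bigr do rewrite !mulrBr mulr1.
  by rewrite !sumrB unif1 //; have := avg_hmono t s; move: C; lra.
apply: (@le_trans _ _ (pm * (1 - hpcrit #|A|%:R))).
  have := mulr_ge0 t0 p0; lra.
apply: ler_wpM2l; first lra.
by have := expR_ge1Dx (- hpcrit #|A|%:R).
Qed.

Lemma avg_hproper t s : \sum_x P t x * (~~ [exists b, hmono s b x])%:R <= pm.
Proof.
have X0 : (0 < #|{: X}|)%N by rewrite card_ffun !card_ord expn_gt0 n0.
apply: (@le_trans _ _ (\sum_x P t x * (1 - \sum_b (hmono s b x)%:R))); last first.
  under eq_bigr do rewrite mulrBr mulr1.
  by rewrite sumrB unif1 // lerD2l lerN2; exact: avg_hmono.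
apply: ler_sum => x _; apply: ler_wpM2l; first exact: unif0.
apply: le_trans (_ : (hok s set0 x)%:R <= _).
  rewrite ler_nat /hok; case: existsP => //= _; rewrite lt0b; apply/existsPn => p.
  by rewrite /hcrit !inE.
apply: le_trans (hok_le s set0 x) _; rewrite gerBl; exact: sumr_ge0.
Qed.

Lemma hmono_edge xs s : s \in hypergraph_2colorings (setof eo xs) ->
  forall x, x \in xs -> ~~ [exists b, hmono s b x].
Proof.
move=> sS x xxs; apply/existsPn => b; apply/negP => /forallP h.
move: sS; rewrite inE => /forallP /(_ (eo x)); rewrite (_ : eo x \in _) /=; last by rewrite inE; apply/mapP; exists x.
move=> /negP []; apply/forallP => u; apply/implyP; rewrite inE => /existsP[i /eqP ui].
apply/forallP => v; apply/implyP; rewrite inE => /existsP[j /eqP vj].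
have E w : widen_ord (leqnn n) w = w by apply/val_inj.
by rewrite E in ui; rewrite E in vj; rewrite -ui -vj (eqP (h i)) (eqP (h j)).
Qed.

Lemma bad_hok (c g : R) (u1 : nat) xs s : 0 <= c -> u1%:R <= (1 - g) * n%:R ->
  s \in hypergraph_2colorings (setof eo xs) ->
  ~~ (g * n%:R <= #|[set v | rigid (hypergraph_2colorings (setof eo xs)) s (c * n%:R) v]%SET|%:R) ->
  exists A : {set 'I_n}, [/\ (u1 <= #|A|)%N, #|A|%:R <= u1%:R + c * n%:R :> R & all (hok s A) xs].
Proof.
move=> c0 hu sS hb; have [A [A1 A2 A3]] := nonrigid_window c0 hb hu.
exists A; split=> //; apply/allP => x xxs; rewrite /hok (hmono_edge sS xxs) /=.
apply/existsPn => p; apply/negP => /andP[]; rewrite inE => /andP[iA /eqP si] /forallP hj.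
have [t [tS tw tX]] := A3 _ iA.
have /existsPn /(_ (t (x p.2))) /negP := hmono_edge tS xxs; apply; apply/forallP => j.
have [->//|jp] := eqVneq j p.2.
have := hj j; rewrite jp inE /= => /andP[jA sj].
have E : t (x j) = s (x j) by apply/eqP; apply: contraNT jA => /tX.
by apply/eqP; rewrite E; apply: (@two_colors _ _ p.1) => //; rewrite -si.
Qed.

Variables (b0 ub : R).
Hypothesis loE : lo = (1 - b0) * (n%:R / 2).
Hypothesis Hub : \sum_(s : Om) 2%:R ^- n * (~~ balc b0 s)%:R <= ub.

(** Unbalanced colourings are bounded by their proportion [ub] alone; for balanced ones the argument
    is that of the clauses, with [hok] in place of [okx]. *)
Lemma hbad_expectation (m u1 : nat) (c g nu s0 : R) : 0 <= c -> 0 <= s0 -> u1%:R <= (1 - g) * n%:R ->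
  u1%:R + c * n%:R <= lo ->
  (forall a : R, u1%:R <= a -> a <= u1%:R + c * n%:R -> nu * a <= m%:R * hpcrit a) ->
  Ex P m (fun xs => (all (fun x => eo x \in kedges k n) xs)%:R *
    #|[set s in hypergraph_2colorings (setof eo xs) |
       ~~ (g * n%:R <= #|[set v | rigid (hypergraph_2colorings (setof eo xs)) s (c * n%:R) v]%SET|%:R)]%SET|%:R)
  <= 2 ^+ n * pm ^+ m * (ub + expR (n%:R * expR (s0 - nu) - s0 * u1%:R)).
Proof.
move=> c0 s00 hu hlo hnu.
have U0 : forall t x, 0 <= P t x by exact: unif0.
have X0 : (0 < #|{: X}|)%N by rewrite card_ffun !card_ord expn_gt0 n0.
have U1 t : \sum_x P t x = 1 by exact: unif1.
have t4 : 4 <= 2 ^+ k :> R.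
  rewrite (_ : 4 = 2 ^+ 2 :> R); last by ring.
  by apply: ler_weXn2l; [rewrite ler1n|apply: leq_trans k3].
have t1 : 0 <= pm by rewrite subr_ge0 ler_pdivrMr; lra.
pose win (A : {set 'I_n}) := (u1 <= #|A|)%N && (#|A|%:R <= u1%:R + c * n%:R)%R.
apply: (@le_trans _ _ (Ex P m (fun xs => \sum_(s : Om)
   ((~~ balc b0 s)%:R * \prod_(x <- xs) (~~ [exists b, hmono s b x])%:R +
    (balc b0 s)%:R * \sum_(A | win A) \prod_(x <- xs) (hok s A x)%:R)))).
  apply: Ex_le => // xs _.
  set B := [set s in _ | _]%SET.
  apply: (@le_trans _ _ #|B|%:R); first by case: (all _ _); rewrite ?mul1r ?mul0r.
  rewrite -(sum_indic R B); apply: ler_sum => s _.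
  have pr0 A : 0 <= \prod_(x <- xs) (hok s A x)%:R :> R by apply: prodr_ge0.
  have sr0 : 0 <= \sum_(A | win A) \prod_(x <- xs) (hok s A x)%:R :> R by apply: sumr_ge0.
  case sB: (s \in B); last by rewrite addr_ge0 // mulr_ge0 // prodr_ge0.
  move: sB; rewrite inE => /andP[sS sb].
  case: (boolP (balc b0 s)) => _ /=; rewrite mul0r mul1r ?add0r ?addr0; last first.
    by rewrite big_seq big1 // => x xxs; rewrite (hmono_edge sS xxs).
  have [A [A1 A2 A3]] := bad_hok c0 hu sS sb.
  rewrite (bigD1 A) /=; last by rewrite /win A1 A2.
  rewrite big_seq big1 => [|x xxs]; last by rewrite (allP A3).
  by rewrite lerDl; apply: sumr_ge0.
rewrite Ex_sum //.
apply: (@le_trans _ _ (\sum_(s : Om) ((~~ balc b0 s)%:R * pm ^+ m +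
   pm ^+ m * expR (n%:R * expR (s0 - nu) - s0 * u1%:R)))); last first.
  rewrite big_split /= -mulr_suml sumr_const card_ffun !card_ord -[X in _ + X]mulr_natl natrX.
  have -> : 2 ^+ n * pm ^+ m * (ub + expR (n%:R * expR (s0 - nu) - s0 * u1%:R)) =
    2 ^+ n * ub * pm ^+ m + 2 ^+ n * (pm ^+ m * expR (n%:R * expR (s0 - nu) - s0 * u1%:R)) by ring.
  rewrite lerD2r; apply: ler_wpM2r; first exact: exprn_ge0.
  rewrite mulrC -ler_pdivrMr ?exprn_gt0 // mulr_suml; apply: le_trans Hub; apply: ler_sum => s _; by rewrite mulrC.
apply: ler_sum => s _; rewrite ExD // !ExZ //; apply: lerD.
  apply: ler_wpM2l => //.
  rewrite (Ex_prod U0 m (h := fun x => (~~ [exists b, hmono s b x])%:R) (q := \sum_x P 0 x * (~~ [exists b, hmono s b x])%:R)) //.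
  apply: lerXn2r; rewrite ?nnegrE //; last exact: avg_hproper.
  by apply: sumr_ge0 => x _; rewrite mulr_ge0.
case: (boolP (balc b0 s)) => [bal|_]; last by rewrite mul0r mulr_ge0 ?exprn_ge0 ?expR_ge0.
have slo b : lo <= ncol R s b by rewrite loE; case/andP: (forallP bal b).
rewrite mul1r Ex_sum //.
apply: (@le_trans _ _ (\sum_(A : {set 'I_n} | u1%:R <= #|A|%:R :> R) pm ^+ m * expR (- (nu * #|A|%:R)))); last first.
  by rewrite -mulr_sumr; apply: ler_wpM2l; [exact: exprn_ge0|exact: sum_large_sets].
rewrite big_mkcond [leRHS]big_mkcond; apply: ler_sum => A _; rewrite ler_nat /win.
case: (leqP u1 #|A|) => //= h1; case: ifP => h2; last by rewrite mulr_ge0 ?exprn_ge0 ?expR_ge0.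
rewrite (Ex_prod U0 m (h := fun x => (hok s A x)%:R) (q := \sum_x P 0 x * (hok s A x)%:R)) //.
apply: (@le_trans _ _ ((pm * expR (- hpcrit #|A|%:R)) ^+ m)).
  apply: lerXn2r; rewrite ?nnegrE ?mulr_ge0 ?expR_ge0 //; last by apply: avg_hok => //; exact: le_trans h2 hlo.
  by apply: sumr_ge0 => x _; rewrite mulr_ge0.
rewrite exprMn -expRM_natl; apply: ler_wpM2l; first exact: exprn_ge0.
by rewrite ler_expR mulrN lerN2; apply: hnu => //; rewrite ler_nat.
Qed.
End PlantedHypergraph.

Lemma A'_gc (R : realType) k : 2 < 2 ^+ k :> R -> A' (gc R) (Ac R k) = (2 ^+ k - 2)^-1.
Proof.
move=> t2; rewrite /A' /Ac /gc /=; field.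
by apply/andP; split; rewrite lt0r_neq0 //; move: t2; move: (2 ^+ k : R) => w; lra.
Qed.

Theorem hyper_rigid (R : realType) (eps : R) : 0 < eps -> eps < 1 / 4 ->
  exists K : nat, forall k, (K <= k)%N -> forall r : R,
  (1 + eps) * (2 ^+ (k - 1) / k%:R * ln k%:R) <= r -> r <= (1 - eps) * (2 ^+ (k - 1) * ln 2) ->
  exists2 c : R, 0 < c & whp_rigid (uniform_hypergraphs k) hypergraph_2colorings
    (fun n => Num.truncn (r * n%:R)) c (1 - eps).
Proof.
move=> e0 e4; pose del := eps / 64; pose e := eps / 2.
have dele : del = eps / 64 by [].
have del0 : 0 < del by rewrite divr_gt0.
have ep0 : 0 < e by rewrite divr_gt0.
have [K HK] := ev_and (ev_nat (3 : R)) (ev_and (ev_pow (64 : R) 2) (ev_and (ev_pow (256 : R) 0)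
  (ev_and (ev_nat (40 * ln (8 / e) / e)) (ev_and (ev_pow (2 * (1 + 8 / eps)) 1)
   (ev_ln (1 + 8 / (del * eps))))))).
exists K => k /HK[k3 [kp2 [kp0 [ke [kp1 kln]]]]] r.
have kN3 : (2 < k)%N by rewrite -(ler_nat R).
have kN0 : (0 < k)%N by apply: leq_trans kN3.
pose t : R := 2 ^+ k.
have t2E : 2 ^+ (k - 1) = t / 2 :> R by rewrite subn1 /t -[in RHS](prednK kN0) exprS; field.
rewrite t2E => r1 r2.
have kp : 0 < k%:R :> R by lra.
have k1 : 1 <= k%:R :> R by lra.
have kn0 : k%:R != 0 :> R by rewrite lt0r_neq0.
have ln2_1 : ln 2 <= 1 :> R by have := @le_ln1Dx R 1; rewrite (_ : 1 + 1 = 2 :> R); lra.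
have ln2_0 : 0 < ln 2 :> R by rewrite ln_gt0 // ltr1n.
have t43 : (4 / 3) ^+ k <= t by apply: lerXn2r; rewrite ?nnegrE //; lra.
have tp : 0 < t by rewrite exprn_gt0.
have tn0 : t != 0 by rewrite lt0r_neq0.
have kk : k%:R <= k%:R ^+ 2 :> R by rewrite expr2 ler_peMr // ltW.
have k_large : 64 * k%:R ^+ 2 <= t by apply: le_trans kp2 t43.
have t64 : 64 <= t by move: k_large kk k1; clear; lra.
have td : 0 < t - 2 by move: t64; clear; lra.
have L1 : 1 <= ln k%:R :> R.
  by apply: le_trans kln; rewrite lerDl divr_ge0 // mulr_ge0 // ltW.
have L2 : 2 <= del * (eps / 4) * ln k%:R.
  have : 8 / (del * eps) <= ln k%:R by move: kln; clear; lra.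
  by rewrite ler_pdivrMr ?mulr_gt0 //; clear; lra.
have tk1 : 1 <= t / 2 / k%:R.
  by rewrite ler_pdivlMr // mul1r ler_pdivlMr //; move: k_large kk k1; clear; lra.
have r1' : 1 <= r.
  apply: le_trans r1; apply: mulr_ege1; first by move: e0; clear; lra.
  exact: mulr_ege1.
have r0 : 0 < r by move: r1'; clear; lra.
have rt : r <= t.
  apply: le_trans r2 _; apply: (@le_trans _ _ (1 * (t * 1))); last by rewrite mul1r mulr1.
  apply: ler_pM; [by move: e4; clear; lra|by rewrite mulr_ge0 ?divr_ge0 // ltW|by move: e0; clear; lra|].
  by apply: ler_pM; rewrite ?divr_ge0 ?(ltW tp) ?(ltW ln2_0) //; move: tp; clear; lra.
have rk : (1 + eps) * ln k%:R <= r * k%:R / (t / 2).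
  rewrite ler_pdivlMr ?divr_gt0 // -ler_pdivrMr //; apply: le_trans r1.
  by apply: eq_ler; ring.
exists (del / k%:R); first by rewrite divr_gt0.
apply: whp_rigid_intro => z z0.
pose M := k`!; pose kappa : R := k%:R ^+ 2 + k%:R.
have Mp : 0 < M%:R :> R by rewrite ltr0n fact_gt0.
pose C0 := expR (2 * kappa * r + 4 * r ^+ 2 * M%:R).
have C0p : 0 < C0 by exact: expR_gt0.
(* The imbalance enters with the power [k - 1], so it must be of order [1 / k]. *)
pose b0 := del / k%:R.
have b00 : 0 < b0 by rewrite divr_gt0.
have b0d : b0 <= del by rewrite ler_pdivrMr // ler_peMr // ltW.
have b01 : b0 <= 1 by move: b0d e4; rewrite dele; clear; lra.
(* Half the exponent [b0 ^ 2 / 32] that [balc_prob] gives for two colours. *)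
pose zeta := b0 ^+ 2 / 64.
have z_0 : 0 < zeta by rewrite divr_gt0 // exprn_gt0.
have zk : zeta <= 1 / (2 * k%:R).
  have : b0 ^+ 2 <= b0 by rewrite expr2 ler_piMl // ltW.
  have : b0 <= 1 / k%:R by rewrite ler_pM2r ?invr_gt0 // dele; move: e4; clear; lra.
  have -> : 1 / (2 * k%:R) = 1 / k%:R / 2 :> R by field.
  by rewrite /zeta; move: b00; clear; lra.
pose d := Num.min (z / C0) (zeta / 4).
have d0 : 0 < d by rewrite lt_min (divr_gt0 z0 C0p) (divr_gt0 z_0).
have dz : d <= z / C0 by rewrite ge_min lexx.
have dk : d <= zeta / 4 by rewrite ge_min lexx orbT.
have kap0 : 0 < e / 16 by rewrite divr_gt0.
have [Y0 HY] := @spin_asymptotics R k (gc R) (Ac R k) (e / 16) r d kap0 (ltW r0) d0.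
pose s0 := eps / 4 * ln k%:R.
have s00 : 0 <= s0 by rewrite mulr_ge0 ?divr_ge0 ?(ltW e0) //; move: L1; clear; lra.
have z4 : 0 < zeta / 4 by rewrite divr_gt0.
have [N HN] := ev_and (ev_nat (1 : R)) (ev_and (ev_nat (`|Y0| ^+ 8)) (ev_and (ev_nat (2 * kappa))
  (ev_and (ev_nat (4 * r * M%:R)) (ev_and (ev_exp (24 / zeta) z4 ltr01) (ev_and (ev_exp (C0 * (4 + expR s0)) z_0 z0)
   (ev_nat (4 / eps))))))).
exists N => n /HN[n1 [nY [nk [nr [nC1 [nC2 ne]]]]]] {N HN}.
have n0 : (0 < n)%N by rewrite -(ltr_nat R); apply: lt_le_trans n1.
have np : 0 < n%:R :> R by rewrite ltr0n.
have nn0 : n%:R != 0 :> R by rewrite lt0r_neq0.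
pose m := Num.truncn (r * n%:R); rewrite -/m.
have rn0 : 0 <= r * n%:R by rewrite mulr_ge0 // ltW.
have mr : m%:R <= r * n%:R by rewrite truncn_le.
have mr' : r * n%:R - 1 <= m%:R by exact: truncn_ge_sub1.
pose h := uphalf n; pose N := (2 * h)%N.
have NE : N = (odd n + n)%N by rewrite /N mul2n uphalfK.
have nN : (n <= N)%N by rewrite NE leq_addl.
have NS : (N <= n.+1)%N by rewrite NE -add1n leq_add2r leq_b1.
have N0' : (0 < N)%N by exact: leq_trans nN.
have nNR : n%:R <= N%:R :> R by rewrite ler_nat.
have NSR : N%:R <= n%:R + 1 :> R by rewrite natr1 ler_nat.
have [y Yy y8] := root8 N0' (le_trans nY nNR) (normr_ge0 Y0).
have mrN : m%:R <= r * N%:R by apply: le_trans mr _; rewrite ler_pM2l.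
have [y1 yl fail loss] := HY y N m (le_trans (ler_norm _) Yy) y8 mrN.
have Xn N' : (n <= N')%N -> (n ^ 2 <= #|{: {ffun 'I_k -> 'I_N'}}|)%N.
  move=> nN'; rewrite card_ffun !card_ord; apply: (@leq_trans (N' ^ 2)); first by rewrite leq_exp2r.
  by rewrite leq_pexp2l ?(leq_trans n0) // ltnW.
have kap_0 : 0 <= kappa by rewrite addr_ge0 // exprn_ge0.
have fibr N' (nN' : (n <= N')%N) u : u \in kedges k n ->
   #|[set x : {ffun 'I_k -> 'I_N'} | edge_of nN' x == u]%SET| = M by exact: edge_fibre.
have avgC N' (nN' : (n <= N')%N) (NS' : (N' <= n.+1)%N) := @avg_edge R n N' k nN' NS' n0 kN3 k_large 0.
have [Cc _ _ mC] := constraint_count (fact_gt0 k) n0 (ltW r0) (@fibr N nN) (Xn N nN) (avgC N nN NS) kap_0 nk mr nr.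
(* Applied twice: with the even [N] for the lower bound on the count, and with [n] itself for the
   planted bound. *)
have TR N' (nN' : (n <= N')%N) (NS' : (N' <= n.+1)%N) g : (forall J, 0 <= g J) -> _ :=
  @subset_le_list_const R _ _ _ _ M n m kappa r g (fact_gt0 k) n0 (ltW r0) (@fibr N' nN') (Xn N' nN') (avgC N' nN' NS') kap_0 nk mr nr.
pose p := 1 - 2 / t.
have p1 : 0 < p by rewrite subr_gt0 ltr_pdivrMr //; move: t64; clear; lra.
pose L := 2 ^+ n * p ^+ m * expR (- (zeta * n%:R)).
have Lp : 0 < L by rewrite mulr_gt0 ?expR_gt0 // mulr_gt0 ?exprn_gt0.
exists L; split=> //.
- by rewrite hypergraph_subs card_subs bin_gt0; apply: leq_trans mC; exact: leq_pmull.
- rewrite hypergraph_subs; apply: le_trans (TR N nN NS _ _) _ => //; rewrite -/C0.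
  rewrite mulrC -ler_pdivlMr //; apply: le_trans dz; apply: le_trans fail.
  apply: (@colorings_lower R n N k nN NS n0 kN3 k_large h erefl m e y L) => //.
  + by rewrite /e; move: e4; clear; lra.
  + rewrite A'_gc -/t; last by move: t64; clear; lra.
    have ta : t / (t - 2) <= 1 + eps / 8.
      rewrite ler_pdivrMr //.
      have : 2 * (1 + 8 / eps) <= t.
        apply: le_trans t43; apply: le_trans kp1; rewrite expr1 ler_peMr // mulr_ge0 // addr_ge0 // divr_ge0 // ltW //.
      rewrite -(ler_pM2l (x := eps / 8)) ?divr_gt0 //.
      have -> : eps / 8 * (2 * (1 + 8 / eps)) = 2 * (1 + eps / 8).
        by field; rewrite lt0r_neq0.
      by clear; lra.
    have ta0 : 0 <= t / (t - 2) by rewrite divr_ge0 // ltW.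
    apply: (@le_trans _ _ (2 * r / t * N%:R * (t / (t - 2)) ^+ 2)).
      rewrite (_ : m%:R * _ * 2 * t = 2 * m%:R / t * (t / (t - 2)) ^+ 2); last first.
        by field; rewrite tn0 lt0r_neq0.
      apply: ler_wpM2r; first exact: sqr_ge0.
      by rewrite [leRHS]mulrAC; apply: ler_wpM2r; rewrite ?invr_ge0 ?(ltW tp) // -mulrA ler_pM2l.
    have rt2 : 2 * r / t <= (1 - eps) * ln 2.
      rewrite ler_pdivrMr //; move: r2; clear; move: (1 - eps) (ln 2) => a b; lra.
    apply: (@le_trans _ _ ((1 - eps) * ln 2 * N%:R * (1 + eps / 8) ^+ 2)).
      apply: ler_pM; rewrite ?sqr_ge0 //.
      * by rewrite mulr_ge0 // divr_ge0 ?(ltW tp) // mulr_ge0 // ltW.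
      * by apply: ler_wpM2r.
      * by rewrite lerXn2r // nnegrE; move: e0; clear; lra.
    have -> : (1 - eps) * ln 2 * N%:R * (1 + eps / 8) ^+ 2 = (1 - eps) * (1 + eps / 8) ^+ 2 * (ln 2 * N%:R) by ring.
    rewrite -[leRHS]mulrA; apply: ler_wpM2r; first by rewrite mulr_ge0 // ltW.
    by rewrite /e; move: e0 e4; clear; nra.
  + have -> : (3 / 4) ^+ k = ((4 / 3) ^+ k)^-1 :> R by rewrite -exprVn; congr (_ ^+ _); field.
    rewrite expr0 mulr1 in kp0; move: kp0; clear; move: (_ ^+ k) => w w256.
    by rewrite ler_pdivrMr; lra.
  + by move: ke; rewrite ler_pdivrMr //; clear; lra.
  rewrite -/t -/p.
  apply: (@le_trans _ _ (expR (zeta / 2 * n%:R) * L)).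
    rewrite ler_pM2r //.
    have x0 : 0 < zeta / 4 * n%:R by rewrite mulr_gt0.
    have h1 : 24 / zeta <= expR (zeta / 4 * n%:R).
      by move: nC1; rewrite expRN ler_pdivrMr ?expR_gt0 // mul1r.
    have h2 : 1 + zeta / 4 * n%:R <= expR (zeta / 4 * n%:R) by exact: expR_ge1Dx.
    have -> : zeta / 2 * n%:R = zeta / 4 * n%:R + zeta / 4 * n%:R by field.
    rewrite expRD; apply: (@le_trans _ _ (24 / zeta * (zeta / 4 * n%:R))).
      have -> : 24 / zeta * (zeta / 4 * n%:R) = 6 * n%:R by field; rewrite lt0r_neq0.
      by rewrite -natr1; move: NSR n1; clear; lra.
    apply: ler_pM => //; [by rewrite divr_ge0 // ltW|exact: ltW|].
    by move: h2; clear; lra.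
  rewrite /L mulrCA -expRD; apply: ler_pM; rewrite ?expR_ge0 //.
  + by rewrite mulr_ge0 // exprn_ge0 // ltW.
  + by apply: ler_wpM2r; [rewrite exprn_ge0 // ltW|apply: ler_weXn2l; rewrite // ler1n].
  + rewrite ler_expR.
    have h1 : d * N%:R <= zeta / 4 * (2 * n%:R).
      by apply: ler_pM => //; [exact: ltW|move: NSR n1; clear; lra].
    by move: h1 loss; clear; lra.
rewrite hypergraph_subs; apply: le_trans (TR n (leqnn n) (leqnSn n) _ _) _ => //; rewrite -/C0.
pose u1 := Num.truncn (del / k%:R * n%:R).
have u0 : 0 <= del / k%:R * n%:R by rewrite mulr_ge0 // divr_ge0 // ltW.
have u1l : u1%:R <= del / k%:R * n%:R by rewrite truncn_le.
have u1g : del / k%:R * n%:R - 1 <= u1%:R by exact: truncn_ge_sub1.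
pose nu := (1 + eps / 2) * ln k%:R.
pose lo := (1 - b0) * (n%:R / 2).
have b0n : b0 * n%:R <= 1 / 256 * n%:R by rewrite ler_pM2r //; apply: le_trans b0d _; rewrite dele; move: e4; clear; lra.
have ulo : u1%:R + del / k%:R * n%:R <= lo by rewrite /lo; move: u1l b0n np; rewrite -/b0; clear; lra.
have HB := @balc_prob R n 2 isT b0 (ltW b00) b01.
have BM := @hbad_expectation R n k n0 kN3 lo b0 _ erefl HB m u1 (del / k%:R) (1 - eps) nu s0 (ltW b00) s00.
apply: le_trans (ler_wpM2l (ltW C0p) (BM _ ulo _)) _.
- apply: le_trans u1l _; rewrite ler_pM2r // opprB addrCA subrr addr0; apply: le_trans b0d _; rewrite dele; move: e0; clear; lra.
- move=> a a1 a2; have a0 : 0 <= a by apply: le_trans a1.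
  have an : a <= 2 * b0 * n%:R by move: u1l a2; rewrite -/b0; clear; lra.
  have x1 : 5 * b0 <= 1 by move: b0d e4; rewrite dele; clear; lra.
  have x0 : 0 <= 5 * b0 by rewrite mulr_ge0 // ltW.
  have B1 : (1 - 5 * del) / 2 ^+ k.-1 <= ((lo - a) / n%:R) ^+ k.-1.
    apply: (@le_trans _ _ (((1 - 5 * b0) / 2) ^+ k.-1)).
      rewrite expr_div_n ler_pM2r ?invr_gt0 ?exprn_gt0 //.
      apply: le_trans (bernoulli _ x0 x1).
      have : k.-1%:R * (5 * b0) <= 5 * del.
        have -> : 5 * del = k%:R * (5 * b0) by rewrite /b0; field.
        by apply: ler_wpM2r => //; rewrite ler_nat leq_pred.
      by clear; lra.
    apply: lerXn2r; rewrite ?nnegrE ?divr_ge0 ?subr_ge0 ?(ltW np) //.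
      by apply: le_trans a2 ulo.
    by rewrite ler_pdivlMr // /lo; move: an; clear; lra.
  have tE : t / 2 = 2 ^+ k.-1 by rewrite -t2E subn1.
  rewrite -tE in B1.
  have -> : hpcrit n k lo a = a * (k%:R / n%:R * ((lo - a) / n%:R) ^+ k.-1) by rewrite /hpcrit; ring.
  rewrite mulrCA [leLHS]mulrC; apply: ler_wpM2l => //.
  apply: (@le_trans _ _ ((r * n%:R - 1) * (k%:R / n%:R * ((1 - 5 * del) / (t / 2))))); last first.
    have g5 : 0 <= 1 - 5 * del by rewrite dele; move: e4; clear; lra.
    apply: ler_pM => //.
    - by rewrite subr_ge0; apply: le_trans n1 _; rewrite ler_peMl // ltW.
    - by rewrite mulr_ge0 ?divr_ge0 // ?(ltW tp) ?(ltW np).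
    - by apply: ler_wpM2l => //; rewrite !divr_ge0 // ltW.
  have -> : (r * n%:R - 1) * (k%:R / n%:R * ((1 - 5 * del) / (t / 2))) =
    (r * k%:R / (t / 2) - k%:R / (t / 2) / n%:R) * (1 - 5 * del) by field; rewrite tn0 nn0.
  have kt1 : k%:R / (t / 2) / n%:R <= eps / 4.
    rewrite ler_pdivrMr //; apply: (@le_trans _ _ 1).
      by rewrite ler_pdivrMr ?divr_gt0 // mul1r; move: k_large kk k1; clear; lra.
    by move: ne; rewrite ler_pdivrMr //; clear; lra.
  have kt2 : eps / 4 <= eps / 4 * ln k%:R by rewrite ler_peMr // divr_ge0 // ltW.
  apply: (@le_trans _ _ (((1 + eps) * ln k%:R - eps / 4 * ln k%:R) * (1 - 5 * del))); last first.
    by apply: ler_wpM2r; [rewrite dele; move: e4; clear; lra|move: rk kt1 kt2; clear; lra].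
  rewrite /nu -mulrBl mulrAC; apply: ler_wpM2r; [move: L1; clear; lra|rewrite dele; move: e0 e4; clear; nra].
apply: (@le_trans _ _ (C0 * (4 + expR s0) * expR (- (zeta * n%:R)) * L)); last by rewrite ler_pM2r.
have -> : C0 * (4 + expR s0) * expR (- (zeta * n%:R)) * L = C0 * (2 ^+ n * p ^+ m *
  ((4 + expR s0) * (expR (- (zeta * n%:R)) * expR (- (zeta * n%:R))))) by rewrite /L; ring.
rewrite ler_pM2l // -/t -/p ler_pM2l; last by rewrite mulr_gt0 // exprn_gt0.
rewrite -expRD [leRHS]mulrDl; apply: lerD.
  rewrite (_ : 2 * 2%:R = 4 :> R); last by rewrite -natrM.
  by rewrite ler_pM2l // ler_expR; apply: eq_ler; rewrite /zeta; field.
rewrite -expRD ler_expR.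
have E1 : expR (s0 - nu) <= 1 / k%:R.
  apply: (@le_trans _ _ (expR (- ln k%:R))).
    have : 0 <= eps * ln k%:R by rewrite mulr_ge0 ?(ltW e0) //; apply: le_trans L1.
    by rewrite ler_expR /s0 /nu; clear; lra.
  by rewrite expRN lnK ?posrE // mul1r.
have E2 : n%:R * expR (s0 - nu) <= n%:R / k%:R.
  by rewrite ler_pM2l //; move: E1; rewrite mul1r.
have E3 : s0 * (del / k%:R * n%:R - 1) <= s0 * u1%:R by apply: ler_wpM2l.
have E4 : 2 * (n%:R / k%:R) <= del * (eps / 4) * ln k%:R * (n%:R / k%:R).
  by apply: ler_wpM2r; rewrite ?divr_ge0.
have E5 : s0 * (del / k%:R * n%:R - 1) = del * (eps / 4) * ln k%:R * (n%:R / k%:R) - s0 by rewrite /s0; ring.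
have E6 : zeta * n%:R <= n%:R / k%:R / 2.
  have -> : n%:R / k%:R / 2 = 1 / (2 * k%:R) * n%:R :> R by field.
  by rewrite ler_pM2r.
by move: E2 E3 E4 E5 E6; clear; lra.
Qed.

(** * Diagonal choice of the sequences *)

Lemma cvg_seq (R : realType) (f : nat -> R) (l : R) :
  (forall e : R, 0 < e -> exists N, forall n, (N <= n)%N -> `|l - f n| <= e) -> f @ \oo --> l.
Proof.
move=> h; apply/cvgrPdist_le => e e0; have [N hN] := h e e0.
by near=> n; apply: hN; near: n; exact: nbhs_infty_ge.
Unshelve. all: by end_near.
Qed.

(** For each [k] the smallest available tolerance is taken, that is, the largest [j <= k] with
    [K j <= k]; the bound [j <= k] guarantees a maximum. The pair (2, 0) is the default when no
    tolerance is available yet. *)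
Lemma diagonal_sequence (R : realType) (P : R -> nat -> Prop) :
  (forall e : R, 0 < e -> e < 1 / 4 -> exists K, forall k, (K <= k)%N -> P e k) ->
  exists eps gam : nat -> R, [/\ eps @ \oo --> (0 : R), gam @ \oo --> (1 : R) &
    forall k, (eps k = 2 /\ gam k = 0) \/ (P (eps k) k /\ gam k = 1 - eps k)].
Proof.
(* The offset 5 keeps every tolerance below 1/4. *)
move=> h; pose ej (j : nat) : R := (j%:R + 5)^-1.
have ej0 j : 0 < ej j by rewrite invr_gt0 ltr_wpDl.
have ej4 j : ej j < 1 / 4.
  have j0 : 0 <= j%:R :> R by [].
  by rewrite /ej -[X in X < _]div1r ltr_pdivrMr; lra.
have [K HK] := boolp.choice (fun j => h (ej j) (ej0 j) (ej4 j)).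
have /boolp.choice[f Hf] (k : nat) : exists p : R * R,
   ((p.1 = 2 /\ p.2 = 0) \/ (P p.1 k /\ p.2 = 1 - p.1)) /\
   forall j, (j <= k)%N -> (K j <= k)%N -> [/\ 0 <= p.1, p.1 <= ej j & p.2 = 1 - p.1].
  case: (boolP [exists j : 'I_k.+1, K j <= k]%N) => [/existsP[j0 j0P]|/existsPn no]; last first.
    exists (2, 0); split; first by left.
    move=> j jk Kj; have jk1 : (j < k.+1)%N by [].
    by have := no (Ordinal jk1); rewrite /= Kj.
  have exP : exists j, (j <= k)%N && (K j <= k)%N by exists j0; rewrite j0P -ltnS ltn_ord.
  have ub j : (j <= k)%N && (K j <= k)%N -> (j <= k)%N by case/andP.
  case: (ex_maxnP exP ub) => j /andP[jk Kj] jmax.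
  exists (ej j, 1 - ej j) => /=; split; first by right; split=> //; exact: HK.
  move=> i ik Ki; split=> //; first exact: ltW.
  have ij : (i <= j)%N by apply: jmax; rewrite ik.
  by rewrite /ej lef_pV2 ?posrE ?ltr_wpDl // lerD2r ler_nat.
have small (e : R) : 0 < e -> exists N, forall k, (N <= k)%N ->
    [/\ 0 <= (f k).1, (f k).1 <= e & (f k).2 = 1 - (f k).1].
  move=> e0; have [j hj] := ev_nat e^-1; exists (maxn j (K j)) => k; rewrite geq_max => /andP[jk Kk].
  have [a b c] := (Hf k).2 j jk Kk; split=> //; apply: le_trans b _.
  rewrite -[leRHS]invrK lef_pV2 ?posrE ?invr_gt0 ?ltr_wpDl //.
  by apply: le_trans (hj j (leqnn j)) _; rewrite lerDl.
exists (fun k => (f k).1), (fun k => (f k).2); split.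
- apply: cvg_seq => e e0; have [N HN] := small e e0; exists N => k /HN[a b _].
  by rewrite sub0r normrN ger0_norm.
- apply: cvg_seq => e e0; have [N HN] := small e e0; exists N => k /HN[a b ->].
  by rewrite opprB addrCA subrr addr0 ger0_norm.
- by move=> k; exact: (Hf k).1.
Qed.

(** With the required fraction 0 the event holds for every pair, and the probability is 1 as soon as
    a colouring exists, which [0 < k] ensures. *)
Lemma edgeless_whp_rigid (R : realType) (k : nat) (c : R) : (0 < k)%N ->
  whp_rigid graphs (proper_colorings k) (fun n => Num.truncn (0 * n%:R / 2 : R)) c 0.
Proof.
move=> k0; apply: cvg_seq => e e0; exists 0%N => n _.
rewrite !mul0r truncn0 /pair_prob.
have -> : graphs n 0 = [set set0]%SET.
  apply/setP => J; rewrite !inE cards_eq0; case: eqP => //= ->.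
  by apply/forallP => u; rewrite inE.
rewrite big_set1 cards1 divr1.
have -> : [set s in proper_colorings k (n := n) set0 | 0 <= #|[set v | rigid (proper_colorings k set0) s (c * n%:R) v]%SET|%:R :> R]%SET = proper_colorings k set0.
  by apply/setP => s; rewrite inE ler0n andbT.
rewrite divff ?subrr ?normr0 ?ltW // pnatr_eq0 -lt0n card_gt0; apply/set0Pn.
exists [ffun=> Ordinal k0]; rewrite inE; apply/forallP => u; apply/forallP => v.
by rewrite inE andbF.
Qed.

Theorem theorem4 (R : realType) :
  exists (eps gam : nat -> R),
    [/\ eps @ \oo --> (0 : R),
        gam @ \oo --> (1 : R) &
        forall k : nat, (0 < k)%N ->
        [/\ forall d : R,
              (1 + eps k) * (k%:R * ln k%:R) <= d ->
              d <= (2 - eps k) * (k%:R * ln k%:R) ->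
              exists2 c : R, 0 < c &
                whp_rigid graphs (proper_colorings k)
                  (fun n => Num.truncn (d * n%:R / 2)) c (gam k),
            forall r : R,
              (1 + eps k) * (2 ^+ k / k%:R * ln k%:R) <= r ->
              r <= (1 - eps k) * (2 ^+ k * ln 2) ->
              exists2 c : R, 0 < c &
                whp_rigid (cnf_formulas k) sat_assignments
                  (fun n => Num.truncn (r * n%:R)) c (gam k) &
            forall r : R,
              (1 + eps k) * (2 ^+ (k - 1) / k%:R * ln k%:R) <= r ->
              r <= (1 - eps k) * (2 ^+ (k - 1) * ln 2) ->
              exists2 c : R, 0 < c &
                whp_rigid (uniform_hypergraphs k) hypergraph_2colorings
                  (fun n => Num.truncn (r * n%:R)) c (gam k)]].
Proof.
pose P (e : R) (k : nat) :=
  [/\ forall d : R, (1 + e) * (k%:R * ln k%:R) <= d -> d <= (2 - e) * (k%:R * ln k%:R) ->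
        exists2 c : R, 0 < c & whp_rigid graphs (proper_colorings k)
          (fun n => Num.truncn (d * n%:R / 2)) c (1 - e),
      forall r : R, (1 + e) * (2 ^+ k / k%:R * ln k%:R) <= r -> r <= (1 - e) * (2 ^+ k * ln 2) ->
        exists2 c : R, 0 < c & whp_rigid (cnf_formulas k) sat_assignments
          (fun n => Num.truncn (r * n%:R)) c (1 - e) &
      forall r : R, (1 + e) * (2 ^+ (k - 1) / k%:R * ln k%:R) <= r ->
        r <= (1 - e) * (2 ^+ (k - 1) * ln 2) ->
        exists2 c : R, 0 < c & whp_rigid (uniform_hypergraphs k) hypergraph_2colorings
          (fun n => Num.truncn (r * n%:R)) c (1 - e)].
have [e e0 e4|eps [gam [c0 c1 H]]] := @diagonal_sequence R P.
  have [K HK] := ev_and (color_rigid e0 e4) (ev_and (ksat_rigid e0 e4) (hyper_rigid e0 e4)).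
  by exists K => k /HK[? [? ?]].
exists eps, gam; split=> // k k0; case: (H k) => [[-> ->]|[hP ->]]; last exact: hP.
have kp : 0 < k%:R :> R by rewrite ltr0n.
have l0 : 0 <= ln k%:R :> R by rewrite ln_ge0 // ler1n.
have l2 : 0 < ln 2 :> R by rewrite ln_gt0 // ltr1n.
(* With eps k = 2 only the edgeless graph of part (a) is admissible. *)
have empty (j : nat) (r : R) : (1 + 2) * (2 ^+ j / k%:R * ln k%:R) <= r -> r <= (1 - 2) * (2 ^+ j * ln 2) -> False.
  have : 0 <= 2 ^+ j / k%:R * ln k%:R :> R by rewrite mulr_ge0 // divr_ge0 ?exprn_ge0 // ltW.
  have : 0 < 2 ^+ j * ln 2 :> R by rewrite mulr_gt0 // exprn_gt0.
  by lra.
split=> [d d1 d2|r r1 r2|r r1 r2]; [|by case: (empty _ _ r1 r2)|by case: (empty _ _ r1 r2)].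
exists 1 => //; have -> : d = 0.
  have : 0 <= k%:R * ln k%:R :> R by rewrite mulr_ge0 // ltW.
  by lra.
exact: edgeless_whp_rigid.
Qed.
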